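(* Let $m>0$ and $b>0$. For any $\psi_0\in H^{1/2}(\mathbb{R}^2,\mathbb{C}^2)$ there exists a constant $C=C(\|\psi_0\|_{H^{1/2}})>0$ such that the solution $\psi\in C([0,\infty);H^{1/2}(\mathbb{R}^2,\mathbb{C}^2))$ to the integral equation $$\psi(t)=e^{-\mathrm{i}t\mathcal{D}_m}\psi_0+\mathrm{i}\int_0^t e^{-\mathrm{i}(t-\tau)\mathcal{D}_m}\big((b-\Delta)^{-1}|\psi(\tau)|^2\big)\gamma^0\psi(\tau)\,d\tau$$ satisfies $$\left|\langle\mathcal{D}_m\psi(t),\psi(t)\rangle_{L^2}\right|\lesssim e^{Ct},\qquad t\in[0,\infty),$$ that is, there is a constant $K>0$ independent of $t$ with $|\langle\mathcal{D}_m\psi(t),\psi(t)\rangle_{L^2}|\le Ke^{Ct}$ for all $t\ge0$.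
   Context: Here $\mathcal{D}_m=-\mathrm{i}(\alpha^1\partial_{x_1}+\alpha^2\partial_{x_2})+m\gamma^0$ is the two-dimensional Dirac operator, self-adjoint on $L^2(\mathbb{R}^2,\mathbb{C}^2)$ with domain $H^1(\mathbb{R}^2,\mathbb{C}^2)$, where $$\gamma^0=\begin{pmatrix}1&0\\0&-1\end{pmatrix},\quad \alpha^1=\begin{pmatrix}0&\mathrm{i}\\-\mathrm{i}&0\end{pmatrix},\quad \alpha^2=\begin{pmatrix}0&1\\1&0\end{pmatrix}.$$ For $\psi\in H^{1/2}$, $\langle\mathcal{D}_m\psi,\psi\rangle_{L^2}$ denotes the (indefinite) quadratic form of $\mathcal{D}_m$, i.e. the $H^{-1/2}$–$H^{1/2}$ pairing extending the $L^2$ inner product. $|\psi|^2$ is the squared Euclidean (Hermitian) norm of $\psi\in\mathbb{C}^2$ pointwise, and $(b-\Delta)^{-1}$ is the Fourier multiplier with symbol $(b+|\xi|^2)^{-1}$ on $\mathbb{R}^2$. For every $\psi_0\in H^{1/2}(\mathbb{R}^2,\mathbb{C}^2)$ the integral equation has a unique solution in $C([0,\infty);H^{1/2}(\mathbb{R}^2,\mathbb{C}^2))$; this is the solution referred to. The notation $f(t)\lesssim g(t)$ means $f(t)\le Kg(t)$ with a constant $K>0$ possibly depending on fixed values (such as $m$, $b$, $\psi_0$) but independent of $t$. *)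

(* Defs.v *)
From HB Require Import structures.
From mathcomp Require Import all_boot all_order all_algebra.
From mathcomp Require Import complex.
From mathcomp Require Import all_classical all_reals all_analysis measurable_realfun.
Set Implicit Arguments.
Unset Strict Implicit.
Unset Printing Implicit Defensive.
Import Order.TTheory GRing.Theory Num.Theory.
Import numFieldNormedType.Exports.
Import ComplexField.Normc.

Local Open Scope classical_set_scope.
Local Open Scope ring_scope.
Local Open Scope complex_scope.

Section DiracHartree.
Context {R : realType}.

Definition plane : Type := (measurableTypeR R * measurableTypeR R)%type.

Local Notation leb2 := (@lebesgue_measure R \x @lebesgue_measure R)%E.

Definition dot (x y : plane) : R := x.1 * y.1 + x.2 * y.2.

Definition spinor : Type := 'cV[R[i]]_2.

Definition spinor_norm (v : spinor) : R :=
  Num.sqrt (\sum_k normc (v k 0) ^+ 2).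

Definition spinor_dot (u v : spinor) : R[i] := \sum_k u k 0 * (v k 0)^*.

Definition cmeasurable (f : plane -> R[i]) : Prop :=
  measurable_fun setT (fun x => complex.Re (f x)) /\
  measurable_fun setT (fun x => complex.Im (f x)).

Definition cintegral (D : set plane) (f : plane -> R[i]) : R[i] :=
  (\int[leb2]_(x in D) complex.Re (f x)) +i*
  (\int[leb2]_(x in D) complex.Im (f x)).

(* Elements of L^2 are handled through representatives; every statement below
   only depends on their classes modulo equality almost everywhere. *)

Definition norm2 (f : plane -> R[i]) : \bar R :=
  Lnorm leb2 2%:E (fun x => (normc (f x))%:E).

Definition in_L2 (f : plane -> R[i]) : Prop :=
  cmeasurable f /\ (norm2 f < +oo)%E.

Definition spinor_norm2 (u : plane -> spinor) : \bar R :=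
  Lnorm leb2 2%:E (fun x => (spinor_norm (u x))%:E).

Definition spinor_in_L2 (u : plane -> spinor) : Prop :=
  (forall k, cmeasurable (fun x => u x k 0)) /\ (spinor_norm2 u < +oo)%E.

Definition cis (a : R) : R[i] := cos a +i* sin a.

Definition fourier_ball (f : plane -> R[i]) (r : R) (xi : plane) : R[i] :=
  ((2 * pi)^-1)%:C *
  cintegral [set x | dot x x <= r ^+ 2] (fun x => cis (- dot x xi) * f x).

(* The unitary Fourier transform on L^2, as the L^2 limit of the Fourier
   integrals over balls of radius r as r tends to infinity. *)
Definition is_fourier (f g : plane -> R[i]) : Prop :=
  in_L2 g /\
  norm2 (fun xi => fourier_ball f r xi - g xi) @[r --> +oo] --> 0%E.

(* For f in L^2 the transform exists and is unique up to null sets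
   (Plancherel), and [fourier f] is a representative of it; it is only ever
   meaningful for such f. *)
Definition fourier (f : plane -> R[i]) : plane -> R[i] :=
  xget (fun=> 0) [set g | is_fourier f g].

Definition inv_fourier (f : plane -> R[i]) (x : plane) : R[i] :=
  fourier f (- x.1, - x.2).

Definition spinor_fourier (u : plane -> spinor) (xi : plane) : spinor :=
  \col_k fourier (fun x => u x k 0) xi.

Definition spinor_inv_fourier (u : plane -> spinor) (x : plane) : spinor :=
  \col_k inv_fourier (fun xi => u xi k 0) x.

Definition sobolev_norm (s : R) (u : plane -> spinor) : \bar R :=
  spinor_norm2
    (fun xi => ((1 + dot xi xi) `^ (s / 2))%:C *: spinor_fourier u xi).

Definition in_sobolev (s : R) (u : plane -> spinor) : Prop :=
  spinor_in_L2 u /\ (sobolev_norm s u < +oo)%E.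

Definition continuous_sobolev (s : R) (psi : R -> plane -> spinor) : Prop :=
  (forall t, 0 <= t -> in_sobolev s (psi t)) /\
  (forall t, 0 <= t ->
     sobolev_norm s (fun x => psi t' x - psi t x)
       @[t' --> within [set t' | 0 <= t'] (nbhs t)] --> 0%E).

Definition mx22 (a b c d : R[i]) : 'M[R[i]]_2 :=
  \matrix_(i, j) if i == 0 then (if j == 0 then a else b)
                 else (if j == 0 then c else d).

Definition gamma0 : 'M[R[i]]_2 := mx22 1 0 0 (-1).
Definition alpha1 : 'M[R[i]]_2 := mx22 0 'i (- 'i) 0.
Definition alpha2 : 'M[R[i]]_2 := mx22 0 1 1 0.

(* Entrywise sum of the exponential series. *)
Definition expmx (A : 'M[R[i]]_2) : 'M[R[i]]_2 :=
  let S n := \sum_(0 <= k < n) (k`!%:R)^-1 *: A ^+ k in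
  \matrix_(i, j) (lim (complex.Re (S n i j) @[n --> \oo]) +i*
                  lim (complex.Im (S n i j) @[n --> \oo])).

(* - i d/dx_j is multiplication by xi_j on the Fourier side. *)
Definition dirac_symbol (m : R) (xi : plane) : 'M[R[i]]_2 :=
  xi.1%:C *: alpha1 + xi.2%:C *: alpha2 + m%:C *: gamma0.

(* The group exp(- i t D_m) generated by D_m, as a Fourier multiplier. *)
Definition dirac_group (m t : R) (u : plane -> spinor) : plane -> spinor :=
  spinor_inv_fourier (fun xi =>
    expmx ((- 'i * t%:C) *: dirac_symbol m xi) *m spinor_fourier u xi).

(* <D_m u, u> for u in H^{1/2}: the H^{-1/2} - H^{1/2} pairing extending the
   L^2 inner product, which is computed on the Fourier side. *)
Definition dirac_form (m : R) (u : plane -> spinor) : R[i] :=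
  cintegral setT (fun xi =>
    spinor_dot (dirac_symbol m xi *m spinor_fourier u xi)
               (spinor_fourier u xi)).

(* (b - Delta)^{-1}; the argument has to be in L^2. *)
Definition resolvent (b : R) (f : plane -> R[i]) : plane -> R[i] :=
  inv_fourier (fun xi => ((b + dot xi xi)^-1)%:C * fourier f xi).

(* The density |u|^2 is in L^2 for u in H^{1/2}, since H^{1/2} embeds in L^4. *)
Definition hartree (b : R) (u : plane -> spinor) (x : plane) : spinor :=
  resolvent b (fun y => (spinor_norm (u y) ^+ 2)%:C) x *: (gamma0 *m u x).

(* Simple functions from R to L^2: the list of pairs (A, v) stands for the sum
   of the functions 1_A v. *)
Definition step : Type := seq (set R * (plane -> spinor)).

Definition is_step (s : step) : Prop :=
  forall p, p \in s ->
    measurable (p.1 : set (measurableTypeR R)) /\ spinor_in_L2 p.2.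

Definition step_fun (s : step) (tau : R) (x : plane) : spinor :=
  \sum_(p <- s) (\1_(p.1) tau)%:C *: p.2 x.

Definition step_integral (t : R) (s : step) (x : plane) : spinor :=
  \sum_(p <- s)
    (fine (@lebesgue_measure R (p.1 `&` `[0, t])))%:C *: p.2 x.

(* v is the Bochner integral over [0, t] of the L^2-valued function F. *)
Definition is_bochner_integral (t : R) (F : R -> plane -> spinor)
    (v : plane -> spinor) : Prop :=
  (forall tau, 0 <= tau <= t -> spinor_in_L2 (F tau)) /\
  spinor_in_L2 v /\
  exists s : nat -> step,
    let err n (tau : R) : \bar R :=
      spinor_norm2 (fun x => F tau x - step_fun (s n) tau x) in
    [/\ forall n, is_step (s n),
        forall n, measurable_fun `[0, t] (err n),
        (\int[@lebesgue_measure R]_(tau in `[0%R, t]) err n tau)%E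
          @[n --> \oo] --> 0%E &
        spinor_norm2 (fun x => step_integral t (s n) x - v x)
          @[n --> \oo] --> 0%E].

Definition duhamel_solution (m b : R) (psi0 : plane -> spinor)
    (psi : R -> plane -> spinor) : Prop :=
  forall t, 0 <= t ->
    exists2 v, is_bochner_integral t
                 (fun tau => dirac_group m (t - tau) (hartree b (psi tau))) v &
      {ae leb2, forall x, psi t x = dirac_group m t psi0 x + 'i *: v x}.

End DiracHartree.

(* Main.v *)
(** Everything is done on the Fourier side. Write [f^] for the transform of [f],
    [N] for the Hartree term, [M] for the squared L^2 norm of [psi], [A_w(t)]
    for the integral of [w |psi^(t)|^2] with a bounded weight [w], and
    [B(t)] for the integral of [(1 + |xi|^2)^(1/2) |psi^(t)|^2]. The free group
    is unitary and commutes with multiplication by [w], so [A_w] only changes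
    through [Re i <N^, w psi^>]. Since the potential is real and [gamma0] is
    diagonal, this is a commutator: only [w(xi) - w(xi - z)] enters, which is at
    most [|z|] times the Lipschitz constant of [w]. The transform of [|psi|^2]
    is bounded both by [M] and by the correlation
    [G(z) = int |psi^(xi - z)| |psi^(xi)|]; one factor is estimated by [M], and
    a Schur test in each of the two variables gives
    [int G(z) |z| / (b + |z|^2) dz <= C B]. With [w = 1], [M] is conserved;
    with [w = min((1 + |xi|^2)^(1/2), n)] and [n -> oo],
    [B(t) <= B(s) + C M (t - s) sup_[s, t] B]. Hence [B] at most doubles over
    times of order [1 / (C M)], and it controls the quadratic form. *)

Require Import Defs.
From HB Require Import structures.
From mathcomp Require Import all_boot all_order all_algebra.
From mathcomp Require Import complex.
From mathcomp Require Import all_classical all_reals all_analysis measurable_realfun.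
From mathcomp Require Import ring lra.
Set Implicit Arguments.
Unset Strict Implicit.
Unset Printing Implicit Defensive.
Import Order.TTheory GRing.Theory Num.Theory.
Import numFieldNormedType.Exports.
Import ComplexField.Normc.

Local Open Scope classical_set_scope.
Local Open Scope ring_scope.
Local Open Scope complex_scope.

Local Notation "x ^*" := (conjc x) : ring_scope.
Local Notation "x ^*" := (conjc x) : complex_scope.

(** At this regularity [psi] is not known to be differentiable in time, so [A_w] cannot simply be
    differentiated. Instead the free flow is undone: for [phi(t) = exp(i t D) psi(t)], the integral
    equation paired with a fixed vector becomes a scalar integral over time. Freezing costs an error
    quadratic in [y - x], which disappears under subdivision of the time interval. The weight is cut
    off at [n] because the unbounded one does not act on L^2; the cut-off weights share one
    Lipschitz constant, so the estimates are uniform in [n]. The kernel [|z| / (b + |z|^2)] is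
    replaced by a multiple of [((1 + |z.1|)(1 + |z.2|))^(-1/2)]. This is larger, but it factors into
    one-dimensional kernels, whose Schur integrals have explicit arctangent primitives. Continuity
    in H^(1/2) makes the supremum of [B] a finite maximum, so that it can be absorbed on short
    intervals. The rate then depends on the conserved mass alone, which is why the growth is
    exponential. *)

Lemma ler_sqrE {R : realDomainType} (a b : R) : 0 <= a -> 0 <= b ->
  (a ^+ 2 <= b ^+ 2) = (a <= b).
Proof. by move=> a0 b0; rewrite ler_pXn2r. Qed.

(** * Complex-valued functions and their integrals *)

Section ComplexNorm.
Context {R : realType}.
Implicit Types z w : R[i].

Lemma normc_ge0 z : 0 <= normc z.
Proof. by case: z => a b; exact: sqrtr_ge0. Qed.

Lemma sqr_normcE z : normc z ^+ 2 = complex.Re z ^+ 2 + complex.Im z ^+ 2.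
Proof. by case: z => a b /=; rewrite sqr_sqrtr// addr_ge0// sqr_ge0. Qed.

Lemma ler_Re_normc z : `|complex.Re z| <= normc z.
Proof.
rewrite -(@ler_pXn2r _ 2)// ?nnegrE ?normc_ge0// sqr_normcE real_normK ?num_real//.
by rewrite lerDl sqr_ge0.
Qed.

Lemma ler_Im_normc z : `|complex.Im z| <= normc z.
Proof.
rewrite -(@ler_pXn2r _ 2)// ?nnegrE ?normc_ge0// sqr_normcE real_normK ?num_real//.
by rewrite lerDr sqr_ge0.
Qed.

Lemma normc_le_ReIm z : normc z <= `|complex.Re z| + `|complex.Im z|.
Proof.
rewrite -(@ler_pXn2r _ 2)// ?nnegrE ?normc_ge0// sqr_normcE sqrrD.
by rewrite !real_normK ?num_real// lerD2r lerDl mulrn_wge0// mulr_ge0.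
Qed.

Lemma normc_conj z : normc z^* = normc z.
Proof. by case: z => a b /=; rewrite sqrrN. Qed.

Lemma normc_real (x : R) : normc x%:C = `|x|.
Proof. by rewrite /= expr0n addr0 sqrtr_sqr. Qed.

Lemma mulc_conj z : z * z^* = (normc z ^+ 2)%:C.
Proof.
case: z => a b; rewrite sqr_normcE /=; apply/eqP; rewrite eq_complex/=.
by apply/andP; split; apply/eqP; ring.
Qed.

Lemma ReD z w : complex.Re (z + w) = complex.Re z + complex.Re w.
Proof. by case: z w => a b [c d]. Qed.

Lemma ImD z w : complex.Im (z + w) = complex.Im z + complex.Im w.
Proof. by case: z w => a b [c d]. Qed.

Lemma ReN z : complex.Re (- z) = - complex.Re z.
Proof. by case: z. Qed.

Lemma ImN z : complex.Im (- z) = - complex.Im z.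
Proof. by case: z. Qed.

Lemma ReM z w : complex.Re (z * w) =
  complex.Re z * complex.Re w - complex.Im z * complex.Im w.
Proof. by case: z w => a b [c d]. Qed.

Lemma ImM z w : complex.Im (z * w) =
  complex.Re z * complex.Im w + complex.Im z * complex.Re w.
Proof. by case: z w => a b [c d] /=. Qed.

Lemma Re_conj z : complex.Re z^* = complex.Re z. Proof. by case: z. Qed.
Lemma Im_conj z : complex.Im z^* = - complex.Im z. Proof. by case: z. Qed.

Lemma conjcM z w : (z * w)^* = z^* * w^*. Proof. exact: rmorphM. Qed.
Lemma conjcD z w : (z + w)^* = z^* + w^*. Proof. exact: rmorphD. Qed.
Lemma conjcB z w : (z - w)^* = z^* - w^*. Proof. exact: rmorphB. Qed.

Lemma Re_realC (x : R) : complex.Re x%:C = x. Proof. by []. Qed.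
Lemma Im_realC (x : R) : complex.Im x%:C = 0. Proof. by []. Qed.
Lemma conjcKK z : z^*^* = z. Proof. exact: conjcK. Qed.

Lemma complex_eqP z w : complex.Re z = complex.Re w ->
  complex.Im z = complex.Im w -> z = w.
Proof. by case: z w => a b [c d] /= -> ->. Qed.

Lemma normc_eq0P z : normc z = 0 <-> z = 0.
Proof. by split=> [/eq0_normc//|->]; exact: normc0. Qed.

Lemma le_normc_distD x z w : normc (z - w) <= normc (z - x) + normc (x - w).
Proof. by rewrite (le_trans _ (le_normcD _ _))// addrA subrK. Qed.

Lemma ler_dist_normc z w : `|normc z - normc w| <= normc (z - w).
Proof.
have h1 := le_normcD (z - w) w; have h2 := le_normcD (w - z) z.
rewrite !subrK -(normcN (w - z)) opprB in h1 h2.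
by rewrite ler_norml; apply/andP; split; lra.
Qed.

Lemma normc_sum I (r : seq I) (P : pred I) (F : I -> R[i]) :
  normc (\sum_(i <- r | P i) F i) <= \sum_(i <- r | P i) normc (F i).
Proof.
elim/big_ind2 : _ => //; first by rewrite normc0.
by move=> x1 y1 x2 y2 h1 h2; exact: le_trans (le_normcD _ _) (lerD h1 h2).
Qed.

Lemma normc_cis (a : R) : normc (cis a) = 1.
Proof. by rewrite /cis /= cos2Dsin2 sqrtr1. Qed.

Lemma cisD (a b : R) : cis (a + b) = cis a * cis b.
Proof.
by apply: complex_eqP; rewrite ?ReM ?ImM /cis/= ?cosD ?sinD//; ring.
Qed.

Lemma cisN (a : R) : cis (- a) = (cis a)^*.
Proof. by rewrite /cis cosN sinN. Qed.

End ComplexNorm.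
#[global] Hint Extern 0 (is_true (0 <= normc _)) => solve [exact: normc_ge0] : core.

Lemma normcE_ge0 {R : realType} (z : R[i]) : (0 <= (normc z)%:E)%E.
Proof. by rewrite lee_fin. Qed.
#[global] Hint Extern 0 (is_true (@Order.le ereal_display _ _ _)) => solve [exact: normcE_ge0] : core.

Section ComplexMeasurable.
Context {R : realType} {d} {T : measurableType d}.
Implicit Types f g : T -> R[i].

Definition cmeas f :=
  measurable_fun setT (fun x => complex.Re (f x)) /\
  measurable_fun setT (fun x => complex.Im (f x)).

Lemma cmeas_cst (c : R[i]) : cmeas (fun=> c).
Proof. by split; exact: measurable_cst. Qed.

Lemma cmeasD f g : cmeas f -> cmeas g -> cmeas (fun x => f x + g x).
Proof.
move=> [f1 f2] [g1 g2]; split.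
  by under eq_fun do rewrite ReD; exact: measurable_funD.
by under eq_fun do rewrite ImD; exact: measurable_funD.
Qed.

Lemma cmeasN f : cmeas f -> cmeas (fun x => - f x).
Proof.
move=> [f1 f2]; split.
  by under eq_fun do rewrite ReN; exact: measurableT_comp.
by under eq_fun do rewrite ImN; exact: measurableT_comp.
Qed.

Lemma cmeasB f g : cmeas f -> cmeas g -> cmeas (fun x => f x - g x).
Proof. by move=> mf mg; apply: cmeasD => //; exact: cmeasN. Qed.

Lemma cmeasM f g : cmeas f -> cmeas g -> cmeas (fun x => f x * g x).
Proof.
move=> [f1 f2] [g1 g2]; split.
  by under eq_fun do rewrite ReM; apply: measurable_funB; exact: measurable_funM.
by under eq_fun do rewrite ImM; apply: measurable_funD; exact: measurable_funM.
Qed.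

Lemma cmeas_conj f : cmeas f -> cmeas (fun x => (f x)^*).
Proof.
move=> [f1 f2]; split.
  by under eq_fun do rewrite Re_conj.
by under eq_fun do rewrite Im_conj; exact: measurableT_comp.
Qed.

Lemma cmeas_real (h : T -> R) : measurable_fun setT h -> cmeas (fun x => (h x)%:C).
Proof. by move=> mh; split => //=; exact: measurable_cst. Qed.

Lemma cmeas_normc f : cmeas f -> measurable_fun setT (fun x => normc (f x)).
Proof.
move=> [f1 f2].
rewrite (_ : (fun _ => _) = fun x =>
    Num.sqrt (complex.Re (f x) ^+ 2 + complex.Im (f x) ^+ 2)); last first.
  by apply/funext => x; case: (f x).
apply: (@measurableT_comp _ _ _ _ _ _ (@Num.sqrt R)); first by apply: continuous_measurable_fun; exact: sqrt_continuous.
by apply: measurable_funD; exact: measurable_funX.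
Qed.

Lemma cmeas_cis (h : T -> R) : measurable_fun setT h -> cmeas (fun x => cis (h x)).
Proof.
move=> mh; split => /=.
  by apply: measurableT_comp => //; apply: continuous_measurable_fun; exact: continuous_cos.
by apply: measurableT_comp => //; apply: continuous_measurable_fun; exact: continuous_sin.
Qed.

Lemma cmeas_sum I (r : seq I) (F : I -> T -> R[i]) :
  (forall i, cmeas (F i)) -> cmeas (fun x => \sum_(i <- r) F i x).
Proof.
move=> mF; elim: r => [|i r ih].
  by under eq_fun do rewrite big_nil; exact: cmeas_cst.
by under eq_fun do rewrite big_cons; exact: cmeasD.
Qed.

Lemma cmeas_lim (f_ : nat -> T -> R[i]) f : (forall n, cmeas (f_ n)) ->
  (forall x, normc (f_ n x - f x) @[n --> \oo] --> 0) -> cmeas f.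
Proof.
move=> mf ff; split.
- apply/measurable_EFinP.
  apply: (@emeasurable_fun_cvg _ _ _ _ (fun n x => (complex.Re (f_ n x))%:E)) => //.
    by move=> n; apply/measurable_EFinP; exact: (mf n).1.
  move=> x _; apply: cvg_EFin; first exact: nearW.
  apply/cvgrPdist_le => e e0; move/cvgrPdist_le/(_ _ e0): (ff x).
  apply: filterS => n; rewrite sub0r normrN ger0_norm//; apply: le_trans.
  by rewrite distrC -ReN -ReD; exact: ler_Re_normc.
- apply/measurable_EFinP.
  apply: (@emeasurable_fun_cvg _ _ _ _ (fun n x => (complex.Im (f_ n x))%:E)) => //.
    by move=> n; apply/measurable_EFinP; exact: (mf n).2.
  move=> x _; apply: cvg_EFin; first exact: nearW.
  apply/cvgrPdist_le => e e0; move/cvgrPdist_le/(_ _ e0): (ff x).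
  apply: filterS => n; rewrite sub0r normrN ger0_norm//; apply: le_trans.
  by rewrite distrC -ImN -ImD; exact: ler_Im_normc.
Qed.

End ComplexMeasurable.

Lemma cmeas_comp {R : realType} d1 d2 (T1 : measurableType d1) (T2 : measurableType d2)
  (f : T2 -> R[i]) (h : T1 -> T2) :
  measurable_fun setT h -> cmeas f -> cmeas (fun x => f (h x)).
Proof.
move=> mh [f1 f2]; split.
  exact: (measurableT_comp f1 mh).
exact: (measurableT_comp f2 mh).
Qed.

(** Both parts are finite parts of extended integrals, so the value carries information only under
    [cintegrable]. *)
Definition cint {R : realType} {d} {T : measurableType d}
    (mu : {measure set T -> \bar R}) (f : T -> R[i]) : R[i] :=
  (\int[mu]_x complex.Re (f x))%R +i* (\int[mu]_x complex.Im (f x))%R.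
Arguments cint : simpl never.

Definition cintegrable {R : realType} {d} {T : measurableType d}
    (mu : {measure set T -> \bar R}) (f : T -> R[i]) : Prop :=
  cmeas f /\ (\int[mu]_x (normc (f x))%:E < +oo)%E.

Section ComplexIntegral.
Context {R : realType} {d} {T : measurableType d} (mu : {measure set T -> \bar R}).
Implicit Types f g : T -> R[i].

Lemma measurable_normcE f : cmeas f -> measurable_fun setT (fun x => (normc (f x))%:E).
Proof. by move=> mf; apply/measurable_EFinP; exact: cmeas_normc. Qed.

Lemma cintegrable_Re f : cintegrable mu f ->
  mu.-integrable setT (EFin \o (fun x => complex.Re (f x))).
Proof.
move=> [mf fi]; apply/integrableP; split; first by apply/measurable_EFinP; exact: mf.1.
apply: le_lt_trans fi; apply: ge0_le_integral => //.
- by apply: measurableT_comp => //; apply/measurable_EFinP; exact: mf.1.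
- exact: measurable_normcE.
- by move=> x _ /=; rewrite lee_fin ler_Re_normc.
Qed.

Lemma cintegrable_Im f : cintegrable mu f ->
  mu.-integrable setT (EFin \o (fun x => complex.Im (f x))).
Proof.
move=> [mf fi]; apply/integrableP; split; first by apply/measurable_EFinP; exact: mf.2.
apply: le_lt_trans fi; apply: ge0_le_integral => //.
- by apply: measurableT_comp => //; apply/measurable_EFinP; exact: mf.2.
- exact: measurable_normcE.
- by move=> x _ /=; rewrite lee_fin ler_Im_normc.
Qed.

Lemma le_cintegrable f (g : T -> R) : cmeas f -> measurable_fun setT g ->
  (forall x, normc (f x) <= g x) -> (\int[mu]_x (g x)%:E < +oo)%E -> cintegrable mu f.
Proof.
move=> mf mg fg gi; split => //; apply: le_lt_trans gi; apply: ge0_le_integral => //.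
- exact: measurable_normcE.
- exact/measurable_EFinP.
- by move=> x _; rewrite lee_fin.
Qed.

Lemma cintegrableD f g : cintegrable mu f -> cintegrable mu g ->
  cintegrable mu (fun x => f x + g x).
Proof.
move=> [mf fi] [mg gi]; apply: (@le_cintegrable _ (fun x => normc (f x) + normc (g x))).
- exact: cmeasD.
- by apply: measurable_funD; exact: cmeas_normc.
- by move=> x; exact: le_normcD.
- under eq_integral => x _ do rewrite EFinD.
  rewrite ge0_integralD//; first exact: lte_add_pinfty.
  + exact: measurable_normcE.
  + exact: measurable_normcE.
Qed.

Lemma cintegrableMl f g (c : R) : cmeas g -> (forall x, normc (g x) <= c) ->
  cintegrable mu f -> cintegrable mu (fun x => g x * f x).
Proof.
move=> mg gc [mf fi]; apply: (@le_cintegrable _ (fun x => `|c| * normc (f x))).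
- exact: cmeasM.
- by apply: measurable_funM => //; exact: cmeas_normc.
- by move=> x; rewrite normcM ler_wpM2r// (le_trans (gc x))// ler_norm.
- under eq_integral => x _ do rewrite EFinM.
  rewrite ge0_integralZl_EFin//.
  + by rewrite lte_mul_pinfty.
  + exact: measurable_normcE.
Qed.

Lemma cintegrableZl (c : R[i]) f : cintegrable mu f -> cintegrable mu (fun x => c * f x).
Proof. by apply: cintegrableMl; [exact: cmeas_cst|move=> x; exact: lexx]. Qed.

Lemma cintegrable_conj f : cintegrable mu f -> cintegrable mu (fun x => (f x)^*).
Proof.
move=> [mf fi]; split; first exact: cmeas_conj.
by under eq_integral => x _ do rewrite normc_conj.
Qed.

Lemma cintegrableN f : cintegrable mu f -> cintegrable mu (fun x => - f x).
Proof.
move=> [mf fi]; split; first exact: cmeasN.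
by under eq_integral => x _ do rewrite normcN.
Qed.

Lemma cintegrableB f g : cintegrable mu f -> cintegrable mu g ->
  cintegrable mu (fun x => f x - g x).
Proof. by move=> fi gi; apply: cintegrableD => //; exact: cintegrableN. Qed.

Lemma eq_cint f g : f =1 g -> cint mu f = cint mu g.
Proof. by move=> fg; congr cint; exact/funext. Qed.

Lemma cintD f g : cintegrable mu f -> cintegrable mu g ->
  cint mu (fun x => f x + g x) = cint mu f + cint mu g.
Proof.
move=> fi gi; rewrite /cint; apply: complex_eqP; rewrite ?ReD ?ImD /=.
  under eq_Rintegral => x _ do rewrite ReD.
  by rewrite RintegralD//; exact: cintegrable_Re.
under eq_Rintegral => x _ do rewrite ImD.
by rewrite RintegralD//; exact: cintegrable_Im.
Qed.

Lemma cintZl (c : R[i]) f : cintegrable mu f ->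
  cint mu (fun x => c * f x) = c * cint mu f.
Proof.
move=> fi; have fi1 := cintegrable_Re fi; have fi2 := cintegrable_Im fi.
rewrite /cint; apply: complex_eqP; rewrite ?ReM ?ImM /=.
  under eq_Rintegral => x _ do rewrite ReM.
  rewrite RintegralB ?RintegralZl//; first exact: integrableZl fi1.
  exact: integrableZl fi2.
under eq_Rintegral => x _ do rewrite ImM.
rewrite RintegralD ?RintegralZl//; first exact: integrableZl fi2.
exact: integrableZl fi1.
Qed.

Lemma cintN f : cintegrable mu f -> cint mu (fun x => - f x) = - cint mu f.
Proof.
by move=> fi; rewrite -mulN1r -cintZl//; apply: eq_cint => x; rewrite mulN1r.
Qed.

Lemma cintB f g : cintegrable mu f -> cintegrable mu g ->
  cint mu (fun x => f x - g x) = cint mu f - cint mu g.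
Proof. by move=> fi gi; rewrite cintD ?cintN//; exact: cintegrableN. Qed.

Lemma cint_conj f : cintegrable mu f -> cint mu (fun x => (f x)^*) = (cint mu f)^*.
Proof.
move=> fi; apply: complex_eqP; rewrite ?Re_conj ?Im_conj /cint /=.
  by apply: eq_Rintegral => x _; rewrite Re_conj.
under eq_Rintegral => x _ do rewrite Im_conj -mulN1r.
by rewrite RintegralZl ?mulN1r//; exact: cintegrable_Im.
Qed.

Lemma cint0 : cint mu (fun=> 0) = 0.
Proof. by rewrite /cint /= Rintegral_cst// mul0r. Qed.

Lemma ae_eq_cint f g : cmeas f -> cmeas g -> {ae mu, forall x, f x = g x} ->
  cint mu f = cint mu g.
Proof.
move=> [f1 f2] [g1 g2] fg; rewrite /cint /Rintegral; congr (fine _ +i* fine _).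
  apply: ae_eq_integral => //; [exact/measurable_EFinP..|].
  by apply: filterS fg => x -> _.
apply: ae_eq_integral => //; [exact/measurable_EFinP..|].
by apply: filterS fg => x -> _.
Qed.

Lemma ae_eq_cintegrable f g : cmeas g -> {ae mu, forall x, f x = g x} ->
  cintegrable mu f -> cintegrable mu g.
Proof.
move=> mg fg [mf fi]; split => //; rewrite (_ : integral _ _ _ = \int[mu]_x (normc (f x))%:E)%E//.
apply: ae_eq_integral => //; [exact: measurable_normcE..|].
by apply: filterS fg => x -> _.
Qed.

Lemma cint_real (g : T -> R) : cint mu (fun x => (g x)%:C) = (\int[mu]_x g x)%R%:C.
Proof. by rewrite /cint/= Rintegral_cst// mul0r. Qed.

(** Rotation to the real axis: with [z] the integral of [f], the integral of the real part of
    [z^* f] is [|z|^2], and it is at most [|z|] times the integral of [|f|]; then divide by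
    [|z|]. *)
Lemma normc_cint_le f : cintegrable mu f ->
  ((normc (cint mu f))%:E <= \int[mu]_x (normc (f x))%:E)%E.
Proof.
move=> fi; have [mf fi'] := fi; pose z := cint mu f.
have [z0|z0] := eqVneq (normc z) 0.
  by rewrite -/z z0; exact: integral_ge0.
have zgt0 : 0 < normc z by rewrite lt_def z0 normc_ge0.
have zfi : cintegrable mu (fun x => z^* * f x) by exact: cintegrableZl.
have : (normc z ^+ 2)%:E = (\int[mu]_x (complex.Re (z^* * f x))%:E)%E.
  rewrite -[RHS]fineK; last by apply: integrable_fin_num => //; exact: (cintegrable_Re zfi).
  have /(congr1 (@complex.Re _)) : cint mu (fun x => z^* * f x) = (normc z ^+ 2)%:C.
    by rewrite cintZl// mulrC mulc_conj.
  by move=> /= <-.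
have le1 : (\int[mu]_x (complex.Re (z^* * f x))%:E <=
            (normc z)%:E * \int[mu]_x (normc (f x))%:E)%E.
  rewrite -ge0_integralZl_EFin//.
  - apply: le_integral => //; first exact: (cintegrable_Re zfi).
      apply/integrableP; split.
        by apply: measurable_funeM; exact: measurable_normcE.
      under eq_integral => x _ do rewrite gee0_abs ?mule_ge0 ?lee_fin//.
      rewrite ge0_integralZl_EFin//; first by rewrite lte_mul_pinfty// lee_fin.
      exact: measurable_normcE.
    move=> x _; rewrite -EFinM lee_fin -(normc_conj z) -normcM.
    exact: le_trans (ler_norm _) (ler_Re_normc _).
  - exact: measurable_normcE.
have If : (\int[mu]_x (normc (f x))%:E)%E \is a fin_num.
  by rewrite ge0_fin_numE//; exact: integral_ge0.
move=> E; move: le1; rewrite -E -/z -(fineK If) -EFinM !lee_fin expr2.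
by rewrite ler_pM2l.
Qed.

Lemma cint_dominated_cvg (f_ : nat -> T -> R[i]) f (g : T -> R) :
  (forall n, cmeas (f_ n)) -> cmeas f ->
  {ae mu, forall x, normc (f_ n x - f x) @[n --> \oo] --> 0} ->
  mu.-integrable setT (EFin \o g) -> (forall n x, normc (f_ n x) <= g x) ->
  normc (cint mu (f_ n) - cint mu f) @[n --> \oo] --> 0.
Proof.
move=> mf_ mf ff gi fg.
(* [P] stands for the real or the imaginary part, so that one argument serves both. *)
have Rec (P : R[i] -> R) : (forall z w, P (z - w) = P z - P w) ->
    (forall z, `|P z| <= normc z) -> (forall h, cmeas h -> measurable_fun setT (fun x : T => P (h x))) ->
    (\int[mu]_x P (f_ n x))%R @[n --> \oo] --> (\int[mu]_x P (f x))%R.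
  move=> PB Pn Pm.
  have [] := @dominated_convergence _ _ _ mu setT measurableT
     (fun n => EFin \o (fun x => P (f_ n x))) (EFin \o (fun x => P (f x))) (EFin \o g).
  - by move=> n; apply/measurable_EFinP; exact: Pm.
  - by apply/measurable_EFinP; exact: Pm.
  - apply: filterS ff => x fx _; apply: cvg_EFin; first exact: nearW.
    apply/cvgrPdist_le => e e0; move/cvgrPdist_le/(_ _ e0): fx.
    apply: filterS => n; rewrite sub0r normrN ger0_norm//; apply: le_trans.
    by rewrite distrC /comp/= -PB; exact: Pn.
  - by [].
  - by apply: nearW => x n _ /=; rewrite lee_fin (le_trans (Pn _)).
  - move=> Pi _; rewrite -[X in _ --> X -> _]fineK; last exact: integrable_fin_num.
    by move=> Pc; exact: fine_cvg Pc.
have Re_ := Rec (@complex.Re R) _ (@ler_Re_normc R) (fun h mh => mh.1).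
have Im_ := Rec (@complex.Im R) _ (@ler_Im_normc R) (fun h mh => mh.2).
have c1 : (fun n => complex.Re (cint mu (f_ n) - cint mu f)) @ \oo --> (0 : R).
  rewrite (_ : (fun _ => _) = fun n => (\int[mu]_x complex.Re (f_ n x))%R -
    (\int[mu]_x complex.Re (f x))%R); last by apply/funext => n; rewrite ReD ReN.
  by apply/subr_cvg0; apply: Re_ => z w; rewrite ReD ReN.
have c2 : (fun n => complex.Im (cint mu (f_ n) - cint mu f)) @ \oo --> (0 : R).
  rewrite (_ : (fun _ => _) = fun n => (\int[mu]_x complex.Im (f_ n x))%R -
    (\int[mu]_x complex.Im (f x))%R); last by apply/funext => n; rewrite ImD ImN.
  by apply/subr_cvg0; apply: Im_ => z w; rewrite ImD ImN.
have : (fun n => `|complex.Re (cint mu (f_ n) - cint mu f)| +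
    `|complex.Im (cint mu (f_ n) - cint mu f)|) @ \oo --> (0 : R).
  by rewrite -[X in _ --> X](addr0 0) -{1}(@normr0 _ R) -{2}(@normr0 _ R);
    apply: cvgD; apply: cvg_norm.
apply: squeeze_cvgr; last exact: cvg_cst.
by apply: nearW => n; rewrite normc_ge0 normc_le_ReIm.
Qed.

End ComplexIntegral.

Section ComplexFubini.
Context {R : realType} {d1 d2} {T1 : measurableType d1} {T2 : measurableType d2}.
Variables (m1 : {sigma_finite_measure set T1 -> \bar R})
  (m2 : {sigma_finite_measure set T2 -> \bar R}).

Lemma Rintegral_prod (F : T1 * T2 -> R) : (m1 \x m2)%E.-integrable setT (EFin \o F) ->
  (\int[m1]_x (\int[m2]_y F (x, y)))%R = (\int[(m1 \x m2)%E]_z F z)%R.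
Proof.
move=> iF; rewrite {1}/Rintegral [RHS]/Rintegral -(integral12_prod_meas1 iF); congr fine.
have mF := measurable_fubini_F iF.
apply: ae_eq_integral => //; first by apply/measurable_EFinP; apply: measurableT_comp mF.
have /integrable_ae-/(_ measurableT) := integrable_fubini_F iF.
by apply: filterS => x /(_ I) h _; rewrite /Rintegral /= fineK.
Qed.

Lemma Rintegral_prod2 (F : T1 * T2 -> R) : (m1 \x m2)%E.-integrable setT (EFin \o F) ->
  (\int[m2]_y (\int[m1]_x F (x, y)))%R = (\int[(m1 \x m2)%E]_z F z)%R.
Proof.
move=> iF; rewrite {1}/Rintegral [RHS]/Rintegral -(integral21_prod_meas1 iF); congr fine.
have mF := measurable_fubini_G iF.
apply: ae_eq_integral => //; first by apply/measurable_EFinP; apply: measurableT_comp mF.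
apply: filterS (ae_integrable2 iF) => y h _; rewrite /Rintegral /= fineK//.
exact: (integrable_fin_num measurableT h).
Qed.

Lemma cint_prod (F : T1 * T2 -> R[i]) : cintegrable (m1 \x m2)%E F ->
  cint m1 (fun x => cint m2 (fun y => F (x, y))) = cint (m1 \x m2)%E F.
Proof.
move=> iF; rewrite /cint /=; congr (_ +i* _).
  exact: Rintegral_prod (cintegrable_Re iF).
exact: Rintegral_prod (cintegrable_Im iF).
Qed.

Lemma cint_prod2 (F : T1 * T2 -> R[i]) : cintegrable (m1 \x m2)%E F ->
  cint m2 (fun y => cint m1 (fun x => F (x, y))) = cint (m1 \x m2)%E F.
Proof.
move=> iF; rewrite /cint /=; congr (_ +i* _).
  exact: Rintegral_prod2 (cintegrable_Re iF).
exact: Rintegral_prod2 (cintegrable_Im iF).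
Qed.

Lemma cint_fubini (F : T1 * T2 -> R[i]) : cintegrable (m1 \x m2)%E F ->
  cint m1 (fun x => cint m2 (fun y => F (x, y))) =
  cint m2 (fun y => cint m1 (fun x => F (x, y))).
Proof. by move=> iF; rewrite cint_prod// cint_prod2. Qed.

Lemma cmeas_cint2 (F : T1 * T2 -> R[i]) : cintegrable (m1 \x m2)%E F ->
  cmeas (fun x => cint m2 (fun y => F (x, y))).
Proof.
move=> iF; split.
  exact: measurableT_comp (measurable_fubini_F (cintegrable_Re iF)).
exact: measurableT_comp (measurable_fubini_F (cintegrable_Im iF)).
Qed.

End ComplexFubini.

(** * Square-integrable functions *)

Section SquareIntegrable.
Context {R : realType} {d} {T : measurableType d} (mu : {measure set T -> \bar R}).
Implicit Types f g h : T -> R[i].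

(** Kept in the extended reals so that it makes sense before membership in [L2] is known. *)
Definition nsq f : \bar R := (\int[mu]_x (normc (f x) ^+ 2)%:E)%E.
Definition L2 f : Prop := cmeas f /\ (nsq f < +oo)%E.
Definition nrm f : R := Num.sqrt (fine (nsq f)).
Definition ip f g : R[i] := cint mu (fun x => f x * (g x)^*).

Arguments nsq : simpl never.
Arguments nrm : simpl never.
Arguments ip : simpl never.

Lemma measurable_sqnormc f : cmeas f ->
  measurable_fun setT (fun x => (normc (f x) ^+ 2)%:E).
Proof. by move=> mf; apply/measurable_EFinP; apply: measurable_funX; exact: cmeas_normc. Qed.

Lemma sqnormcE_ge0 (z : R[i]) : (0 <= (normc z ^+ 2)%:E)%E.
Proof. by rewrite lee_fin sqr_ge0. Qed.
Hint Extern 0 (is_true (@Order.le ereal_display _ _ _)) => solve [apply: sqnormcE_ge0] : core.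

Lemma nsq_ge0 f : (0 <= nsq f)%E.
Proof. exact: integral_ge0. Qed.

Lemma nrm_ge0 f : 0 <= nrm f.
Proof. exact: sqrtr_ge0. Qed.

Lemma nrm_sq f : L2 f -> (nrm f ^+ 2)%:E = nsq f.
Proof.
move=> [mf fi]; rewrite sqr_sqrtr; last by rewrite fine_ge0// nsq_ge0.
by rewrite fineK// ge0_fin_numE// nsq_ge0.
Qed.

Lemma le_L2 f (c : R) g : cmeas f -> (forall x, normc (f x) <= c * normc (g x)) ->
  L2 g -> L2 f.
Proof.
move=> mf fg [mg gi]; split => //.
apply: (@le_lt_trans _ _ (\int[mu]_x ((c ^+ 2)%:E * (normc (g x) ^+ 2)%:E))%E).
  apply: ge0_le_integral => //.
  - exact: measurable_sqnormc.
  - by apply: measurable_funeM; exact: measurable_sqnormc.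
  - move=> x _; rewrite -EFinM lee_fin -exprMn lerXn2r ?nnegrE//.
    exact: le_trans (fg x).
rewrite ge0_integralZl_EFin ?sqr_ge0//; first by rewrite lte_mul_pinfty ?lee_fin ?sqr_ge0.
exact: measurable_sqnormc.
Qed.

Lemma L2N f : L2 f -> L2 (fun x => - f x).
Proof.
move=> Lf; apply: (@le_L2 _ 1 f) => //; first by apply: cmeasN; case: Lf.
by move=> x; rewrite normcN mul1r.
Qed.

Lemma L2Ml g (c : R) f : cmeas g -> (forall x, normc (g x) <= c) -> L2 f ->
  L2 (fun x => g x * f x).
Proof.
move=> mg gc Lf; apply: (@le_L2 _ c f) => //; first by apply: cmeasM => //; case: Lf.
by move=> x; rewrite normcM ler_wpM2r.
Qed.

Lemma L2Zl (c : R[i]) f : L2 f -> L2 (fun x => c * f x).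
Proof. by apply: (@L2Ml _ (normc c)) => //; exact: cmeas_cst. Qed.

Lemma L2D f g : L2 f -> L2 g -> L2 (fun x => f x + g x).
Proof.
move=> [mf fi] [mg gi]; split; first exact: cmeasD.
apply: (@le_lt_trans _ _ (\int[mu]_x ((2%:E * (normc (f x) ^+ 2)%:E) + (2%:E * (normc (g x) ^+ 2)%:E)))%E).
  apply: ge0_le_integral => //.
  - by apply: measurable_sqnormc; exact: cmeasD.
  - by apply: emeasurable_funD; apply: measurable_funeM; exact: measurable_sqnormc.
  - move=> x _; rewrite -!EFinM -EFinD lee_fin.
    apply: (@le_trans _ _ ((normc (f x) + normc (g x)) ^+ 2)).
      by rewrite lerXn2r ?nnegrE ?addr_ge0// le_normcD.
    by have := sqr_ge0 (normc (f x) - normc (g x)); nra.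
rewrite ge0_integralD//; last 4 first.
- by move=> x _; rewrite mule_ge0.
- by apply: measurable_funeM; exact: measurable_sqnormc.
- by move=> x _; rewrite mule_ge0.
- by apply: measurable_funeM; exact: measurable_sqnormc.
rewrite !ge0_integralZl_EFin//; try exact: measurable_sqnormc.
by apply: lte_add_pinfty; rewrite lte_mul_pinfty// lee_fin.
Qed.

Lemma L2B f g : L2 f -> L2 g -> L2 (fun x => f x - g x).
Proof. by move=> Lf Lg; apply: L2D => //; exact: L2N. Qed.

Lemma L2_0 : L2 (fun=> 0).
Proof.
split; first exact: cmeas_cst.
rewrite /nsq; under eq_integral => x _ do rewrite normc0 expr0n/=.
by rewrite integral0.
Qed.

Lemma L2_sum I (r : seq I) (F : I -> T -> R[i]) :
  (forall i, L2 (F i)) -> L2 (fun x => \sum_(i <- r) F i x).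
Proof.
move=> LF; elim: r => [|i r ih].
  by under eq_fun do rewrite big_nil; exact: L2_0.
by under eq_fun do rewrite big_cons; exact: L2D.
Qed.

Lemma cintegrable_ip f g : L2 f -> L2 g -> cintegrable mu (fun x => f x * (g x)^*).
Proof.
move=> [mf fi] [mg gi].
apply: (@le_cintegrable _ _ _ _ _ (fun x => normc (f x) ^+ 2 + normc (g x) ^+ 2)).
- by apply: cmeasM => //; exact: cmeas_conj.
- by apply: measurable_funD; apply: measurable_funX; exact: cmeas_normc.
- move=> x; rewrite normcM normc_conj.
  by have := sqr_ge0 (normc (f x) - normc (g x)); have := normc_ge0 (f x);
    have := normc_ge0 (g x); nra.
- under eq_integral => x _ do rewrite EFinD.
  rewrite ge0_integralD//; [exact: lte_add_pinfty|exact: measurable_sqnormc..].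
Qed.

Lemma ipDl f g h : L2 f -> L2 g -> L2 h ->
  ip (fun x => f x + g x) h = ip f h + ip g h.
Proof.
move=> Lf Lg Lh; rewrite /ip -cintD; [|exact: cintegrable_ip..].
by apply: eq_cint => x; rewrite mulrDl.
Qed.

Lemma ipZl (c : R[i]) f h : L2 f -> L2 h -> ip (fun x => c * f x) h = c * ip f h.
Proof.
move=> Lf Lh; rewrite /ip -cintZl; last exact: cintegrable_ip.
by apply: eq_cint => x; rewrite mulrA.
Qed.

Lemma ip_conj f g : L2 f -> L2 g -> (ip f g)^* = ip g f.
Proof.
move=> Lf Lg; rewrite /ip -cint_conj; last exact: cintegrable_ip.
by apply: eq_cint => x; rewrite conjcM conjcKK mulrC.
Qed.

Lemma ipBl f g h : L2 f -> L2 g -> L2 h ->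
  ip (fun x => f x - g x) h = ip f h - ip g h.
Proof.
move=> Lf Lg Lh; rewrite /ip -cintB; [|exact: cintegrable_ip..].
by apply: eq_cint => x; rewrite mulrBl.
Qed.

Lemma ipDr f g h : L2 f -> L2 g -> L2 h ->
  ip h (fun x => f x + g x) = ip h f + ip h g.
Proof.
move=> Lf Lg Lh; rewrite /ip -cintD; [|exact: cintegrable_ip..].
by apply: eq_cint => x; rewrite conjcD mulrDr.
Qed.

Lemma ipBr f g h : L2 f -> L2 g -> L2 h ->
  ip h (fun x => f x - g x) = ip h f - ip h g.
Proof.
move=> Lf Lg Lh; rewrite /ip -cintB; [|exact: cintegrable_ip..].
by apply: eq_cint => x; rewrite conjcB mulrBr.
Qed.

Lemma ipZr (c : R[i]) f h : L2 f -> L2 h -> ip h (fun x => c * f x) = c^* * ip h f.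
Proof.
move=> Lf Lh; rewrite /ip -cintZl; last exact: cintegrable_ip.
by apply: eq_cint => x; rewrite conjcM mulrCA.
Qed.

Lemma ip_same f : L2 f -> ip f f = (nrm f ^+ 2)%:C.
Proof.
move=> Lf; rewrite /ip (eq_cint _ (fun x => mulc_conj (f x))) cint_real.
congr real_complex_def.
have [_ fi] := Lf.
by apply: EFin_inj; rewrite nrm_sq// /Rintegral fineK// ge0_fin_numE// nsq_ge0.
Qed.

(** Young's inequality [2 |f g| <= a |f|^2 + |g|^2 / a], with [a] close to the quotient of the
    norms. The form with moduli inside the integral also bounds correlations. *)
Lemma cauchy_schwarz f g : L2 f -> L2 g ->
  (\int[mu]_x (normc (f x) * normc (g x))%:E <= (nrm f * nrm g)%:E)%E.
Proof.
move=> Lf Lg; have [mf fi] := Lf; have [mg gi] := Lg.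
have F0 := nrm_ge0 f; have G0 := nrm_ge0 g.
apply/lee_addgt0Pr => e e0.
(* Both norms are shifted by [e'] so that the quotient [a] exists when one of them vanishes; [e'] is
   chosen so that the shift costs at most [e]. *)
pose D := (nrm f + nrm g + 1) ; have D0 : 0 < D by rewrite /D; lra.
pose e' := e / D; have e'0 : 0 < e' by rewrite divr_gt0.
pose a := (nrm g + e') / (nrm f + e').
have fe0 : 0 < nrm f + e' by rewrite ltr_wpDl.
have ge0 : 0 < nrm g + e' by rewrite ltr_wpDl.
have a0 : 0 < a by rewrite divr_gt0.
apply: (@le_trans _ _ (\int[mu]_x ((a / 2)%:E * (normc (f x) ^+ 2)%:E + (a^-1 / 2)%:E * (normc (g x) ^+ 2)%:E))%E).
  apply: ge0_le_integral => //.
  - by move=> x _; rewrite lee_fin mulr_ge0.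
  - by apply/measurable_EFinP; apply: measurable_funM; exact: cmeas_normc.
  - by apply: emeasurable_funD; apply: measurable_funeM; exact: measurable_sqnormc.
  - move=> x _; rewrite -!EFinM -EFinD lee_fin.
    have := sqr_ge0 (a * normc (f x) - normc (g x)).
    rewrite -(ler_pM2l (_ : 0 < 2 * a)); last lra.
    have -> : 2 * a * (a / 2 * normc (f x) ^+ 2 + a^-1 / 2 * normc (g x) ^+ 2) =
       a ^+ 2 * normc (f x) ^+ 2 + normc (g x) ^+ 2 by field; rewrite gt_eqF.
    nra.
rewrite ge0_integralD//; last 4 first.
- by move=> x _; rewrite mule_ge0// lee_fin divr_ge0// ltW.
- by apply: measurable_funeM; exact: measurable_sqnormc.
- by move=> x _; rewrite mule_ge0// lee_fin divr_ge0// invr_ge0 ltW.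
- by apply: measurable_funeM; exact: measurable_sqnormc.
have a20 : 0 <= a / 2 by rewrite divr_ge0// ltW.
have a30 : 0 <= a^-1 / 2 by rewrite divr_ge0// invr_ge0 ltW.
rewrite !ge0_integralZl_EFin//; try exact: measurable_sqnormc.
rewrite -/(nsq f) -/(nsq g) -!nrm_sq// -!EFinM -!EFinD lee_fin.
have h1 : a * nrm f ^+ 2 <= (nrm g + e') * nrm f.
  rewrite expr2 mulrA ler_wpM2r// /a mulrAC ler_pdivrMr// ler_pM2l//; lra.
have h2 : a^-1 * nrm g ^+ 2 <= nrm g * (nrm f + e').
  rewrite [leRHS]mulrC expr2 mulrA ler_wpM2r// /a invf_div mulrAC ler_pdivrMr// ler_pM2l//; lra.
have h3 : e' * (nrm f + nrm g) <= e.
  by rewrite /e' mulrAC ler_pdivrMr// ler_wpM2l ?ltW// /D; lra.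
nra.
Qed.

Lemma normc_ip_le f g : L2 f -> L2 g -> normc (ip f g) <= nrm f * nrm g.
Proof.
move=> Lf Lg; rewrite -lee_fin; apply: le_trans (cauchy_schwarz Lf Lg).
apply: le_trans (normc_cint_le (cintegrable_ip Lf Lg)) _.
rewrite le_eqVlt; apply/orP; left; apply/eqP; apply: eq_integral => x _.
by rewrite normcM normc_conj.
Qed.

Lemma nrm_sqD f g : L2 f -> L2 g ->
  nrm (fun x => f x + g x) ^+ 2 = nrm f ^+ 2 + nrm g ^+ 2 + 2 * complex.Re (ip f g).
Proof.
move=> Lf Lg; have Lfg := L2D Lf Lg.
have /(congr1 (@complex.Re R)) := ip_same Lfg.
rewrite ipDl// !ipDr// !ReD !ip_same// -(ip_conj Lf Lg) Re_conj !Re_realC => <-.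
by ring.
Qed.

Lemma le_nrmD f g : L2 f -> L2 g -> nrm (fun x => f x + g x) <= nrm f + nrm g.
Proof.
move=> Lf Lg; have F0 := nrm_ge0 f; have G0 := nrm_ge0 g.
rewrite -(@ler_pXn2r _ 2)// ?nnegrE ?addr_ge0 ?nrm_ge0// nrm_sqD//.
have := le_trans (ler_norm _) (le_trans (ler_Re_normc _) (normc_ip_le Lf Lg)).
by nra.
Qed.

Lemma eq_nrm f g : (forall x, normc (f x) = normc (g x)) -> nrm f = nrm g.
Proof.
by move=> fg; rewrite /nrm /nsq; under eq_integral => x _ do rewrite fg.
Qed.

Lemma nrmN f : nrm (fun x => - f x) = nrm f.
Proof. by apply: eq_nrm => x; rewrite normcN. Qed.

Lemma nrm_distC f g : nrm (fun x => f x - g x) = nrm (fun x => g x - f x).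
Proof. by apply: eq_nrm => x; rewrite -normcN opprB. Qed.

Lemma nrmZ (c : R[i]) f : L2 f -> nrm (fun x => c * f x) = normc c * nrm f.
Proof.
move=> Lf; apply/eqP.
rewrite -(@eqrXn2 _ 2)// ?nrm_ge0// ?mulr_ge0 ?nrm_ge0//.
have := ip_same (L2Zl c Lf); rewrite ipZl//; last exact: L2Zl.
rewrite ipZr// ip_same// mulrA mulc_conj exprMn => /(congr1 (@complex.Re R)) /=.
by rewrite mul0r subr0 => ->.
Qed.

Lemma le_nrm_distD h f g : L2 f -> L2 g -> L2 h ->
  nrm (fun x => f x - g x) <= nrm (fun x => f x - h x) + nrm (fun x => h x - g x).
Proof.
move=> Lf Lg Lh; rewrite -[leLHS](_ : nrm (fun x => (f x - h x) + (h x - g x)) = _).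
  by apply: le_nrmD; exact: L2B.
by apply: eq_nrm => x; rewrite addrA subrK.
Qed.

Lemma ler_nrm_sub f g : L2 f -> L2 g -> nrm f - nrm g <= nrm (fun x => f x - g x).
Proof.
move=> Lf Lg; rewrite lerBlDr -[leLHS](_ : nrm (fun x => (f x - g x) + g x) = _).
  by apply: le_nrmD => //; exact: L2B.
by apply: eq_nrm => x; rewrite subrK.
Qed.

Lemma ae_eq_nsq f g : cmeas f -> cmeas g -> {ae mu, forall x, f x = g x} -> nsq f = nsq g.
Proof.
move=> mf mg fg; apply: ae_eq_integral => //; [exact: measurable_sqnormc..|].
by apply: filterS fg => x -> _.
Qed.

Lemma ae_eq_nrm f g : cmeas f -> cmeas g -> {ae mu, forall x, f x = g x} -> nrm f = nrm g.
Proof. by move=> mf mg fg; rewrite /nrm (ae_eq_nsq mf mg fg). Qed.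

Lemma ae_eq_L2 f g : cmeas g -> {ae mu, forall x, f x = g x} -> L2 f -> L2 g.
Proof. by move=> mg fg [mf fi]; split => //; rewrite -(ae_eq_nsq mf mg fg). Qed.

Lemma ae_eq_ip f f' g g' : cmeas f -> cmeas f' -> cmeas g -> cmeas g' ->
  {ae mu, forall x, f x = f' x} -> {ae mu, forall x, g x = g' x} -> ip f g = ip f' g'.
Proof.
move=> mf mf' mg mg' ff gg; apply: ae_eq_cint.
- by apply: cmeasM => //; exact: cmeas_conj.
- by apply: cmeasM => //; exact: cmeas_conj.
- by apply: filterS2 ff gg => x -> ->.
Qed.

Lemma nrm_eq0_ae f : L2 f -> nrm f = 0 -> {ae mu, forall x, f x = 0}.
Proof.
move=> Lf f0; have := nrm_sq Lf; rewrite f0 expr0n/= => E.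
have [mf _] := Lf.
have [+ _] := ae_eq_integral_abs mu measurableT (measurable_sqnormc mf).
have -> : (\int[mu]_x `|(normc (f x) ^+ 2)%:E|)%E = nsq f.
  by apply: eq_integral => x _; rewrite gee0_abs.
rewrite -E => /(_ erefl); apply: filterS => x /(_ I) /= [].
by move/eqP; rewrite expf_eq0/= => /eqP; exact: eq0_normc.
Qed.

Lemma nrm0P f g : L2 f -> L2 g -> nrm (fun x => f x - g x) = 0 -> {ae mu, forall x, f x = g x}.
Proof.
move=> Lf Lg /(nrm_eq0_ae (L2B Lf Lg)); apply: filterS => x /eqP.
by rewrite subr_eq0 => /eqP.
Qed.

Lemma nrm_0 : nrm (fun=> 0) = 0.
Proof.
rewrite /nrm /nsq; under eq_integral => x _ do rewrite normc0 expr0n/=.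
by rewrite integral0 sqrtr0.
Qed.

End SquareIntegrable.
Arguments nsq : simpl never.
Arguments nrm : simpl never.
Arguments ip : simpl never.
#[global] Hint Extern 0 (is_true (@Order.le ereal_display _ _ _)) => solve [apply: sqnormcE_ge0] : core.
#[global] Hint Extern 0 (is_true (0 <= nrm _ _)) => solve [exact: nrm_ge0] : core.

Lemma normc_cvg {R : realType} (z_ : nat -> R[i]) (z : R[i]) :
  (fun n => complex.Re (z_ n)) @ \oo --> complex.Re z ->
  (fun n => complex.Im (z_ n)) @ \oo --> complex.Im z ->
  (fun n => normc (z_ n - z)) @ \oo --> (0 : R).
Proof.
move=> c1 c2.
have : (fun n => `|complex.Re (z_ n) - complex.Re z| +
    `|complex.Im (z_ n) - complex.Im z|) @ \oo --> (0 : R).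
  rewrite -[X in _ --> X](addr0 0) -{1}(@normr0 _ R) -{2}(@normr0 _ R).
  by apply: cvgD; apply: cvg_norm; exact/subr_cvg0.
apply: squeeze_cvgr; last exact: cvg_cst.
apply: nearW => n; rewrite normc_ge0 (le_trans (normc_le_ReIm _))//.
by rewrite ReD ImD ReN ImN.
Qed.

(** The telescoping series converges absolutely. *)
Lemma cvg_geometric_increments {R : realType} (a : nat -> R) (c : R) :
  (forall n, `|a n.+1 - a n| <= c * 2^-1 ^+ n) -> cvgn a.
Proof.
move=> ac; have : cvgn (series (telescope a)).
  apply: normed_cvg; apply: (@series_le_cvg _ _ (geometric c 2^-1)) => //.
  - by move=> n; exact: normr_ge0.
  - by move=> n; exact: le_trans (normr_ge0 _) (ac n).
  - by apply: is_cvg_geometric_series; rewrite ger0_norm ?invr_ge0// invf_lt1// ltr1n.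
move=> ca; rewrite (_ : a = fun n => a 0%N + series (telescope a) n).
  by apply: is_cvgD => //; exact: is_cvg_cst.
by apply/funext => n; exact: eq_sum_telescope.
Qed.

Lemma fatou_le {R : realType} {d} {T : measurableType d} (mu : {measure set T -> \bar R})
    (h_ : nat -> T -> R) (h : T -> R) (c : \bar R) :
  (forall n, measurable_fun setT (h_ n)) -> (forall n x, 0 <= h_ n x) ->
  {ae mu, forall x, h_ n x @[n --> \oo] --> h x} -> measurable_fun setT h ->
  (forall x, 0 <= h x) ->
  (\forall n \near \oo, \int[mu]_x (h_ n x)%:E <= c)%E ->
  (\int[mu]_x (h x)%:E <= c)%E.
Proof.
move=> mh h0 hh mh' h0' hc.
have mE n : measurable_fun setT (fun x => (h_ n x)%:E) by exact/measurable_EFinP.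
have := fatou mu measurableT mE (fun n x _ => h0 n x).
set I := (X in (X <= _ -> _)%E); have -> : I = (\int[mu]_x (h x)%:E)%E.
  apply: ae_eq_integral => //.
  - apply: measurableT_comp => //; apply: measurable_fun_limn_esup => n.
    by apply: measurableT_comp.
  - exact/measurable_EFinP.
  - apply: filterS hh => x hx _.
    have hx' : (fun n => (h_ n x)%:E) @ \oo --> (h x)%:E.
      by apply: cvg_EFin => //; exact: nearW.
    rewrite is_cvg_limn_einfE; first exact/cvg_lim.
    by apply/cvg_ex; eexists; exact: hx'.
move=> /le_trans; apply; rewrite limn_einf_lim; apply: lime_le.
  exact: is_cvg_einfs.
apply: filterS hc => n hn; apply: le_trans hn.
by apply: ereal_inf_lbound; exists n => /=.
Qed.

(** * Completeness of L^2 *)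

Section Completeness.
Context {R : realType} {d} {T : measurableType d} (mu : {measure set T -> \bar R}).

(** The core of the Riesz-Fischer theorem. The series of [4^n |g_(n+1) - g_n|^2] has a finite
    integral, hence a finite sum [S] almost everywhere; where [S] is finite, the increments are at
    most [2^-n] times the square root of [S]. *)
Lemma L2_cvg_fast (g : nat -> T -> R[i]) : (forall n, L2 mu (g n)) ->
  (forall n, nrm mu (fun x => g n.+1 x - g n x) <= 4^-1 ^+ n) ->
  exists2 f, cmeas f & {ae mu, forall x, normc (g n x - f x) @[n --> \oo] --> 0}.
Proof.
move=> Lg gn; pose D n x := 4 ^+ n * normc (g n.+1 x - g n x) ^+ 2.
have D0 n x : 0 <= D n x by rewrite mulr_ge0// ?exprn_ge0// sqr_ge0.
have mD n : measurable_fun setT (fun x => (D n x)%:E).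
  apply/measurable_EFinP; apply: measurable_funM => //.
  by apply: measurable_funX; apply: cmeas_normc; apply: cmeasB; case: (Lg n); case: (Lg n.+1).
pose S x := (\sum_(n <oo) (D n x)%:E)%E.
have mS : measurable_fun setT S.
  by apply: ge0_emeasurable_sum => // n x _ _; rewrite lee_fin.
have intS : (\int[mu]_x S x < +oo)%E.
  rewrite /S integral_nneseries//; last by move=> n x _; rewrite lee_fin.
  apply: (@le_lt_trans _ _ (\sum_(n <oo) (2 / (2 ^ (n + 0.+1))%:R)%:E)%E).
    apply: lee_nneseries => n _ => [_|].
      by apply: integral_ge0 => x _; rewrite lee_fin.
    rewrite /D; under eq_integral => x _ do rewrite EFinM.
    rewrite ge0_integralZl_EFin ?exprn_ge0//.
      rewrite -/(nsq mu (fun x => g n.+1 x - g n x)) -nrm_sq; last exact: L2B.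
      have -> : 2 / (2 ^ (n + 0.+1))%:R = 2^-1 ^+ n :> R.
        by rewrite addn1 natrX exprS invfM mulrA divff ?pnatr_eq0// mul1r exprVn.
      rewrite -EFinM lee_fin.
      apply: (@le_trans _ _ (4 ^+ n * (4^-1 ^+ n) ^+ 2)).
        rewrite ler_wpM2l ?exprn_ge0// lerXn2r ?nnegrE ?exprn_ge0 ?invr_ge0//.
      rewrite expr2 mulrA -exprMn divff// expr1n mul1r.
      by rewrite lerXn2r ?nnegrE ?invr_ge0// lef_pV2 ?posrE ?ler_nat.
    by apply: measurable_sqnormc; apply: cmeasB; case: (Lg n); case: (Lg n.+1).
  by rewrite (cvg_lim _ (@cvg_geometric_eseries_half R 2 0))// ltry.
have iS : mu.-integrable setT S.
  apply/integrableP; split => //; apply: le_lt_trans intS.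
  rewrite le_eqVlt; apply/orP; left; apply/eqP; apply: eq_integral => x _.
  by rewrite gee0_abs// nneseries_ge0// => n _ _; rewrite lee_fin.
have mE : measurable [set x | S x < +oo]%E.
  by rewrite -[X in measurable X]setTI; exact: emeasurable_fun_infty_o.
(* Cutting off where [S] is infinite makes the sequence converge at every point, so that its limit
   is measurable. *)
pose g' n x := (\1_[set x | S x < +oo]%E x)%:C * g n x.
have mg' n : cmeas (g' n).
  by apply: cmeasM; [exact: cmeas_real|case: (Lg n)].
have cg' (P : R[i] -> R) x : (forall z w, P (z - w) = P z - P w) ->
    (forall z, `|P z| <= normc z) -> cvgn (fun n => P (g' n x)).
  move=> PB Pn; rewrite /g' indicE.
  have [Sx|Sx] := boolP (x \in _); last first.
    by under eq_fun do rewrite mul0r; exact: is_cvg_cst.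
  under eq_fun do rewrite mul1r.
  move: Sx; rewrite inE /= => Sx.
  have S0 : (0 <= S x)%E by apply: nneseries_ge0 => n _ _; rewrite lee_fin.
  have Sf : S x \is a fin_num by rewrite ge0_fin_numE.
  apply: (@cvg_geometric_increments _ _ (Num.sqrt (fine (S x)))) => n.
  rewrite -PB (le_trans (Pn _))//.
  rewrite -(@ler_pXn2r _ 2)// ?nnegrE ?mulr_ge0 ?exprn_ge0 ?sqrtr_ge0 ?invr_ge0//.
  rewrite exprMn sqr_sqrtr ?fine_ge0// -exprM mulnC exprM.
  rewrite -(@ler_pM2l _ (4 ^+ n)) ?exprn_gt0// [leRHS]mulrCA -exprMn.
  have -> : (4 * 2^-1 ^+ 2 : R) = 1 by field.
  rewrite expr1n mulr1 -lee_fin fineK//.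
  have Dk k : true -> (0 <= (D k x)%:E)%E by move=> _; rewrite lee_fin.
  rewrite /S (nneseriesD1 Dk (erefl (true : bool)) (n := n)).
  by rewrite leeDl// nneseries_ge0// => k _ _; rewrite lee_fin.
pose f x := limn (fun n => complex.Re (g' n x)) +i* limn (fun n => complex.Im (g' n x)).
have g'f x : normc (g' n x - f x) @[n --> \oo] --> 0.
  apply: normc_cvg.
    by apply: (cg' (@complex.Re R)) => [z w|]; [rewrite ReD ReN|exact: ler_Re_normc].
  by apply: (cg' (@complex.Im R)) => [z w|]; [rewrite ImD ImN|exact: ler_Im_normc].
exists f; first exact: cmeas_lim g'f.
have := integrable_ae measurableT iS; apply: filterS => x /(_ I) Sx.
have Sx' : (S x < +oo)%E.
  by rewrite -ge0_fin_numE// nneseries_ge0// => n _ _; rewrite lee_fin.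
have E1 n : g' n x = g n x by rewrite /g' indicE mem_set// mul1r.
by have := g'f x; under eq_fun do rewrite E1.
Qed.

Lemma L2_complete (f_ : nat -> T -> R[i]) : (forall n, L2 mu (f_ n)) ->
  (forall e, 0 < e -> exists N, forall n m, (N <= n)%N -> (N <= m)%N ->
     nrm mu (fun x => f_ n x - f_ m x) <= e) ->
  exists2 f, L2 mu f & nrm mu (fun x => f_ n x - f x) @[n --> \oo] --> 0.
Proof.
move=> Lf fC.
have /choice[N NP] : forall i, exists N, forall n m, (N <= n)%N -> (N <= m)%N ->
    nrm mu (fun x => f_ n x - f_ m x) <= 4^-1 ^+ i.
  by move=> i; apply: fC; rewrite exprn_gt0// invr_gt0.
(* The partial sums give a nondecreasing index beyond both [N n] and [n], so [g] is a subsequence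
   with geometric increments. *)
pose k n := (\sum_(i < n.+1) (N i).+1)%N; pose g n := f_ (k n).
have Nk n : (N n <= k n)%N.
  by rewrite /k big_ord_recr/= (leq_trans (leqnSn _))// leq_addl.
have kk n : (k n <= k n.+1)%N by rewrite /k [leqRHS]big_ord_recr leq_addr.
have kn n : (n <= k n)%N.
  by elim: n => // n ih; rewrite /k big_ord_recr/= -/(k n) addnS ltnS (leq_trans ih)// leq_addr.
have Lg n : L2 mu (g n) by exact: Lf.
have [|f mf gf] := L2_cvg_fast Lg.
  by move=> n; apply: (NP n) => //; exact: leq_trans (kk n).
(* Fatou's lemma in the second index turns the Cauchy estimate into an estimate of the distance to
   [f]. *)
have key e : 0 < e -> exists M, forall n, (M <= n)%N ->
    (nsq mu (fun x => (f_ n x - f x)%R) <= (e ^+ 2)%:E)%E.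
  move=> e0; have [M MP] := fC e e0; exists M => n Mn.
  have mgn p : measurable_fun setT (fun x => normc (f_ n x - g p x) ^+ 2).
    apply: measurable_funX; apply: cmeas_normc.
    by apply: cmeasB; [case: (Lf n)|case: (Lg p)].
  apply: (@fatou_le _ _ _ mu (fun p x => normc (f_ n x - g p x) ^+ 2)) => //.
  - by move=> p x; exact: sqr_ge0.
  - apply: filterS gf => x gx; rewrite !expr2.
    suff h : normc (f_ n x - g p x) @[p --> \oo] --> normc (f_ n x - f x) by exact: cvgM.
    apply/cvgrPdist_le => e' e'0; move/cvgrPdist_le/(_ _ e'0) : gx.
    apply: filterS => p; rewrite sub0r normrN ger0_norm//; apply: le_trans.
    rewrite (le_trans (ler_dist_normc _ _))// le_eqVlt; apply/orP; left; apply/eqP.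
    by congr normc; ring.
  - by apply: measurable_funX; apply: cmeas_normc; apply: cmeasB => //; case: (Lf n).
  - by move=> x; exact: sqr_ge0.
  - exists M => // p Mp /=; rewrite -/(nsq mu (fun x => f_ n x - g p x)) -nrm_sq; last exact: L2B.
    rewrite lee_fin lerXn2r ?nnegrE ?nrm_ge0 ?(ltW e0)//.
    by apply: MP => //; exact: leq_trans (kn p).
have Lf' : L2 mu f.
  have [M /(_ M (leqnn M)) h] := key 1 ltr01.
  have h' : L2 mu (fun x => f_ M x - f x).
    by split; [apply: cmeasB => //; case: (Lf M)|apply: le_lt_trans h _; rewrite ltry].
  by apply: ae_eq_L2 (L2B (Lf M) h') => //; apply: nearW => x; ring.
exists f => //; apply/cvgrPdist_le => e e0; have [M MP] := key e e0.
exists M => // n /= Mn; rewrite sub0r normrN ger0_norm//.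
rewrite -(@ler_pXn2r _ 2)// ?nnegrE ?(ltW e0)// -lee_fin nrm_sq; last exact: L2B.
exact: MP.
Qed.

End Completeness.

(** * Measure-preserving changes of variable *)

Section MeasurePreserving.
Context {R : realType} {d} {T : measurableType d} (mu : {measure set T -> \bar R}).
Variable phi : T -> T.
Hypothesis mphi : measurable_fun setT phi.
Hypothesis mu_phi : forall A, measurable A -> mu (phi @^-1` A) = mu A.

Lemma ge0_integral_preserving (f : T -> \bar R) : measurable_fun setT f ->
  (forall x, 0 <= f x)%E -> (\int[mu]_x f (phi x) = \int[mu]_x f x)%E.
Proof.
move=> mf f0; have := @ge0_integral_pushforward _ _ _ _ _ _ mphi mu setT f measurableT mf.
rewrite preimage_setT => /(_ (fun x _ => f0 x)) <-.
by apply: eq_measure_integral => A mA _; exact: mu_phi.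
Qed.

Lemma cint_preserving (f : T -> R[i]) : cintegrable mu f ->
  cint mu (fun x => f (phi x)) = cint mu f.
Proof.
move=> fi; have fi' : cintegrable mu (fun x => f (phi x)).
  have [mf foo] := fi; split; first exact: cmeas_comp.
  by rewrite (ge0_integral_preserving (f := fun x => (normc (f x))%:E))//; exact: measurable_normcE.
have h (g : T -> R) : mu.-integrable setT (EFin \o g) ->
    mu.-integrable setT (EFin \o (g \o phi)) ->
    (\int[mu]_x (g (phi x)))%R = (\int[mu]_x g x)%R.
  move=> ig igp; rewrite /Rintegral; congr fine.
  have := @integral_pushforward _ _ _ _ _ phi mphi mu setT (EFin \o g) (measurable_int _ ig).
  rewrite preimage_setT => /(_ igp measurableT) <-.
  by apply: eq_measure_integral => A mA _; exact: mu_phi.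
rewrite /cint; congr (_ +i* _).
  by apply: h; [exact: cintegrable_Re|exact: (cintegrable_Re fi')].
by apply: h; [exact: cintegrable_Im|exact: (cintegrable_Im fi')].
Qed.

Lemma nsq_preserving (f : T -> R[i]) : cmeas f -> nsq mu (fun x => f (phi x)) = nsq mu f.
Proof.
move=> mf; rewrite /nsq (ge0_integral_preserving (f := fun x => (normc (f x) ^+ 2)%:E))//.
exact: measurable_sqnormc.
Qed.

Lemma L2_preserving (f : T -> R[i]) : L2 mu f -> L2 mu (fun x => f (phi x)).
Proof. by move=> [mf fi]; split; [exact: cmeas_comp|rewrite nsq_preserving]. Qed.

Lemma nrm_preserving (f : T -> R[i]) : cmeas f -> nrm mu (fun x => f (phi x)) = nrm mu f.
Proof. by move=> mf; rewrite /nrm nsq_preserving. Qed.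

Lemma ae_preserving (P : T -> Prop) : {ae mu, forall x, P x} -> {ae mu, forall x, P (phi x)}.
Proof.
move=> [N [mN N0 PN]]; exists (phi @^-1` N); split.
- by rewrite -[X in measurable X]setTI; exact: mphi.
- by rewrite mu_phi.
- by move=> x /= nP; exact: PN.
Qed.

End MeasurePreserving.

Section PlaneMeasure.
Context {R : realType}.
Local Notation leb := (@lebesgue_measure R).

Lemma sigma_finite_leb2 : sigma_finite (setT : set (@plane R)) (leb \x leb)%E.
Proof.
have /sigma_finiteP[F [TF ndF Foo]] := @sigma_finiteT _ _ _ leb.
exists (fun n => F n `*` F n).
  rewrite -setXTT TF predeqE => -[x y]; split.
    move=> [/= [n _ Fnx] [k _ Gky]]; exists (maxn n k) => //; split.
    - by move: x Fnx; exact/subsetPset/ndF/leq_maxl.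
    - by move: y Gky; exact/subsetPset/ndF/leq_maxr.
  by move=> [n _ []/= ? ?]; split; exists n.
move=> k; have [? ?] := Foo k; split; first exact: measurableX.
by rewrite product_measure1E// lte_mul_pinfty// ge0_fin_numE.
Qed.

Definition mu2 : {sigma_finite_measure set (@plane R) -> \bar R} :=
  HB.pack (leb \x leb)%E (Measure_isSigmaFinite.Build _ _ _ (leb \x leb)%E sigma_finite_leb2).

Lemma cintegralE (f : @plane R -> R[i]) : cintegral setT f = cint mu2 f.
Proof. by []. Qed.

End PlaneMeasure.

Section PlaneAffine.
Context {R : realType}.
Local Notation leb := (@lebesgue_measure R).

Lemma measurable_affine (s a : R) :
  measurable_fun setT (fun x : measurableTypeR R => s * x + a : measurableTypeR R).
Proof.
apply: continuous_measurable_fun => x.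
by apply: cvgD; [apply: cvgM; [exact: cvg_cst|exact: cvg_id]|exact: cvg_cst].
Qed.

(** Lebesgue measure is determined by half-open intervals. A reflection turns []x1, x2]] into an
    interval closed on the other side, of the same length. *)
Lemma lebesgue_measure_affine (s a : R) (A : set (measurableTypeR R)) :
  s \in [:: 1; -1] -> measurable A -> leb ((fun x => s * x + a) @^-1` A) = leb A.
Proof.
move=> hs mA; apply/esym.
have mf := measurable_affine s a.
pose f : {mfun measurableTypeR R >-> measurableTypeR R} :=
  HB.pack (fun x : measurableTypeR R => s * x + a : measurableTypeR R)
    (isMeasurableFun.Build _ _ _ _ _ mf).
apply: (lebesgue_measure_unique (mu := pushforward leb f)) => // X [[x1 x2] _ <-] /=.
rewrite /pushforward/= lebesgue_measure_itv/=.
move: hs; rewrite !inE => /orP[] /eqP ->.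
  have -> : (fun x => 1 * x + a) @^-1` `]x1, x2] = `]x1 - a, x2 - a]%classic.
    by apply/seteqP; split => x /=; rewrite !in_itv/= mul1r ltrBlDr lerBrDr.
  rewrite lebesgue_measure_itv/= !lte_fin ltrD2r -!EFinD.
  by case: ifP => // _; congr EFin; ring.
have -> : (fun x => -1 * x + a) @^-1` `]x1, x2] = `[a - x2, a - x1[%classic.
  apply/seteqP; split => x /=; rewrite !in_itv/= mulN1r => /andP[h1 h2]; apply/andP; split; lra.
rewrite lebesgue_measure_itv/= !lte_fin ltrD2l ltrN2 -!EFinD.
by case: ifP => // _; congr EFin; ring.
Qed.

(** Covers translations, with [s = 1], and point reflections, with [s = -1]. *)
Definition pmap (s : R) (a x : @plane R) : @plane R := (s * x.1 + a.1, s * x.2 + a.2).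

Lemma measurable_pmap s a : measurable_fun setT (pmap s a).
Proof.
apply/measurable_fun_pairP; split.
  exact: measurableT_comp (measurable_affine s a.1) measurable_fst.
exact: measurableT_comp (measurable_affine s a.2) measurable_snd.
Qed.

(** The product measure is determined by rectangles, and preimages of rectangles are rectangles. *)
Lemma mu2_pmap s a (A : set (@plane R)) : s \in [:: 1; -1] -> measurable A ->
  mu2 (pmap s a @^-1` A) = mu2 A.
Proof.
move=> hs mA; apply/esym.
have mf := measurable_pmap s a.
pose f : {mfun @plane R >-> @plane R} := HB.pack (pmap s a) (isMeasurableFun.Build _ _ _ _ _ mf).
apply: (product_measure_unique (m' := pushforward (leb \x leb)%E f)) => // X Y mX mY /=.
rewrite /pushforward /=.
have -> : pmap s a @^-1` (X `*` Y) =
   ((fun x => s * x + a.1) @^-1` X) `*` ((fun x => s * x + a.2) @^-1` Y) by [].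
rewrite product_measure1E.
- by rewrite -(lebesgue_measure_affine a.1 hs mX) -(lebesgue_measure_affine a.2 hs mY).
- by rewrite -[X in measurable X]setTI; exact: measurable_affine.
- by rewrite -[X in measurable X]setTI; exact: measurable_affine.
Qed.

End PlaneAffine.

(** * The exponential weight and the Poisson kernel on the line *)

Section EvenIntegral.
Context {R : realType}.
Local Notation leb := (@lebesgue_measure R).

(** [f] is [g] with the absolute values dropped: the two need to agree only on the half-line. The
    even function [g] may have a corner at 0, where [F] is nevertheless differentiated from both
    sides. *)
Lemma integral_even_FTC (g f F : R -> R) (l : R) :
  continuous g -> (forall x, 0 <= g x) -> (forall x, g (- x) = g x) ->
  (forall x, 0 <= x -> g x = f x) -> continuous f ->
  (forall x : R, 0 <= x -> is_derive x 1 F (f x)) -> F x @[x --> +oo] --> l ->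
  (\int[leb]_x (g x)%:E = (2 * (l - F 0))%:E)%E.
Proof.
move=> cg g0 gN gf cf dF Fl.
rewrite ge0_symfun_integralT//; last by move=> x /=; rewrite gN.
rewrite -set_itvcy.
have -> : (\int[leb]_(x in `[0%R, +oo[) (g x)%:E = \int[leb]_(x in `[0%R, +oo[) (f x)%:E)%E.
  by apply: eq_integral => x; rewrite inE/= in_itv/= andbT => x0; rewrite gf.
rewrite (@ge0_continuous_FTC2y _ f F 0 l) ?EFinM ?EFinB//.
- by move=> x x0; rewrite -gf.
- by apply: continuous_subspaceT.
- by move=> x x0; have := dF x (ltW x0); case.
- apply: cvg_at_right_filter.
  have d0 := dF 0 (lexx 0).
  by apply: differentiable_continuous; apply/derivable1_diffP; case: d0.
- move=> x; rewrite in_itv/= andbT => x0.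
  by rewrite derive1E; have := dF x (ltW x0); case.
Qed.

End EvenIntegral.

Section Poisson.
Context {R : realType}.
Local Notation leb := (@lebesgue_measure R).
Variable e : R.
Hypothesis e0 : 0 < e.

Definition expabs (t : R) : R := expR (- (e * `|t|)).

Lemma expabs_ge0 t : 0 <= expabs t. Proof. exact: expR_ge0. Qed.

Lemma continuous_expabs : continuous expabs.
Proof.
move=> t; apply: (@continuous_comp _ _ _ (fun t => - (e * `|t|)) expR); last exact: continuous_expR.
by apply: cvgN; apply: cvgM; [exact: cvg_cst|exact: norm_continuous].
Qed.

Lemma expR_decay_cvg (h : R -> R) (K : R) : (forall t, `|h t| <= K) ->
  expR (- (e * t)) * h t @[t --> +oo] --> 0.
Proof.
move=> hK; have c : (fun t => K * expR (- (e * t))) @ +oo --> (0 : R).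
  rewrite -[X in _ --> X](mulr0 K); apply: cvgM; first exact: cvg_cst.
  apply: (@cvg_comp _ _ _ (fun t => e * t) (fun x => expR (- x)) _ (pinfty_nbhs R)).
    by apply: gt0_cvgMry => //; exact: cvg_id.
  exact: cvgr_expR.
apply/norm_cvg0P; apply: (squeeze_cvgr _ (cvg_cst 0) c).
apply: nearW => t; rewrite normr_ge0 normrM ger0_norm ?expR_ge0// mulrC.
by rewrite ler_wpM2r ?expR_ge0.
Qed.

(** The added 1 makes the integrand nonnegative, as [integral_even_FTC] asks; the case [x = 0] later
    removes the extra term. *)
Lemma integral_expabs_cos (x : R) :
  (\int[leb]_t (expabs t * (1 + cos (t * x)))%:E = (2 * (e^-1 + e / (e ^+ 2 + x ^+ 2)))%:E)%E.
Proof.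
have ex0 : e ^+ 2 + x ^+ 2 != 0 by rewrite gt_eqF// ltr_pwDl ?sqr_ge0// exprn_gt0.
have cc : continuous (fun t : R => 1 + cos (t * x)).
  move=> t; apply: cvgD; first exact: cvg_cst.
  apply: continuous_cvg; first exact: continuous_cos.
  by apply: cvgM; [exact: cvg_id|exact: cvg_cst].
(* The antiderivative found by integrating by parts twice. *)
pose F t := expR (- (e * t)) * (- e^-1 + (x * sin (t * x) - e * cos (t * x)) / (e ^+ 2 + x ^+ 2)).
have -> : e^-1 + e / (e ^+ 2 + x ^+ 2) = 0 - F 0.
  by rewrite /F mulr0 oppr0 expR0 mul0r sin0 cos0 !mulr0 mulr1 mul1r; field; rewrite ?ex0 ?gt_eqF.
apply: (@integral_even_FTC _ _ (fun t => expR (- (e * t)) * (1 + cos (t * x))) F).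
- by move=> t; apply: cvgM; [exact: continuous_expabs|exact: cc].
- move=> t; rewrite mulr_ge0 ?expabs_ge0//; have := @cos_geN1 R (t * x); lra.
- by move=> t; rewrite /expabs normrN mulNr cosN.
- by move=> t t0; rewrite /expabs ger0_norm.
- move=> t; apply: cvgM; last exact: cc.
  apply: continuous_cvg; first exact: continuous_expR.
  by apply: cvgN; apply: cvgM; [exact: cvg_cst|exact: cvg_id].
- move=> t _; apply: is_derive_eq.
  rewrite /GRing.scale/= !mulr0 !mulr1 ?add0r ?addr0; field.
  by rewrite ?ex0 ?gt_eqF.
- apply: (@expR_decay_cvg _ (e^-1 + (`|x| + e) / (e ^+ 2 + x ^+ 2))) => t.
  have d0 : 0 < (e ^+ 2 + x ^+ 2)^-1 by rewrite invr_gt0 lt_def ex0 addr_ge0 ?sqr_ge0.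
  rewrite (le_trans (ler_normD _ _))// normrN [`|e^-1|]ger0_norm ?invr_ge0 ?(ltW e0)// lerD2l.
  rewrite normrM [X in _ * X]ger0_norm ?(ltW d0)// ler_wpM2r ?(ltW d0)//.
  rewrite (le_trans (ler_normB _ _))// !normrM [`|e|]ger0_norm ?(ltW e0)// lerD//.
    by rewrite ler_piMr// ler_norml sin_geN1 sin_le1.
  by rewrite ler_piMr ?(ltW e0)// ler_norml cos_geN1 cos_le1.
Qed.

Lemma integral_expabs : (\int[leb]_t (expabs t)%:E = (2 / e)%:E)%E.
Proof.
have := integral_expabs_cos 0.
under eq_integral => t _ do rewrite mulr0 cos0 mulrC EFinM.
rewrite ge0_integralZl_EFin//.
- rewrite expr0n addr0 => h.
  have : (2^-1%:E * ((1 + 1)%:E * \int[leb]_t (expabs t)%:E) = (2 / e)%:E)%E.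
    rewrite h -EFinM; congr EFin; field; rewrite gt_eqF//.
  by rewrite muleA -EFinM [2^-1 * _](_ : _ = 1) ?mul1e//; field.
- by move=> t _; rewrite lee_fin expabs_ge0.
- by apply/measurable_EFinP; apply: continuous_measurable_fun; exact: continuous_expabs.
Qed.

Lemma measurable_expabs : measurable_fun setT expabs.
Proof. by apply: continuous_measurable_fun; exact: continuous_expabs. Qed.

Lemma cintegrable_expabs : cintegrable leb (fun t => (expabs t)%:C).
Proof.
split; first by apply: cmeas_real; exact: measurable_expabs.
under eq_integral => t _ do rewrite normc_real ger0_norm ?expabs_ge0//.
by rewrite integral_expabs ltry.
Qed.

(** The real part follows from [integral_expabs_cos]. The imaginary part vanishes because the
    reflection [t -> - t] conjugates the integrand. *)
Lemma cint_expabs (x : R) : cint leb (fun t => cis (- (t * x)) * (expabs t)%:C) =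
  (2 * e / (e ^+ 2 + x ^+ 2))%:C.
Proof.
have mt : measurable_fun setT (fun t : measurableTypeR R => - (t * x)).
  apply: continuous_measurable_fun => t.
  by apply: cvgN; apply: cvgM; [exact: cvg_id|exact: cvg_cst].
have ie := cintegrable_expabs.
have ice : cintegrable leb (fun t => cis (- (t * x)) * (expabs t)%:C).
  by apply: (@cintegrableMl _ _ _ _ _ _ 1) => // [|t]; [exact: cmeas_cis|rewrite normc_cis].
apply: complex_eqP; rewrite ?Re_realC ?Im_realC.
  have : complex.Re (cint leb (fun t => (expabs t)%:C + cis (- (t * x)) * (expabs t)%:C)) =
      2 * (e^-1 + e / (e ^+ 2 + x ^+ 2)).
    have E t : complex.Re ((expabs t)%:C + cis (- (t * x)) * (expabs t)%:C) = expabs t * (1 + cos (t * x)).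
      by rewrite ReD ReM Re_realC Im_realC /cis/= cosN; ring.
    transitivity (\int[leb]_t (expabs t * (1 + cos (t * x))))%R.
      by apply: eq_Rintegral => t _; exact: E.
    by rewrite /Rintegral integral_expabs_cos.
  rewrite cintD// ReD; have -> : complex.Re (cint leb (fun t => (expabs t)%:C)) = 2 / e.
    by rewrite cint_real Re_realC /Rintegral integral_expabs.
  by move=> h; apply: (addrI (2 / e)); rewrite h mulrDr mulrA.
have mN := measurable_affine (-1) (0 : R).
have muN A : measurable A -> leb ((fun x : measurableTypeR R => -1 * x + 0 : measurableTypeR R) @^-1` A) = leb A.
  by move=> mA; rewrite lebesgue_measure_affine// !inE eqxx orbT.
have hE : cint leb (fun t => (cis (- (t * x)) * (expabs t)%:C)^*) =
    cint leb (fun t => cis (- ((-1 * t + 0) * x)) * (expabs (-1 * t + 0))%:C).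
  apply: eq_cint => t; rewrite conjcM -cisN mulN1r addr0 mulNr conjc_real.
  by rewrite /expabs normrN.
have gen (z : R[i]) : z^* = z -> complex.Im z = 0.
  by case: z => u v /= [] h; lra.
set z := cint leb _; have hz : z^* = z.
  by rewrite /z -(cint_conj ice) hE; exact: (cint_preserving mN muN ice).
by rewrite (gen z hz).
Qed.

(** The Poisson kernel of the half-plane at height [e]: by [cint_expabs] it is the Fourier integral
    of [exp(- e |t|)] divided by [2 pi]. *)
Definition poisson (x : R) : R := e / (e ^+ 2 + x ^+ 2) / pi.

Lemma poisson_ge0 x : 0 <= poisson x.
Proof.
apply: divr_ge0; last exact: pi_ge0.
by apply: divr_ge0; [exact: ltW|rewrite addr_ge0 ?sqr_ge0].
Qed.

Lemma is_derive_poisson (x : R) : is_derive x 1 (fun x => atan (x / e) / pi) (poisson x).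
Proof.
have pi0 : pi != 0 :> R by rewrite gt_eqF ?pi_gt0.
apply: is_derive_eq; rewrite /GRing.scale/= /poisson !mulr0 ?mulr1 ?add0r ?addr0.
have e2 : 0 < e ^+ 2 by rewrite exprn_gt0.
have x2 := sqr_ge0 x.
move: (pi : R) pi0 => p p0.
by field; rewrite p0 (gt_eqF e0)/= !gt_eqF//; nra.
Qed.

Lemma continuous_poisson : continuous poisson.
Proof.
move=> x; apply: cvgM; last exact: cvg_cst.
apply: cvgM; first exact: cvg_cst.
apply: cvgV; first by rewrite gt_eqF// ltr_pwDl ?sqr_ge0// exprn_gt0.
by apply: cvgD; [exact: cvg_cst|exact: exprn_continuous].
Qed.

Lemma integral_poisson : (\int[leb]_x (poisson x)%:E = 1)%E.
Proof.
have pi0 : pi != 0 :> R by rewrite gt_eqF ?pi_gt0.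
have -> : 1%E = (2 * (2^-1 - atan (0 / e) / pi))%:E :> \bar R.
  by rewrite mul0r atan0 mul0r subr0 divff.
apply: (@integral_even_FTC _ _ poisson (fun x => atan (x / e) / pi) 2^-1) => //.
- exact: continuous_poisson.
- exact: poisson_ge0.
- by move=> x; rewrite /poisson sqrrN.
- exact: continuous_poisson.
- by move=> x _; exact: is_derive_poisson.
- have h : atan (x / e) @[x --> +oo] --> pi / 2.
    apply: (@cvg_comp _ _ _ (fun x => x / e) atan _ (pinfty_nbhs R)); last exact: cvgy_atan.
    by apply: gt0_cvgMly; [rewrite invr_gt0|exact: cvg_id].
  have E : pi / 2 * pi^-1 = 2^-1 :> R by rewrite mulrAC divff// mul1r.
  by rewrite -E; exact: (cvgM h (cvg_cst (pi^-1 : R))).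
Qed.

Lemma integral_poisson_itv (a b x : R) : a < b ->
  (\int[leb]_(y in `[a, b]) (poisson (x - y))%:E =
    ((atan ((x - a) / e) - atan ((x - b) / e)) / pi)%:E)%E.
Proof.
move=> ab.
have dF (y : R) : is_derive y 1 (fun y => - (atan ((x - y) / e) / pi)) (poisson (x - y)).
  have d1 : is_derive y 1 (fun y : R => x - y) (-1).
    by apply: is_derive_eq; rewrite add0r mul1r.
  have := @is_derive1_comp _ (fun x => atan (x / e) / pi) (fun y => x - y) y _ _ (is_derive_poisson (x - y)) d1.
  move=> d2; have := is_deriveN d2; rewrite mulrN1 opprK; exact.
have cF (y : R) : {for y, continuous (fun y => - (atan ((x - y) / e) / pi))}.
  by apply: differentiable_continuous; apply/derivable1_diffP; case: (dF y).
rewrite (@continuous_FTC2 _ _ (fun y => - (atan ((x - y) / e) / pi)) a b)//.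
- by rewrite -EFinB; congr EFin; rewrite opprK addrC -mulrBl.
- apply: continuous_subspaceT => y.
  apply: continuous_cvg; first exact: continuous_poisson.
  by apply: cvgB; [exact: cvg_cst|exact: cvg_id].
- split.
  + by move=> y _; case: (dF y).
  + by apply: cvg_at_right_filter; exact: cF.
  + by apply: cvg_at_left_filter; exact: cF.
- by move=> y _; rewrite derive1E; case: (dF y).
Qed.

End Poisson.

(** * Integrals of products in separate variables *)

Section Tensor.
Context {R : realType} {d1 d2} {T1 : measurableType d1} {T2 : measurableType d2}.
Variables (m1 : {sigma_finite_measure set T1 -> \bar R})
  (m2 : {sigma_finite_measure set T2 -> \bar R}).

Lemma ge0_integral_tensor (u : T1 -> R) (v : T2 -> R) :
  measurable_fun setT u -> measurable_fun setT v ->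
  (forall x, 0 <= u x) -> (forall y, 0 <= v y) ->
  (\int[m1 \x m2]_p (u p.1 * v p.2)%:E =
   (\int[m1]_x (u x)%:E) * \int[m2]_y (v y)%:E)%E.
Proof.
move=> mu mv u0 v0.
have mF : measurable_fun setT (fun p : T1 * T2 => (u p.1 * v p.2)%:E).
  apply/measurable_EFinP; apply: measurable_funM.
    exact: (measurableT_comp mu measurable_fst).
  exact: (measurableT_comp mv measurable_snd).
rewrite fubini_tonelli1//=; last by move=> p; rewrite lee_fin mulr_ge0.
have v0' : (0 <= \int[m2]_y (v y)%:E)%E by apply: integral_ge0 => y _; rewrite lee_fin.
transitivity (\int[m1]_x ((u x)%:E * \int[m2]_y (v y)%:E))%E.
  apply: eq_integral => x _; rewrite /fubini_F -ge0_integralZl_EFin//.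
  - by move=> y _; rewrite lee_fin.
  - exact/measurable_EFinP.
rewrite ge0_integralZr//; first exact/measurable_EFinP.
by move=> x _; rewrite lee_fin.
Qed.

Lemma cintegrable_tensor (f : T1 -> R[i]) (h : T2 -> R[i]) :
  cintegrable m1 f -> cintegrable m2 h ->
  cintegrable (m1 \x m2)%E (fun p => f p.1 * h p.2).
Proof.
move=> [mf fi] [mh hi]; split.
  apply: cmeasM; first exact: (cmeas_comp measurable_fst mf).
  exact: (cmeas_comp measurable_snd mh).
under eq_integral => p _ do rewrite normcM.
rewrite (ge0_integral_tensor (u := fun x => normc (f x)) (v := fun y => normc (h y)))//.
- by rewrite lte_mul_pinfty// ?integral_ge0// ge0_fin_numE ?integral_ge0.
- exact: cmeas_normc.
- exact: cmeas_normc.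
Qed.

Lemma cint_tensor (f : T1 -> R[i]) (h : T2 -> R[i]) :
  cintegrable m1 f -> cintegrable m2 h ->
  cint (m1 \x m2)%E (fun p => f p.1 * h p.2) = cint m1 f * cint m2 h.
Proof.
move=> fi hi; rewrite -(cint_prod (cintegrable_tensor fi hi)) /=.
rewrite mulrC -(cintZl (cint m2 h) fi); apply: eq_cint => x.
by rewrite (cintZl (f x) hi) mulrC.
Qed.

End Tensor.

(** * The Fourier transform on the plane *)

Section FourierL1.
Context {R : realType}.
Local Notation leb := (@lebesgue_measure R).
Local Notation plane := (@plane R).
Implicit Types (f g h : plane -> R[i]).

(** The transform of an integrable function, defined at every point, in the unitary normalization
    for two dimensions. *)
Definition FT f (xi : plane) : R[i] :=
  ((2 * pi)^-1)%:C * cint mu2 (fun x => cis (- dot x xi) * f x).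

Lemma measurable_dot : measurable_fun setT (fun p : plane * plane => dot p.1 p.2).
Proof.
have m11 : measurable_fun setT (fun p : plane * plane => p.1.1).
  exact: (measurableT_comp measurable_fst measurable_fst).
have m12 : measurable_fun setT (fun p : plane * plane => p.1.2).
  exact: (measurableT_comp measurable_snd measurable_fst).
have m21 : measurable_fun setT (fun p : plane * plane => p.2.1).
  exact: (measurableT_comp measurable_fst measurable_snd).
have m22 : measurable_fun setT (fun p : plane * plane => p.2.2).
  exact: (measurableT_comp measurable_snd measurable_snd).
by apply: measurable_funD; apply: measurable_funM.
Qed.

Lemma measurable_dotr (xi : plane) : measurable_fun setT (fun x => dot x xi).
Proof. by apply: measurable_funD; apply: measurable_funM. Qed.

Lemma dotC (x y : plane) : dot x y = dot y x.
Proof. by rewrite /dot; ring. Qed.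

Lemma cintegrable_cis f (xi : plane) : cintegrable mu2 f ->
  cintegrable mu2 (fun x => cis (- dot x xi) * f x).
Proof.
apply: (@cintegrableMl _ _ _ _ _ _ 1); last by move=> x; rewrite normc_cis.
apply: cmeas_cis; apply: measurableT_comp => //; exact: measurable_dotr.
Qed.

Lemma normc_FT_le f xi : cintegrable mu2 f ->
  normc (FT f xi) <= (2 * pi)^-1 * (\int[mu2]_x normc (f x))%R.
Proof.
move=> fi; rewrite /FT normcM normc_real ger0_norm ?invr_ge0 ?mulr_ge0 ?pi_ge0//.
rewrite ler_wpM2l ?invr_ge0 ?mulr_ge0 ?pi_ge0//.
rewrite -lee_fin (le_trans (normc_cint_le (cintegrable_cis xi fi)))//.
rewrite /Rintegral fineK; last first.
  by rewrite ge0_fin_numE ?integral_ge0//; case: fi.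
rewrite le_eqVlt; apply/orP; left; apply/eqP; apply: eq_integral => x _.
by rewrite normcM normc_cis mul1r.
Qed.

(** The factor of Abel summation; it is a product, so its transform is a product of two Poisson
    kernels on the line. *)
Definition weight (e : R) (xi : plane) : R := expabs e xi.1 * expabs e xi.2.

Lemma measurable_weight e : measurable_fun setT (weight e).
Proof.
apply: measurable_funM.
  exact: (measurableT_comp (measurable_expabs e) measurable_fst).
exact: (measurableT_comp (measurable_expabs e) measurable_snd).
Qed.

Lemma weight_gt0 e xi : 0 < weight e xi.
Proof. by rewrite mulr_gt0 ?expR_gt0. Qed.

Lemma weight_le1 e xi : 0 < e -> weight e xi <= 1.
Proof.
by move=> e0; rewrite /weight /expabs -expRD -expR0 ler_expR -opprD oppr_le0
  addr_ge0 ?mulr_ge0 ?(ltW e0).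
Qed.

Lemma cintegrable_weight e : 0 < e -> cintegrable mu2 (fun xi => (weight e xi)%:C).
Proof.
move=> e0; under eq_fun do rewrite /weight rmorphM.
exact: (cintegrable_tensor (cintegrable_expabs e0) (cintegrable_expabs e0)).
Qed.

Lemma cintegrable_kernel f h : cintegrable mu2 f -> cintegrable mu2 h ->
  cintegrable (mu2 \x mu2)%E (fun p => cis (- dot p.2 p.1) * (f p.1 * h p.2)).
Proof.
move=> fi hi; apply: (@cintegrableMl _ _ _ _ _ _ 1).
- apply: cmeas_cis; apply: measurableT_comp => //.
  by under eq_fun do rewrite dotC; exact: measurable_dot.
- by move=> x; rewrite normc_cis.
- exact: (cintegrable_tensor (m1 := mu2) (m2 := mu2)).
Qed.

(** Measurability in [xi] comes out of Fubini, which needs a kernel integrable in both variables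
    jointly. So the transform is multiplied by the integrable [weight 1] and divided by it again. *)
Lemma cmeas_FT f : cintegrable mu2 f -> cmeas (FT f).
Proof.
move=> fi; have wi := cintegrable_weight (@ltr01 R).
have := cmeas_cint2 (m1 := mu2) (m2 := mu2) (cintegrable_kernel wi fi) => /= mF.
have -> : FT f = fun xi => (((2 * pi)^-1) * (weight 1 xi)^-1)%:C *
    cint mu2 (fun y => cis (- dot y xi) * ((weight 1 xi)%:C * f y)).
  apply/funext => xi; rewrite /FT rmorphM -mulrA; congr (_ * _).
  rewrite -cintZl.
    apply: eq_cint => y; rewrite [RHS]mulrCA [X in _ = _ * X]mulrA -rmorphM mulVf ?mul1r//.
    by rewrite gt_eqF// weight_gt0.
  by apply: cintegrable_cis; exact: cintegrableZl.
apply: cmeasM => //; apply: cmeas_real; apply: measurable_funM => //.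
rewrite (_ : (fun _ => _) = fun xi => expR (`|xi.1| + `|xi.2|)); last first.
  apply/funext => xi; rewrite /weight /expabs -expRD -opprD !mul1r.
  by rewrite expRN invrK.
apply: measurableT_comp => //; apply: measurable_funD; apply: measurableT_comp => //.
Qed.

(** Fubini, since the kernel is symmetric in [x] and [xi]. *)
Lemma FT_swap f h : cintegrable mu2 f -> cintegrable mu2 h ->
  cint mu2 (fun xi => FT f xi * h xi) = cint mu2 (fun x => f x * FT h x).
Proof.
move=> fi hi; pose c : R[i] := ((2 * pi)^-1)%:C.
pose G (p : plane * plane) := (c * h p.1) * (cis (- dot p.2 p.1) * f p.2).
have Gi : cintegrable (mu2 \x mu2)%E G.
  have := cintegrableZl c (cintegrable_kernel hi fi).
  by congr (cintegrable _ _); apply/funext => p; rewrite /G; ring.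
transitivity (cint mu2 (fun xi => cint mu2 (fun x => G (xi, x)))).
  apply: eq_cint => xi; rewrite /G /= cintZl ?/FT; last exact: cintegrable_cis.
  by rewrite -/c mulrAC.
rewrite (cint_fubini Gi); apply: eq_cint => x.
rewrite /FT mulrA -cintZl; last exact: cintegrable_cis.
by apply: eq_cint => xi; rewrite /G /= dotC -/c; ring.
Qed.

Lemma FT_conj f xi : cintegrable mu2 f ->
  (FT f xi)^* = FT (fun x => (f x)^*) (- xi.1, - xi.2).
Proof.
move=> fi; rewrite /FT conjcM conjc_real -cint_conj; last exact: cintegrable_cis.
congr (_ * _); apply: eq_cint => x; rewrite conjcM -cisN; congr (cis _ * _).
by rewrite /dot /=; ring.
Qed.

Lemma FTB f h xi : cintegrable mu2 f -> cintegrable mu2 h ->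
  FT (fun x => f x - h x) xi = FT f xi - FT h xi.
Proof.
move=> fi hi; rewrite /FT -mulrBr -cintB; [|exact: cintegrable_cis..].
by congr (_ * _); apply: eq_cint => x; rewrite mulrBr.
Qed.

Lemma FT_weight (e : R) (x : plane) : 0 < e ->
  ((2 * pi)^-1)%:C * FT (fun xi => (weight e xi)%:C) x =
  (poisson e x.1 * poisson e x.2)%:C.
Proof.
move=> e0; rewrite /FT.
have ii (y : R) : cintegrable leb (fun t => cis (- (t * y)) * (expabs e t)%:C).
  apply: (@cintegrableMl _ _ _ _ _ _ 1); last exact: cintegrable_expabs.
    apply: cmeas_cis; apply: measurableT_comp => //; exact: measurable_funM.
  by move=> t; rewrite normc_cis.
transitivity (((2 * pi)^-1)%:C * (((2 * pi)^-1)%:C * cint mu2 (fun p =>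
    (cis (- (p.1 * x.1)) * (expabs e p.1)%:C) * (cis (- (p.2 * x.2)) * (expabs e p.2)%:C)))).
  congr (_ * (_ * _)); apply: eq_cint => p; rewrite /weight rmorphM /dot opprD cisD /=.
  by ring.
have -> := cint_tensor (ii x.1) (ii x.2); rewrite !cint_expabs//.
have pi0 : pi != 0 :> R by rewrite gt_eqF ?pi_gt0.
rewrite -!rmorphM; congr real_complex_def; rewrite /poisson.
have h (y : R) : e ^+ 2 + y ^+ 2 != 0 by rewrite gt_eqF// ltr_pwDl ?sqr_ge0// exprn_gt0.
move: (pi : R) pi0 => p p0.
by field; rewrite p0 !h.
Qed.

End FourierL1.

Section PoissonFormula.
Context {R : realType}.
Local Notation leb := (@lebesgue_measure R).
Local Notation plane := (@plane R).
Implicit Types (f g h : plane -> R[i]).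

Definition psub (x y : plane) : plane := (x.1 - y.1, x.2 - y.2).
Definition popp (x : plane) : plane := (- x.1, - x.2).
Definition poisson2 (e : R) (x : plane) : R := poisson e x.1 * poisson e x.2.

Lemma psub_pmap (y x : plane) : psub y x = pmap 1 (popp x) y.
Proof. by rewrite /psub /pmap !mul1r. Qed.

Lemma psub_pmapN (y x : plane) : psub y x = pmap (-1) y x.
Proof. by rewrite /psub /pmap !mulN1r ![- _ + _]addrC. Qed.

Lemma popp_pmap (x : plane) : popp x = pmap (-1) (0, 0) x.
Proof. by rewrite /popp /pmap !mulN1r !addr0. Qed.

Lemma measurable_popp : measurable_fun setT popp.
Proof.
rewrite (_ : popp = pmap (-1) (0, 0)); first exact: measurable_pmap.
by apply/funext => x; exact: popp_pmap.
Qed.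

Lemma mu2_popp (A : set plane) : measurable A -> mu2 (popp @^-1` A) = mu2 A.
Proof.
move=> mA; have -> : popp = pmap (-1) (0, 0) by apply/funext => x; exact: popp_pmap.
by apply: mu2_pmap => //; rewrite !inE eqxx orbT.
Qed.

Lemma measurable_psubl (x : plane) : measurable_fun setT (fun y => psub y x).
Proof. by under eq_fun do rewrite psub_pmap; exact: measurable_pmap. Qed.

Lemma measurable_psubr (y : plane) : measurable_fun setT (fun x => psub y x).
Proof.
rewrite (_ : (fun x => _) = pmap (-1) y); first exact: measurable_pmap.
by apply/funext => x; exact: psub_pmapN.
Qed.

Lemma mu2_psubl (x : plane) (A : set plane) : measurable A -> mu2 ((fun y => psub y x) @^-1` A) = mu2 A.
Proof.
move=> mA; have -> : psub^~ x = pmap 1 (popp x) by apply/funext => y; exact: psub_pmap.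
by apply: mu2_pmap => //; rewrite !inE eqxx.
Qed.

Lemma mu2_psubr (y : plane) (A : set plane) : measurable A -> mu2 ((fun x => psub y x) @^-1` A) = mu2 A.
Proof.
move=> mA; have -> : psub y = pmap (-1) y by apply/funext => x; exact: psub_pmapN.
by apply: mu2_pmap => //; rewrite !inE eqxx orbT.
Qed.

Lemma measurable_psub : measurable_fun setT (fun p : plane * plane => psub p.1 p.2).
Proof.
have m11 : measurable_fun setT (fun p : plane * plane => p.1.1).
  exact: (measurableT_comp measurable_fst measurable_fst).
have m12 : measurable_fun setT (fun p : plane * plane => p.1.2).
  exact: (measurableT_comp measurable_snd measurable_fst).
have m21 : measurable_fun setT (fun p : plane * plane => p.2.1).
  exact: (measurableT_comp measurable_fst measurable_snd).
have m22 : measurable_fun setT (fun p : plane * plane => p.2.2).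
  exact: (measurableT_comp measurable_snd measurable_snd).
by apply/measurable_fun_pairP; split; apply: measurable_funB.
Qed.

Lemma measurable_psub_swap : measurable_fun setT (fun p : plane * plane => psub p.2 p.1).
Proof.
have m11 : measurable_fun setT (fun p : plane * plane => p.1.1).
  exact: (measurableT_comp measurable_fst measurable_fst).
have m12 : measurable_fun setT (fun p : plane * plane => p.1.2).
  exact: (measurableT_comp measurable_snd measurable_fst).
have m21 : measurable_fun setT (fun p : plane * plane => p.2.1).
  exact: (measurableT_comp measurable_fst measurable_snd).
have m22 : measurable_fun setT (fun p : plane * plane => p.2.2).
  exact: (measurableT_comp measurable_snd measurable_snd).
by apply/measurable_fun_pairP; split; apply: measurable_funB.
Qed.

Lemma measurable_poisson (e : R) : 0 < e -> measurable_fun setT (poisson e).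
Proof. by move=> e0; apply: continuous_measurable_fun; exact: continuous_poisson. Qed.

Lemma measurable_poisson2 (e : R) : 0 < e -> measurable_fun setT (poisson2 e).
Proof.
move=> e0; apply: measurable_funM.
  exact: (measurableT_comp (measurable_poisson e0) measurable_fst).
exact: (measurableT_comp (measurable_poisson e0) measurable_snd).
Qed.

Lemma poisson_le (e x : R) : 0 < e -> poisson e x <= e^-1 / pi.
Proof.
move=> e0; rewrite /poisson ler_wpM2r ?invr_ge0 ?pi_ge0//.
have e2 : 0 < e ^+ 2 by rewrite exprn_gt0.
rewrite ler_pdivrMr; last by rewrite ltr_pwDl ?sqr_ge0.
rewrite mulrDr expr2 mulKf ?gt_eqF// lerDl mulr_ge0 ?sqr_ge0// invr_ge0 ltW//.
Qed.

Lemma poisson2_le e x : 0 < e -> poisson2 e x <= (e^-1 / pi) ^+ 2.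
Proof. by move=> e0; rewrite expr2 ler_pM ?poisson_ge0 ?poisson_le. Qed.

Lemma poisson2_ge0 e x : 0 < e -> 0 <= poisson2 e x.
Proof. by move=> e0; rewrite mulr_ge0 ?poisson_ge0. Qed.

Lemma integral_poisson2 e : 0 < e -> (\int[mu2]_x (poisson2 e x)%:E = 1)%E.
Proof.
move=> e0; have := ge0_integral_tensor leb leb (measurable_poisson e0) (measurable_poisson e0)
  (poisson_ge0 e0) (poisson_ge0 e0).
by rewrite integral_poisson// mul1e.
Qed.

Lemma integral_poisson2_psubl e x : 0 < e -> (\int[mu2]_y (poisson2 e (psub y x))%:E = 1)%E.
Proof.
move=> e0; rewrite -(integral_poisson2 e0).
apply: (ge0_integral_preserving (measurable_psubl x) (mu2_psubl x) (f := fun z => (poisson2 e z)%:E)).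
  by apply/measurable_EFinP; exact: measurable_poisson2.
by move=> z; rewrite lee_fin poisson2_ge0.
Qed.

Lemma integral_poisson2_psubr e y : 0 < e -> (\int[mu2]_x (poisson2 e (psub y x))%:E = 1)%E.
Proof.
move=> e0; rewrite -(integral_poisson2 e0).
apply: (ge0_integral_preserving (measurable_psubr y) (mu2_psubr y) (f := fun z => (poisson2 e z)%:E)).
  by apply/measurable_EFinP; exact: measurable_poisson2.
by move=> z; rewrite lee_fin poisson2_ge0.
Qed.

Lemma cintegrable_FT_weight g e : cintegrable mu2 g -> 0 < e ->
  cintegrable mu2 (fun xi => (FT g xi)^* * (weight e xi)%:C).
Proof.
move=> gi e0; apply: (@cintegrableMl _ _ _ _ _ _ ((2 * pi)^-1 * (\int[mu2]_x normc (g x))%R)).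
- by apply: cmeas_conj; exact: cmeas_FT.
- by move=> x; rewrite normc_conj; exact: normc_FT_le.
- exact: cintegrable_weight.
Qed.

(** [FT_swap] moves the transform from the conjugate of [g] onto the weight, which becomes the
    Poisson kernel centered at [x]. *)
Lemma FT_conj_FT_weight g e x : cintegrable mu2 g -> 0 < e ->
  FT (fun xi => (FT g xi)^* * (weight e xi)%:C) x =
  cint mu2 (fun y => (g y)^* * (poisson2 e (psub y x))%:C).
Proof.
move=> gi e0; have wi := cintegrable_weight e0.
pose k (xi : plane) := cis (- dot xi (popp x)) * (weight e xi)%:C.
have ki : cintegrable mu2 k by exact: cintegrable_cis.
have hi := cintegrable_conj gi.
have prod_i : cintegrable mu2 (fun xi => FT (fun y => (g y)^*) xi * k xi).
  apply: (@cintegrableMl _ _ _ _ _ _ ((2 * pi)^-1 * (\int[mu2]_x normc ((g x)^*))%R)) => //.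
    exact: cmeas_FT.
  by move=> y; exact: normc_FT_le.
rewrite {1}/FT; transitivity (((2 * pi)^-1)%:C * cint mu2 (fun xi => FT (fun y => (g y)^*) xi * k xi)).
  congr (_ * _); rewrite -(cint_preserving measurable_popp mu2_popp prod_i).
  apply: eq_cint => xi; rewrite FT_conj// /k mulrCA; congr (_ * (cis _ * _)).
  - by rewrite /dot /=; ring.
  - by rewrite /weight /expabs /= !normrN.
rewrite FT_swap// -cintZl; last first.
  apply: (@ae_eq_cintegrable _ _ _ _ (fun y => FT k y * (g y)^*)).
  - apply: cmeasM; [by case: hi|exact: cmeas_FT].
  - by apply: nearW => y; rewrite mulrC.
  - apply: (@cintegrableMl _ _ _ _ _ _ ((2 * pi)^-1 * (\int[mu2]_x normc (k x))%R)) => //.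
      exact: cmeas_FT.
    by move=> y; exact: normc_FT_le.
apply: eq_cint => y; rewrite mulrCA; congr (_ * _).
rewrite -FT_weight//; congr (_ * _); rewrite /FT; congr (_ * _).
apply: eq_cint => xi; rewrite /k mulrA -cisD; congr (cis _ * _).
by rewrite /dot /=; ring.
Qed.

(** Parseval's identity regularized by the weight: on the right, [f] is paired with a Poisson mean.
    Its limit as [e] tends to 0, taken for boxes [g], is the way to the inversion formula. *)
Lemma poisson_formula f g e : cintegrable mu2 f -> cintegrable mu2 g -> 0 < e ->
  cint mu2 (fun xi => FT f xi * ((FT g xi)^* * (weight e xi)%:C)) =
  cint mu2 (fun x => f x * cint mu2 (fun y => (g y)^* * (poisson2 e (psub y x))%:C)).
Proof.
move=> fi gi e0; rewrite FT_swap//; last exact: cintegrable_FT_weight.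
by apply: eq_cint => x; rewrite FT_conj_FT_weight.
Qed.

(** The regularized identity with [g = f]. In the double integral, [|f(x)| |f(y)|] is at most the
    mean of the two squares, and the Poisson kernel has mass 1 in either variable. *)
Lemma nsq_FT_weight_le f e : cintegrable mu2 f -> L2 mu2 f -> 0 < e ->
  (\int[mu2]_xi (normc (FT f xi) ^+ 2 * weight e xi)%:E <= nsq mu2 f)%E.
Proof.
move=> fi Lf e0; have [mf foo] := Lf.
have hi := cintegrable_FT_weight fi e0.
pose h xi := (FT f xi)^* * (weight e xi)%:C.
have fhi : cintegrable mu2 (fun x => FT h x * f x).
  apply: (@cintegrableMl _ _ _ _ _ _ ((2 * pi)^-1 * (\int[mu2]_x normc (h x))%R)) => //.
    exact: cmeas_FT.
  by move=> y; exact: normc_FT_le.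
have P0 x y : 0 <= poisson2 e (psub y x) by exact: poisson2_ge0.
have mP : measurable_fun setT (fun p : plane * plane => poisson2 e (psub p.2 p.1)).
  apply: (measurableT_comp (measurable_poisson2 e0)).
  exact: measurable_psub_swap.
have mPx x : measurable_fun setT (fun y => poisson2 e (psub y x)).
  exact: (measurableT_comp (measurable_poisson2 e0) (measurable_psubl x)).
have mPy y : measurable_fun setT (fun x => poisson2 e (psub y x)).
  exact: (measurableT_comp (measurable_poisson2 e0) (measurable_psubr y)).
have m1 : measurable_fun setT (fun p : plane * plane => normc (f p.1)).
  exact: (measurableT_comp (cmeas_normc mf) measurable_fst).
have m2 : measurable_fun setT (fun p : plane * plane => normc (f p.2)).
  exact: (measurableT_comp (cmeas_normc mf) measurable_snd).
have lhsE : (\int[mu2]_xi (normc (FT f xi) ^+ 2 * weight e xi)%:E <=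
    (normc (cint mu2 (fun xi => FT f xi * h xi)))%:E)%E.
  have E : cint mu2 (fun xi => FT f xi * h xi) =
      (\int[mu2]_xi (normc (FT f xi) ^+ 2 * weight e xi))%R%:C.
    by rewrite -cint_real; apply: eq_cint => xi; rewrite /h mulrA mulc_conj -rmorphM.
  rewrite E normc_real ger0_norm; last first.
    by apply: Rintegral_ge0 => xi _; rewrite mulr_ge0 ?sqr_ge0// ltW// weight_gt0.
  rewrite /Rintegral fineK//.
  rewrite ge0_fin_numE; last first.
    by apply: integral_ge0 => xi _; rewrite lee_fin mulr_ge0 ?sqr_ge0// ltW// weight_gt0.
  have : cintegrable mu2 (fun xi => FT f xi * h xi).
    apply: (@cintegrableMl _ _ _ _ _ _ ((2 * pi)^-1 * (\int[mu2]_x normc (f x))%R)) => //.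
      exact: cmeas_FT.
    by move=> y; exact: normc_FT_le.
  move=> [_]; apply: le_lt_trans; rewrite le_eqVlt; apply/orP; left; apply/eqP.
  apply: eq_integral => xi _; rewrite /h (normcM (FT f xi)) (normcM (FT f xi)^*) normc_conj normc_real ger0_norm.
    by congr EFin; ring.
  by rewrite ltW// weight_gt0.
apply: le_trans lhsE _; rewrite FT_swap//.
have -> : cint mu2 (fun x => f x * FT h x) = cint mu2 (fun x => FT h x * f x).
  by apply: eq_cint => x; rewrite mulrC.
apply: le_trans (normc_cint_le fhi) _.
apply: (@le_trans _ _ (\int[mu2]_x \int[mu2]_y
   (2^-1 * (normc (f x) ^+ 2 * poisson2 e (psub y x)) + 2^-1 * (normc (f y) ^+ 2 * poisson2 e (psub y x)))%:E)%E).
  apply: ge0_le_integral => //.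
  - by apply: measurable_normcE; case: fhi.
  - pose F (p : plane * plane) := (2^-1 * (normc (f p.1) ^+ 2 * poisson2 e (psub p.2 p.1)) +
      2^-1 * (normc (f p.2) ^+ 2 * poisson2 e (psub p.2 p.1)))%:E.
    have Q (u : R[i]) (v : plane) : 0 <= 2^-1 * (normc u ^+ 2 * poisson2 e v).
      apply: mulr_ge0; first by rewrite invr_ge0.
      by apply: mulr_ge0; [exact: sqr_ge0|exact: poisson2_ge0].
    have F0 p : (0 <= F p)%E by rewrite /F lee_fin; apply: addr_ge0; exact: Q.
    have mF : measurable_fun setT F.
      apply/measurable_EFinP; apply: measurable_funD; apply: measurable_funM => //;
      apply: measurable_funM => //; exact: measurable_funX.
    exact: (measurable_fun_fubini_tonelli_F (m2 := mu2) F mF F0).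
  - move=> x _; rewrite normcM FT_conj_FT_weight//.
    have gi : cintegrable mu2 (fun y => (f y)^* * (poisson2 e (psub y x))%:C).
      have [mf' fi'] := fi.
      apply: (@le_cintegrable _ _ _ _ _ (fun y => normc (f y) * (e^-1 / pi) ^+ 2)).
      - by apply: cmeasM; [exact: cmeas_conj|apply: cmeas_real].
      - by apply: measurable_funM => //; exact: cmeas_normc.
      - by move=> y; rewrite normcM normc_conj normc_real ger0_norm// ler_wpM2l// poisson2_le.
      - under eq_integral => y _ do rewrite EFinM muleC.
        rewrite ge0_integralZl_EFin ?sqr_ge0//; last exact: measurable_normcE.
        by rewrite lte_mul_pinfty ?lee_fin ?sqr_ge0.
    rewrite mulrC EFinM; apply: (@le_trans _ _ ((normc (f x))%:E *
        \int[mu2]_y (normc ((f y)^* * (poisson2 e (psub y x))%:C))%:E)%E).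
      by apply: lee_wpmul2l => //; exact: normc_cint_le.
    rewrite -ge0_integralZl_EFin//; last by apply: measurable_normcE; case: gi.
    apply: ge0_le_integral => //.
    + by move=> y _; rewrite mule_ge0.
    + by apply: measurable_funeM; apply: measurable_normcE; case: gi.
    + apply/measurable_EFinP; apply: measurable_funD; apply: measurable_funM => //;
      apply: measurable_funM => //; apply: measurable_funX; exact: cmeas_normc.
    + move=> y _; rewrite -EFinM lee_fin normcM normc_conj normc_real ger0_norm//.
      by have := P0 x y; have := sqr_ge0 (normc (f x) - normc (f y)); nra.
have I1 : (\int[mu2]_x \int[mu2]_y (normc (f x) ^+ 2 * poisson2 e (psub y x))%:E = nsq mu2 f)%E.
  apply: eq_integral => x _; under eq_integral => y _ do rewrite EFinM.
  rewrite ge0_integralZl_EFin ?sqr_ge0// ?integral_poisson2_psubl ?mule1//.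
    by move=> y _; rewrite lee_fin.
  exact/measurable_EFinP.
have I2 : (\int[mu2]_x \int[mu2]_y (normc (f y) ^+ 2 * poisson2 e (psub y x))%:E = nsq mu2 f)%E.
  have := fubini_tonelli (m1 := mu2) (m2 := mu2) (fun p => (normc (f p.2) ^+ 2 * poisson2 e (psub p.2 p.1))%:E).
  move=> /= ->.
  - apply: eq_integral => y _; rewrite /fubini_G; under eq_integral => x _ do rewrite EFinM.
    rewrite ge0_integralZl_EFin ?sqr_ge0// ?integral_poisson2_psubr ?mule1//.
      by move=> x _; rewrite lee_fin.
    exact/measurable_EFinP.
  - by apply/measurable_EFinP; apply: measurable_funM => //; exact: measurable_funX.
  - by move=> p; rewrite lee_fin mulr_ge0 ?sqr_ge0.
have mF1 : measurable_fun setT (fun p : plane * plane => (normc (f p.1) ^+ 2 * poisson2 e (psub p.2 p.1))%:E).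
  by apply/measurable_EFinP; apply: measurable_funM => //; exact: measurable_funX.
have mF2 : measurable_fun setT (fun p : plane * plane => (normc (f p.2) ^+ 2 * poisson2 e (psub p.2 p.1))%:E).
  by apply/measurable_EFinP; apply: measurable_funM => //; exact: measurable_funX.
have F0 (u : plane) (x y : plane) : (0 <= (normc (f u) ^+ 2 * poisson2 e (psub y x))%:E)%E.
  by rewrite lee_fin mulr_ge0 ?sqr_ge0.
rewrite (eq_integral (fun x => (2^-1)%:E * \int[mu2]_y (normc (f x) ^+ 2 * poisson2 e (psub y x))%:E
   + (2^-1)%:E * \int[mu2]_y (normc (f y) ^+ 2 * poisson2 e (psub y x))%:E)%E); last first.
  move=> x _.
  have mx1 : measurable_fun setT (fun y => (normc (f x) ^+ 2 * poisson2 e (psub y x))%:E).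
    by apply/measurable_EFinP; exact: measurable_funM.
  have mx2 : measurable_fun setT (fun y => (normc (f y) ^+ 2 * poisson2 e (psub y x))%:E).
    by apply/measurable_EFinP; apply: measurable_funM => //; apply: measurable_funX; exact: cmeas_normc.
  transitivity (\int[mu2]_y ((2^-1)%:E * (normc (f x) ^+ 2 * poisson2 e (psub y x))%:E +
      (2^-1)%:E * (normc (f y) ^+ 2 * poisson2 e (psub y x))%:E))%E.
    by apply: eq_integral => y _; rewrite -!EFinM -EFinD.
  rewrite ge0_integralD//.
  - congr (_ + _)%E.
      by apply: ge0_integralZl_EFin.
    by apply: ge0_integralZl_EFin.
  - by move=> y _; apply: mule_ge0; [rewrite lee_fin invr_ge0|exact: F0].
  - exact: measurable_funeM.
  - by move=> y _; apply: mule_ge0; [rewrite lee_fin invr_ge0|exact: F0].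
  - exact: measurable_funeM.
have mI1 := measurable_fun_fubini_tonelli_F (m2 := mu2) _ mF1 (fun p => F0 p.1 p.1 p.2).
have mI2 := measurable_fun_fubini_tonelli_F (m2 := mu2) _ mF2 (fun p => F0 p.2 p.1 p.2).
rewrite ge0_integralD//.
- have G0 u : (0 <= \int[mu2]_y (normc (f u) ^+ 2 * poisson2 e (psub y u))%:E)%E.
    by apply: integral_ge0 => y _; exact: F0.
  have G1 u : (0 <= \int[mu2]_y (normc (f y) ^+ 2 * poisson2 e (psub y u))%:E)%E.
    by apply: integral_ge0 => y _; exact: F0.
  have i2 : 0 <= 2^-1 :> R by rewrite invr_ge0.
  have -> := ge0_integralZl_EFin mu2 measurableT (fun u _ => G0 u) mI1 i2.
  have -> := ge0_integralZl_EFin mu2 measurableT (fun u _ => G1 u) mI2 i2.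
  rewrite I1 I2 -nrm_sq// -!EFinM -EFinD lee_fin; lra.
- by move=> x _; apply: mule_ge0; [rewrite lee_fin invr_ge0|apply: integral_ge0 => y _; exact: F0].
- exact: measurable_funeM.
- by move=> x _; apply: mule_ge0; [rewrite lee_fin invr_ge0|apply: integral_ge0 => y _; exact: F0].
- exact: measurable_funeM.
Qed.

End PoissonFormula.

Lemma integrable_normc {R : realType} {d} {T : measurableType d}
    (mu : {measure set T -> \bar R}) (f : T -> R[i]) :
  cintegrable mu f -> mu.-integrable setT (EFin \o (fun x => normc (f x))).
Proof.
move=> [mf fi]; apply/integrableP; split; first exact: measurable_normcE.
by under eq_integral => x _ do rewrite /= ger0_norm//.
Qed.

Lemma normc_cvg_unique {R : realType} (l : nat -> R[i]) (z w : R[i]) :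
  normc (l n - z) @[n --> \oo] --> 0 -> normc (l n - w) @[n --> \oo] --> 0 -> z = w.
Proof.
move=> lz lw; apply/eqP; rewrite -subr_eq0; apply/eqP/normc_eq0P/eqP.
rewrite eq_le normc_ge0 andbT; have h := cvgD lz lw; rewrite addr0 in h.
have nn : \forall n \near \oo, (fun=> normc (z - w)) n <= normc (l n - z) + normc (l n - w).
  apply: nearW => n /=; rewrite -(normcN (l n - z)) opprB; exact: le_normc_distD.
exact: (ler_cvg_to (cvg_cst _) (h _) nn).
Qed.

Section BoxFormula.
Context {R : realType}.
Local Notation leb := (@lebesgue_measure R).
Local Notation plane := (@plane R).
Implicit Types (f g h : plane -> R[i]).

Lemma harmonic_pos n : 0 < (@harmonic R n).
Proof. by rewrite /harmonic /= invr_gt0. Qed.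

Lemma weight_cvg (xi : plane) : weight (harmonic n) xi @[n --> \oo] --> (1 : R).
Proof.
have h (t : R) : expabs (harmonic n) t @[n --> \oo] --> (1 : R).
  rewrite /expabs -[X in _ --> X]expR0; apply: continuous_cvg; first exact: continuous_expR.
  rewrite -oppr0; apply: cvgN; rewrite -[X in _ --> X](mul0r `|t|).
  by apply: cvgM; [exact: cvg_harmonic|exact: cvg_cst].
by rewrite -[X in _ --> X](mulr1 1); apply: cvgM; exact: h.
Qed.

(** Fatou's lemma as the weight tends to 1. Equality comes only later, through inversion. *)
Lemma nsq_FT_le f : cintegrable mu2 f -> L2 mu2 f -> (nsq mu2 (FT f) <= nsq mu2 f)%E.
Proof.
move=> fi Lf; have mF := cmeas_FT fi.
apply: (@fatou_le _ _ _ mu2 (fun n xi => normc (FT f xi) ^+ 2 * weight (harmonic n) xi)).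
- move=> n; apply: measurable_funM; last exact: measurable_weight.
  by apply: measurable_funX; exact: cmeas_normc.
- by move=> n x; apply: mulr_ge0; [exact: sqr_ge0|exact/ltW/weight_gt0].
- apply: nearW => xi; rewrite -[X in _ --> X]mulr1.
  by apply: cvgM; [exact: cvg_cst|exact: weight_cvg].
- by apply: measurable_funX; exact: cmeas_normc.
- by move=> x; exact: sqr_ge0.
- by apply: nearW => n; apply: nsq_FT_weight_le => //; exact: harmonic_pos.
Qed.

Lemma L2_FT f : cintegrable mu2 f -> L2 mu2 f -> L2 mu2 (FT f).
Proof.
move=> fi Lf; split; first exact: cmeas_FT.
by apply: le_lt_trans (nsq_FT_le fi Lf) _; case: Lf.
Qed.

Lemma nrm_FT_le f : cintegrable mu2 f -> L2 mu2 f -> nrm mu2 (FT f) <= nrm mu2 f.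
Proof.
move=> fi Lf; rewrite -(@ler_pXn2r _ 2)// ?nnegrE ?nrm_ge0// -lee_fin !nrm_sq//.
  exact: nsq_FT_le.
exact: L2_FT.
Qed.

Definition box (a b c d : R) (y : plane) : R :=
  \1_(`[a, b]%classic : set R) y.1 * \1_(`[c, d]%classic : set R) y.2.

(** For [a < b], the indicator of [[a, b]] with the value 1/2 at the endpoints: this is the limit of
    the Poisson integrals of the indicator at every point. *)
Definition halfsg (a b x : R) : R := (Num.sg (x - a) - Num.sg (x - b)) / 2.

Lemma measurable_box a b c d : measurable_fun setT (box a b c d).
Proof.
apply: measurable_funM.
  apply: (measurableT_comp _ measurable_fst); exact: measurable_indic.
apply: (measurableT_comp _ measurable_snd); exact: measurable_indic.
Qed.

Lemma box_ge0 a b c d y : 0 <= box a b c d y.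
Proof. by rewrite mulr_ge0. Qed.

Lemma box_le1 a b c d y : box a b c d y <= 1.
Proof. by rewrite /box -[leRHS]mulr1 ler_pM// indicE lern1 leq_b1. Qed.

Lemma integral_box_lty a b c d : a < b -> c < d -> (\int[mu2]_y (box a b c d y)%:E < +oo)%E.
Proof.
move=> ab cd; have mi (u v : R) : measurable_fun setT (\1_(`[u, v]%classic : set (measurableTypeR R)) : _ -> R).
  exact: measurable_indic.
have := ge0_integral_tensor leb leb (mi a b) (mi c d).
move=> ->; [|by []..].
rewrite !integral_indic//= !setIT.
by rewrite !lebesgue_measure_itv/= !lte_fin ab cd -!EFinB -EFinM ltry.
Qed.

Lemma cintegrable_box a b c d : a < b -> c < d ->
  cintegrable mu2 (fun y => (box a b c d y)%:C).
Proof.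
move=> ab cd; apply: (@le_cintegrable _ _ _ _ _ (box a b c d)).
- by apply: cmeas_real; exact: measurable_box.
- exact: measurable_box.
- by move=> y; rewrite normc_real ger0_norm// box_ge0.
- exact: integral_box_lty.
Qed.

Lemma L2_box a b c d : a < b -> c < d -> L2 mu2 (fun y => (box a b c d y)%:C).
Proof.
move=> ab cd; split; first by apply: cmeas_real; exact: measurable_box.
apply: le_lt_trans (integral_box_lty ab cd); apply: ge0_le_integral => //.
- by apply: measurable_sqnormc; apply: cmeas_real; exact: measurable_box.
- by apply/measurable_EFinP; exact: measurable_box.
- move=> y _; rewrite lee_fin normc_real ger0_norm ?box_ge0// expr2.
  by rewrite ler_piMr ?box_ge0 ?box_le1.
Qed.

(** For [a < b], the Poisson integral of the indicator of [[a, b]]. *)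
Definition atan_itv (e a b x : R) : R := (atan ((x - a) / e) - atan ((x - b) / e)) / pi.

Lemma poisson_box e a b c d x : 0 < e -> a < b -> c < d ->
  cint mu2 (fun y => ((box a b c d y)%:C)^* * (poisson2 e (psub y x))%:C) =
  (atan_itv e a b x.1 * atan_itv e c d x.2)%:C.
Proof.
move=> e0 ab cd.
pose u (a b t y : R) : R := \1_(`[a, b]%classic : set R) y * poisson e (t - y).
have mu a' b' t : measurable_fun setT (u a' b' t : measurableTypeR R -> R).
  apply: measurable_funM; first exact: measurable_indic.
  apply: continuous_measurable_fun => y; apply: continuous_cvg.
    exact: continuous_poisson.
  by apply: cvgB; [exact: cvg_cst|exact: cvg_id].
have u0 a' b' t y : 0 <= u a' b' t y by rewrite mulr_ge0 ?poisson_ge0.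
have iu a' b' t : a' < b' -> (\int[leb]_y (u a' b' t y)%:E = (atan_itv e a' b' t)%:E)%E.
  move=> ab'; rewrite /atan_itv -integral_poisson_itv// [RHS]integral_mkcond.
  apply: eq_integral => y _; rewrite patchE /u indicE.
  by case: ifP => _; rewrite ?mul1r ?mul0r.
transitivity (cint mu2 (fun y => (u a b x.1 y.1 * u c d x.2 y.2)%:C)).
  apply: eq_cint => y; rewrite conjc_real -rmorphM; congr real_complex_def.
  rewrite /u /box /poisson2 /psub /=.
  have -> : poisson e (y.1 - x.1) = poisson e (x.1 - y.1).
    by rewrite /poisson -(sqrrN (y.1 - x.1)) opprB.
  have -> : poisson e (y.2 - x.2) = poisson e (x.2 - y.2).
    by rewrite /poisson -(sqrrN (y.2 - x.2)) opprB.
  by ring.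
rewrite cint_real; congr real_complex_def; rewrite /Rintegral.
have -> := ge0_integral_tensor leb leb (mu a b x.1) (mu c d x.2) (u0 a b x.1) (u0 c d x.2).
by rewrite !iu.
Qed.

Lemma atan_itv_bound e a b x : `|atan_itv e a b x| <= 1.
Proof.
have p0 := @pi_gt0 R.
rewrite /atan_itv normrM [`|pi^-1|]ger0_norm ?invr_ge0 ?pi_ge0// ler_pdivrMr// mul1r.
have := atan_gtNpi2 ((x - a) / e); have := atan_ltpi2 ((x - a) / e).
have := atan_gtNpi2 ((x - b) / e); have := atan_ltpi2 ((x - b) / e).
move: (atan _) (atan _) (pi : R) p0 => u v p p0 h1 h2 h3 h4.
by rewrite ler_norml; apply/andP; split; lra.
Qed.

Lemma atan_harmonic_cvg (y : R) : atan (y / harmonic n) @[n --> \oo] --> Num.sg y * (pi / 2).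
Proof.
have pos (z : R) : 0 < z -> atan (z / harmonic n) @[n --> \oo] --> pi / 2.
  move=> z0; apply: (cvg_comp _ _ _ (@cvgy_atan R)).
  have : (fun n => z * n.+1%:R) @ \oo --> +oo.
    apply/cvgryPge => A.
    have h : \forall n \near \oo, A / z <= n%:R by exact: nbhs_infty_ger.
    apply: filterS h => n h; rewrite mulrC -ler_pdivrMr//; apply: (le_trans h).
    by rewrite ler_nat.
  by apply: cvg_trans; apply: near_eq_cvg; apply: nearW => n; rewrite /harmonic /= invrK.
have [y0|y0|<-] := ltgtP 0 y.
- by rewrite gtr0_sg// mul1r; exact: pos.
- rewrite ltr0_sg// mulN1r.
  rewrite (_ : (fun n => _) = fun n => - atan (- y / harmonic n)); last first.
    by apply/funext => n; rewrite -atanN mulNr opprK.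
  by apply: cvgN; apply: pos; rewrite oppr_gt0.
- rewrite sgr0 mul0r (_ : (fun n => _) = fun=> 0); first exact: cvg_cst.
  by apply/funext => n; rewrite mul0r atan0.
Qed.

Lemma atan_itv_cvg (a b x : R) : atan_itv (harmonic n) a b x @[n --> \oo] --> halfsg a b x.
Proof.
have pi0 : pi != 0 :> R by rewrite gt_eqF ?pi_gt0.
have -> : halfsg a b x = (Num.sg (x - a) * (pi / 2) - Num.sg (x - b) * (pi / 2)) * pi^-1.
  by rewrite /halfsg; move: (pi : R) pi0 => p p0; field.
have h1 : (fun n => atan ((x - a) / harmonic n) - atan ((x - b) / harmonic n)) @ \oo -->
    Num.sg (x - a) * (pi / 2) - Num.sg (x - b) * (pi / 2).
  by apply: cvgB; exact: atan_harmonic_cvg.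
by apply: (cvgM h1); exact: cvg_cst.
Qed.

Lemma measurable_atan_itv e a b : measurable_fun setT (atan_itv e a b : measurableTypeR R -> R).
Proof.
apply: continuous_measurable_fun => x; apply: cvgM; last exact: cvg_cst.
apply: cvgB; apply: continuous_cvg; try exact: continuous_atan;
  apply: cvgM; try exact: cvg_cst; apply: cvgB; try exact: cvg_cst; exact: cvg_id.
Qed.

Lemma measurable_halfsg a b : measurable_fun setT (halfsg a b : measurableTypeR R -> R).
Proof.
apply/measurable_EFinP.
apply: (@emeasurable_fun_cvg _ _ _ _ (fun n x => (atan_itv (harmonic n) a b x)%:E)) => //.
  by move=> n; apply/measurable_EFinP; exact: measurable_atan_itv.
move=> x _; apply: cvg_EFin; first exact: nearW.
exact: atan_itv_cvg.
Qed.

(** The limit of [poisson_formula] when [g] is a box. Dominated convergence applies on the left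
    because both transforms are in L^2, and on the right because the Poisson integrals of indicators
    are bounded by 1. *)
Lemma FT_box f a b c d : cintegrable mu2 f -> L2 mu2 f -> a < b -> c < d ->
  ip mu2 (FT f) (FT (fun y => (box a b c d y)%:C)) =
  cint mu2 (fun x => f x * (halfsg a b x.1 * halfsg c d x.2)%:C).
Proof.
move=> fi Lf ab cd; have [mf foo] := fi.
have bi := cintegrable_box ab cd; have Lb := L2_box ab cd.
pose g y : R[i] := (box a b c d y)%:C.
pose l n := cint mu2 (fun xi => FT f xi * ((FT g xi)^* * (weight (harmonic n) xi)%:C)).
have cl : normc (l n - ip mu2 (FT f) (FT g)) @[n --> \oo] --> 0.
  apply: (@cint_dominated_cvg _ _ _ mu2 _ _ (fun xi => normc (FT f xi * (FT g xi)^*))).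
  - move=> n; apply: cmeasM; first exact: cmeas_FT.
    apply: cmeasM; first by apply: cmeas_conj; exact: cmeas_FT.
    by apply: cmeas_real; exact: measurable_weight.
  - by apply: cmeasM; [exact: cmeas_FT|apply: cmeas_conj; exact: cmeas_FT].
  - apply: nearW => xi.
    rewrite (_ : (fun n => _) = fun n => normc (FT f xi * (FT g xi)^*) * `|weight (harmonic n) xi - 1|).
      rewrite -[X in _ --> X](mulr0 (normc (FT f xi * (FT g xi)^*))); apply: cvgM; first exact: cvg_cst.
      by rewrite -(normr0 R); apply: cvg_norm; apply/subr_cvg0; exact: weight_cvg.
    apply/funext => n; rewrite -normc_real -normcM; congr normc.
    by rewrite rmorphB rmorph1; ring.
  - exact: integrable_normc (cintegrable_ip (L2_FT fi Lf) (L2_FT bi Lb)).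
  - move=> n xi; rewrite mulrA normcM normc_real ler_piMr// ger0_norm ?weight_le1 ?harmonic_pos//.
    exact/ltW/weight_gt0.
pose k n := cint mu2 (fun x => f x * (atan_itv (harmonic n) a b x.1 * atan_itv (harmonic n) c d x.2)%:C).
have lk n : l n = k n.
  rewrite /l poisson_formula ?harmonic_pos//; apply: eq_cint => x.
  by rewrite poisson_box ?harmonic_pos.
have mai e : measurable_fun setT (fun x : plane => atan_itv e a b x.1 * atan_itv e c d x.2).
  apply: measurable_funM.
    exact: (measurableT_comp (measurable_atan_itv e a b) measurable_fst).
  exact: (measurableT_comp (measurable_atan_itv e c d) measurable_snd).
have ck : normc (k n - cint mu2 (fun x => f x * (halfsg a b x.1 * halfsg c d x.2)%:C)) @[n --> \oo] --> 0.
  apply: (@cint_dominated_cvg _ _ _ mu2 _ _ (fun x => normc (f x))).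
  - by move=> n; apply: cmeasM => //; exact: cmeas_real.
  - apply: cmeasM => //; apply: cmeas_real; apply: measurable_funM.
      exact: (measurableT_comp (measurable_halfsg a b) measurable_fst).
    exact: (measurableT_comp (measurable_halfsg c d) measurable_snd).
  - apply: nearW => x; pose s := halfsg a b x.1 * halfsg c d x.2.
    rewrite (_ : (fun n => _) = fun n => normc (f x) *
       `|atan_itv (harmonic n) a b x.1 * atan_itv (harmonic n) c d x.2 - s|).
      rewrite -[X in _ --> X](mulr0 (normc (f x))); apply: cvgM; first exact: cvg_cst.
      rewrite -(normr0 R); apply: cvg_norm; apply/subr_cvg0.
      by apply: cvgM; exact: atan_itv_cvg.
    by apply/funext => n; rewrite -normc_real -normcM -mulrBr -rmorphB.
  - exact: integrable_normc.
  - move=> n x; rewrite normcM normc_real ler_piMr// normrM.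
    by rewrite -[leRHS]mulr1 ler_pM// atan_itv_bound.
apply: (normc_cvg_unique cl); by under eq_fun do rewrite lk.
Qed.

End BoxFormula.

(** * The Fourier transform on L^2 as a limit over disks *)

Section Truncation.
Context {R : realType}.
Local Notation leb := (@lebesgue_measure R).
Local Notation plane := (@plane R).
Implicit Types (f g h : plane -> R[i]).

Definition disk (r : R) : set plane := [set x | dot x x <= r ^+ 2].

Definition trunc (r : R) f : plane -> R[i] := fun x => (\1_(disk r) x)%:C * f x.

Lemma measurable_sqdot : measurable_fun setT (fun x : plane => dot x x).
Proof. by apply: measurable_funD; apply: measurable_funM. Qed.

Lemma measurable_disk r : measurable (disk r).
Proof.
rewrite (_ : disk r = (fun x : plane => dot x x) @^-1` `]-oo, r ^+ 2]%classic); last first.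
  by apply/seteqP; split => x /=; rewrite in_itv.
by rewrite -[X in measurable X]setTI; exact: measurable_sqdot.
Qed.

Lemma measurable_indic_disk r : measurable_fun setT (\1_(disk r) : plane -> R).
Proof. by apply: measurable_indic; exact: measurable_disk. Qed.

Lemma cmeas_trunc r f : cmeas f -> cmeas (trunc r f).
Proof. by move=> mf; apply: cmeasM => //; apply: cmeas_real; exact: measurable_indic_disk. Qed.

Lemma indic_le1 {T} (A : set T) (x : T) : (\1_A x : R) <= 1.
Proof. by rewrite indicE lern1 leq_b1. Qed.

Lemma normc_indic {T} (A : set T) (x : T) : normc ((\1_A x : R)%:C) = \1_A x.
Proof. by rewrite normc_real ger0_norm. Qed.

Lemma normc_trunc_le r f x : normc (trunc r f x) <= normc (f x).
Proof. by rewrite normcM normc_indic ler_piMl// indic_le1. Qed.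

Lemma L2_trunc r f : L2 mu2 f -> L2 mu2 (trunc r f).
Proof.
move=> Lf; apply: (@le_L2 _ _ _ _ _ 1 f) => //; first by apply: cmeas_trunc; case: Lf.
by move=> x; rewrite mul1r normc_trunc_le.
Qed.

Lemma L2_indic_disk r : L2 mu2 (fun x => (\1_(disk r) x)%:C).
Proof.
(* The extra 1 keeps the box nondegenerate for [r = 0]. *)
have r1 : - (`|r| + 1) < `|r| + 1 by have := normr_ge0 r; lra.
apply: (@le_L2 _ _ _ _ _ 1 _ _ _ (L2_box r1 r1)).
  by apply: cmeas_real; exact: measurable_indic_disk.
move=> x; rewrite mul1r normc_indic normc_real ger0_norm ?box_ge0// /box !indicE.
have [|_] := boolP (x \in disk r); last by rewrite mulr_ge0.
rewrite inE /disk /dot /= => h.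
have b (t : R) : t * t <= r ^+ 2 -> t \in (`[(- (`|r| + 1))%R, (`|r| + 1)%R]%classic : set R).
  move=> ht; rewrite inE /= in_itv /= -ler_norml.
  rewrite -(@ler_pXn2r _ 2)// ?nnegrE ?addr_ge0// real_normK ?num_real// expr2.
  apply: (le_trans ht); rewrite -(real_normK (num_real r)).
  by rewrite lerXn2r// ?nnegrE ?addr_ge0// lerDl.
rewrite !b ?mulr1//.
  by apply: le_trans h; rewrite lerDr -expr2 sqr_ge0.
by apply: le_trans h; rewrite lerDl -expr2 sqr_ge0.
Qed.

Lemma cintegrable_trunc r f : L2 mu2 f -> cintegrable mu2 (trunc r f).
Proof.
move=> Lf; have := cintegrable_ip Lf (L2_indic_disk r).
by congr (cintegrable _ _); apply/funext => x; rewrite conjc_real mulrC.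
Qed.

Lemma trunc_pointwise f x : normc (trunc n%:R f x - f x) @[n --> \oo] --> (0 : R).
Proof.
have h : \forall n \near \oo, dot x x + 1 <= n%:R by exact: nbhs_infty_ger.
apply: cvg_near_cst; apply: filterS h => n hn.
rewrite /trunc indicE mem_set ?mul1r ?subrr ?normc0//.
have d0 : 0 <= dot x x by rewrite /dot addr_ge0// -expr2 sqr_ge0.
by rewrite /disk /=; nra.
Qed.

(** Dominated convergence gives the limit along integers. A real radius [r >= N] is then compared
    with [N], since the disks increase with the radius. *)
Lemma trunc_cvg f e : L2 mu2 f -> 0 < e ->
  exists N : nat, forall r, N%:R <= r -> nrm mu2 (fun x => trunc r f x - f x) <= e.
Proof.
move=> Lf e0; have [mf foo] := Lf.
have LB r : L2 mu2 (fun x => trunc r f x - f x) by apply: L2B => //; exact: L2_trunc.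
have nB r x : normc (trunc r f x - f x) <= normc (f x).
  rewrite /trunc; have [->|->] : (\1_(disk r) x = 1 :> R) \/ (\1_(disk r) x = 0 :> R).
  - by rewrite indicE; case: (_ \in _); [left|right].
  - by rewrite mul1r subrr normc0.
  - by rewrite mul0r sub0r normcN.
have : normc (ip mu2 (fun x => trunc n%:R f x - f x) (fun x => trunc n%:R f x - f x) - cint mu2 (fun=> 0))
    @[n --> \oo] --> 0.
  apply: (@cint_dominated_cvg _ _ _ mu2 _ _ (fun x => normc (f x * (f x)^*))).
  - move=> n; have [mB _] := LB n%:R; apply: cmeasM => //; exact: cmeas_conj.
  - exact: cmeas_cst.
  - apply: nearW => x.
    rewrite (_ : (fun n => _) = fun n : nat => normc (trunc n%:R f x - f x) * normc (trunc n%:R f x - f x)).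
      by rewrite -[X in _ --> X](mul0r 0); apply: cvgM; exact: trunc_pointwise.
    by apply/funext => n; rewrite subr0 normcM normc_conj.
  - exact: integrable_normc (cintegrable_ip Lf Lf).
  - move=> n x; rewrite normcM normc_conj (normcM (f x)) normc_conj.
    by rewrite ler_pM.
move=> /cvgrPdist_le/(_ (e ^+ 2)); rewrite exprn_gt0// => /(_ isT) [N _ NP].
exists N => r Nr; have := NP N (leqnn N).
rewrite cint0 subr0 ip_same// normc_real sub0r normrN !ger0_norm ?sqr_ge0//.
rewrite (ler_sqrE (nrm_ge0 _ _) (ltW e0)); apply: le_trans.
rewrite -(ler_sqrE (nrm_ge0 _ _) (nrm_ge0 _ _)) -lee_fin (nrm_sq (LB r)) (nrm_sq (LB _)).
apply: ge0_le_integral => //.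
- by apply: measurable_sqnormc; case: (LB r).
- by apply: measurable_sqnormc; case: (LB N%:R).
- move=> x _; rewrite lee_fin lerXn2r ?nnegrE// /trunc !indicE.
  have [xr|xr] := boolP (x \in disk r); first by rewrite mul1r subrr normc0.
  have [xN|xN] := boolP (x \in disk N%:R); last by rewrite !mul0r.
  move: xr; rewrite notin_setE => /negP; rewrite -ltNge => xr; exfalso.
  move: xN; rewrite inE /disk /= => xN.
  suff : r ^+ 2 < N%:R ^+ 2 by rewrite ltNge lerXn2r ?nnegrE// (le_trans _ Nr).
  exact: lt_le_trans xN.
Qed.

End Truncation.

Section Norm2.
Context {R : realType}.
Local Notation plane := (@plane R).

Lemma norm2E (f : plane -> R[i]) : norm2 f = (nsq mu2 f `^ 2^-1)%E.
Proof.
rewrite /norm2 unlock; congr (_ `^ _)%E.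
apply: eq_integral => x _; rewrite gee0_abs//.
by rewrite poweR_EFin powR_mulrn.
Qed.

Lemma norm2_lty (f : plane -> R[i]) : (norm2 f < +oo)%E <-> (nsq mu2 f < +oo)%E.
Proof.
rewrite norm2E; have := nsq_ge0 mu2 f; case: (nsq _ _) => [r _|_|//].
  by rewrite poweR_EFin !ltry.
by rewrite poweRyr ?invr_neq0// ltxx.
Qed.

Lemma in_L2P (f : plane -> R[i]) : in_L2 f <-> L2 mu2 f.
Proof. by split => -[mf /norm2_lty ?]. Qed.

Lemma fourier_ballE (f : plane -> R[i]) r : cmeas f -> fourier_ball f r = FT (trunc r f).
Proof.
move=> mf; apply/funext => xi; rewrite /fourier_ball /FT; congr (_ * _).
rewrite /cintegral /cint; congr (_ +i* _).
  rewrite Rintegral_mkcond; apply: eq_Rintegral => x _.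
  rewrite patchE /trunc indicE; case: ifP => _; first by rewrite mul1r.
  by rewrite mul0r mulr0.
rewrite Rintegral_mkcond; apply: eq_Rintegral => x _.
rewrite patchE /trunc indicE; case: ifP => _; first by rewrite mul1r.
by rewrite mul0r mulr0.
Qed.

End Norm2.

Section FourierL2.
Context {R : realType}.
Local Notation plane := (@plane R).
Implicit Types (f g h : plane -> R[i]).

Lemma near_pinfty_nat (P : R -> Prop) :
  (\forall r \near +oo, P r) <-> exists N : nat, forall r, N%:R <= r -> P r.
Proof.
split=> [[M [_ MP]]|[N NP]].
  exists (Num.bound `|M|) => r Nr; apply: MP.
  apply: le_lt_trans (ler_norm M) _; apply: lt_le_trans Nr.
  exact: archi_boundP.
by exists N%:R; split => // r Nr; apply: NP; exact: ltW.
Qed.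

Lemma norm2_leE f e : 0 <= e -> (norm2 f <= e%:E)%E = (nsq mu2 f <= (e ^+ 2)%:E)%E.
Proof.
move=> e0; rewrite norm2E; have := nsq_ge0 mu2 f; case: (nsq _ _) => [r|_|//].
  rewrite poweR_EFin !lee_fin => r0; rewrite -(ler_sqrE (powR_ge0 _ _) e0).
  by rewrite -powR_mulrn ?powR_ge0// -powRrM mulVf// powRr1.
by rewrite poweRyr ?invr_neq0// !leye_eq.
Qed.

(** [is_fourier] in epsilon form, with natural thresholds and the squared norm. *)
Definition isF f g := L2 mu2 g /\ forall e, 0 < e -> exists N : nat, forall r, N%:R <= r ->
  (nsq mu2 (fun xi => (FT (trunc r f) xi - g xi)%R) <= (e ^+ 2)%:E)%E.

Lemma cvg_pinfty0P (u : R -> \bar R) : (forall r, 0 <= u r)%E ->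
  u r @[r --> +oo] --> 0%E <->
  forall e, 0 < e -> exists N : nat, forall r, N%:R <= r -> (u r <= e%:E)%E.
Proof.
move=> u0; split=> [/fine_cvgP [c1 c2] e e0|h].
  apply/near_pinfty_nat; move/cvgrPdist_le/(_ _ e0) : c2.
  apply: filterS2 c1 => r r1 /=; rewrite sub0r normrN.
  by rewrite ger0_norm ?fine_ge0// -lee_fin fineK.
apply/fine_cvgP; split.
  have /near_pinfty_nat := h 1 ltr01; apply: filterS => r h1.
  by rewrite ge0_fin_numE// (le_lt_trans h1)// ltry.
apply/cvgrPdist_le => e e0.
have /near_pinfty_nat := h e e0; apply: filterS => r /= h1.
rewrite sub0r normrN ger0_norm ?fine_ge0// -lee_fin fineK//.
by rewrite ge0_fin_numE// (le_lt_trans h1)// ltry.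
Qed.

Lemma is_fourierP f g : cmeas f -> is_fourier f g <-> isF f g.
Proof.
move=> mf; pose u r := norm2 (fun xi => fourier_ball f r xi - g xi).
have u0 r : (0 <= u r)%E by rewrite /u norm2E poweR_ge0.
have uE r e : 0 < e -> (u r <= e%:E)%E =
    (nsq mu2 (fun xi => (FT (trunc r f) xi - g xi)%R) <= (e ^+ 2)%:E)%E.
  by move=> /ltW e0; rewrite /u (fourier_ballE r mf) (norm2_leE _ e0).
split; last first.
  move=> [Lg c]; split.
    exact: (in_L2P g).2.
  have h : forall e, 0 < e -> exists N : nat, forall r, N%:R <= r -> (u r <= e%:E)%E.
    move=> e e0; have [N NP] := c e e0; exists N => r Nr.
    rewrite uE//; exact: NP.
  exact: ((cvg_pinfty0P u0).2 h).
move=> [Lg c]; have c1 : u r @[r --> +oo] --> 0%E := c.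
have c2 := (cvg_pinfty0P u0).1 c1.
split.
  exact: (in_L2P g).1.
move=> e e0; have [N NP] := c2 e e0; exists N => r Nr.
rewrite -uE//; exact: NP.
Qed.

Lemma nsq_leE f e : L2 mu2 f -> 0 <= e -> (nsq mu2 f <= (e ^+ 2)%:E)%E = (nrm mu2 f <= e).
Proof. by move=> Lf e0; rewrite -(nrm_sq Lf) lee_fin (ler_sqrE (nrm_ge0 _ _) e0). Qed.

Lemma L2_FT_trunc r f : L2 mu2 f -> L2 mu2 (FT (trunc r f)).
Proof. by move=> Lf; apply: L2_FT; [exact: cintegrable_trunc|exact: L2_trunc]. Qed.

Lemma isFP f g : L2 mu2 f -> isF f g <-> L2 mu2 g /\ forall e, 0 < e ->
  exists N : nat, forall r, N%:R <= r -> nrm mu2 (fun xi => FT (trunc r f) xi - g xi) <= e.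
Proof.
move=> Lf; have LB r (Lg : L2 mu2 g) : L2 mu2 (fun xi => FT (trunc r f) xi - g xi).
  by apply: L2B => //; exact: L2_FT_trunc.
split=> -[Lg c]; split => // e e0; have [N NP] := c e e0; exists N => r Nr.
  by rewrite -(nsq_leE (LB r Lg) (ltW e0)); exact: NP.
by rewrite (nsq_leE (LB r Lg) (ltW e0)); exact: NP.
Qed.

Lemma nrm_FT_trunc_dist r s f : L2 mu2 f ->
  nrm mu2 (fun xi => FT (trunc r f) xi - FT (trunc s f) xi) <=
  nrm mu2 (fun x => trunc r f x - f x) + nrm mu2 (fun x => trunc s f x - f x).
Proof.
move=> Lf; have [ir is_] := (cintegrable_trunc r Lf, cintegrable_trunc s Lf).
have [Lr Ls] := (L2_trunc r Lf, L2_trunc s Lf).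
rewrite (_ : (fun xi => _) = FT (fun x => trunc r f x - trunc s f x)); last first.
  by apply/funext => xi; rewrite FTB.
apply: le_trans (nrm_FT_le (cintegrableB ir is_) (L2B Lr Ls)) _.
by rewrite (nrm_distC mu2 (trunc s f)); exact: le_nrm_distD.
Qed.

(** By [nrm_FT_le] the transforms of the truncations form a Cauchy sequence. Completeness provides
    the limit along integers, and the same bound extends it to real radii. *)
Lemma isF_exists f : L2 mu2 f -> exists g, isF f g.
Proof.
move=> Lf; have LT r := L2_FT_trunc r Lf.
have [|g Lg cg] := @L2_complete _ _ _ mu2 (fun n => FT (trunc n%:R f)) (fun n => LT _).
  move=> e e0; have e2 : 0 < e / 2 by rewrite divr_gt0.
  have [N NP] := trunc_cvg Lf e2; exists N => n m Nn Nm.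
  apply: le_trans (nrm_FT_trunc_dist _ _ Lf) _.
  by rewrite [leRHS]splitr lerD// NP// ler_nat.
exists g; apply/isFP => //; split => // e e0.
have e4 : 0 < e / 2 / 2 by rewrite !divr_gt0.
have e2 : 0 < e / 2 by rewrite divr_gt0.
have [N NP] := trunc_cvg Lf e4.
move/cvgrPdist_le/(_ _ e2) : cg => [M _ MP]; exists N => r Nr.
have h := MP (maxn N M) (leq_maxr _ _); rewrite /= sub0r normrN ger0_norm ?nrm_ge0// in h.
apply: le_trans (le_nrm_distD (LT r) Lg (LT (maxn N M)%:R)) _.
rewrite [leRHS]splitr lerD//; apply: le_trans (nrm_FT_trunc_dist _ _ Lf) _.
by rewrite [leRHS]splitr lerD// NP// ler_nat leq_maxl.
Qed.

Lemma fourierP f : L2 mu2 f -> isF f (fourier f).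
Proof.
move=> Lf; have [mf _] := Lf; have [g Fg] := isF_exists Lf.
have ex : exists g, [set g | is_fourier f g] g by exists g; exact: ((is_fourierP g mf).2 Fg).
exact: ((is_fourierP _ mf).1 (xgetPex (fun=> 0) ex)).
Qed.

Lemma le_epsilon_nrm (a b : R) : (forall e, 0 < e -> a <= b + e) -> a <= b.
Proof. by move=> h; apply/ler_addgt0Pr. Qed.

Lemma isF_unique f g g' : L2 mu2 f -> isF f g -> isF f g' -> {ae mu2, forall x, g x = g' x}.
Proof.
move=> Lf /isFP-/(_ Lf)[Lg c] /isFP-/(_ Lf)[Lg' c']; apply: nrm0P => //.
apply/eqP; rewrite eq_le nrm_ge0 andbT; apply: le_epsilon_nrm => e e0; rewrite add0r.
have e2 : 0 < e / 2 by rewrite divr_gt0.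
have [N NP] := c _ e2; have [M MP] := c' _ e2.
have LT := L2_FT_trunc (maxn N M)%:R Lf.
apply: le_trans (le_nrm_distD Lg Lg' LT) _; rewrite [leRHS]splitr lerD//.
  by rewrite nrm_distC; apply: NP; rewrite ler_nat leq_maxl.
by apply: MP; rewrite ler_nat leq_maxr.
Qed.

Lemma isFB f f' g g' : L2 mu2 f -> L2 mu2 f' -> isF f g -> isF f' g' ->
  isF (fun x => f x - f' x) (fun x => g x - g' x).
Proof.
move=> Lf Lf' /isFP-/(_ Lf)[Lg c] /isFP-/(_ Lf')[Lg' c'].
apply/isFP; first exact: L2B.
split; first exact: L2B.
move=> e e0; have e2 : 0 < e / 2 by rewrite divr_gt0.
have [N NP] := c _ e2; have [M MP] := c' _ e2; exists (maxn N M) => r Nr.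
have [ir Lr LT] := And3 (cintegrable_trunc r Lf) (L2_trunc r Lf) (L2_FT_trunc r Lf).
have [ir' Lr' LT'] := And3 (cintegrable_trunc r Lf') (L2_trunc r Lf') (L2_FT_trunc r Lf').
have E : (fun xi => FT (trunc r (fun x => f x - f' x)) xi - (g xi - g' xi)) =
    fun xi => (FT (trunc r f) xi - g xi) - (FT (trunc r f') xi - g' xi).
  apply/funext => xi; rewrite (_ : trunc r (fun x => f x - f' x) = fun x => trunc r f x - trunc r f' x).
    by rewrite (FTB xi ir ir'); ring.
  by apply/funext => x; rewrite /trunc mulrBr.
have LB : L2 mu2 (fun xi => FT (trunc r f) xi - g xi) by exact: L2B.
have LB' : L2 mu2 (fun xi => FT (trunc r f') xi - g' xi) by exact: L2B.
have h := le_nrmD LB (L2N LB'); rewrite nrmN in h.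
rewrite E; apply: (le_trans h); rewrite [leRHS]splitr; apply: lerD.
  by apply: NP; apply: le_trans Nr; rewrite ler_nat leq_maxl.
by apply: MP; apply: le_trans Nr; rewrite ler_nat leq_maxr.
Qed.

Lemma isF_FT f : cintegrable mu2 f -> L2 mu2 f -> isF f (FT f).
Proof.
move=> fi Lf; apply/isFP => //; split; first exact: L2_FT.
move=> e e0; have [N NP] := trunc_cvg Lf e0; exists N => r Nr; apply: le_trans (NP r Nr).
have ir := cintegrable_trunc r Lf; have Lr := L2_trunc r Lf.
have -> : (fun xi => FT (trunc r f) xi - FT f xi) = FT (fun x => trunc r f x - f x).
  by apply/funext => xi; rewrite FTB.
by apply: nrm_FT_le; [exact: cintegrableB|exact: L2B].
Qed.

Lemma isF_popp f g : L2 mu2 f -> isF f g -> isF (fun x => f (popp x)) (fun x => g (popp x)).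
Proof.
move=> Lf /isFP-/(_ Lf)[Lg c].
have Lfp : L2 mu2 (fun x => f (popp x)) := L2_preserving measurable_popp mu2_popp Lf.
have Lgp : L2 mu2 (fun x => g (popp x)) := L2_preserving measurable_popp mu2_popp Lg.
apply: (isFP _ Lfp).2; split; first exact: Lgp.
move=> e e0; have [N NP] := c _ e0; exists N => r Nr; apply: le_trans (NP r Nr).
have LB : L2 mu2 (fun xi => FT (trunc r f) xi - g xi) by apply: L2B => //; exact: L2_FT_trunc.
rewrite -(nrm_preserving measurable_popp mu2_popp LB.1) le_eqVlt; apply/orP; left; apply/eqP.
congr nrm; apply/funext => xi; congr (_ - _).
have ii := cintegrable_cis (popp xi) (cintegrable_trunc r Lf).
rewrite /FT -(cint_preserving measurable_popp mu2_popp ii).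
apply: (congr1 (fun z => ((2 * pi)^-1)%:C * z)); apply: eq_cint => x.
have -> : dot (popp x) (popp xi) = dot x xi by rewrite /dot /=; ring.
apply: (congr1 (fun z => cis (- dot x xi) * z)).
have -> // : trunc r (fun x => f (popp x)) x = trunc r f (popp x).
rewrite /trunc !indicE; apply: (congr1 (fun b : bool => (b%:R)%:C * f (popp x))).
by apply/idP/idP; rewrite !inE /disk /dot /= !mulrNN.
Qed.

Lemma isF_translation f g z : L2 mu2 f -> isF f g ->
  isF (fun x => cis (dot x z) * f x) (fun xi => g (psub xi z)).
Proof.
move=> Lf /isFP-/(_ Lf)[Lg c].
have Lfp : L2 mu2 (fun x => cis (dot x z) * f x).
  apply: (@L2Ml _ _ _ _ _ 1) => // [|x]; last by rewrite normc_cis.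
  by apply: cmeas_cis; exact: measurable_dotr.
have pz := measurable_psubl z; have mz := mu2_psubl z.
have Lgp : L2 mu2 (fun x => g (psub x z)) := L2_preserving pz mz Lg.
apply: (isFP _ Lfp).2; split; first exact: Lgp.
move=> e e0; have [N NP] := c _ e0; exists N => r Nr; apply: le_trans (NP r Nr).
have LB : L2 mu2 (fun xi => FT (trunc r f) xi - g xi) by apply: L2B => //; exact: L2_FT_trunc.
rewrite -(nrm_preserving pz mz LB.1) le_eqVlt; apply/orP; left; apply/eqP.
congr nrm; apply/funext => xi; congr (_ - _); rewrite /FT.
apply: (congr1 (fun z => ((2 * pi)^-1)%:C * z)); apply: eq_cint => x.
have -> : dot x (psub xi z) = dot x xi - dot x z by rewrite /dot /=; ring.
by rewrite opprB addrC cisD /trunc; ring.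
Qed.

End FourierL2.

(** * Functions whose integrals over boxes vanish *)

Section DynkinIntegral.
Context {R : realType} {d1 d2} {X : measurableType d1} {T : measurableType d2}.
Variables (mu : {measure set X -> \bar R}) (phi : X -> T) (k : X -> R[i]).
Hypothesis mphi : measurable_fun setT phi.
Hypothesis ki : cintegrable mu k.

Let I (A : set T) := cint mu (fun x => (\1_A (phi x))%:C * k x).

Lemma cintegrable_indic (A : set T) : measurable A ->
  cintegrable mu (fun x => (\1_A (phi x))%:C * k x).
Proof.
move=> mA; apply: (@cintegrableMl _ _ _ _ _ _ 1) => //.
  by apply: cmeas_real; apply: measurableT_comp mphi; exact: measurable_indic.
by move=> x; rewrite normc_indic indic_le1.
Qed.

(** The sets with vanishing integral form a Dynkin system: complements use that the whole integral
    vanishes, disjoint unions use dominated convergence. The map [phi] allows the argument to run in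
    one coordinate at a time. *)
Lemma dynkin_cint (G : set (set T)) : @measurable _ T = <<s G >> -> setI_closed G ->
  (forall A, G A -> cint mu (fun x => (\1_A (phi x))%:C * k x) = 0) ->
  cint mu k = 0 ->
  forall A, measurable A -> cint mu (fun x => (\1_A (phi x))%:C * k x) = 0.
Proof.
move=> GE GI G0 k0; have := @dynkin_induction _ T G (fun A => I A = 0) GE GI.
rewrite -GE; apply.
- by rewrite /I -[RHS]k0; apply: eq_cint => x; rewrite indicT mul1r.
- by move=> A; exact: G0.
- move=> A mA IA; rewrite /I.
  have -> : (fun x => (\1_(~` A) (phi x))%:C * k x) = fun x => k x - (\1_A (phi x))%:C * k x.
    apply/funext => x; rewrite !indicE in_setC.
    by case: (_ \in _) => /=; rewrite ?mul1r ?mul0r ?subrr ?subr0.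
  by rewrite (cintB ki (cintegrable_indic mA)) -/(I A) IA k0 subr0.
- move=> F mF tF IF.
  pose U n := \big[setU/set0]_(i < n) F i.
  have mU n : measurable (U n) by apply: bigsetU_measurable => i _; exact: mF.
  have IU n : I (U n) = 0.
    elim: n => [|n ih].
      rewrite /I /U big_ord0 -[RHS](cint0 mu); apply: eq_cint => x.
      by rewrite indic0 mul0r.
    rewrite /I; have -> : (fun x => (\1_(U n.+1) (phi x))%:C * k x) =
        fun x => (\1_(U n) (phi x))%:C * k x + (\1_(F n) (phi x))%:C * k x.
      apply/funext => x; rewrite -mulrDl -rmorphD; congr (_%:C * _).
      rewrite /U big_ord_recr /= -/(U n) !indicE in_setU.
      have [xU|] := boolP (phi x \in U n); have [xF|] := boolP (phi x \in F n); rewrite ?addr0 ?add0r//.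
      exfalso; move: xU xF; rewrite !inE /U -bigcup_mkord => -[j /= jn Fj] Fn.
      have := tF j n Logic.I Logic.I; move=> /(_ (ex_intro _ _ (conj Fj Fn))) E.
      by rewrite E ltnn in jn.
    by rewrite (cintD (cintegrable_indic (mU n)) (cintegrable_indic (mF n))) -/(I _) -/(I _) ih IF addr0.
  have mC : measurable (\bigcup_k F k) by exact: bigcupT_measurable.
  have c : normc (I (U n) - I (\bigcup_k F k)) @[n --> \oo] --> 0.
    apply: (@cint_dominated_cvg _ _ _ mu _ _ (fun x => normc (k x))).
    + by move=> n; case: (cintegrable_indic (mU n)).
    + by case: (cintegrable_indic mC).
    + apply: nearW => x; apply: cvg_near_cst.
      have [[j _ Fj]|nF] := pselect ((\bigcup_k F k) (phi x)).
        exists j.+1 => // n /= jn; rewrite !indicE !mem_set ?subrr ?normc0//.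
          by exists j.
        by rewrite /U -bigcup_mkord; exists j.
      apply: nearW => n; rewrite !indicE !memNset ?mul0r ?subrr ?normc0//.
      by rewrite /U -bigcup_mkord => -[j _ Fj]; apply: nF; exists j.
    + exact: integrable_normc.
    + by move=> n x; rewrite normcM normc_indic ler_piMl// indic_le1.
  apply: (normc_cvg_unique (l := fun n => I (U n)) c).
  apply: cvg_near_cst; apply: nearW => n.
  by rewrite IU subrr normc0.
Qed.

End DynkinIntegral.

Section Boxes.
Context {R : realType}.
Local Notation plane := (@plane R).
Local Notation leb := (@lebesgue_measure R).

(** The Dynkin argument runs in the first coordinate, then in the second, then over rectangles. The
    line itself is not a bounded interval, so the vanishing of the whole integral is read off from
    [I0], since [k] vanishes outside the square over [I0]. *)
Lemma ocitv_sets_zero (k : plane -> R[i]) (I0 : set R) : cintegrable mu2 k -> ocitv I0 ->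
  (forall x, k x = (\1_I0 x.1)%:C * ((\1_I0 x.2)%:C * k x)) ->
  (forall A B : set R, ocitv A -> ocitv B ->
    cint mu2 (fun x => (\1_A x.1)%:C * ((\1_B x.2)%:C * k x)) = 0) ->
  forall D : set plane, measurable D -> cint mu2 (fun x => (\1_D x)%:C * k x) = 0.
Proof.
move=> ki oI kI k0.
have mo (A : set R) : ocitv A -> measurable (A : set (measurableTypeR R)).
  by move=> oA; exact: sub_sigma_algebra.
have GE : @measurable _ (measurableTypeR R) = <<s @ocitv R >> by [].
have GI : setI_closed (@ocitv R) by exact: ocitvI.
have absorb1 x : (\1_I0 x.1)%:C * k x = k x.
  rewrite [in LHS](kI x) [RHS](kI x) mulrA -rmorphM; congr (_%:C * _).
  by rewrite indicE; case: (_ \in _); rewrite /= ?mul1r ?mul0r.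
have absorb2 x : (\1_I0 x.2)%:C * k x = k x.
  rewrite [in LHS](kI x) [RHS](kI x) mulrCA; congr (_ * _); rewrite mulrA -rmorphM; congr (_%:C * _).
  by rewrite indicE; case: (_ \in _); rewrite /= ?mul1r ?mul0r.
have step1 (A : set (measurableTypeR R)) B : measurable A -> ocitv B ->
    cint mu2 (fun x => (\1_A x.1)%:C * ((\1_B x.2)%:C * k x)) = 0.
  move=> mA oB.
  apply: (dynkin_cint measurable_fst (cintegrable_indic measurable_snd ki (mo B oB)) GE GI _ _ mA).
    by move=> A' oA'; exact: k0.
  rewrite -[RHS](k0 I0 B oI oB); apply: eq_cint => x; rewrite [RHS]mulrCA; congr (_ * _).
  by rewrite absorb1.
have step2 (A B : set (measurableTypeR R)) : measurable A -> measurable B ->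
    cint mu2 (fun x => (\1_A x.1)%:C * ((\1_B x.2)%:C * k x)) = 0.
  move=> mA mB; have ci := cintegrable_indic measurable_fst ki mA.
  have := dynkin_cint measurable_snd ci GE GI _ _ mB.
  have E (B' : set R) : cint mu2 (fun x => (\1_B' x.2)%:C * ((\1_A x.1)%:C * k x)) =
      cint mu2 (fun x => (\1_A x.1)%:C * ((\1_B' x.2)%:C * k x)).
    by apply: eq_cint => x; rewrite mulrCA.
  rewrite E; apply.
    by move=> B' oB'; rewrite E; exact: step1.
  rewrite -[RHS](step1 A I0 mA oI); apply: eq_cint => x.
  by rewrite absorb2.
have GP : setI_closed [set A `*` B | A in @measurable _ (measurableTypeR R)
    & B in @measurable _ (measurableTypeR R)].
  move=> _ _ [A1 mA1 [B1 mB1 <-]] [A2 mA2 [B2 mB2 <-]].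
  exists (A1 `&` A2); first exact: measurableI.
  exists (B1 `&` B2); first exact: measurableI.
  by apply/seteqP; split => -[x y] /= [] [? ?] [? ?].
have D0 := dynkin_cint (phi := fun x : plane => x) (@measurable_id _ _ setT) ki
  (@measurable_prod_measurableType _ _ (measurableTypeR R) (measurableTypeR R)) GP.
apply: D0.
- move=> _ [A mA [B mB <-]]; rewrite -[RHS](step2 A B mA mB); apply: eq_cint => x /=.
  rewrite mulrA -rmorphM; congr (_%:C * _); rewrite !indicE in_setX.
  by case: (_ \in _); rewrite /= ?mul1r ?mul0r.
- rewrite -[RHS](step2 setT setT measurableT measurableT); apply: eq_cint => x.
  by rewrite !indicT !mul1r.
Qed.

(** With [D] the set where the real part is nonnegative, [2 1_D - 1] is its sign, so the integral of
    [|Re k|] vanishes. *)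
Lemma sets_zero_ae_Re (k : plane -> R[i]) : cintegrable mu2 k ->
  (forall D : set plane, measurable D -> cint mu2 (fun x => (\1_D x)%:C * k x) = 0) ->
  {ae mu2, forall x, complex.Re (k x) = 0}.
Proof.
move=> ki k0; have [[mRe mIm] _] := ki.
pose D : set plane := (fun x => complex.Re (k x)) @^-1` `[0, +oo[%classic.
have mD : measurable D by rewrite /D -[X in measurable X]setTI; exact: mRe.
have iD := cintegrable_indic (phi := fun x : plane => x) (@measurable_id _ _ setT) ki mD.
have : cint mu2 (fun x => 2%:C * ((\1_D x)%:C * k x) - k x) = 0.
  rewrite (cintB (cintegrableZl _ iD) ki) (cintZl _ iD) (k0 D mD) mulr0 sub0r.
  rewrite -[X in - X]/(cint mu2 k); have := k0 setT measurableT.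
  have -> : (fun x => (\1_setT x)%:C * k x) = k by apply/funext => x; rewrite indicT mul1r.
  by move=> ->; rewrite oppr0.
have E : (fun x => complex.Re (2%:C * ((\1_D x)%:C * k x) - k x)) = fun x => `|complex.Re (k x)|.
  apply/funext => x; rewrite ReD ReN !ReM /= !mul0r !subr0 indicE.
  have [|] := boolP (x \in D).
    rewrite inE /D /= in_itv /= andbT => h; rewrite ger0_norm//; ring.
  rewrite notin_setE /D /= in_itv /= andbT => /negP; rewrite -ltNge => h.
  by rewrite ltr0_norm// mul0r mulr0 add0r.
move=> /(congr1 (@complex.Re R)); rewrite Re_realC => h.
have h' : (\int[mu2]_x `|complex.Re (k x)|)%R = 0 by rewrite -[RHS]h -E.
have iRe := cintegrable_Re ki.
have [+ _] := ae_eq_integral_abs mu2 measurableT (measurable_int _ iRe).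
have -> : (\int[mu2]_x `|(EFin \o (fun x => complex.Re (k x))) x|)%E = 0%E.
  rewrite -[LHS]fineK; first by rewrite -[fine _]/(Rintegral _ _ _) h'.
  by rewrite ge0_fin_numE ?integral_ge0//; case/integrableP : iRe.
by move=> /(_ erefl); apply: filterS => x /(_ Logic.I) [].
Qed.

(** Up to sign, the imaginary part of [k] is the real part of [i k]. *)
Lemma sets_zero_ae (k : plane -> R[i]) : cintegrable mu2 k ->
  (forall D : set plane, measurable D -> cint mu2 (fun x => (\1_D x)%:C * k x) = 0) ->
  {ae mu2, forall x, k x = 0}.
Proof.
move=> ki k0; have h1 := sets_zero_ae_Re ki k0.
have h2 : {ae mu2, forall x, complex.Re ('i * k x) = 0}.
  apply: sets_zero_ae_Re; first exact: cintegrableZl.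
  move=> D mD; rewrite -[RHS](mulr0 'i) -(k0 D mD) -cintZl.
    by apply: eq_cint => x; rewrite mulrCA.
  exact: (cintegrable_indic (phi := fun x : plane => x) (@measurable_id _ _ setT) ki mD).
apply: filterS2 h1 h2 => x e1 e2; apply: complex_eqP => //=.
by move: e2; rewrite ReM /= mul0r mul1r sub0r => /eqP; rewrite oppr_eq0 => /eqP.
Qed.

(** An L^2 function need not be integrable, so [h] is first restricted to the squares over [J n],
    which exhaust the plane. *)
Lemma L2_boxes_zero (h : plane -> R[i]) : L2 mu2 h ->
  (forall A B : set R, ocitv A -> ocitv B ->
    cint mu2 (fun x => (\1_A x.1)%:C * ((\1_B x.2)%:C * h x)) = 0) ->
  {ae mu2, forall x, h x = 0}.
Proof.
move=> Lh h0.
pose J (n : nat) : set R := `](- n.+1%:R), n.+1%:R]%classic.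
have oJ n : ocitv (J n) by exists (- n.+1%:R, n.+1%:R).
have oI := @ocitvI R.
pose k n x := (\1_(J n) x.1)%:C * ((\1_(J n) x.2)%:C * h x).
have mJ n : measurable (J n : set (measurableTypeR R)) by apply: sub_sigma_algebra; exact: oJ.
have ki n : cintegrable mu2 (k n).
  have n1 : - n.+1%:R < n.+1%:R :> R by apply: (@lt_trans _ _ 0); rewrite ?oppr_lt0 ltr0n.
  pose w (x : plane) : R[i] := (\1_(J n) x.1 * \1_(J n) x.2)%:C.
  have Lw : L2 mu2 w.
    apply: (@le_L2 _ _ _ _ _ 1 _ _ _ (L2_box n1 n1)).
      apply: cmeas_real; apply: measurable_funM.
        exact: (measurableT_comp (measurable_indic (mJ n)) measurable_fst).
      exact: (measurableT_comp (measurable_indic (mJ n)) measurable_snd).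
    move=> x; rewrite mul1r !normc_real !ger0_norm ?box_ge0 ?mulr_ge0// /box.
    have b (t : R) : \1_(J n) t <= \1_(`[(- n.+1%:R)%R, n.+1%:R%R]%classic : set R) t :> R.
      rewrite !indicE ler_nat; have [|//] := boolP (t \in J n).
      rewrite inE /J /= in_itv /= => /andP[h1 h2].
      by rewrite mem_set//= in_itv /= h2 ltW.
    by rewrite ler_pM.
  have := cintegrable_ip Lh Lw.
  by congr (cintegrable _ _); apply/funext => x; rewrite /k /w conjc_real rmorphM; ring.
have kae n : {ae mu2, forall x, k n x = 0}.
  apply: sets_zero_ae => //; apply: (ocitv_sets_zero (ki n) (oJ n)).
    move=> x; rewrite /k !indicE.
    by case: (_ \in _); case: (_ \in _); rewrite /= ?mul1r ?mul0r ?mulr0.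
  move=> A B oA oB; have := h0 (A `&` J n) (B `&` J n) (oI _ _ oA (oJ n)) (oI _ _ oB (oJ n)).
  move=> <-; apply: eq_cint => x; rewrite /k !indicI /= !rmorphM; ring.
have := ae_foralln kae; apply: filterS => x hx.
have [N hN] : exists N : nat, `|x.1| + `|x.2| < N.+1%:R.
  exists (Num.bound (`|x.1| + `|x.2|)).
  apply: lt_trans (archi_boundP _) _; first by rewrite addr_ge0.
  by rewrite ltr_nat.
have b (t : R) : `|t| < N.+1%:R -> t \in J N.
  rewrite ltr_norml => /andP[t1 t2]; rewrite inE /J /= in_itv /= t1 ltW//.
have := hx N; rewrite /k !indicE !b ?mul1r//.
  by apply: le_lt_trans hN; rewrite lerDr.
by apply: le_lt_trans hN; rewrite lerDl.
Qed.

End Boxes.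

Section InnerLimit.
Context {R : realType} {d} {T : measurableType d} (mu : {measure set T -> \bar R}).

Lemma ip_cvg (f_ g_ : nat -> T -> R[i]) (f g : T -> R[i]) :
  (forall n, L2 mu (f_ n)) -> (forall n, L2 mu (g_ n)) -> L2 mu f -> L2 mu g ->
  nrm mu (fun x => f_ n x - f x) @[n --> \oo] --> 0 ->
  nrm mu (fun x => g_ n x - g x) @[n --> \oo] --> 0 ->
  normc (ip mu (f_ n) (g_ n) - ip mu f g) @[n --> \oo] --> 0.
Proof.
move=> Lf_ Lg_ Lf Lg cf cg.
have h : (fun n => nrm mu (fun x => f_ n x - f x) * (nrm mu (fun x => g_ n x - g x) + nrm mu g) +
    nrm mu f * nrm mu (fun x => g_ n x - g x)) @ \oo --> (0 : R).
  have -> : 0 = 0 * (0 + nrm mu g) + nrm mu f * 0 :> R by ring.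
  by apply: cvgD; apply: cvgM => //; [apply: cvgD => //; exact: cvg_cst|exact: cvg_cst].
apply: (squeeze_cvgr _ (cvg_cst 0) h); apply: nearW => n.
apply/andP; split; first exact: normc_ge0.
have LBf := L2B (Lf_ n) Lf; have LBg := L2B (Lg_ n) Lg.
have E : ip mu (f_ n) (g_ n) - ip mu f g =
    ip mu (fun x => f_ n x - f x) (g_ n) + ip mu f (fun x => g_ n x - g x).
  by rewrite (ipBl (Lf_ n) Lf (Lg_ n)) (ipBr (Lg_ n) Lg Lf); ring.
rewrite [X in normc X]E; apply: le_trans (le_normcD _ _) _; apply: lerD.
  apply: le_trans (normc_ip_le LBf (Lg_ n)) _; rewrite ler_wpM2l ?nrm_ge0//.
  by rewrite -lerBlDr; exact: ler_nrm_sub.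
exact: normc_ip_le.
Qed.

End InnerLimit.

(** * Inversion and Plancherel's theorem *)

Section Plancherel.
Context {R : realType}.
Local Notation plane := (@plane R).
Local Notation leb := (@lebesgue_measure R).
Implicit Types (f g h : plane -> R[i]).

Lemma nat_eps_cvg (u : nat -> R) : (forall n, 0 <= u n) ->
  (forall e, 0 < e -> exists N : nat, forall n, (N <= n)%N -> u n <= e) ->
  u n @[n --> \oo] --> 0.
Proof.
move=> u0 h; apply/cvgrPdist_le => e e0; have [N NP] := h e e0; exists N => // n /= Nn.
by rewrite sub0r normrN ger0_norm//; exact: NP.
Qed.

Lemma trunc_cvgn f : L2 mu2 f -> nrm mu2 (fun x => trunc n%:R f x - f x) @[n --> \oo] --> 0.
Proof.
move=> Lf; apply: nat_eps_cvg => [n|e e0]; first exact: nrm_ge0.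
by have [N NP] := trunc_cvg Lf e0; exists N => n Nn; apply: NP; rewrite ler_nat.
Qed.

Lemma isF_cvgn f g : L2 mu2 f -> isF f g ->
  nrm mu2 (fun x => FT (trunc n%:R f) x - g x) @[n --> \oo] --> 0.
Proof.
move=> Lf /(isFP _ Lf).1 [Lg c]; apply: nat_eps_cvg => [n|e e0]; first exact: nrm_ge0.
by have [N NP] := c e e0; exists N => n Nn; apply: NP; rewrite ler_nat.
Qed.

Lemma popp_popp (x : plane) : popp (popp x) = x.
Proof. by case: x => a b; rewrite /popp /= !opprK. Qed.

Lemma FT_adjoint f g : cintegrable mu2 f -> cintegrable mu2 g ->
  ip mu2 (FT f) g = ip mu2 f (fun x => FT g (popp x)).
Proof.
move=> fi gi; rewrite /ip (FT_swap fi (cintegrable_conj gi)); apply: eq_cint => x.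
by rewrite (FT_conj _ gi) -/(popp (popp x)) popp_popp.
Qed.

Lemma L2_popp f : L2 mu2 f -> L2 mu2 (fun x => f (popp x)).
Proof. exact: (L2_preserving measurable_popp mu2_popp). Qed.

Lemma isF_L2 f g : isF f g -> L2 mu2 g. Proof. by case. Qed.

(** [FT_adjoint] holds for the truncations, and the inner products pass to the limit. The reflection
    comes from conjugating the kernel. *)
Lemma isF_adjoint f g f' g' : L2 mu2 f -> L2 mu2 g -> isF f f' -> isF g g' ->
  ip mu2 f' g = ip mu2 f (fun x => g' (popp x)).
Proof.
move=> Lf Lg Ff Fg; have Lf' := isF_L2 Ff; have Lg' := isF_L2 Fg.
have LT h n : L2 mu2 h -> L2 mu2 (FT (trunc n%:R h)) := @L2_FT_trunc _ _ _.
have c1 := ip_cvg (fun n => LT f n Lf) (fun n => L2_trunc n%:R Lg) Lf' Lg (isF_cvgn Lf Ff) (trunc_cvgn Lg).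
have c2 : normc (ip mu2 (trunc n%:R f) (fun x => FT (trunc n%:R g) (popp x)) -
    ip mu2 f (fun x => g' (popp x))) @[n --> \oo] --> 0.
  apply: (ip_cvg (fun n => L2_trunc n%:R Lf) (fun n => L2_popp (LT g n Lg)) Lf (L2_popp Lg') (trunc_cvgn Lf)).
  rewrite (_ : (fun n => _) = fun n : nat => nrm mu2 (fun x => FT (trunc n%:R g) x - g' x)).
    exact: isF_cvgn.
  apply/funext => n; have LB := L2B (LT g n Lg) Lg'.
  exact: (nrm_preserving measurable_popp mu2_popp LB.1).
apply: (normc_cvg_unique c1).
rewrite (_ : (fun n => _) = fun n : nat => normc (ip mu2 (trunc n%:R f) (fun x => FT (trunc n%:R g) (popp x)) -
    ip mu2 f (fun x => g' (popp x)))); first exact: c2.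
apply/funext => n; congr (normc (_ - _)).
exact: (FT_adjoint (cintegrable_trunc _ Lf) (cintegrable_trunc _ Lg)).
Qed.

Lemma ae_fst (P : R -> Prop) : {ae leb, forall t, P t} -> {ae mu2, forall x : plane, P x.1}.
Proof.
move=> [N [mN N0 PN]]; exists (N `*` setT); split.
- exact: measurableX.
- transitivity (leb N * leb setT)%E; first exact: product_measure1E.
  by rewrite (N0 : leb N = 0%E) mul0e.
- by move=> x /= nP; split => //; exact: PN.
Qed.

Lemma ae_snd (P : R -> Prop) : {ae leb, forall t, P t} -> {ae mu2, forall x : plane, P x.2}.
Proof.
move=> [N [mN N0 PN]]; exists (setT `*` N); split.
- exact: measurableX.
- transitivity (leb setT * leb N)%E; first exact: product_measure1E.
  by rewrite (N0 : leb N = 0%E) mule0.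
- by move=> x /= nP; split => //; exact: PN.
Qed.

Lemma ae_neq (a : R) : {ae leb, forall t, t != a}.
Proof.
exists [set a]; split; [exact: measurable_set1|exact: lebesgue_measure_set1|].
by move=> t /= /negP; rewrite negbK => /eqP.
Qed.

Lemma ae_neq_corners (a b c d : R) :
  {ae mu2, forall x : plane, [/\ x.1 != a, x.1 != b, x.2 != c & x.2 != d]}.
Proof.
have h1 := ae_fst (ae_neq a); have h2 := ae_fst (ae_neq b).
have h3 := ae_snd (ae_neq c); have h4 := ae_snd (ae_neq d).
by apply: filterS2 (filterI h1 h2) (filterI h3 h4) => x [? ?] [? ?].
Qed.

Lemma halfsg_indic (a b t : R) : a < b -> t != a -> t != b ->
  halfsg a b t = \1_(`[a, b]%classic : set R) t.
Proof.
move=> ab; rewrite neq_lt => /orP[ta|ta]; rewrite neq_lt => /orP[tb|tb].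
- rewrite /halfsg !ltr0_sg ?subr_lt0// subrr mul0r indicE memNset//= in_itv /=.
  by rewrite leNgt ta.
- by move: (lt_trans ta ab) => /(lt_trans tb); rewrite ltxx.
- rewrite /halfsg gtr0_sg ?subr_gt0// ltr0_sg ?subr_lt0// indicE mem_set//=.
    by rewrite opprK divff.
  by rewrite in_itv /= !ltW.
- rewrite /halfsg !gtr0_sg ?subr_gt0// subrr mul0r indicE memNset//= in_itv /=.
  by rewrite [t <= b]leNgt tb andbF.
Qed.

Lemma oc_cc_indic (a b t : R) : t != a ->
  \1_(`]a, b]%classic : set R) t = \1_(`[a, b]%classic : set R) t :> R.
Proof.
move=> ta; rewrite !indicE; congr (nat_of_bool _)%:R.
have E : (a <= t) = (a < t) by rewrite le_eqVlt eq_sym (negbTE ta).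
by apply/idP/idP; rewrite !inE /= !in_itv /= E.
Qed.

(** [FT_box] for the truncations of [f], in the limit; the endpoint values of [halfsg] sit on a null
    set. *)
Lemma isF_box f f' a b c d : L2 mu2 f -> isF f f' -> a < b -> c < d ->
  ip mu2 f' (FT (fun y => (box a b c d y)%:C)) = ip mu2 f (fun y => (box a b c d y)%:C).
Proof.
move=> Lf Ff ab cd; have Lf' := isF_L2 Ff.
have bi := cintegrable_box ab cd; have Lb := L2_box ab cd; have LFb := L2_FT bi Lb.
have cz (g : plane -> R[i]) (Lg : L2 mu2 g) : nrm mu2 (fun x => g x - g x) @[n --> \oo] --> 0.
  rewrite (_ : (fun x => g x - g x) = fun=> 0); first by rewrite nrm_0; exact: cvg_cst.
  by apply/funext => x; rewrite subrr.
have c1 := ip_cvg (fun n => L2_FT_trunc n%:R Lf) (fun=> LFb) Lf' LFb (isF_cvgn Lf Ff) (cz _ LFb).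
have c2 := ip_cvg (fun n => L2_trunc n%:R Lf) (fun=> Lb) Lf Lb (trunc_cvgn Lf) (cz _ Lb).
apply: (normc_cvg_unique c1).
rewrite (_ : (fun n => _) = fun n : nat => normc (ip mu2 (trunc n%:R f) (fun y => (box a b c d y)%:C) -
    ip mu2 f (fun y => (box a b c d y)%:C))); first exact: c2.
apply/funext => n; congr (normc (_ - _)).
rewrite (FT_box (cintegrable_trunc _ Lf) (L2_trunc _ Lf) ab cd).
have mt := cmeas_trunc n%:R Lf.1.
apply: ae_eq_cint.
- apply: cmeasM => //; apply: cmeas_real; apply: measurable_funM.
    exact: (measurableT_comp (measurable_halfsg a b) measurable_fst).
  exact: (measurableT_comp (measurable_halfsg c d) measurable_snd).
- by apply: cmeasM => //; apply: cmeas_conj; apply: cmeas_real; exact: measurable_box.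
- apply: filterS (ae_neq_corners a b c d) => x [x1 x2 x3 x4].
  by rewrite conjc_real /box !halfsg_indic.
Qed.

(** By [isF_adjoint] and [isF_box], the reflected double transform and [f] have the same inner
    product with every box, and boxes separate L^2 functions. *)
Lemma isF_inversion f f' f'' : L2 mu2 f -> isF f f' -> isF f' f'' ->
  {ae mu2, forall x, f'' (popp x) = f x}.
Proof.
move=> Lf F1 F2; have Lf' := isF_L2 F1; have Lf'' := isF_L2 F2.
have Lp := L2_popp Lf''; have LB := L2B Lp Lf.
have key a b c d : a < b -> c < d ->
    ip mu2 (fun x => f'' (popp x) - f x) (fun y => (box a b c d y)%:C) = 0.
  move=> ab cd; have bi := cintegrable_box ab cd; have Lb := L2_box ab cd.
  have LFb := L2_FT bi Lb.
  rewrite (ipBl Lp Lf Lb) -(isF_box Lf F1 ab cd) -(ip_conj LFb Lf').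
  by rewrite (isF_adjoint Lb Lf' (isF_FT bi Lb) F2) (ip_conj Lb Lp) subrr.
have h := L2_boxes_zero LB.
have h' : {ae mu2, forall x, f'' (popp x) - f x = 0}.
  apply: h => _ _ [[a b] _ <-] [[c d] _ <-] /=.
  have [ab|ab] := ltP a b; last first.
    rewrite -[RHS](cint0 mu2); apply: eq_cint => x; rewrite indicE memNset ?mul0r//=.
    rewrite in_itv /= => /andP[h1 h2]; have := lt_le_trans h1 h2.
    by rewrite ltNge ab.
  have [cd|cd] := ltP c d; last first.
    rewrite -[RHS](cint0 mu2); apply: eq_cint => x.
    suff z : \1_(`]c, d]%classic : set R) x.2 = 0 :> R by rewrite z mul0r mulr0.
    rewrite indicE memNset//= in_itv /= => /andP[h1 h2]; have := lt_le_trans h1 h2.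
    by rewrite ltNge cd.
  (* The half-open boxes of the Dynkin argument and the closed boxes of [key] differ by a null
     set. *)
  rewrite -[RHS](key a b c d ab cd); apply: ae_eq_cint.
  - have mo (u v : R) : measurable_fun setT (\1_(`]u, v]%classic : set (measurableTypeR R)) : _ -> R).
      exact: measurable_indic.
    apply: cmeasM; first by apply: cmeas_real; exact: (measurableT_comp (mo a b) measurable_fst).
    apply: cmeasM; last by case: LB.
    by apply: cmeas_real; exact: (measurableT_comp (mo c d) measurable_snd).
  - apply: cmeasM; first by case: LB.
    by apply: cmeas_conj; apply: cmeas_real; exact: measurable_box.
  - apply: filterS (ae_neq_corners a b c d) => x [x1 _ x3 _].
    by rewrite conjc_real /box !oc_cc_indic// rmorphM; ring.
by apply: filterS h' => x /eqP; rewrite subr_eq0 => /eqP.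
Qed.

(** Adjointness moves one transform across, and inversion undoes it. *)
Lemma isF_parseval f g f' g' : L2 mu2 f -> L2 mu2 g -> isF f f' -> isF g g' ->
  ip mu2 f' g' = ip mu2 f g.
Proof.
move=> Lf Lg Ff Fg; have Lg' := isF_L2 Fg; have Lf' := isF_L2 Ff.
have [g'' Fg'] := isF_exists Lg'; have Lg'' := isF_L2 Fg'.
rewrite (isF_adjoint Lf Lg' Ff Fg'); apply: ae_eq_ip.
- by case: Lf.
- by case: Lf.
- by case: (L2_popp Lg'').
- by case: Lg.
- by apply: nearW.
- exact: isF_inversion Lg Fg Fg'.
Qed.

Lemma isF_nrm f f' : L2 mu2 f -> isF f f' -> nrm mu2 f' = nrm mu2 f.
Proof.
move=> Lf Ff; have Lf' := isF_L2 Ff.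
have := isF_parseval Lf Lf Ff Ff; rewrite (ip_same Lf') (ip_same Lf) => /complexI /eqP.
by rewrite eqrXn2 ?nrm_ge0// => /eqP.
Qed.

Lemma isF_ae f f' g g' : L2 mu2 f -> L2 mu2 g -> isF f f' -> isF g g' ->
  {ae mu2, forall x, f x = g x} -> {ae mu2, forall x, f' x = g' x}.
Proof.
move=> Lf Lg Ff Fg fg; have Lf' := isF_L2 Ff; have Lg' := isF_L2 Fg.
apply: nrm0P => //; have LB := L2B Lf Lg.
rewrite (isF_nrm LB (isFB Lf Lg Ff Fg)) -[RHS](nrm_0 mu2); apply: ae_eq_nrm.
- by case: LB.
- exact: cmeas_cst.
- by apply: filterS fg => x ->; rewrite subrr.
Qed.

Lemma L2_fourier f : L2 mu2 f -> L2 mu2 (fourier f).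
Proof. by move=> Lf; have := isF_L2 (fourierP Lf). Qed.

Lemma L2_inv_fourier f : L2 mu2 f -> L2 mu2 (inv_fourier f).
Proof. by move=> Lf; exact: L2_popp (L2_fourier Lf). Qed.

Lemma isF_inv_fourier f : L2 mu2 f -> isF (inv_fourier f) (fun x => fourier (fourier f) (popp x)).
Proof. by move=> Lf; exact: isF_popp (L2_fourier Lf) (fourierP (L2_fourier Lf)). Qed.

Lemma fourier_inv_fourier f : L2 mu2 f -> {ae mu2, forall x, fourier (inv_fourier f) x = f x}.
Proof.
move=> Lf; have Li := L2_inv_fourier Lf.
have h1 := isF_unique Li (fourierP Li) (isF_inv_fourier Lf).
have h2 := isF_inversion Lf (fourierP Lf) (fourierP (L2_fourier Lf)).
by apply: filterS2 h1 h2 => x -> ->.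
Qed.

Lemma fourier_parseval f g : L2 mu2 f -> L2 mu2 g ->
  ip mu2 (fourier f) (fourier g) = ip mu2 f g.
Proof. by move=> Lf Lg; exact: isF_parseval Lf Lg (fourierP Lf) (fourierP Lg). Qed.

Lemma fourier_adjoint f g : L2 mu2 f -> L2 mu2 g ->
  ip mu2 (fourier f) g = ip mu2 f (inv_fourier g).
Proof. by move=> Lf Lg; exact: isF_adjoint Lf Lg (fourierP Lf) (fourierP Lg). Qed.

Lemma nrm_fourier f : L2 mu2 f -> nrm mu2 (fourier f) = nrm mu2 f.
Proof. by move=> Lf; exact: isF_nrm Lf (fourierP Lf). Qed.

Lemma ae_fourier f g : L2 mu2 f -> L2 mu2 g -> {ae mu2, forall x, f x = g x} ->
  {ae mu2, forall x, fourier f x = fourier g x}.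
Proof. by move=> Lf Lg; exact: isF_ae Lf Lg (fourierP Lf) (fourierP Lg). Qed.

Lemma fourierB f g : L2 mu2 f -> L2 mu2 g ->
  {ae mu2, forall x, fourier (fun y => f y - g y) x = fourier f x - fourier g x}.
Proof.
move=> Lf Lg; have LB := L2B Lf Lg.
exact: isF_unique LB (fourierP LB) (isFB Lf Lg (fourierP Lf) (fourierP Lg)).
Qed.

Lemma fourier_translation f z : L2 mu2 f ->
  {ae mu2, forall xi, fourier (fun x => cis (dot x z) * f x) xi = fourier f (psub xi z)}.
Proof.
move=> Lf; have Lm : L2 mu2 (fun x => cis (dot x z) * f x).
  apply: (@L2Ml _ _ _ _ _ 1) => // [|x]; last by rewrite normc_cis.
  by apply: cmeas_cis; exact: measurable_dotr.
exact: isF_unique Lm (fourierP Lm) (isF_translation z Lf (fourierP Lf)).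
Qed.

Lemma FT_trunc_pointwise f xi : cintegrable mu2 f ->
  normc (FT (trunc n%:R f) xi - FT f xi) @[n --> \oo] --> 0.
Proof.
move=> fi; have [mf _] := fi.
have c := @cint_dominated_cvg _ _ _ mu2 (fun n x => cis (- dot x xi) * trunc n%:R f x)
  (fun x => cis (- dot x xi) * f x) (fun x => normc (f x)).
have mc : cmeas (fun x : plane => cis (- dot x xi)).
  by apply: cmeas_cis; apply: measurableT_comp => //; exact: measurable_dotr.
have {}c : normc (cint mu2 (fun x => cis (- dot x xi) * trunc n%:R f x) -
    cint mu2 (fun x => cis (- dot x xi) * f x)) @[n --> \oo] --> 0.
  apply: c.
  - by move=> n; apply: cmeasM => //; exact: cmeas_trunc.
  - exact: cmeasM.
  - apply: nearW => x; rewrite (_ : (fun n => _) = fun n : nat => normc (trunc n%:R f x - f x)).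
      exact: trunc_pointwise.
    by apply/funext => n; rewrite -mulrBr normcM normc_cis mul1r.
  - exact: integrable_normc.
  - by move=> n x; rewrite normcM normc_cis mul1r normc_trunc_le.
rewrite (_ : (fun n => _) = fun n : nat => normc (((2 * pi)^-1)%:C : R[i]) *
    normc (cint mu2 (fun x => cis (- dot x xi) * trunc n%:R f x) -
    cint mu2 (fun x => cis (- dot x xi) * f x))).
  rewrite -[X in _ --> X](mulr0 (normc (((2 * pi)^-1)%:C : R[i]))).
  by apply: cvgM => //; exact: cvg_cst.
by apply/funext => n; rewrite /FT -mulrBr normcM.
Qed.

(** The transforms of the truncations converge to [FT f] at every point and to [g] in L^2, so
    Fatou's lemma identifies the two limits. This serves the density [|psi|^2], which is handled as
    an integrable function. *)
Lemma isF_L1 f g : cintegrable mu2 f -> isF f g -> {ae mu2, forall x, g x = FT f x}.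
Proof.
move=> fi [Lg c]; have mF := cmeas_FT fi; have [mf foo] := fi.
have ti n : cintegrable mu2 (trunc n%:R f).
  apply: (@le_cintegrable _ _ _ _ _ (fun x => normc (f x))) => //.
  - exact: cmeas_trunc.
  - exact: cmeas_normc.
  - by move=> x; exact: normc_trunc_le.
have mg : cmeas g by case: Lg.
have mB : cmeas (fun xi => FT f xi - g xi) by exact: cmeasB.
have h e : 0 < e -> (nsq mu2 (fun xi => FT f xi - g xi)%R <= (e ^+ 2)%:E)%E.
  move=> e0; have [N NP] := c e e0.
  apply: (@fatou_le _ _ _ mu2 (fun n xi => normc (FT (trunc n%:R f) xi - g xi) ^+ 2)).
  - by move=> n; apply: measurable_funX; apply: cmeas_normc; apply: cmeasB => //; exact: cmeas_FT.
  - by move=> n x; exact: sqr_ge0.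
  - apply: nearW => xi; rewrite !expr2.
    suff hh : normc (FT (trunc n%:R f) xi - g xi) @[n --> \oo] --> normc (FT f xi - g xi) by exact: cvgM.
    have := FT_trunc_pointwise xi fi => /cvgrPdist_le c'; apply/cvgrPdist_le => e' e'0.
    apply: filterS (c' _ e'0) => n; rewrite sub0r normrN ger0_norm; last exact: normc_ge0.
    apply: le_trans; rewrite distrC; apply: le_trans (ler_dist_normc _ _) _.
    by rewrite opprB addrA subrK.
  - by apply: measurable_funX; exact: cmeas_normc.
  - by move=> x; exact: sqr_ge0.
  - by exists N => // n /= Nn; apply: NP; rewrite ler_nat.
have LB : L2 mu2 (fun xi => FT f xi - g xi).
  by split => //; apply: le_lt_trans (h 1 ltr01) _; rewrite ltry.
have n0 : nrm mu2 (fun xi => FT f xi - g xi) = 0.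
  apply/eqP; rewrite eq_le nrm_ge0 andbT; apply: le_epsilon_nrm => e e0; rewrite add0r.
  by rewrite -(nsq_leE LB (ltW e0)); exact: h.
apply: filterS (nrm_eq0_ae LB n0) => x /eqP.
by rewrite subr_eq0 => /eqP ->.
Qed.

End Plancherel.

(** * Schur test for the kernel of the resolvent *)

Section Schur1.
Context {R : realType}.
Local Notation leb := (@lebesgue_measure R).

(** All weights of the Schur test are powers of the fourth root of [1 + |x|], which makes their
    comparison polynomial arithmetic. *)
Definition root4 (x : R) : R := Num.sqrt (Num.sqrt (1 + `|x|)).

Lemma root4_ge1 x : 1 <= root4 x.
Proof.
have h1 : 1 <= 1 + `|x| by rewrite lerDl.
have h2 : 1 <= Num.sqrt (1 + `|x|) by rewrite -[leLHS]sqrtr1; exact: ler_wsqrtr.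
by rewrite /root4 -[leLHS]sqrtr1; exact: ler_wsqrtr.
Qed.

Lemma root4_gt0 x : 0 < root4 x.
Proof. exact: lt_le_trans ltr01 (root4_ge1 x). Qed.

Lemma root4_sq x : root4 x ^+ 2 = Num.sqrt (1 + `|x|).
Proof. by rewrite sqr_sqrtr ?sqrtr_ge0. Qed.

Lemma root4_X4 x : root4 x ^+ 4 = 1 + `|x|.
Proof. by rewrite (exprM _ 2 2) root4_sq sqr_sqrtr// addr_ge0. Qed.

Lemma root4N x : root4 (- x) = root4 x.
Proof. by rewrite /root4 normrN. Qed.

Lemma continuous_root4 : continuous root4.
Proof.
move=> x; apply: continuous_cvg; first exact: sqrt_continuous.
apply: continuous_cvg; first exact: sqrt_continuous.
by apply: cvgD; [exact: cvg_cst|exact: norm_continuous].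
Qed.

Lemma is_derive_root4 (x : R) : 0 <= x ->
  is_derive x 1 (fun y => Num.sqrt (Num.sqrt (1 + y))) (4^-1 * (root4 x ^+ 3)^-1).
Proof.
move=> x0; have x1 : 0 < 1 + x by rewrite ltr_wpDr.
have s1 : 0 < Num.sqrt (1 + x) by rewrite sqrtr_gt0.
have d0 : is_derive x 1 (fun y : R => 1 + y) 1 by apply: is_derive_eq; rewrite add0r mulr1.
have d1 := @is_derive1_comp _ (@Num.sqrt R) (fun y => 1 + y) x _ _ (is_derive1_sqrt x1) d0.
have d2 := @is_derive1_comp _ (@Num.sqrt R) _ x _ _ (is_derive1_sqrt s1) d1.
apply: (is_derive_eq d2); have := root4_sq x; have := root4_gt0 x.
rewrite /root4 ger0_norm//; set v := Num.sqrt (Num.sqrt _) => v0 <-.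
by field; rewrite gt_eqF.
Qed.

(** Chosen for its primitive: for [x >= 0] and [v = root4 x] one has [dv/dx = 1 / (4 v^3)], so
    [bump r] is the derivative of [(4 / r) atan (v / r)]. *)
Definition bump (r x : R) : R := (root4 x ^+ 3 * (r ^+ 2 + root4 x ^+ 2))^-1.

Lemma bump_den r x : 0 < root4 x ^+ 3 * (r ^+ 2 + root4 x ^+ 2).
Proof.
have h := root4_gt0 x; rewrite mulr_gt0 ?exprn_gt0//.
by rewrite ltr_wpDl ?sqr_ge0 ?exprn_gt0.
Qed.

Lemma bump_ge0 r x : 0 <= bump r x.
Proof. by rewrite invr_ge0; exact: ltW (bump_den r x). Qed.

Lemma continuous_bump r : continuous (bump r).
Proof.
move=> x; apply: cvgV; first by rewrite gt_eqF// bump_den.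
have c n : (fun y => root4 y ^+ n) @ x --> root4 x ^+ n.
  exact: (cvg_comp _ _ (@continuous_root4 x) (@exprn_continuous R n (root4 x))).
by apply: cvgM => //; apply: cvgD => //; exact: cvg_cst.
Qed.

Lemma measurable_bump r : measurable_fun setT (bump r).
Proof. by apply: continuous_measurable_fun; exact: continuous_bump. Qed.

Lemma integral_bump_le r : 0 < r -> (\int[leb]_x (bump r x)%:E <= (4 * pi / r)%:E)%E.
Proof.
move=> r0; pose F (y : R) := 4 / r * atan (r^-1 * Num.sqrt (Num.sqrt (1 + y))).
have -> : (\int[leb]_x (bump r x)%:E = (2 * (4 / r * (pi / 2) - F 0))%:E)%E.
  apply: (@integral_even_FTC _ _ (bump r) F).
  - exact: continuous_bump.
  - exact: bump_ge0.
  - by move=> x; rewrite /bump root4N.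
  - by [].
  - exact: continuous_bump.
  - move=> x x0; have d1 := is_derive_root4 x0.
    pose w (y : R) := Num.sqrt (Num.sqrt (1 + y)).
    have d2 : is_derive x 1 (fun y => r^-1 * w y) (r^-1 * (4^-1 * (root4 x ^+ 3)^-1)).
      exact: (@is_deriveZ _ _ _ w r^-1 x 1 _ d1).
    have d3 := @is_derive1_comp _ (@atan R) (fun y => r^-1 * w y) x _ _ (is_derive1_atan _) d2.
    have d4 : is_derive x 1 F
        ((4 / r) * ((1 + (r^-1 * w x) ^+ 2)^-1 * (r^-1 * (4^-1 * (root4 x ^+ 3)^-1)))).
      exact: (@is_deriveZ _ _ _ _ (4 / r) x 1 _ d3).
    apply: (is_derive_eq d4).
    have -> : w x = root4 x by rewrite /w /root4 ger0_norm.
    have v0 := root4_gt0 x; rewrite /bump; move: (root4 x) v0 => v v0.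
    have h1 : r ^+ 2 + v ^+ 2 != 0 by rewrite gt_eqF// ltr_wpDl ?sqr_ge0 ?exprn_gt0.
    by field; rewrite ?(gt_eqF r0) ?(gt_eqF v0) ?h1.
  - apply: cvgM; first exact: cvg_cst.
    apply: (@cvg_comp _ _ _ (fun y => r^-1 * Num.sqrt (Num.sqrt (1 + y))) (@atan R) _ (pinfty_nbhs R));
      last exact: cvgy_atan.
    apply: gt0_cvgMry; first by rewrite invr_gt0.
    apply/cvgryPge => A; exists ((A ^+ 2) ^+ 2); split; first by rewrite num_real.
    move=> y hy; have y0 : 0 <= y by apply: le_trans (ltW hy); rewrite sqr_ge0.
    rewrite (le_trans (ler_norm A))// -sqrtr_sqr ler_sqrt ?sqrtr_ge0//.
    rewrite -[leLHS](@ger0_norm _ (A ^+ 2)) ?sqr_ge0// -sqrtr_sqr ler_sqrt; last by rewrite addr_ge0.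
    by rewrite (le_trans (ltW hy))// lerDr.
rewrite lee_fin /F addr0 !sqrtr1 mulr1.
have h : 0 <= atan r^-1.
  by rewrite -(@atan0 R) le_atan// invr_ge0 ltW.
have h2 : 0 <= 4 / r * atan r^-1 by rewrite mulr_ge0// divr_ge0// ltW.
have -> : 4 * pi / r = 2 * (4 / r * (pi / 2)) by field; rewrite gt_eqF.
by rewrite ler_pM2l// gerBl.
Qed.

Definition kap (x : R) : R := (root4 x ^+ 2)^-1.

Lemma kap_ge0 x : 0 <= kap x.
Proof. by rewrite invr_ge0 sqr_ge0. Qed.

Lemma measurable_root4 : measurable_fun setT root4.
Proof. by apply: continuous_measurable_fun; exact: continuous_root4. Qed.

Lemma measurable_kap : measurable_fun setT kap.
Proof.
apply: continuous_measurable_fun => x; apply: cvgV.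
  by rewrite gt_eqF// exprn_gt0// root4_gt0.
exact: (cvg_comp _ _ (@continuous_root4 x) (@exprn_continuous R 2 (root4 x))).
Qed.

Lemma measurable_root4V3 : measurable_fun setT (fun x => (root4 x ^+ 3)^-1).
Proof.
apply: continuous_measurable_fun => x; apply: cvgV.
  by rewrite gt_eqF// exprn_gt0// root4_gt0.
exact: (cvg_comp _ _ (@continuous_root4 x) (@exprn_continuous R 3 (root4 x))).
Qed.

(* With [a], [c], [r] the fourth roots of [1 + |x - y|], [1 + |y|], [1 + |x|],
   the larger of [a], [c] is comparable with [r] from above. *)
Lemma kap_bump_le (x y : R) :
  kap (x - y) * (root4 y ^+ 3)^-1 <= 3 * (bump (root4 x) (x - y) + bump (root4 x) y).
Proof.
have hr : root4 x ^+ 4 <= root4 (x - y) ^+ 4 + root4 y ^+ 4.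
  rewrite !root4_X4; have := ler_normD (x - y) y; rewrite subrK; lra.
rewrite /kap /bump.
move: (root4_gt0 x) (root4_gt0 y) (root4_gt0 (x - y)) hr.
move: (root4 x) (root4 y) (root4 (x - y)) => r c a r0 c0 a0 hr.
have d1 : 0 < r ^+ 2 + a ^+ 2 by rewrite ltr_wpDl ?sqr_ge0 ?exprn_gt0.
have d2 : 0 < r ^+ 2 + c ^+ 2 by rewrite ltr_wpDl ?sqr_ge0 ?exprn_gt0.
have B1 : 0 <= (a ^+ 3 * (r ^+ 2 + a ^+ 2))^-1.
  by rewrite invr_ge0 mulr_ge0 ?exprn_ge0 ?(ltW a0) ?(ltW d1).
have B2 : 0 <= (c ^+ 3 * (r ^+ 2 + c ^+ 2))^-1.
  by rewrite invr_ge0 mulr_ge0 ?exprn_ge0 ?(ltW c0) ?(ltW d2).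
have sq (u v : R) : 0 < u -> 0 < v -> u <= v -> r ^+ 4 <= v ^+ 4 + u ^+ 4 -> r ^+ 2 <= 2 * v ^+ 2.
  move=> u0 v0 uv h.
  have u4 : u ^+ 4 <= v ^+ 4 by rewrite lerXn2r ?nnegrE ?(ltW u0) ?(ltW v0).
  have h1 : (r ^+ 2) ^+ 2 <= (2 * v ^+ 2) ^+ 2.
    have -> : (r ^+ 2) ^+ 2 = r ^+ 4 by ring.
    have -> : (2 * v ^+ 2) ^+ 2 = 4 * v ^+ 4 by ring.
    have := exprn_ge0 4 (ltW v0); lra.
  have v2 : 0 <= 2 * v ^+ 2 by rewrite mulr_ge0 ?sqr_ge0.
  by rewrite -(ler_sqrE (sqr_ge0 r) v2).
have [ca|/ltW ac] := leP c a.
  have r2 := sq c a c0 a0 ca hr.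
  have c2 : c ^+ 2 <= a ^+ 2 by rewrite lerXn2r ?nnegrE ?(ltW a0) ?(ltW c0).
  apply: (@le_trans _ _ (3 * (c ^+ 3 * (r ^+ 2 + c ^+ 2))^-1)); last by rewrite ler_pM2l// lerDr.
  rewrite ler_pdivlMr; last by rewrite mulr_gt0 ?exprn_gt0.
  have -> : (a ^+ 2)^-1 * (c ^+ 3)^-1 * (c ^+ 3 * (r ^+ 2 + c ^+ 2)) = (r ^+ 2 + c ^+ 2) / a ^+ 2.
    by field; rewrite !gt_eqF.
  by rewrite ler_pdivrMr ?exprn_gt0//; lra.
have r2 : r ^+ 2 <= 2 * c ^+ 2 by apply: (sq a c) => //; rewrite addrC.
have a2 : a ^+ 2 <= c ^+ 2 by rewrite lerXn2r ?nnegrE ?(ltW a0) ?(ltW c0).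
apply: (@le_trans _ _ (3 * (a ^+ 3 * (r ^+ 2 + a ^+ 2))^-1)); last by rewrite ler_pM2l// lerDl.
rewrite ler_pdivlMr; last by rewrite mulr_gt0 ?exprn_gt0.
have -> : (a ^+ 2)^-1 * (c ^+ 3)^-1 * (a ^+ 3 * (r ^+ 2 + a ^+ 2)) = (a * (r ^+ 2 + a ^+ 2)) / c ^+ 3.
  by field; rewrite !gt_eqF.
rewrite ler_pdivrMr ?exprn_gt0//.
apply: (@le_trans _ _ (c * (3 * c ^+ 2))); last by rewrite exprS mulrCA.
by apply: ler_pM; [exact: ltW a0|exact: ltW d1|exact: ac|lra].
Qed.

(** Each of the two bumps integrates to at most [4 pi / root4 x], and [kap_bump_le] contributes the
    factor 3; hence [24 pi]. *)
Lemma integral_kap_le (x : R) :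
  (\int[leb]_y (kap (x - y) * (root4 y ^+ 3)^-1)%:E <= (24 * pi / root4 x)%:E)%E.
Proof.
have r0 := root4_gt0 x.
have mb := measurable_bump (root4 x).
have mN : measurable_fun setT (fun y : measurableTypeR R => -1 * y + x : measurableTypeR R) := measurable_affine (-1) x.
have muN A : measurable A -> leb ((fun y : measurableTypeR R => -1 * y + x : measurableTypeR R) @^-1` A) = leb A.
  by move=> mA; rewrite lebesgue_measure_affine// !inE eqxx orbT.
have E y : x - y = -1 * y + x by rewrite mulN1r addrC.
have mb2 : measurable_fun setT (fun y : measurableTypeR R => bump (root4 x) (x - y)).
  rewrite (_ : (fun y => _) = bump (root4 x) \o (fun y => -1 * y + x)).
    exact: (measurableT_comp mb mN).
  by apply/funext => y /=; rewrite E.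
apply: (@le_trans _ _ (\int[leb]_y (3%:E * ((bump (root4 x) (x - y))%:E + (bump (root4 x) y)%:E)))%E).
  apply: ge0_le_integral => //.
  - by move=> y _; rewrite lee_fin mulr_ge0 ?kap_ge0// invr_ge0 exprn_ge0// ltW// root4_gt0.
  - apply/measurable_EFinP; apply: measurable_funM; last exact: measurable_root4V3.
    rewrite (_ : (fun y => _) = kap \o (fun y : measurableTypeR R => -1 * y + x)).
      exact: (measurableT_comp measurable_kap mN).
    by apply/funext => y /=; rewrite E.
  - by apply: measurable_funeM; apply: emeasurable_funD; exact/measurable_EFinP.
  - by move=> y _; rewrite -EFinD -EFinM lee_fin kap_bump_le.
have b0 y : (0 <= (bump (root4 x) y)%:E)%E by rewrite lee_fin bump_ge0.
rewrite ge0_integralZl_EFin//; last 2 first.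
- by move=> y _; rewrite adde_ge0.
- by apply: emeasurable_funD; exact/measurable_EFinP.
rewrite ge0_integralD//; last 2 first.
- exact/measurable_EFinP.
- exact/measurable_EFinP.
have -> : (\int[leb]_y (bump (root4 x) (x - y))%:E = \int[leb]_y (bump (root4 x) y)%:E)%E.
  have mbE : measurable_fun setT (fun y => (bump (root4 x) y)%:E) by exact/measurable_EFinP.
  rewrite -[RHS](ge0_integral_preserving mN muN mbE b0).
  by apply: eq_integral => y _; rewrite E.
have h := integral_bump_le r0.
have -> : 24 * pi / root4 x = 3 * (4 * pi / root4 x + 4 * pi / root4 x) by field; rewrite gt_eqF.
rewrite EFinM; apply: lee_wpmul2l; first by rewrite lee_fin.
by rewrite EFinD; apply: leeD.
Qed.

End Schur1.

Section Schur2.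
Context {R : realType}.
Local Notation leb := (@lebesgue_measure R).
Local Notation plane := (@plane R).

(** A product of two factors [(1 + |t|)^(-1/2)], so that the Schur test splits into the coordinates.
    Up to a constant it dominates [|z| / (b + |z|^2)]. *)
Definition kap2 (z : plane) : R := kap z.1 * kap z.2.
(** The exponent is 3/4 in each coordinate. The kernel integrated against the inverse weight is then
    of order [1 / (root4 x.1 * root4 x.2)], which is the inverse weight at [x] times
    [sqrt ((1 + |x.1|) (1 + |x.2|))], and the latter is of the order of [lam x] at most. *)
Definition schur_weight (z : plane) : R := root4 z.1 ^+ 3 * root4 z.2 ^+ 3.
Definition lam (xi : plane) : R := Num.sqrt (1 + dot xi xi).
Definition norm1 (z : plane) : R := `|z.1| + `|z.2|.
(** One [24 pi] for each coordinate, and 2 from [root4_lam_le]. *)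
Definition schurC : R := 2 * (24 * pi) ^+ 2.

Lemma schurC_ge0 : 0 <= schurC.
Proof. by rewrite mulr_ge0// sqr_ge0. Qed.

Lemma dot_ge0 (x : plane) : 0 <= dot x x.
Proof. by rewrite /dot addr_ge0// -expr2 sqr_ge0. Qed.

Lemma lam_sq xi : lam xi ^+ 2 = 1 + dot xi xi.
Proof. by rewrite sqr_sqrtr// addr_ge0// dot_ge0. Qed.

Lemma lam_ge1 xi : 1 <= lam xi.
Proof. by rewrite -[leLHS]sqrtr1; apply: ler_wsqrtr; rewrite lerDl dot_ge0. Qed.

Lemma lam_ge0 xi : 0 <= lam xi. Proof. exact: le_trans ler01 (lam_ge1 xi). Qed.

Lemma measurable_lam : measurable_fun setT lam.
Proof.
apply: (@measurableT_comp _ _ _ _ _ _ (@Num.sqrt R)).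
  by apply: continuous_measurable_fun; exact: sqrt_continuous.
by apply: measurable_funD => //; exact: measurable_sqdot.
Qed.

Lemma measurable_norm1 : measurable_fun setT norm1.
Proof.
apply: measurable_funD.
  exact: (measurableT_comp (@normr_measurable R setT) measurable_fst).
exact: (measurableT_comp (@normr_measurable R setT) measurable_snd).
Qed.

Lemma kap2_ge0 z : 0 <= kap2 z. Proof. by rewrite mulr_ge0 ?kap_ge0. Qed.

Lemma schur_weight_gt0 z : 0 < schur_weight z.
Proof. by rewrite mulr_gt0 ?exprn_gt0 ?root4_gt0. Qed.

Lemma measurable_kap2 : measurable_fun setT kap2.
Proof.
apply: measurable_funM.
  exact: (measurableT_comp measurable_kap measurable_fst).
exact: (measurableT_comp measurable_kap measurable_snd).
Qed.

Lemma measurable_schur_weight : measurable_fun setT schur_weight.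
Proof.
apply: measurable_funM; apply: measurable_funX.
  exact: (measurableT_comp measurable_root4 measurable_fst).
exact: (measurableT_comp measurable_root4 measurable_snd).
Qed.

Lemma schur_weightV z : (schur_weight z)^-1 = (root4 z.1 ^+ 3)^-1 * (root4 z.2 ^+ 3)^-1.
Proof. by rewrite invfM. Qed.

Lemma measurable_schur_weightV : measurable_fun setT (fun z => (schur_weight z)^-1).
Proof.
under eq_fun do rewrite schur_weightV; apply: measurable_funM.
  exact: (measurableT_comp measurable_root4V3 measurable_fst).
exact: (measurableT_comp measurable_root4V3 measurable_snd).
Qed.

Lemma kap2N (x y : plane) : kap2 (psub x y) = kap2 (psub y x).
Proof. by rewrite /kap2 /kap /= -root4N opprB -(root4N (x.2 - y.2)) opprB. Qed.

Lemma integral_kap2_le (x : plane) :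
  (\int[mu2]_y (kap2 (psub x y) * (schur_weight y)^-1)%:E <=
    ((24 * pi) ^+ 2 / (root4 x.1 * root4 x.2))%:E)%E.
Proof.
pose v (t y : R) := kap (t - y) * (root4 y ^+ 3)^-1.
have v0 t y : 0 <= v t y.
  by rewrite mulr_ge0 ?kap_ge0// invr_ge0 exprn_ge0// ltW// root4_gt0.
have mv t : measurable_fun setT (v t : measurableTypeR R -> R).
  apply: measurable_funM; last exact: measurable_root4V3.
  rewrite (_ : (fun y => _) = kap \o (fun y : measurableTypeR R => -1 * y + t)).
    exact: (measurableT_comp measurable_kap (measurable_affine (-1) t)).
  by apply/funext => y /=; rewrite mulN1r addrC.
have -> : (\int[mu2]_y (kap2 (psub x y) * (schur_weight y)^-1)%:E =
    \int[mu2]_y (v x.1 y.1 * v x.2 y.2)%:E)%E.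
  apply: eq_integral => y _; congr EFin; rewrite schur_weightV /v /kap2 /psub /=.
  by rewrite mulrACA.
have -> := ge0_integral_tensor leb leb (mv x.1) (mv x.2) (v0 x.1) (v0 x.2).
have -> : (24 * pi) ^+ 2 / (root4 x.1 * root4 x.2) = (24 * pi / root4 x.1) * (24 * pi / root4 x.2).
  by field; rewrite !gt_eqF ?root4_gt0.
rewrite EFinM; apply: lee_pmul; try exact: integral_kap_le;
  by apply: integral_ge0 => y _; rewrite lee_fin.
Qed.

(** After squaring this reads [(1 + |x.1|) (1 + |x.2|) <= 4 (1 + |x|^2)]. *)
Lemma root4_lam_le (x : plane) : root4 x.1 ^+ 2 * root4 x.2 ^+ 2 <= 2 * lam x.
Proof.
have l0 := lam_ge0 x.
have h0 : 0 <= root4 x.1 ^+ 2 * root4 x.2 ^+ 2 by rewrite mulr_ge0 ?sqr_ge0.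
have h1 : 0 <= 2 * lam x by rewrite mulr_ge0.
rewrite -(ler_sqrE h0 h1).
have -> : (root4 x.1 ^+ 2 * root4 x.2 ^+ 2) ^+ 2 = root4 x.1 ^+ 4 * root4 x.2 ^+ 4 by ring.
have -> : (2 * lam x) ^+ 2 = 4 * lam x ^+ 2 by ring.
rewrite !root4_X4 lam_sq /dot.
have e1 : x.1 * x.1 = `|x.1| ^+ 2 by rewrite real_normK ?num_real.
have e2 : x.2 * x.2 = `|x.2| ^+ 2 by rewrite real_normK ?num_real.
rewrite e1 e2; move: (normr_ge0 x.1) (normr_ge0 x.2).
move: (`|x.1|) (`|x.2|) => a c a0 c0.
have := sqr_ge0 (a - 1); have := sqr_ge0 (c - 1); have := sqr_ge0 (a - c); nra.
Qed.

Lemma schur_inner (x : plane) :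
  (\int[mu2]_y (kap2 (psub x y) * (schur_weight y)^-1)%:E <=
    (schurC * lam x / schur_weight x)%:E)%E.
Proof.
apply: le_trans (integral_kap2_le x) _; rewrite lee_fin.
have r1 := root4_gt0 x.1; have r2 := root4_gt0 x.2.
rewrite ler_pdivlMr ?schur_weight_gt0//.
have -> : (24 * pi) ^+ 2 / (root4 x.1 * root4 x.2) * schur_weight x =
    (24 * pi) ^+ 2 * (root4 x.1 ^+ 2 * root4 x.2 ^+ 2).
  by rewrite /schur_weight; field; rewrite !gt_eqF.
have -> : schurC * lam x = (24 * pi) ^+ 2 * (2 * lam x) by rewrite /schurC; ring.
by rewrite ler_wpM2l ?sqr_ge0 ?root4_lam_le.
Qed.

(** Schur's test: with [p], [q] the weights at [x], [y], [U x U y] is at most half of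
    [U x ^2 p / q + U y ^2 q / p]. The kernel is symmetric, so both terms have the same integral,
    and [schur_inner] bounds the inner integral of the first. *)
Lemma schur (U : plane -> R) : measurable_fun setT U -> (forall x, 0 <= U x) ->
  (\int[mu2]_x \int[mu2]_y (kap2 (psub x y) * (U x * U y))%:E <=
   schurC%:E * \int[mu2]_x (lam x * U x ^+ 2)%:E)%E.
Proof.
move=> mU U0.
have mU1 : measurable_fun setT (fun p : plane * plane => U p.1).
  exact: (measurableT_comp mU measurable_fst).
have mU2 : measurable_fun setT (fun p : plane * plane => U p.2).
  exact: (measurableT_comp mU measurable_snd).
have mk : measurable_fun setT (fun p : plane * plane => kap2 (psub p.1 p.2)).
  exact: (measurableT_comp measurable_kap2 measurable_psub).
have mw1 : measurable_fun setT (fun p : plane * plane => schur_weight p.1).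
  exact: (measurableT_comp measurable_schur_weight measurable_fst).
have mw2 : measurable_fun setT (fun p : plane * plane => schur_weight p.2).
  exact: (measurableT_comp measurable_schur_weight measurable_snd).
have mv1 : measurable_fun setT (fun p : plane * plane => (schur_weight p.1)^-1).
  exact: (measurableT_comp measurable_schur_weightV measurable_fst).
have mv2 : measurable_fun setT (fun p : plane * plane => (schur_weight p.2)^-1).
  exact: (measurableT_comp measurable_schur_weightV measurable_snd).
pose A (p : plane * plane) := kap2 (psub p.1 p.2) * (U p.1 ^+ 2 * (schur_weight p.1 * (schur_weight p.2)^-1)).
pose B (p : plane * plane) := kap2 (psub p.1 p.2) * (U p.2 ^+ 2 * (schur_weight p.2 * (schur_weight p.1)^-1)).
have w0 x : 0 <= (schur_weight x)^-1 by rewrite invr_ge0; exact: ltW (schur_weight_gt0 x).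
have A0 p : (0 <= (A p)%:E)%E.
  rewrite lee_fin; apply: mulr_ge0; first exact: kap2_ge0.
  apply: mulr_ge0; first exact: sqr_ge0.
  by apply: mulr_ge0; [exact: ltW (schur_weight_gt0 _)|exact: w0].
have B0 p : (0 <= (B p)%:E)%E.
  rewrite lee_fin; apply: mulr_ge0; first exact: kap2_ge0.
  apply: mulr_ge0; first exact: sqr_ge0.
  by apply: mulr_ge0; [exact: ltW (schur_weight_gt0 _)|exact: w0].
have mA : measurable_fun setT (fun p => (A p)%:E).
  apply/measurable_EFinP; apply: measurable_funM => //.
  by apply: measurable_funM; [exact: measurable_funX|exact: measurable_funM].
have mB : measurable_fun setT (fun p => (B p)%:E).
  apply/measurable_EFinP; apply: measurable_funM => //.
  by apply: measurable_funM; [exact: measurable_funX|exact: measurable_funM].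
have mC : measurable_fun setT (fun p : plane * plane => (kap2 (psub p.1 p.2) * (U p.1 * U p.2))%:E).
  by apply/measurable_EFinP; apply: measurable_funM => //; exact: measurable_funM.
have C0 (p : plane * plane) : (0 <= (kap2 (psub p.1 p.2) * (U p.1 * U p.2))%:E)%E.
  by rewrite lee_fin; apply: mulr_ge0; [exact: kap2_ge0|exact: mulr_ge0].
have E1 : (\int[mu2]_x \int[mu2]_y (A (x, y))%:E = \int[(mu2 \x mu2)%E]_p (A p)%:E)%E.
  by rewrite (fubini_tonelli1 (m1 := mu2) (m2 := mu2) _ mA A0).
have E2 : (\int[(mu2 \x mu2)%E]_p (B p)%:E = \int[(mu2 \x mu2)%E]_p (A p)%:E)%E.
  rewrite (fubini_tonelli2 (m1 := mu2) (m2 := mu2) _ mB B0) -E1.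
  apply: eq_integral => y _; apply: eq_integral => x _; congr EFin.
  by rewrite /A /B /= kap2N.
have E3 : (\int[mu2]_x \int[mu2]_y (kap2 (psub x y) * (U x * U y))%:E <=
    \int[(mu2 \x mu2)%E]_p (A p)%:E)%E.
  rewrite -(fubini_tonelli1 (m1 := mu2) (m2 := mu2) _ mC C0).
  apply: (@le_trans _ _ (\int[(mu2 \x mu2)%E]_p ((2^-1)%:E * ((A p)%:E + (B p)%:E)))%E).
    apply: (ge0_le_integral _ measurableT (fun p _ => C0 p) mC).
    - by apply: measurable_funeM; exact: emeasurable_funD.
    - move=> [x y] _; rewrite -EFinD -EFinM lee_fin /A /B /=.
      have := schur_weight_gt0 x; have := schur_weight_gt0 y; have := kap2_ge0 (psub x y).
      move: (schur_weight x) (schur_weight y) (kap2 _) (U x) (U y) => p q k u v k0 q0 p0.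
      rewrite -mulrDr [leRHS]mulrCA; apply: ler_wpM2l => //.
      have -> : 2^-1 * (u ^+ 2 * (p * q^-1) + v ^+ 2 * (q * p^-1)) =
          u * v + (u * p - v * q) ^+ 2 / (2 * p * q) by field; rewrite !gt_eqF.
      rewrite lerDl; apply: divr_ge0; first exact: sqr_ge0.
      by rewrite ltW ?mulr_gt0.
  have i2 : 0 <= 2^-1 :> R by rewrite invr_ge0.
  rewrite (ge0_integralZl_EFin (mu2 \x mu2)%E measurableT (fun p _ => adde_ge0 (A0 p) (B0 p))
    (emeasurable_funD mA mB) i2).
  rewrite (ge0_integralD _ measurableT (fun p _ => A0 p) mA (fun p _ => B0 p) mB) E2.
  have : (0 <= \int[(mu2 \x mu2)%E]_p (A p)%:E)%E by apply: integral_ge0 => p _; exact: A0.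
  case: (integral _ _ _) => [r r0|_|r0]; last by [].
  - rewrite -EFinD -EFinM lee_fin.
    by have -> : 2^-1 * (r + r) = r by field.
  - by rewrite leey.
apply: le_trans E3 _; rewrite -E1.
have L0 x : (0 <= (lam x * U x ^+ 2)%:E)%E.
  by rewrite lee_fin; apply: mulr_ge0; [exact: lam_ge0|exact: sqr_ge0].
have mL : measurable_fun setT (fun x => (lam x * U x ^+ 2)%:E).
  apply/measurable_EFinP; apply: measurable_funM; first exact: measurable_lam.
  exact: measurable_funX.
rewrite -(ge0_integralZl_EFin mu2 measurableT (fun x _ => L0 x) mL schurC_ge0).
have AI0 x : (0 <= \int[mu2]_y (A (x, y))%:E)%E by apply: integral_ge0 => y _; exact: A0.
apply: (ge0_le_integral _ measurableT (fun x _ => AI0 x)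
  (measurable_fun_fubini_tonelli_F (m2 := mu2) _ mA A0) (measurable_funeM _ mL)).
move=> x _; have Ux0 : 0 <= U x ^+ 2 * schur_weight x.
  by apply: mulr_ge0; [exact: sqr_ge0|exact: ltW (schur_weight_gt0 x)].
have -> : (\int[mu2]_y (A (x, y))%:E = (U x ^+ 2 * schur_weight x)%:E *
    \int[mu2]_y (kap2 (psub x y) * (schur_weight y)^-1)%:E)%E.
  have k0 y : (0 <= (kap2 (psub x y) * (schur_weight y)^-1)%:E)%E.
    by rewrite lee_fin; apply: mulr_ge0; [exact: kap2_ge0|exact: w0].
  have mk0 : measurable_fun setT (fun y => (kap2 (psub x y) * (schur_weight y)^-1)%:E).
    apply/measurable_EFinP; apply: measurable_funM; last exact: measurable_schur_weightV.
    exact: (measurableT_comp measurable_kap2 (measurable_psubr x)).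
  rewrite -(ge0_integralZl_EFin mu2 measurableT (fun y _ => k0 y) mk0 Ux0).
  by apply: eq_integral => y _; rewrite -EFinM; congr EFin; rewrite /A /=; ring.
apply: le_trans (lee_wpmul2l _ (schur_inner x)) _; first by rewrite lee_fin.
rewrite -!EFinM lee_fin le_eqVlt; apply/orP; left; apply/eqP.
have sw := schur_weight_gt0 x; move: (schur_weight x) sw => sw sw0.
by field; rewrite gt_eqF.
Qed.

(** In [(1 + |z|_1)^2 <= 2 + 4 |z|^2], where [|z|_1] is [norm1 z], the coefficient 4 absorbs the
    quadratic term and [2 / b] the constant. *)
Definition resC (b : R) : R := 4 + 2 / b.

Lemma resC_ge0 b : 0 < b -> 0 <= resC b.
Proof. by move=> b0; rewrite /resC addr_ge0// divr_ge0// ltW. Qed.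

(** That is, [(1 + |z.1|) (1 + |z.2|) <= (1 + |z.1| + |z.2|)^2]. *)
Lemma kap2_norm1 z : 1 <= kap2 z * (1 + norm1 z).
Proof.
rewrite /kap2 /kap -invfM mulrC.
have r1 := root4_gt0 z.1; have r2 := root4_gt0 z.2.
rewrite ler_pdivlMr ?mulr_gt0 ?exprn_gt0// mul1r.
have n0 : 0 <= 1 + norm1 z by rewrite /norm1 !addr_ge0.
have h0 : 0 <= root4 z.1 ^+ 2 * root4 z.2 ^+ 2 by rewrite mulr_ge0 ?sqr_ge0.
rewrite -(ler_sqrE h0 n0).
have -> : (root4 z.1 ^+ 2 * root4 z.2 ^+ 2) ^+ 2 = root4 z.1 ^+ 4 * root4 z.2 ^+ 4 by ring.
rewrite !root4_X4 /norm1.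
move: (normr_ge0 z.1) (normr_ge0 z.2); move: (`|z.1|) (`|z.2|) => a c a0 c0.
nra.
Qed.

(** The factor [1 + norm1 z] lets one estimate serve both for the symbol of the resolvent and for
    that symbol times [|z|]. *)
Lemma resolvent_kap2 b z : 0 < b ->
  (1 + norm1 z) * (b + dot z z)^-1 <= resC b * kap2 z.
Proof.
move=> b0; have d0 := dot_ge0 z.
have bd : 0 < b + dot z z by rewrite ltr_pwDl.
have n0 : 0 <= 1 + norm1 z by rewrite /norm1 !addr_ge0.
rewrite ler_pdivrMr//.
have h : (1 + norm1 z) ^+ 2 <= resC b * (b + dot z z).
  have -> : resC b * (b + dot z z) = 4 * b + 4 * dot z z + 2 + 2 / b * dot z z.
    by rewrite /resC; field; rewrite gt_eqF.
  have bz : 0 <= 2 / b * dot z z by rewrite mulr_ge0// divr_ge0// ltW.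
  have : norm1 z ^+ 2 <= 2 * dot z z.
    have e1 : z.1 * z.1 = `|z.1| ^+ 2 by rewrite real_normK ?num_real.
    have e2 : z.2 * z.2 = `|z.2| ^+ 2 by rewrite real_normK ?num_real.
    rewrite /norm1 /dot e1 e2; have := sqr_ge0 (`|z.1| - `|z.2|); nra.
  have := sqr_ge0 (norm1 z - 1); nra.
apply: (@le_trans _ _ (kap2 z * (1 + norm1 z) * (1 + norm1 z))).
  by rewrite ler_peMl// kap2_norm1.
rewrite -mulrA -expr2 [leRHS]mulrAC [leRHS]mulrC.
by rewrite ler_wpM2l ?kap2_ge0.
Qed.

(** Multiplication by [lam x + lam y] yields a difference of squares, and every coordinate of a
    point is at most [lam] there. *)
Lemma lam_lipschitz (x y : plane) : `|lam x - lam y| <= norm1 (psub x y).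
Proof.
have l1 := lam_ge1 x; have l2 := lam_ge1 y.
have s0 : 0 < lam x + lam y by lra.
rewrite -(ler_pM2r s0) -[in leLHS](ger0_norm (ltW s0)) -normrM.
have -> : (lam x - lam y) * (lam x + lam y) = (x.1 - y.1) * (x.1 + y.1) + (x.2 - y.2) * (x.2 + y.2).
  rewrite (_ : (lam x - lam y) * (lam x + lam y) = lam x ^+ 2 - lam y ^+ 2); last by ring.
  by rewrite !lam_sq /dot; ring.
rewrite (le_trans (ler_normD _ _))// !normrM /norm1 /= mulrDl.
have c (z : plane) : `|z.1| <= lam z /\ `|z.2| <= lam z.
  have z0 := lam_ge0 z; rewrite -!(ler_sqrE (normr_ge0 _) z0) lam_sq !real_normK ?num_real// /dot.
  by have := sqr_ge0 z.1; have := sqr_ge0 z.2; split; nra.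
have [x1 x2] := c x; have [y1 y2] := c y.
apply: lerD; rewrite ler_wpM2l//; apply: le_trans (ler_normD _ _) _; exact: lerD.
Qed.

End Schur2.

(** * The Hartree potential on the Fourier side *)

Section Correlation.
Context {R : realType}.
Local Notation plane := (@plane R).
Implicit Types (f g p q u h s : plane -> R[i]) (w : plane -> R) (z : plane).

Definition corr u z : \bar R :=
  (\int[mu2]_xi (normc (u (psub xi z)) * normc (u xi))%:E)%E.

Definition energy u : \bar R := (\int[mu2]_xi (lam xi * normc (u xi) ^+ 2)%:E)%E.

Arguments corr : simpl never.
Arguments energy : simpl never.

Lemma corr_ge0 u z : (0 <= corr u z)%E.
Proof.
by apply: integral_ge0 => xi _; rewrite lee_fin; apply: mulr_ge0; exact: normc_ge0.
Qed.

Lemma energy_ge0 u : (0 <= energy u)%E.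
Proof.
by apply: integral_ge0 => xi _; rewrite lee_fin; apply: mulr_ge0; [exact: lam_ge0|exact: sqr_ge0].
Qed.

Lemma L2_psubl u z : L2 mu2 u -> L2 mu2 (fun xi => u (psub xi z)).
Proof. by move=> Lu; exact: (L2_preserving (measurable_psubl z) (mu2_psubl z) Lu). Qed.

Lemma corr_le u z : L2 mu2 u -> (corr u z <= (nrm mu2 u ^+ 2)%:E)%E.
Proof.
move=> Lu; rewrite expr2.
rewrite -[X in (_ <= (X * _)%:E)%E](nrm_preserving (measurable_psubl z) (mu2_psubl z) Lu.1).
exact: cauchy_schwarz (L2_psubl z Lu) Lu.
Qed.

Lemma measurable_corr_kernel u : cmeas u ->
  measurable_fun setT (fun p : plane * plane => normc (u (psub p.2 p.1)) * normc (u p.2)).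
Proof.
move=> mu; have mn := cmeas_normc mu; apply: measurable_funM.
  exact: (measurableT_comp mn measurable_psub_swap).
exact: (measurableT_comp mn measurable_snd).
Qed.

Lemma measurable_corr u : cmeas u -> measurable_fun setT (corr u).
Proof.
move=> mu; have := measurable_corr_kernel mu => /measurable_EFinP mk.
apply: (measurable_fun_fubini_tonelli_F (m2 := mu2) _ mk) => p.
by rewrite lee_fin; apply: mulr_ge0; exact: normc_ge0.
Qed.

Lemma psub_psub (x y : plane) : psub x (psub x y) = y.
Proof. by case: y => a c; rewrite /psub /= !subKr. Qed.

(** For fixed [xi], the substitution [y = xi - z] turns the left-hand side into the bilinear form of
    [schur] with [U = |u|]. *)
Lemma integral_corr_le u : cmeas u ->
  (\int[mu2]_z ((kap2 z)%:E * corr u z) <= schurC%:E * energy u)%E.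
Proof.
move=> mu; have mn := cmeas_normc mu.
have n0 x : 0 <= normc (u x) by exact: normc_ge0.
apply: le_trans (schur mn n0).
pose G (p : plane * plane) := (kap2 p.1 * (normc (u (psub p.2 p.1)) * normc (u p.2)))%:E.
have G0 a : (0 <= G a)%E.
  by rewrite lee_fin; apply: mulr_ge0; [exact: kap2_ge0|exact: mulr_ge0].
have mG : measurable_fun setT G.
  apply/measurable_EFinP; apply: measurable_funM; last exact: measurable_corr_kernel.
  exact: (measurableT_comp measurable_kap2 measurable_fst).
have -> : (\int[mu2]_z ((kap2 z)%:E * corr u z) = \int[mu2]_z \int[mu2]_xi G (z, xi))%E.
  apply: eq_integral => z _.
  have mk : measurable_fun setT (fun xi => (normc (u (psub xi z)) * normc (u xi))%:E).
    apply/measurable_EFinP; apply: (measurable_funM _ mn).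
    exact: (measurableT_comp mn (measurable_psubl z)).
  rewrite -(ge0_integralZl_EFin mu2 measurableT _ mk (kap2_ge0 z)) => [|xi _].
    by apply: eq_integral => xi _; rewrite -EFinM.
  by rewrite lee_fin; exact: mulr_ge0.
rewrite -(fubini_tonelli1 (m1 := mu2) (m2 := mu2) _ mG G0).
rewrite (fubini_tonelli2 (m1 := mu2) (m2 := mu2) _ mG G0).
apply: (ge0_le_integral _ measurableT).
- by move=> x _; apply: integral_ge0 => y _; exact: G0.
- exact: (measurable_fun_fubini_tonelli_G (m1 := mu2) _ mG G0).
- have mH : measurable_fun setT (fun p : plane * plane =>
      (kap2 (psub p.1 p.2) * (normc (u p.1) * normc (u p.2)))%:E).
    apply/measurable_EFinP; apply: measurable_funM.
      exact: (measurableT_comp measurable_kap2 measurable_psub).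
    apply: measurable_funM; first exact: (measurableT_comp mn measurable_fst).
    exact: (measurableT_comp mn measurable_snd).
  apply: (measurable_fun_fubini_tonelli_F (m2 := mu2) _ mH) => p.
  by rewrite lee_fin; apply: mulr_ge0; [exact: kap2_ge0|exact: mulr_ge0].
move=> xi _; rewrite le_eqVlt; apply/orP; left; apply/eqP.
have mGx : measurable_fun setT (fun z => G (z, xi)).
  exact: (measurableT_comp mG (measurable_pair2 xi)).
have e := ge0_integral_preserving (measurable_psubr xi) (mu2_psubr xi) mGx (fun z => G0 (z, xi)).
apply: (etrans (esym e)).
by apply: eq_integral => y _; rewrite /G /= psub_psub [X in _ * X]mulrC.
Qed.

(** Evaluation at [- z] puts the factor [cis (dot x z)] on [p], which translates its transform by
    [z]; the rest is Parseval's identity. *)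
Lemma FT_product p q z : L2 mu2 p -> L2 mu2 q ->
  FT (fun x => p x * (q x)^*) (popp z) =
  ((2 * pi)^-1)%:C * ip mu2 (fun xi => fourier p (psub xi z)) (fourier q).
Proof.
move=> Lp Lq; rewrite /FT.
have mc : cmeas (fun x : plane => cis (dot x z)) by apply: cmeas_cis; exact: measurable_dotr.
have Lcp : L2 mu2 (fun x => cis (dot x z) * p x).
  by apply: (L2Ml (c := 1) mc _ Lp) => x; rewrite normc_cis.
have <- : ip mu2 (fun x => cis (dot x z) * p x) q =
    ip mu2 (fun xi => fourier p (psub xi z)) (fourier q).
  rewrite -(fourier_parseval Lcp Lq); apply: ae_eq_ip.
  - by have [] := L2_fourier Lcp.
  - by have [] := L2_psubl z (L2_fourier Lp).
  - by have [] := L2_fourier Lq.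
  - by have [] := L2_fourier Lq.
  - exact: fourier_translation.
  - exact: aeW.
apply: (congr1 (fun c => _ * c)); apply: eq_cint => x.
by rewrite mulrA; congr (cis _ * _ * _); rewrite /dot /popp /=; ring.
Qed.

End Correlation.
Arguments corr : simpl never.
Arguments energy : simpl never.

Section NormComparison.
Context {R : realType} {d} {T : measurableType d} (mu : {measure set T -> \bar R}).

Lemma nrm_le_mul (f g : T -> R[i]) c : L2 mu f -> L2 mu g -> 0 <= c ->
  (forall x, normc (f x) <= c * normc (g x)) -> nrm mu f <= c * nrm mu g.
Proof.
move=> Lf Lg c0 fg; have Lcg := L2Zl c%:C Lg.
have -> : c * nrm mu g = nrm mu (fun x => c%:C * g x).
  by rewrite (nrmZ c%:C Lg) normc_real (ger0_norm c0).
rewrite -(ler_sqrE (nrm_ge0 _ _) (nrm_ge0 _ _)) -lee_fin (nrm_sq Lf) (nrm_sq Lcg).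
apply: (ge0_le_integral _ measurableT) => [x _||| x _].
- by rewrite lee_fin; exact: sqr_ge0.
- exact: measurable_sqnormc Lf.1.
- exact: measurable_sqnormc Lcg.1.
- rewrite lee_fin (ler_sqrE (normc_ge0 _) (normc_ge0 _)) normcM normc_real (ger0_norm c0).
  exact: fg.
Qed.

End NormComparison.

(** * The commutator of a potential with a Fourier weight *)

Section Commutator.
Context {R : realType}.
Local Notation plane := (@plane R).
Implicit Types (f g p q u h s : plane -> R[i]) (w : plane -> R) (z : plane).

(** The coefficient with which the frequency [z] of a potential enters the pairing of its product
    with [w u]. *)
Definition cross u w z : R[i] := cint mu2 (fun xi => u (psub xi z) * ((w xi)%:C * u xi)^*).

Lemma L2_real_mul w c u : measurable_fun setT w -> (forall x, `|w x| <= c) -> L2 mu2 u ->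
  L2 mu2 (fun xi => (w xi)%:C * u xi).
Proof.
move=> mw wc Lu; apply: (L2Ml (c := c) (cmeas_real mw) _ Lu) => x.
by rewrite normc_real.
Qed.

Lemma cmeas_FT_popp f : cintegrable mu2 f -> cmeas (fun x => FT f (popp x)).
Proof. by move=> fi; exact: (cmeas_comp measurable_popp (cmeas_FT fi)). Qed.

(* For the transform [V] of [h], pairing [V p] with [phi] is integrating [h]
   against the correlations of the transforms of [p] and [phi]. *)
Lemma FT_multiplication h p w c : cintegrable mu2 h -> L2 mu2 p ->
  measurable_fun setT w -> (forall x, `|w x| <= c) ->
  let u := fourier p in
  let phi := inv_fourier (fun xi => (w xi)%:C * u xi) in
  [/\ cmeas (cross u w),
      forall z, ((normc (cross u w z))%:E <= (c * nrm mu2 u ^+ 2)%:E)%E &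
      ip mu2 (fun x => FT h (popp x) * p x) phi =
      ((2 * pi)^-1)%:C * cint mu2 (fun z => h z * cross u w z)].
Proof.
move=> hi Lp mw wc u phi; have Lu : L2 mu2 u := L2_fourier Lp.
have Lwu := L2_real_mul mw wc Lu; have Lphi := L2_inv_fourier Lwu.
have gi := cintegrable_ip Lp Lphi.
set g := (fun x => p x * (phi x)^*) in gi.
have tp : (2 * pi : R) != 0 by rewrite mulf_neq0 ?gt_eqF// pi_gt0.
have ge z : FT g (popp z) = ((2 * pi)^-1)%:C * cross u w z.
  rewrite FT_product//; apply: (congr1 (fun c => _ * c)).
  apply: (ae_eq_ip (L2_psubl z Lu).1 (L2_psubl z Lu).1 (L2_fourier Lphi).1 Lwu.1).
    exact: aeW.
  exact: fourier_inv_fourier.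
have ce : cross u w = fun z => (2 * pi)%:C * FT g (popp z).
  by apply/funext => z; rewrite ge mulrA -rmorphM/= mulfV// mul1r.
split.
- by rewrite ce; apply: cmeasM; [exact: cmeas_cst|exact: cmeas_FT_popp].
- move=> z; rewrite lee_fin; apply: le_trans (normc_ip_le (L2_psubl z Lu) Lwu) _.
  rewrite (nrm_preserving (measurable_psubl z) (mu2_psubl z) Lu.1).
  rewrite expr2 mulrCA; apply: ler_wpM2l; first exact: nrm_ge0.
  have c0 : 0 <= c by exact: le_trans (normr_ge0 _) (wc (0, 0)).
  apply: (nrm_le_mul Lwu Lu c0) => x; rewrite normcM normc_real.
  by apply: ler_wpM2r; [exact: normc_ge0|exact: wc].
- have -> : ip mu2 (fun x => FT h (popp x) * p x) phi =
    cint mu2 (fun x => (fun y => FT h y * g (popp y)) (popp x)).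
    by apply: eq_cint => x; rewrite /= popp_popp mulrA.
  have gpi : cintegrable mu2 (fun y => g (popp y)).
    have [mg goo] := gi; split; first exact: cmeas_comp measurable_popp mg.
    have n0 x : (0 <= (normc (g x))%:E)%E by rewrite lee_fin; exact: normc_ge0.
    have -> := ge0_integral_preserving measurable_popp mu2_popp (measurable_normcE mg) n0.
    exact: goo.
  have Hi : cintegrable mu2 (fun y => FT h y * g (popp y)).
    apply: (cintegrableMl (c := (2 * pi)^-1 * (\int[mu2]_x normc (h x))%R) (cmeas_FT hi) _ gpi).
    by move=> x; exact: normc_FT_le.
  rewrite (cint_preserving measurable_popp mu2_popp Hi) (FT_swap hi gpi).
  have cb : cintegrable mu2 (fun z => h z * cross u w z).
    have -> : (fun z => h z * cross u w z) = fun z => ((2 * pi)%:C * FT g (popp z)) * h z.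
      by apply/funext => z; rewrite ce mulrC.
    apply: (cintegrableMl (c := normc ((2 * pi)%:C) * ((2 * pi)^-1 * (\int[mu2]_x normc (g x))%R))
      _ _ hi).
      by apply: cmeasM; [exact: cmeas_cst|exact: cmeas_FT_popp].
    move=> z; rewrite normcM; apply: ler_wpM2l; first exact: normc_ge0.
    exact: normc_FT_le.
  rewrite -(cintZl _ cb); apply: eq_cint => z.
  rewrite [RHS]mulrCA -ge; apply: (congr1 (fun c => _ * c)).
  have -> : FT g (popp z) = ((2 * pi)^-1)%:C *
     cint mu2 (fun x => (fun y => cis (- dot y z) * g (popp y)) (popp x)).
    apply: (congr1 (fun c => _ * c)); apply: eq_cint => x; rewrite /= popp_popp.
    by congr (cis _ * _); rewrite /dot /popp /=; ring.
  apply: (congr1 (fun c => _ * c)); apply/esym.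
  exact: (cint_preserving measurable_popp mu2_popp (cintegrable_cis z gpi)).
Qed.

End Commutator.

Section CommutatorBound.
Context {R : realType}.
Local Notation plane := (@plane R).
Implicit Types (f g p q u h s : plane -> R[i]) (w : plane -> R) (z : plane).

Lemma cintegrable_bounded_mul h g c : cintegrable mu2 h -> cmeas g ->
  (forall z, normc (g z) <= c) -> cintegrable mu2 (fun z => h z * g z).
Proof.
move=> hi mg gc; have := cintegrableMl mg gc hi.
by rewrite (_ : (fun x => _) = fun z => h z * g z)//; apply/funext => z; rewrite mulrC.
Qed.

Lemma psub_psub_popp (x z : plane) : psub (psub x z) (popp z) = x.
Proof. by case: x => a c; rewrite /psub /popp /= !opprK !subrK. Qed.

(* Translating [xi] in the conjugate of [cross u w (popp z)] moves the weight to [xi - z]. *)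
Lemma cross_reflect u w c z : L2 mu2 u -> measurable_fun setT w -> (forall x, `|w x| <= c) ->
  (cross u w (popp z))^* =
  cint mu2 (fun xi => u (psub xi z) * ((w (psub xi z))%:C * u xi)^*).
Proof.
move=> Lu mw wc; have Lwu := L2_real_mul mw wc Lu.
have ci := cintegrable_ip (L2_psubl (popp z) Lu) Lwu.
rewrite /cross -(cint_conj ci).
apply: (etrans (esym (cint_preserving (measurable_psubl z) (mu2_psubl z) (cintegrable_conj ci)))).
apply: eq_cint => xi; rewrite /= psub_psub_popp.
by rewrite [LHS]conjcM conjcKK conjcM conjc_real mulrA [RHS]mulrC -mulrA mulrCA mulrA.
Qed.

Lemma Lipschitz_weight_diff w l x z : (forall x y, `|w x - w y| <= l * norm1 (psub x y)) ->
  `|w x - w (psub x z)| <= l * norm1 z.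
Proof. by move=> h; have := h x (psub x z); rewrite psub_psub. Qed.

(** The symmetry of [h] says that the potential is real. Conjugating [X] and reflecting [z]
    therefore preserves [h] and moves the weight from [xi] to [xi - z]. In [X - X^*], which is [2 i]
    times the imaginary part of [X], only the difference of the two weights is left, and it is at
    most [l * norm1 z]. *)
Lemma commutator_le h p w c l : cintegrable mu2 h -> (forall z, (h z)^* = h (popp z)) ->
  L2 mu2 p -> measurable_fun setT w -> (forall x, `|w x| <= c) -> 0 <= l ->
  (forall x y, `|w x - w y| <= l * norm1 (psub x y)) ->
  let u := fourier p in
  let X := ip mu2 (fun x => FT h (popp x) * p x) (inv_fourier (fun xi => (w xi)%:C * u xi)) in
  is_true ((2 * `|complex.Im X|)%:E <=
   ((2 * pi)^-1 * l)%:E * \int[mu2]_z ((normc (h z) * norm1 z)%:E * corr u z))%E.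
Proof.
move=> hi hc Lp mw wc l0 wl u X; have Lu : L2 mu2 u := L2_fourier Lp.
have Lwu := L2_real_mul mw wc Lu.
have [mJ Jb XE] := FT_multiplication hi Lp mw wc.
have {}Jb z : normc (cross u w z) <= c * nrm mu2 u ^+ 2 by rewrite -lee_fin; exact: Jb.
have mJ' : cmeas (fun z => (cross u w (popp z))^*).
  by apply: cmeas_conj; exact: (cmeas_comp measurable_popp mJ).
have J'b z : normc ((cross u w (popp z))^*) <= c * nrm mu2 u ^+ 2.
  by rewrite normc_conj.
have i1 := cintegrable_bounded_mul hi mJ Jb.
have i2 := cintegrable_bounded_mul hi mJ' J'b.
have XC : X^* = ((2 * pi)^-1)%:C * cint mu2 (fun z => h z * (cross u w (popp z))^*).
  rewrite /X XE conjcM; rewrite conjc_real.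
  apply: (congr1 (fun a => _ * a)); rewrite -(cint_conj i1).
  apply: (etrans (esym (cint_preserving measurable_popp mu2_popp (cintegrable_conj i1)))).
  by apply: eq_cint => z; rewrite /= conjcM hc popp_popp.
pose D z := cint mu2 (fun xi => u (psub xi z) * ((w xi - w (psub xi z))%:C * u xi)^*).
have bw : forall z x, `|w (psub x z)| <= c by [].
have mwz z : measurable_fun setT (fun x => w (psub x z)).
  exact: (measurableT_comp mw (measurable_psubl z)).
have DE z : h z * cross u w z - h z * (cross u w (popp z))^* = h z * D z.
  rewrite (cross_reflect z Lu mw wc) -mulrBr; apply: (congr1 (fun a => h z * a)).
  have j1 := cintegrable_ip (L2_psubl z Lu) Lwu.
  have j2 := cintegrable_ip (L2_psubl z Lu) (L2_real_mul (mwz z) (bw z) Lu).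
  rewrite /cross -(cintB j1 j2); apply: eq_cint => xi.
  by rewrite -mulrBr -conjcB -mulrBl rmorphB.
have iD : cintegrable mu2 (fun z => h z * D z).
  have e : (fun z => h z * cross u w z - h z * (cross u w (popp z))^*) = fun z => h z * D z.
    by apply/funext => z; exact: DE.
  by have := cintegrableB i1 i2; rewrite e.
have XXE : X - X^* = ((2 * pi)^-1)%:C * cint mu2 (fun z => h z * D z).
  rewrite XC /X XE -mulrBr; apply: (congr1 (fun a => _ * a)).
  by rewrite -(cintB i1 i2); apply: eq_cint => z; rewrite DE.
have p0 : 0 <= (2 * pi)^-1 :> R by rewrite invr_ge0 mulr_ge0// pi_ge0.
have Dle z : ((normc (D z))%:E <= (l * norm1 z)%:E * corr u z)%E.
  have n0 : 0 <= norm1 z by rewrite addr_ge0.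
  have mk : measurable_fun setT (fun xi => (normc (u (psub xi z)) * normc (u xi))%:E).
    have mn := cmeas_normc Lu.1; apply/measurable_EFinP; apply: (measurable_funM _ mn).
    exact: (measurableT_comp mn (measurable_psubl z)).
  have k0 xi : (0 <= (normc (u (psub xi z)) * normc (u xi))%:E)%E.
    by rewrite lee_fin; apply: mulr_ge0; exact: normc_ge0.
  have mwd : measurable_fun setT (fun xi => w xi - w (psub xi z)).
    exact: measurable_funB mw (mwz z).
  have wdb xi : `|w xi - w (psub xi z)| <= c + c.
    by apply: le_trans (ler_normB _ _) _; apply: lerD; exact: wc.
  have jd := cintegrable_ip (L2_psubl z Lu) (L2_real_mul mwd wdb Lu).
  apply: le_trans (normc_cint_le jd) _; rewrite /corr.
  rewrite -(ge0_integralZl_EFin mu2 measurableT (fun x _ => k0 x) mk (mulr_ge0 l0 n0)).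
  apply: (ge0_le_integral _ measurableT) => [x _||| xi _].
  - by rewrite lee_fin; exact: normc_ge0.
  - exact: measurable_normcE jd.1.
  - exact: measurable_funeM.
  - rewrite -EFinM lee_fin normcM normc_conj normcM normc_real mulrCA.
    apply: ler_wpM2r; first by apply: mulr_ge0; exact: normc_ge0.
    exact: Lipschitz_weight_diff.
have ImX : 2 * `|complex.Im X| = `|complex.Im (X - X^*)|.
  rewrite ImD ImN Im_conj opprK; have -> : complex.Im X + complex.Im X = 2 * complex.Im X by ring.
  by rewrite normrM (ger0_norm (ler0n _ _)).
rewrite ImX; apply: (@le_trans _ _ (normc (X - X^*))%:E).
  by rewrite lee_fin; exact: ler_Im_normc.
rewrite XXE normcM normc_real (ger0_norm p0) !EFinM -muleA.
apply: lee_wpmul2l; first by rewrite lee_fin.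
apply: le_trans (normc_cint_le iD) _.
have mc := measurable_corr Lu.1.
have mn1 := @measurable_norm1 R.
have mI : measurable_fun setT (fun z => (normc (h z) * norm1 z)%:E * corr u z)%E.
  apply: emeasurable_funM mc; apply/measurable_EFinP.
  exact: measurable_funM (cmeas_normc hi.1) mn1.
have I0 z : (0 <= (normc (h z) * norm1 z)%:E * corr u z)%E.
  apply: mule_ge0; last exact: corr_ge0.
  by rewrite lee_fin; apply: mulr_ge0; [exact: normc_ge0|rewrite addr_ge0].
rewrite -(ge0_integralZl_EFin mu2 measurableT (fun x _ => I0 x) mI l0).
apply: (ge0_le_integral _ measurableT) => [x _||| z _].
- by rewrite lee_fin; exact: normc_ge0.
- exact: measurable_normcE iD.1.
- exact: measurable_funeM.
- rewrite normcM EFinM; apply: le_trans (lee_wpmul2l _ (Dle z)) _.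
    by rewrite lee_fin; exact: normc_ge0.
  rewrite le_eqVlt; apply/orP; left; apply/eqP.
  by rewrite !muleA -!EFinM; congr (_%:E * _)%E; rewrite mulrCA mulrA.
Qed.

End CommutatorBound.

Lemma sum_ord2 (V : nmodType) (F : 'I_2 -> V) : \sum_k F k = F 0 + F 1.
Proof.
by rewrite big_ord_recl big_ord1; congr (_ + F _); exact: val_inj.
Qed.

(** * Bounds for the Hartree term, component by component *)

Section Hartree.
Context {R : realType}.
Local Notation plane := (@plane R).
Implicit Types (f g u h s : plane -> R[i]) (w : plane -> R) (z : plane) (p : 'I_2 -> plane -> R[i]).

Definition density p (x : plane) : R[i] := (\sum_k normc (p k x) ^+ 2)%:C.

Definition totcorr p z : \bar R := (\sum_k corr (fourier (p k)) z)%E.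

(** One factor [(2 pi)^-1] comes from the transform of the density, the other from passing from that
    side back to the potential. *)
Definition hartreeC (b : R) : R := (2 * pi)^-1 * ((2 * pi)^-1 * (resC b * schurC)).

Lemma pi2V_ge0 : 0 <= (2 * pi)^-1 :> R.
Proof. by rewrite invr_ge0 mulr_ge0// pi_ge0. Qed.

Lemma hartreeC_ge0 b : 0 < b -> 0 <= hartreeC b.
Proof.
move=> b0; apply: mulr_ge0; first exact: pi2V_ge0.
apply: mulr_ge0; first exact: pi2V_ge0.
by apply: mulr_ge0; [exact: resC_ge0|exact: schurC_ge0].
Qed.

Lemma totcorr_ge0 p z : (0 <= totcorr p z)%E.
Proof. by apply: sume_ge0 => k _; exact: corr_ge0. Qed.

Lemma totcorr_le p z : (forall k, L2 mu2 (p k)) ->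
  (totcorr p z <= (\sum_k nrm mu2 (p k) ^+ 2)%:E)%E.
Proof.
move=> Lp; rewrite /totcorr -sumEFin; apply: lee_sum => k _.
rewrite -(nrm_fourier (Lp k)); exact: corr_le (L2_fourier (Lp k)).
Qed.

Lemma measurable_totcorr p : (forall k, L2 mu2 (p k)) -> measurable_fun setT (totcorr p).
Proof.
move=> Lp; apply: emeasurable_sum => k; apply: measurable_corr.
by have [] := L2_fourier (Lp k).
Qed.

Lemma integral_totcorr_le p : (forall k, L2 mu2 (p k)) ->
  (\int[mu2]_z ((kap2 z)%:E * totcorr p z) <=
   schurC%:E * \sum_k energy (fourier (p k)))%E.
Proof.
move=> Lp; have mk k : measurable_fun setT (corr (fourier (p k))).
  by apply: measurable_corr; have [] := L2_fourier (Lp k).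
have k0 k z : (0 <= (kap2 z)%:E * corr (fourier (p k)) z)%E.
  by apply: mule_ge0; [rewrite lee_fin; exact: kap2_ge0|exact: corr_ge0].
have mkk k : measurable_fun setT (fun z => (kap2 z)%:E * corr (fourier (p k)) z)%E.
  by apply: emeasurable_funM (mk k); apply/measurable_EFinP; exact: measurable_kap2.
have -> : (\int[mu2]_z ((kap2 z)%:E * totcorr p z) =
    \int[mu2]_z (\sum_k ((kap2 z)%:E * corr (fourier (p k)) z)))%E.
  apply: eq_integral => z _; rewrite /totcorr ge0_sume_distrr// => k _.
  exact: corr_ge0.
rewrite (ge0_integral_sum mu2 measurableT mkk (fun k x _ => k0 k x)).
rewrite ge0_sume_distrr => [|k _]; last exact: energy_ge0.
apply: lee_sum => k _; apply: integral_corr_le.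
by have [] := L2_fourier (Lp k).
Qed.

Lemma density_integrable p : (forall k, L2 mu2 (p k)) -> cintegrable mu2 (density p).
Proof.
move=> Lp; have -> : density p = fun x => p 0 x * (p 0 x)^* + p 1 x * (p 1 x)^*.
  by apply/funext => x; rewrite /density sum_ord2 rmorphD /= !mulc_conj.
by apply: cintegrableD; exact: cintegrable_ip.
Qed.

(** By [FT_product] the transform of each [|p_k|^2] at [- z] is a correlation of [fourier (p k)]
    with itself; the sign of [z] does not matter because the density is real. *)
Lemma normc_FT_density p z : (forall k, L2 mu2 (p k)) ->
  ((normc (FT (density p) z))%:E <= ((2 * pi)^-1)%:E * totcorr p z)%E.
Proof.
move=> Lp; have di := density_integrable Lp.
have -> : normc (FT (density p) z) = normc (FT (density p) (popp z)).
  rewrite -[LHS]normc_conj (FT_conj z di); apply: (congr1 (fun f => normc (FT f (popp z)))).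
  by apply/funext => x; rewrite /density conjc_real.
have -> : FT (density p) (popp z) =
    \sum_k ((2 * pi)^-1)%:C * ip mu2 (fun xi => fourier (p k) (psub xi z)) (fourier (p k)).
  under eq_bigr => k _ do rewrite -(FT_product z (Lp k) (Lp k)).
  rewrite sum_ord2 /FT -mulrDr; apply: (congr1 (fun c => _ * c)).
  rewrite -(cintD (cintegrable_cis _ (cintegrable_ip (Lp _) (Lp _)))
                  (cintegrable_cis _ (cintegrable_ip (Lp _) (Lp _)))).
  apply: eq_cint => x; rewrite -mulrDr !mulc_conj -rmorphD/=; congr (_ * _%:C).
  by rewrite sum_ord2.
apply: (@le_trans _ _ (\sum_k normc (((2 * pi)^-1)%:C *
    ip mu2 (fun xi => fourier (p k) (psub xi z)) (fourier (p k))))%:E).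
  by rewrite lee_fin; exact: normc_sum.
rewrite -sumEFin /totcorr ge0_sume_distrr => [|k _]; last exact: corr_ge0.
apply: lee_sum => k _; rewrite normcM normc_real (ger0_norm pi2V_ge0) EFinM.
apply: lee_wpmul2l; first by rewrite lee_fin; exact: pi2V_ge0.
have Lu := L2_fourier (Lp k).
have ci := cintegrable_ip (L2_psubl z Lu) Lu.
apply: le_trans (normc_cint_le ci) _; rewrite le_eqVlt; apply/orP; left; apply/eqP.
by apply: eq_integral => x _; rewrite normcM normc_conj.
Qed.

(* The density is only known to be integrable, so its L^2 transform may fail to
   exist; [fourier] is then the junk value 0, which obeys the same bounds. *)
Lemma density_transform p : (forall k, L2 mu2 (p k)) ->
  exists s, [/\ cmeas s, cmeas (fourier (density p)), forall z, (s z)^* = s (popp z),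
    forall z, ((normc (s z))%:E <= ((2 * pi)^-1)%:E * totcorr p z)%E &
    {ae mu2, forall z, fourier (density p) z = s z}].
Proof.
move=> Lp; have di := density_integrable Lp; have [md _] := di.
have [[g Fg]|nF] := pselect (exists g, isF (density p) g).
  have ex : exists g, [set g | is_fourier (density p) g] g.
    by exists g; exact: ((is_fourierP g md).2 Fg).
  have Ff := (is_fourierP _ md).1 (xgetPex (fun=> 0) ex).
  exists (FT (density p)); split.
  - exact: cmeas_FT.
  - by have [[]] := Ff.
  - move=> z; rewrite (FT_conj z di); apply: (congr1 (fun f => FT f (popp z))).
    by apply/funext => x; rewrite /density conjc_real.
  - by move=> z; exact: normc_FT_density.
  - exact: isF_L1 di Ff.
have e : fourier (density p) = fun=> 0.
  rewrite /fourier xgetPN// => g /= Fg; apply: nF; exists g.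
  exact: ((is_fourierP g md).1 Fg).
exists (fun=> 0); rewrite e; split.
- exact: cmeas_cst.
- exact: cmeas_cst.
- by move=> z; rewrite (conjc_real 0).
- move=> z; rewrite normc0; apply: mule_ge0; last exact: totcorr_ge0.
  by rewrite lee_fin; exact: pi2V_ge0.
- exact: aeW.
Qed.

Lemma L2_bounded_integrable h c : cintegrable mu2 h -> (forall z, normc (h z) <= c) -> L2 mu2 h.
Proof.
move=> [mh hoo] hc; split => //.
have c0 : 0 <= c by exact: le_trans (normc_ge0 _) (hc (0, 0)).
apply: (@le_lt_trans _ _ (\int[mu2]_x (c%:E * (normc (h x))%:E))%E).
  apply: (ge0_le_integral _ measurableT) => [x _||| x _].
  - by rewrite lee_fin; exact: sqr_ge0.
  - exact: measurable_sqnormc.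
  - by apply: measurable_funeM; exact: measurable_normcE.
  - by rewrite -EFinM lee_fin expr2; apply: ler_wpM2r; [exact: normc_ge0|exact: hc].
have n0 x : (0 <= (normc (h x))%:E)%E by rewrite lee_fin; exact: normc_ge0.
rewrite (ge0_integralZl_EFin mu2 measurableT (fun x _ => n0 x) (measurable_normcE mh) c0).
by rewrite lte_mul_pinfty// lee_fin.
Qed.

(** [h] is the transform of the potential. The bound of the density by the correlation is used in
    two ways: estimated by the mass it gives the pointwise bound, integrated against [kap2] it gives
    the L^1 bound in terms of the energy. *)
Lemma hartree_potential p b (E : R) : 0 < b -> (forall k, L2 mu2 (p k)) ->
  (\sum_k energy (fourier (p k)) = E%:E)%E ->
  exists h, [/\ cintegrable mu2 h, forall z, (h z)^* = h (popp z),
    forall z, normc (h z) * norm1 z <=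
       (2 * pi)^-1 * resC b * (\sum_k nrm mu2 (p k) ^+ 2) * kap2 z,
    (\int[mu2]_z (normc (h z))%:E <= ((2 * pi)^-1 * (resC b * schurC) * E)%:E)%E &
    cmeas (resolvent b (density p)) /\
    {ae mu2, forall x, resolvent b (density p) x = FT h (popp x)}].
Proof.
move=> b0 Lp EE; have [s [ms mf sc sb se]] := density_transform Lp.
have bz z : 0 < b + dot z z by apply: (ltr_pwDl b0); exact: dot_ge0.
have bzV z : 0 <= (b + dot z z)^-1 by rewrite invr_ge0; exact: ltW.
have mr : cmeas (fun z : plane => ((b + dot z z)^-1)%:C).
  apply: cmeas_real; have -> : (fun z : plane => (b + dot z z)^-1) =
      (fun z : plane => (b + dot z z) `^ (-1)).
    by apply/funext => z; rewrite powR_inv1// ltW.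
  apply: (measurableT_comp (measurable_powR _)).
  by apply: measurable_funD; [exact: measurable_cst|exact: measurable_sqdot].
have rle z : (b + dot z z)^-1 <= resC b * kap2 z.
  apply: le_trans (resolvent_kap2 z b0); rewrite ler_peMl//.
  by rewrite lerDl /norm1 addr_ge0.
pose h z := ((b + dot z z)^-1)%:C * s z.
pose M := \sum_k nrm mu2 (p k) ^+ 2.
have sM z : normc (s z) <= (2 * pi)^-1 * M.
  rewrite -lee_fin EFinM; apply: le_trans (sb z) _; apply: lee_wpmul2l; last exact: totcorr_le.
  by rewrite lee_fin; exact: pi2V_ge0.
have mh : cmeas h by exact: cmeasM.
have hE z : normc (h z) = (b + dot z z)^-1 * normc (s z).
  by rewrite normcM normc_real ger0_norm.
have rC := resC_ge0 b0.
have hint : (\int[mu2]_z (normc (h z))%:E <= ((2 * pi)^-1 * (resC b * schurC) * E)%:E)%E.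
  apply: (@le_trans _ _ (\int[mu2]_z (((2 * pi)^-1 * resC b)%:E * ((kap2 z)%:E * totcorr p z)))%E).
    apply: (ge0_le_integral _ measurableT) => [x _||| z _].
    - by rewrite lee_fin; exact: normc_ge0.
    - exact: measurable_normcE.
    - apply: measurable_funeM; apply: emeasurable_funM (measurable_totcorr Lp).
      by apply/measurable_EFinP; exact: measurable_kap2.
    - rewrite hE EFinM; apply: (@le_trans _ _ ((resC b * kap2 z)%:E * (((2 * pi)^-1)%:E * totcorr p z))%E).
        apply: lee_pmul; [by rewrite lee_fin|by rewrite lee_fin; exact: normc_ge0| |exact: sb].
        by rewrite lee_fin; exact: rle.
      by rewrite !muleA -!EFinM (_ : resC b * kap2 z * _ = (2 * pi)^-1 * resC b * kap2 z); [|ring].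
  have k0 z : (0 <= (kap2 z)%:E * totcorr p z)%E.
    by apply: mule_ge0; [rewrite lee_fin; exact: kap2_ge0|exact: totcorr_ge0].
  have mk : measurable_fun setT (fun z => (kap2 z)%:E * totcorr p z)%E.
    by apply: emeasurable_funM (measurable_totcorr Lp); apply/measurable_EFinP; exact: measurable_kap2.
  have c0 : 0 <= (2 * pi)^-1 * resC b by apply: mulr_ge0 => //; exact: pi2V_ge0.
  rewrite (ge0_integralZl_EFin mu2 measurableT (fun x _ => k0 x) mk c0).
  apply: le_trans (lee_wpmul2l _ (integral_totcorr_le Lp)) _; first by rewrite lee_fin.
  by rewrite EE -!EFinM lee_fin !mulrA.
have hi : cintegrable mu2 h.
  by split => //; apply: le_lt_trans hint _; rewrite ltry.
have M0 : 0 <= M by apply: sumr_ge0 => k _; exact: sqr_ge0.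
(* Bounded and integrable, [h] is in L^2, where [fourier h] and [FT h] agree almost everywhere. *)
have hb z : normc (h z) <= b^-1 * ((2 * pi)^-1 * M).
  rewrite hE; apply: ler_pM => //.
  by rewrite lef_pV2 ?posrE// lerDl dot_ge0.
have Lh := L2_bounded_integrable hi hb.
exists h; split => //.
- by move=> z; rewrite /h conjcM conjc_real sc /dot /popp /= !mulrNN.
- move=> z; rewrite hE mulrAC.
  have n0 : 0 <= norm1 z by rewrite addr_ge0.
  have -> : (2 * pi)^-1 * resC b * M * kap2 z = (resC b * kap2 z) * ((2 * pi)^-1 * M) by ring.
  apply: ler_pM; [by apply: mulr_ge0|exact: normc_ge0| |exact: sM].
  apply: le_trans (resolvent_kap2 z b0); rewrite mulrC; apply: ler_wpM2r => //.
  by rewrite lerDr.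
have mk : cmeas (fun z => ((b + dot z z)^-1)%:C * fourier (density p) z) by exact: cmeasM.
have kh : {ae mu2, forall z, h z = ((b + dot z z)^-1)%:C * fourier (density p) z}.
  by apply: filterS se => z ez; rewrite ez.
have Lk := ae_eq_L2 mk kh Lh.
split; first by have [] := L2_inv_fourier Lk.
have e1 := ae_fourier Lh Lk kh.
have e2 := isF_unique Lh (fourierP Lh) (isF_FT hi Lh).
apply: (ae_preserving measurable_popp mu2_popp
  (P := fun x => fourier (fun z => ((b + dot z z)^-1)%:C * fourier (density p) z) x = FT h x)).
apply: filterS2 e1 e2 => x e1x e2x; exact: (etrans (esym e1x) e2x).
Qed.

(** The supremum of the potential is at most the L^1 norm of [h], hence a multiple of the energy;
    this gives the L^2 bound. In the commutator, [h] is estimated by the mass and the correlation of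
    [p k] by the energy, which keeps that bound linear in the energy. *)
Lemma hartree_component p b (E : R) : 0 < b -> (forall k, L2 mu2 (p k)) ->
  (\sum_k energy (fourier (p k)) = E%:E)%E ->
  let V := resolvent b (density p) in forall k,
  [/\ L2 mu2 (fun x => V x * p k x),
      nrm mu2 (fun x => V x * p k x) <= hartreeC b * E * nrm mu2 (p k) &
      forall w c l, measurable_fun setT w -> (forall x, `|w x| <= c) -> 0 <= l ->
        (forall x y, `|w x - w y| <= l * norm1 (psub x y)) ->
        (`|complex.Im (ip mu2 (fourier (fun x => V x * p k x))
             (fun xi => (w xi)%:C * fourier (p k) xi))|%:E <=
         (hartreeC b * l * \sum_j nrm mu2 (p j) ^+ 2)%:E * energy (fourier (p k)))%E].
Proof.
move=> b0 Lp EE V k; have [h [hi hc hM hint [mV VE]]] := hartree_potential b0 Lp EE.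
pose W x := FT h (popp x).
have mW : cmeas W by exact: cmeas_FT_popp.
have i0 : 0 <= (2 * pi)^-1 * (resC b * schurC) * E.
  rewrite -lee_fin; apply: le_trans hint; apply: integral_ge0 => x _.
  by rewrite lee_fin; exact: normc_ge0.
have Wb x : normc (W x) <= hartreeC b * E.
  apply: le_trans (normc_FT_le _ hi) _; rewrite /hartreeC -mulrA.
  apply: ler_wpM2l; first exact: pi2V_ge0.
  by rewrite /Rintegral -lee_fin fineK ?fin_num_abs//; apply: le_lt_trans hi.2; rewrite gee0_abs//;
     apply: integral_ge0 => y _; rewrite lee_fin; exact: normc_ge0.
have LW : L2 mu2 (fun x => W x * p k x) by exact: L2Ml mW Wb (Lp k).
have WV : {ae mu2, forall x, W x * p k x = V x * p k x}.
  by apply: filterS VE => x ex; rewrite /W -ex.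
have mVp : cmeas (fun x => V x * p k x) by apply: cmeasM => //; have [] := Lp k.
have LV := ae_eq_L2 mVp WV LW.
have c0 : 0 <= hartreeC b * E by exact: le_trans (normc_ge0 _) (Wb (0, 0)).
split => //.
  rewrite -(ae_eq_nrm LW.1 mVp WV); apply: (nrm_le_mul LW (Lp k) c0) => x.
  by rewrite normcM; apply: ler_wpM2r; [exact: normc_ge0|exact: Wb].
move=> w c l mw wc l0 wl; have Lu := L2_fourier (Lp k).
have Lwu := L2_real_mul mw wc Lu; have Lphi := L2_inv_fourier Lwu.
rewrite (fourier_adjoint LV Lwu).
rewrite -(ae_eq_ip LW.1 mVp Lphi.1 Lphi.1 WV (aeW _ (fun x => erefl))).
have : ((2 * `|complex.Im (ip mu2 (fun x => W x * p k x)
    (inv_fourier (fun xi => (w xi)%:C * fourier (p k) xi)))|)%:E <= _)%E :=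
  commutator_le hi hc (Lp k) mw wc l0 wl.
move: (complex.Im _) => I hI.
apply: (@le_trans _ _ (2 * `|I|)%:E).
  by rewrite lee_fin ler_peMl// ler1n.
apply: le_trans hI _.
pose M := \sum_j nrm mu2 (p j) ^+ 2.
have M0 : 0 <= M by apply: sumr_ge0 => j _; exact: sqr_ge0.
have rC := resC_ge0 b0; have p0 := pi2V_ge0.
have cM0 : 0 <= (2 * pi)^-1 * resC b * M by apply: mulr_ge0 => //; exact: mulr_ge0.
have mc := measurable_corr Lu.1.
have mk : measurable_fun setT (fun z => (kap2 z)%:E * corr (fourier (p k)) z)%E.
  by apply: emeasurable_funM mc; apply/measurable_EFinP; exact: measurable_kap2.
have k0 z : (0 <= (kap2 z)%:E * corr (fourier (p k)) z)%E.
  by apply: mule_ge0; [rewrite lee_fin; exact: kap2_ge0|exact: corr_ge0].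
have mn1 := @measurable_norm1 R.
have step : (\int[mu2]_z ((normc (h z) * norm1 z)%:E * corr (fourier (p k)) z) <=
    ((2 * pi)^-1 * resC b * M)%:E * (schurC%:E * energy (fourier (p k))))%E.
  apply: le_trans (lee_wpmul2l _ (integral_corr_le Lu.1)); last by rewrite lee_fin.
  rewrite -(ge0_integralZl_EFin mu2 measurableT (fun x _ => k0 x) mk cM0).
  apply: (ge0_le_integral _ measurableT) => [z _||| z _].
  - apply: mule_ge0; last exact: corr_ge0.
    by rewrite lee_fin; apply: mulr_ge0; [exact: normc_ge0|rewrite addr_ge0].
  - apply: emeasurable_funM mc; apply/measurable_EFinP.
    exact: measurable_funM (cmeas_normc hi.1) mn1.
  - exact: measurable_funeM.
  - rewrite muleA -EFinM; apply: lee_wpmul2r; first exact: corr_ge0.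
    by rewrite lee_fin; exact: hM.
apply: le_trans (lee_wpmul2l _ step) _; first by rewrite lee_fin; apply: mulr_ge0.
rewrite !muleA -!EFinM le_eqVlt; apply/orP; left; apply/eqP.
by congr (_%:E * _)%E; rewrite /hartreeC -/M; ring.
Qed.

End Hartree.

(** * The free propagator and spinor fields *)

Section Propagator.
Context {R : realType}.
Local Notation plane := (@plane R).
Variable m : R.
Hypothesis m0 : 0 < m.
Implicit Types (xi : plane) (t s : R).

Definition omega xi : R := Num.sqrt (m ^+ 2 + dot xi xi).

(** Closed form of the exponential of [- i t] times the symbol, which squares to the scalar
    [omega ^ 2]. *)
Definition propagator t xi : 'M[R[i]]_2 :=
  (cos (t * omega xi))%:C%:M + (- 'i * (sin (t * omega xi) / omega xi)%:C) *: dirac_symbol m xi.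

Lemma omega_sq xi : omega xi ^+ 2 = m ^+ 2 + dot xi xi.
Proof. by rewrite sqr_sqrtr// addr_ge0 ?sqr_ge0 ?dot_ge0. Qed.

Lemma omega_gt0 xi : 0 < omega xi.
Proof. by rewrite sqrtr_gt0 ltr_pwDl ?exprn_gt0 ?dot_ge0. Qed.

Lemma dirac_symbolE xi : dirac_symbol m xi =
  mx22 m%:C (xi.2 +i* xi.1) (xi.2 -i* xi.1) (- m%:C).
Proof.
apply/matrixP => i j; rewrite !mxE.
case: i j => [[|[|//]] ?] [[|[|//]] ?] /=; apply: complex_eqP;
  rewrite ?(ReD, ImD, ReM, ImM)/=; ring.
Qed.

Lemma mx22E (a b c d : R[i]) i j : mx22 a b c d i j =
  if i == 0 then (if j == 0 then a else b) else (if j == 0 then c else d).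
Proof. by rewrite mxE. Qed.

Lemma mx22M (a b c d a' b' c' d' : R[i]) : mx22 a b c d *m mx22 a' b' c' d' =
  mx22 (a * a' + b * c') (a * b' + b * d') (c * a' + d * c') (c * b' + d * d').
Proof.
apply/matrixP => i j; rewrite !mxE sum_ord2 !mxE /=.
by case: i j => [[|[|//]] ?] [[|[|//]] ?].
Qed.

Lemma dirac_symbol_sq xi : dirac_symbol m xi *m dirac_symbol m xi = (omega xi ^+ 2)%:C%:M.
Proof.
rewrite dirac_symbolE mx22M omega_sq /dot; apply/matrixP => i j; rewrite !mxE.
case: i j => [[|[|//]] ?] [[|[|//]] ?] /=; apply: complex_eqP;
  rewrite ?(ReD, ImD, ReM, ImM, ReN, ImN)/=; ring.
Qed.

(** Even powers of the symbol are scalar and odd powers are multiples of the symbol, so they carry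
    the cosine and the sine series. *)
Lemma exp_series_term t xi k :
  (k`!%:R)^-1 *: ((- 'i * t%:C) *: dirac_symbol m xi) ^+ k =
  (cos_coeff (t * omega xi) k)%:C%:M +
  (- 'i * (sin_coeff (t * omega xi) k / omega xi)%:C) *: dirac_symbol m xi.
Proof.
set A := dirac_symbol m xi; set w := omega xi; set x := t * w.
(* The coefficients of the cosine and sine series without the factorial, which makes the recursion
   in [j] a plain multiplication by [x]. *)
pose al j : R := (~~ odd j)%:R * (-1) ^+ j./2 * x ^+ j.
pose be j : R := (odd j)%:R * (-1) ^+ j.-1./2 * x ^+ j.
have alS j : al j.+1 = - (x * be j).
  rewrite /al /be /= negbK uphalf_half.
  case oj: (odd j); rewrite ?mul0r ?mulr0 ?oppr0// !mul1r.
  case: j oj => // j /= oj; rewrite uphalf_half (negbTE oj) add0n add1n !exprS; ring.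
have beS j : be j.+1 = x * al j.
  by rewrite /al /be /=; case: (odd j); rewrite ?mul0r ?mulr0// !mul1r exprS; ring.
have w0 : w != 0 by rewrite gt_eqF// omega_gt0.
have h j : ((- 'i * t%:C) *: A) ^+ j = (al j)%:C%:M + (- 'i * (be j / w)%:C) *: A.
  elim: j => [|j IH].
    by rewrite expr0 /al /be /= !mul1r !mul0r mulr0 scale0r addr0.
  rewrite exprS IH -[LHS]/(_ *m _) mulmxDr -!scalemxAl -scalemxAr dirac_symbol_sq.
  rewrite mul_mx_scalar !scalerA scale_scalar_mx addrC alS beS; congr (_%:M + _ *: _);
    apply: complex_eqP; rewrite ?(ReD, ImD, ReM, ImM, ReN, ImN)/=; rewrite -/w /x; field => //.
rewrite h scalerDr scalerA scale_scalar_mx.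
have f0 : (k`!%:R)^-1 = ((k`!%:R)^-1)%:C :> R[i] by rewrite fmorphV rmorph_nat.
rewrite f0 /cos_coeff /sin_coeff; congr (_%:M + _ *: _); rewrite -/x.
  rewrite -rmorphM/=; congr (_%:C); exact: mulrC.
rewrite mulrCA -rmorphM/=; congr (_ * _%:C).
by rewrite mulrA; congr (_ / _); exact: mulrC.
Qed.

Lemma scalar_addE (c a : R[i]) (A : 'M[R[i]]_2) i j :
  (c%:M + a *: A) i j = c * (i == j)%:R + a * A i j.
Proof. by rewrite !mxE mulr_natr. Qed.

Lemma propagatorE t xi i j : propagator t xi i j = (cos (t * omega xi))%:C * (i == j)%:R +
  (- 'i * (sin (t * omega xi) / omega xi)%:C) * dirac_symbol m xi i j.
Proof. exact: scalar_addE. Qed.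

Lemma expmx_dirac t xi : expmx ((- 'i * t%:C) *: dirac_symbol m xi) = propagator t xi.
Proof.
set A := dirac_symbol m xi; set w := omega xi; set x := t * w.
pose S n : 'M[R[i]]_2 := \sum_(0 <= k < n) (k`!%:R)^-1 *: ((- 'i * t%:C) *: A) ^+ k.
have -> : expmx ((- 'i * t%:C) *: A) = \matrix_(i, j)
    (limn (fun n => complex.Re (S n i j)) +i* limn (fun n => complex.Im (S n i j))) by [].
have SE n i j : S n i j = (series (cos_coeff x) n)%:C * (i == j)%:R +
    (- 'i * (series (sin_coeff x) n / w)%:C) * A i j.
  rewrite /S; under eq_bigr do rewrite exp_series_term -/w -/x.
  rewrite big_split/= mxE; congr (_ + _).
    rewrite -(raddf_sum (@scalar_mx _ 2)) -(rmorph_sum (real_complex R)) !mxE -/x.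
    exact: esym (mulr_natr _ _).
  rewrite -scaler_suml -mulr_sumr -(rmorph_sum (real_complex R)) mxE /series/=.
  by rewrite -mulr_suml.
have cc : series (cos_coeff x) @ \oo --> cos x by rewrite unlock; exact: is_cvg_series_cos_coeff.
have cs : series (sin_coeff x) @ \oo --> sin x by rewrite unlock; exact: is_cvg_series_sin_coeff.
have lims (al be : R) : limn (fun n => series (cos_coeff x) n * al + series (sin_coeff x) n * be) =
    cos x * al + sin x * be.
  by apply/cvg_lim => //; apply: cvgD; apply: cvgMr_tmp.
apply/matrixP => i j; rewrite [LHS]mxE.
have -> : propagator t xi i j = (cos x)%:C * (i == j)%:R + (- 'i * (sin x / w)%:C) * A i j.
  exact: scalar_addE.
pose B := (- 'i * (w^-1)%:C) * A i j.
have SE' n : S n i j = (series (cos_coeff x) n)%:C * (i == j)%:R + (series (sin_coeff x) n)%:C * B.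
  rewrite SE; congr (_ + _); rewrite rmorphM/= /B; ring.
have eRe : (fun n => complex.Re (S n i j)) =
    fun n => series (cos_coeff x) n * (i == j)%:R + series (sin_coeff x) n * complex.Re B.
  apply/funext => n; rewrite SE' ReD !ReM !Re_realC !Im_realC.
  by case: (i == j) => /=; ring.
have eIm : (fun n => complex.Im (S n i j)) =
    fun n => series (cos_coeff x) n * 0 + series (sin_coeff x) n * complex.Im B.
  apply/funext => n; rewrite SE' ImD !ImM !Re_realC !Im_realC.
  by case: (i == j) => /=; ring.
rewrite eRe eIm !lims.
have -> : - 'i * (sin x / w)%:C * A i j = (sin x)%:C * B by rewrite rmorphM/= /B; ring.
apply: complex_eqP; rewrite ?(ReD, ImD, ReM, ImM) /=; case: (i == j) => /=; ring.
Qed.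

Lemma propagator_group s t xi : propagator s xi *m propagator t xi = propagator (s + t) xi.
Proof.
set A := dirac_symbol m xi; set w := omega xi.
have w0 : w != 0 by rewrite gt_eqF// omega_gt0.
have h (a b c d : R[i]) : (a%:M + b *: A) *m (c%:M + d *: A) =
    (a * c + b * d * (w ^+ 2)%:C)%:M + (a * d + b * c) *: A.
  rewrite mulmxDl !mulmxDr -!scalemxAl -!scalemxAr dirac_symbol_sq -/w !mul_scalar_mx mul_mx_scalar.
  rewrite !scalerA !scale_scalar_mx scalerDl [(a * c + _)%:M]raddfD /=.
  by rewrite [X in _ + X = _]addrC addrACA (mulrC d).
rewrite /propagator -/A -/w h mulrDl cosD sinD; congr (_%:M + _ *: _);
  apply: complex_eqP; rewrite ?(ReD, ImD, ReM, ImM, ReN, ImN)/=; field => //.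
Qed.

Lemma propagator0 xi : propagator 0 xi = 1%:M.
Proof. by rewrite /propagator mul0r cos0 sin0 mul0r mulr0 scale0r addr0. Qed.

(** The symbol is Hermitian, so conjugation only changes the sign of the sine term. *)
Lemma propagator_adjoint t xi i j : (propagator t xi i j)^* = propagator (- t) xi j i.
Proof.
apply: (etrans (congr1 conjc (propagatorE t xi i j))).
apply: (etrans _ (esym (propagatorE (- t) xi j i))).
rewrite dirac_symbolE.
rewrite (mx22E _ _ _ _ i j) (mx22E _ _ _ _ j i).
rewrite (mulNr t (omega xi)) (cosN (t * omega xi)) (sinN (t * omega xi)).
move: (cos (t * omega xi)) (sin (t * omega xi)) (omega xi) => c d w.
case: i j => [[|[|//]] ?] [[|[|//]] ?] /=; apply: complex_eqP;
  rewrite ?(Re_conj, Im_conj, ReD, ImD, ReM, ImM, ReN, ImN)/=; ring.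
Qed.

Lemma measurable_omega : measurable_fun setT omega.
Proof.
apply: (@measurableT_comp _ _ _ _ _ _ (@Num.sqrt R)).
  by apply: continuous_measurable_fun; exact: sqrt_continuous.
by apply: measurable_funD; [exact: measurable_cst|exact: measurable_sqdot].
Qed.

Lemma cmeas_dirac_symbol i j : cmeas (fun xi => dirac_symbol m xi i j).
Proof.
have h (a b c : R[i]) (A B C : 'M[R[i]]_2) : (a *: A + b *: B + c *: C) i j =
    a * A i j + b * B i j + c * C i j by rewrite !mxE.
have e xi : dirac_symbol m xi i j =
    xi.1%:C * alpha1 i j + xi.2%:C * alpha2 i j + m%:C * gamma0 i j by exact: h.
under [X in cmeas X]eq_fun do rewrite e.
apply: cmeasD; last exact: cmeas_cst.
by apply: cmeasD; apply: cmeasM (cmeas_cst _); apply: cmeas_real;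
  [exact: measurable_fst|exact: measurable_snd].
Qed.

Lemma cmeas_propagator t i j : cmeas (fun xi => propagator t xi i j).
Proof.
have mo : measurable_fun setT (fun xi => t * omega xi).
  by apply: measurable_funM measurable_omega; exact: measurable_cst.
have mV : measurable_fun setT (fun xi => (omega xi)^-1).
  rewrite (_ : (fun xi => _) = fun xi => omega xi `^ (-1)).
    exact: (measurableT_comp (measurable_powR _) measurable_omega).
  by apply/funext => xi; rewrite powR_inv1// ltW// omega_gt0.
rewrite (_ : (fun xi => _) = fun xi => (cos (t * omega xi))%:C * (i == j)%:R +
    (- 'i * (sin (t * omega xi) * (omega xi)^-1)%:C) * dirac_symbol m xi i j); last first.
  by apply/funext => xi; exact: scalar_addE.
apply: cmeasD; apply: cmeasM.
- apply: cmeas_real; apply: measurableT_comp mo.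
  by apply: continuous_measurable_fun; exact: continuous_cos.
- exact: cmeas_cst.
- apply: cmeasM; first exact: cmeas_cst.
  apply: cmeas_real; apply: measurable_funM mV; apply: measurableT_comp mo.
  by apply: continuous_measurable_fun; exact: continuous_sin.
- exact: cmeas_dirac_symbol.
Qed.

End Propagator.

(** * The Hilbert space of spinor fields *)

Section SpinorHilbert.
Context {R : realType}.
Local Notation plane := (@plane R).
Local Notation spinor := (@spinor R).
Implicit Types (u v a : plane -> spinor) (w : plane -> R) (k : 'I_2).

Definition comp u k : plane -> R[i] := fun xi => u xi k 0.
Definition SL2 u : Prop := forall k, L2 mu2 (comp u k).
Definition snrm u : R := Num.sqrt (\sum_k nrm mu2 (comp u k) ^+ 2).
Definition sip u v : R[i] := cint mu2 (fun xi => spinor_dot (u xi) (v xi)).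
Definition wmul w u : plane -> spinor := fun xi => (w xi)%:C *: u xi.

Arguments sip : simpl never.
Arguments snrm : simpl never.

Lemma snrm_ge0 u : 0 <= snrm u. Proof. exact: sqrtr_ge0. Qed.

Lemma snrm_sq u : snrm u ^+ 2 = \sum_k nrm mu2 (comp u k) ^+ 2.
Proof. by rewrite sqr_sqrtr// sumr_ge0// => k _; exact: sqr_ge0. Qed.

Lemma spinor_normE (v : spinor) : spinor_norm v ^+ 2 = \sum_k normc (v k 0) ^+ 2.
Proof. by rewrite sqr_sqrtr// sumr_ge0// => k _; exact: sqr_ge0. Qed.

Lemma integral_spinor_norm u : (forall k, cmeas (comp u k)) ->
  (\int[mu2]_xi (spinor_norm (u xi) ^+ 2)%:E = \sum_k nsq mu2 (comp u k))%E.
Proof.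
move=> mu.
have m k : measurable_fun setT (fun xi => (normc (comp u k xi) ^+ 2)%:E) := measurable_sqnormc (mu k).
have m0 k xi : (setT xi -> 0 <= (normc (comp u k xi) ^+ 2)%:E)%E.
  by move=> _; rewrite lee_fin; exact: sqr_ge0.
have := ge0_integral_sum mu2 measurableT m m0 (index_enum _); rewrite /nsq => <-.
by apply: eq_integral => xi _; rewrite spinor_normE sumEFin.
Qed.

Lemma spinor_norm2E u :
  spinor_norm2 u = ((\int[mu2]_xi (spinor_norm (u xi) ^+ 2)%:E) `^ 2^-1)%E.
Proof.
rewrite /spinor_norm2 unlock; congr (_ `^ _)%E.
have n0 (v : spinor) : 0 <= spinor_norm v by exact: sqrtr_ge0.
apply: eq_integral => x _; rewrite gee0_abs ?lee_fin//.
by rewrite poweR_EFin powR_mulrn.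
Qed.

Lemma spinor_norm2_snrm u : SL2 u -> spinor_norm2 u = (snrm u)%:E.
Proof.
move=> Lu; rewrite spinor_norm2E (integral_spinor_norm (fun k => (Lu k).1)).
have -> : (\sum_k nsq mu2 (comp u k) = (snrm u ^+ 2)%:E)%E.
  by rewrite snrm_sq -sumEFin; apply: eq_bigr => k _; rewrite (nrm_sq (Lu k)).
have s0 := snrm_ge0 u; rewrite poweR_EFin; congr EFin.
by rewrite -powR_mulrn// -powRrM mulfV// powRr1.
Qed.

Lemma spinor_norm2_ltyP u : (forall k, cmeas (comp u k)) -> (spinor_norm2 u < +oo)%E -> SL2 u.
Proof.
move=> mu; rewrite spinor_norm2E (integral_spinor_norm mu) => h k; split; first exact: mu.
have le : (nsq mu2 (comp u k) <= \sum_k nsq mu2 (comp u k))%E.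
  by rewrite (bigD1 k)//= leeDl// sume_ge0// => j _; exact: nsq_ge0.
apply: le_lt_trans le _; move: h.
have : (0 <= \sum_k nsq mu2 (comp u k))%E by apply: sume_ge0 => j _; exact: nsq_ge0.
case: (\sum_k _)%E => [r _ _|_|//]; first by rewrite ltry.
by rewrite poweRyr ?invr_neq0// ltxx.
Qed.

Lemma spinor_in_L2P u : spinor_in_L2 u <-> SL2 u.
Proof.
split=> [[mu uoo]|Lu]; first exact: spinor_norm2_ltyP.
by split=> [k|]; [exact: (Lu k).1|rewrite spinor_norm2_snrm// ltry].
Qed.

Lemma spinor_dotE (a b : spinor) : spinor_dot a b = \sum_k a k 0 * (b k 0)^*.
Proof. by []. Qed.

Lemma cintegrable_sip u v : SL2 u -> SL2 v -> cintegrable mu2 (fun xi => spinor_dot (u xi) (v xi)).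
Proof.
move=> Lu Lv; have := cintegrableD (cintegrable_ip (Lu 0) (Lv 0)) (cintegrable_ip (Lu 1) (Lv 1)).
rewrite (_ : (fun x => _) = fun xi => spinor_dot (u xi) (v xi))//.
by apply/funext => xi; rewrite spinor_dotE sum_ord2.
Qed.

Lemma sipE u v : SL2 u -> SL2 v -> sip u v = \sum_k ip mu2 (comp u k) (comp v k).
Proof.
move=> Lu Lv; rewrite sum_ord2 /sip.
apply: (etrans _ (cintD (cintegrable_ip (Lu 0) (Lv 0)) (cintegrable_ip (Lu 1) (Lv 1)))).
by apply: eq_cint => xi; rewrite spinor_dotE sum_ord2.
Qed.

Lemma sip_same u : SL2 u -> sip u u = (snrm u ^+ 2)%:C.
Proof.
move=> Lu; rewrite sipE// snrm_sq !sum_ord2 rmorphD/=.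
by rewrite (ip_same (Lu 0)) (ip_same (Lu 1)).
Qed.

Lemma normc_sip_le u v : SL2 u -> SL2 v -> normc (sip u v) <= snrm u * snrm v.
Proof.
move=> Lu Lv; rewrite sipE//; apply: le_trans (normc_sum _ _ _) _; rewrite sum_ord2.
have h k := normc_ip_le (Lu k) (Lv k).
apply: le_trans (lerD (h 0) (h 1)) _.
have n0 k (a : plane -> spinor) : 0 <= nrm mu2 (comp a k) by exact: nrm_ge0.
have := (n0 0 u, n0 1 u, n0 0 v, n0 1 v).
have := snrm_sq u; have := snrm_sq v; rewrite !sum_ord2.
move: (nrm _ (comp u 0)) (nrm _ (comp u 1)) (nrm _ (comp v 0)) (nrm _ (comp v 1)) => a b c d.
have := (snrm_ge0 u, snrm_ge0 v); move: (snrm u) (snrm v) => s t [s0 t0] tE sE [[[a0 b0] c0] d0].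
have h1 : 0 <= a * c + b * d by rewrite addr_ge0 ?mulr_ge0.
rewrite -(ler_sqrE h1 (mulr_ge0 s0 t0)).
have -> : (s * t) ^+ 2 = s ^+ 2 * t ^+ 2 by ring.
rewrite tE sE; have := sqr_ge0 (a * d - b * c); nra.
Qed.

Lemma SL2B u v : SL2 u -> SL2 v -> SL2 (fun x => u x - v x).
Proof.
move=> Lu Lv k; have := L2B (Lu k) (Lv k).
rewrite (_ : (fun x => _) = comp (fun x => u x - v x) k)//.
by apply/funext => x; rewrite /comp !mxE.
Qed.

Lemma compB u v k : comp (fun x => u x - v x) k = fun x => comp u k x - comp v k x.
Proof. by apply/funext => x; rewrite /comp !mxE. Qed.

Lemma SL2D u v : SL2 u -> SL2 v -> SL2 (fun x => u x + v x).
Proof.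
move=> Lu Lv k; have := L2D (Lu k) (Lv k).
rewrite (_ : (fun x => _) = comp (fun x => u x + v x) k)//.
by apply/funext => x; rewrite /comp !mxE.
Qed.

Lemma SL2Zl (c : R[i]) u : SL2 u -> SL2 (fun x => c *: u x).
Proof.
move=> Lu k; have := L2Zl c (Lu k).
rewrite (_ : (fun x => _) = comp (fun x => c *: u x) k)//.
by apply/funext => x; rewrite /comp !mxE.
Qed.

Lemma SL2_0 : SL2 (fun=> 0).
Proof.
move=> k; have := @L2_0 _ _ _ (@mu2 R).
rewrite (_ : (fun=> 0) = comp (fun=> 0) k)//.
by apply/funext => x; rewrite /comp !mxE.
Qed.

Lemma spinor_dotDl (a b c : spinor) : spinor_dot (a + b) c = spinor_dot a c + spinor_dot b c.
Proof. by rewrite !spinor_dotE -big_split/=; apply: eq_bigr => k _; rewrite mxE mulrDl. Qed.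

Lemma spinor_dotZl (z : R[i]) (a c : spinor) : spinor_dot (z *: a) c = z * spinor_dot a c.
Proof. by rewrite !spinor_dotE mulr_sumr; apply: eq_bigr => k _; rewrite mxE mulrA. Qed.

Lemma spinor_dot_conj (a c : spinor) : (spinor_dot a c)^* = spinor_dot c a.
Proof.
rewrite !spinor_dotE !sum_ord2 conjcD !conjcM !conjcKK.
by congr (_ + _); rewrite mulrC.
Qed.

Lemma spinor_dotBl (a b c : spinor) : spinor_dot (a - b) c = spinor_dot a c - spinor_dot b c.
Proof. by rewrite -scaleN1r spinor_dotDl spinor_dotZl mulN1r. Qed.

Lemma spinor_dotBr (a b c : spinor) : spinor_dot c (a - b) = spinor_dot c a - spinor_dot c b.
Proof. by rewrite -!(spinor_dot_conj _ c) spinor_dotBl conjcB. Qed.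

Lemma sipDl u v a : SL2 u -> SL2 v -> SL2 a -> sip (fun x => u x + v x) a = sip u a + sip v a.
Proof.
move=> Lu Lv La; rewrite /sip -(cintD (cintegrable_sip Lu La) (cintegrable_sip Lv La)).
by apply: eq_cint => x; rewrite spinor_dotDl.
Qed.

Lemma sipBl u v a : SL2 u -> SL2 v -> SL2 a -> sip (fun x => u x - v x) a = sip u a - sip v a.
Proof.
move=> Lu Lv La; rewrite /sip -(cintB (cintegrable_sip Lu La) (cintegrable_sip Lv La)).
by apply: eq_cint => x; rewrite spinor_dotBl.
Qed.

Lemma sipBr u v a : SL2 u -> SL2 v -> SL2 a -> sip a (fun x => u x - v x) = sip a u - sip a v.
Proof.
move=> Lu Lv La; rewrite /sip -(cintB (cintegrable_sip La Lu) (cintegrable_sip La Lv)).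
by apply: eq_cint => x; rewrite spinor_dotBr.
Qed.

Lemma sipZl (z : R[i]) u a : SL2 u -> SL2 a -> sip (fun x => z *: u x) a = z * sip u a.
Proof.
move=> Lu La; rewrite /sip -(cintZl z (cintegrable_sip Lu La)).
by apply: eq_cint => x; rewrite spinor_dotZl.
Qed.

Lemma sip_conj u v : SL2 u -> SL2 v -> (sip u v)^* = sip v u.
Proof.
move=> Lu Lv; rewrite /sip -(cint_conj (cintegrable_sip Lu Lv)).
by apply: eq_cint => x; rewrite spinor_dot_conj.
Qed.

Lemma ae_eq_sip u v a : SL2 u -> SL2 v -> SL2 a -> {ae mu2, forall x, u x = v x} ->
  sip u a = sip v a.
Proof.
move=> Lu Lv La uv.
apply: (ae_eq_cint (cintegrable_sip Lu La).1 (cintegrable_sip Lv La).1).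
by apply: filterS uv => x ->.
Qed.

Lemma snrm_distC u v : snrm (fun x => u x - v x) = snrm (fun x => v x - u x).
Proof.
rewrite /snrm; congr Num.sqrt; apply: eq_bigr => k _; congr (_ ^+ 2).
by rewrite !compB nrm_distC.
Qed.

(** Expand [|u|^2 = Re <u, v> + Re <u, u - v>], estimate both terms by Cauchy-Schwarz and divide by
    [|u|]. *)
Lemma snrm_le_dist u v : SL2 u -> SL2 v -> snrm u <= snrm v + snrm (fun x => u x - v x).
Proof.
move=> Lu Lv; have LB := SL2B Lu Lv.
have s0 := snrm_ge0 u; have s1 := snrm_ge0 v; have s2 := snrm_ge0 (fun x => u x - v x).
have e : snrm u ^+ 2 = complex.Re (sip u v) + complex.Re (sip u (fun x => u x - v x)).
  by rewrite (sipBr Lu Lv Lu) (sip_same Lu) ReD ReN Re_realC addrC subrK.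
have h1 := le_trans (le_trans (ler_norm _) (ler_Re_normc _)) (normc_sip_le Lu Lv).
have h2 := le_trans (le_trans (ler_norm _) (ler_Re_normc _)) (normc_sip_le Lu LB).
rewrite leNgt; apply/negP => hlt.
have hu : 0 < snrm u by apply: le_lt_trans hlt; exact: addr_ge0.
have := ltr_pM2l hu (snrm v + snrm (fun x => u x - v x)) (snrm u); rewrite hlt mulrDr -expr2 e.
by move/lt_le_trans => /(_ _ (lerD h1 h2)); rewrite ltxx.
Qed.

Lemma SL2_wmul w c u : measurable_fun setT w -> (forall x, `|w x| <= c) -> SL2 u -> SL2 (wmul w u).
Proof.
move=> mw wc Lu k; have := L2_real_mul mw wc (Lu k).
rewrite (_ : (fun x => _) = comp (wmul w u) k)//.
by apply/funext => x; rewrite /comp /wmul mxE.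
Qed.

Lemma sip_wmul w u v : sip (wmul w u) v = sip u (wmul w v).
Proof.
apply: eq_cint => x; rewrite !spinor_dotE; apply: eq_bigr => k _.
by rewrite !mxE conjcM conjc_real mulrAC mulrC mulrA.
Qed.

Lemma snrm_wmul_le w c u : measurable_fun setT w -> (forall x, `|w x| <= c) -> SL2 u ->
  snrm (wmul w u) <= c * snrm u.
Proof.
move=> mw wc Lu; have Lw := SL2_wmul mw wc Lu.
have c0 : 0 <= c by exact: le_trans (normr_ge0 _) (wc (0, 0)).
rewrite -(ler_sqrE (snrm_ge0 _) (mulr_ge0 c0 (snrm_ge0 _))).
have -> : (c * snrm u) ^+ 2 = c ^+ 2 * snrm u ^+ 2 by ring.
rewrite !snrm_sq mulr_sumr; apply: ler_sum => k _.
have -> : c ^+ 2 * nrm mu2 (comp u k) ^+ 2 = (c * nrm mu2 (comp u k)) ^+ 2 by ring.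
rewrite (ler_sqrE (nrm_ge0 _ _) (mulr_ge0 c0 (nrm_ge0 _ _))).
apply: (nrm_le_mul (Lw k) (Lu k) c0) => x; rewrite /comp /wmul mxE normcM normc_real.
by apply: ler_wpM2r; [exact: normc_ge0|exact: wc].
Qed.

Lemma comp_fourier u k : comp (spinor_fourier u) k = fourier (comp u k).
Proof. by apply/funext => x; rewrite /comp mxE. Qed.

Lemma comp_inv_fourier u k : comp (spinor_inv_fourier u) k = inv_fourier (comp u k).
Proof. by apply/funext => x; rewrite /comp mxE. Qed.

Lemma SL2_fourier u : SL2 u -> SL2 (spinor_fourier u).
Proof. by move=> Lu k; rewrite comp_fourier; exact: L2_fourier. Qed.

Lemma SL2_inv_fourier u : SL2 u -> SL2 (spinor_inv_fourier u).
Proof. by move=> Lu k; rewrite comp_inv_fourier; exact: L2_inv_fourier. Qed.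

Lemma sip_fourier_adjoint u v : SL2 u -> SL2 v ->
  sip (spinor_fourier u) v = sip u (spinor_inv_fourier v).
Proof.
move=> Lu Lv; rewrite (sipE (SL2_fourier Lu) Lv) (sipE Lu (SL2_inv_fourier Lv)).
by apply: eq_bigr => k _; rewrite comp_fourier comp_inv_fourier fourier_adjoint.
Qed.

Lemma sip_inv_fourier u v : SL2 u -> SL2 v ->
  sip (spinor_inv_fourier u) (spinor_inv_fourier v) = sip u v.
Proof.
move=> Lu Lv; have LFu := SL2_inv_fourier Lu.
rewrite -(sip_fourier_adjoint LFu Lv) (sipE (SL2_fourier LFu) Lv) (sipE Lu Lv).
apply: eq_bigr => k _; rewrite comp_fourier comp_inv_fourier.
apply: (ae_eq_ip (L2_fourier (L2_inv_fourier (Lu k))).1 (Lu k).1 (Lv k).1 (Lv k).1).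
  exact: fourier_inv_fourier.
exact: aeW.
Qed.

Lemma snrm_fourier u : SL2 u -> snrm (spinor_fourier u) = snrm u.
Proof.
move=> Lu; rewrite /snrm; congr Num.sqrt; apply: eq_bigr => k _.
by rewrite comp_fourier nrm_fourier.
Qed.

End SpinorHilbert.
Arguments sip : simpl never.
Arguments snrm : simpl never.

Opaque propagator.

Section SpinorPropagator.
Context {R : realType}.
Local Notation plane := (@plane R).
Local Notation spinor := (@spinor R).
Variable m : R.
Hypothesis m0 : 0 < m.
Implicit Types (u v a : plane -> spinor) (w : plane -> R) (k : 'I_2) (t s : R).

Definition evolve t u : plane -> spinor := fun xi => propagator m t xi *m u xi.

(** The rows of a unitary matrix have norm 1. *)
Lemma normc_propagator_le1 t xi i j : normc (propagator m t xi i j) <= 1.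
Proof.
have adj l : propagator m (- t) xi l i = (propagator m t xi i l)^*.
  exact: esym (propagator_adjoint m t xi i l).
have : propagator m t xi *m propagator m (- t) xi = 1%:M.
  by rewrite (propagator_group m0) subrr propagator0.
move: (propagator m t xi) (propagator m (- t) xi) adj => P Q adj.
move=> /matrixP/(_ i i); rewrite mxE mxE eqxx.
under eq_bigr => l _ do rewrite adj mulc_conj.
rewrite -(rmorph_sum (real_complex R)) => /(congr1 (@complex.Re R)) /= e.
rewrite -(ler_sqrE (normc_ge0 _) ler01) expr1n -e (bigD1 j)//= lerDl.
by apply: sumr_ge0 => l _; exact: sqr_ge0.
Qed.

Lemma SL2_evolve t u : SL2 u -> SL2 (evolve t u).
Proof.
move=> Lu k; rewrite (_ : comp _ k = fun xi => \sum_j propagator m t xi k j * comp u j xi); last first.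
  by apply/funext => xi; rewrite /comp /evolve mxE.
apply: L2_sum => j; apply: (L2Ml (c := 1) _ _ (Lu j)).
  exact: cmeas_propagator.
by move=> x; exact: normc_propagator_le1.
Qed.

Lemma spinor_dot_propagator t xi (a c : spinor) :
  spinor_dot (propagator m t xi *m a) c = spinor_dot a (propagator m (- t) xi *m c).
Proof.
have adj i l : propagator m (- t) xi l i = (propagator m t xi i l)^*.
  exact: esym (propagator_adjoint m t xi i l).
move: (propagator m t xi) (propagator m (- t) xi) adj => P Q adj.
rewrite !spinor_dotE !sum_ord2 !mxE !sum_ord2 !adj !conjcD !conjcM !conjcKK.
by rewrite !mulrDl !mulrDr addrACA; congr (_ + _ + (_ + _)); rewrite mulrCA mulrA.
Qed.

Lemma sip_evolve t u v : sip (evolve t u) v = sip u (evolve (- t) v).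
Proof. by apply: eq_cint => xi; rewrite spinor_dot_propagator. Qed.

Lemma evolveD s t u : evolve s (evolve t u) = evolve (s + t) u.
Proof.
apply/funext => xi; apply: (etrans (mulmxA _ _ _)).
exact: (congr1 (fun P => P *m u xi) (propagator_group m0 s t xi)).
Qed.

Lemma evolve0 u : evolve 0 u = u.
Proof. by apply/funext => xi; rewrite /evolve propagator0 mul1mx. Qed.

Lemma evolve_wmul t w u : evolve t (wmul w u) = wmul w (evolve t u).
Proof. by apply/funext => xi; rewrite /evolve /wmul -scalemxAr. Qed.

Lemma sip_evolve2 t u v : sip (evolve t u) (evolve t v) = sip u v.
Proof. by rewrite sip_evolve evolveD addNr evolve0. Qed.

Lemma snrm_evolve t u : SL2 u -> snrm (evolve t u) = snrm u.
Proof.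
move=> Lu; have /(congr1 (@complex.Re R)) : sip (evolve t u) (evolve t u) = sip u u by exact: sip_evolve2.
rewrite (sip_same Lu) (sip_same (SL2_evolve t Lu)) !Re_realC => h.
by apply/le_anti; rewrite -!(ler_sqrE (snrm_ge0 _) (snrm_ge0 _)) h lexx.
Qed.

Lemma dirac_groupE t u : dirac_group m t u = spinor_inv_fourier (evolve t (spinor_fourier u)).
Proof.
rewrite /dirac_group; congr spinor_inv_fourier.
by apply/funext => xi; rewrite (expmx_dirac m0).
Qed.

Lemma SL2_dirac_group t u : SL2 u -> SL2 (dirac_group m t u).
Proof.
by move=> Lu; rewrite dirac_groupE; apply: SL2_inv_fourier; apply: SL2_evolve; exact: SL2_fourier.
Qed.

(** Testing against the free evolution of [a] cancels one of the two evolutions. For [s = t - tau]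
    the remaining time is [- tau], so Duhamel integrals with different [t] have the same
    integrand. *)
Lemma dirac_group_pairing s t u a : SL2 u -> SL2 a ->
  sip (dirac_group m s u) (spinor_inv_fourier (evolve t a)) =
  sip (evolve (s - t) (spinor_fourier u)) a.
Proof.
move=> Lu La; rewrite dirac_groupE sip_inv_fourier; [|exact: SL2_evolve (SL2_fourier Lu)|exact: SL2_evolve].
have e := sip_evolve (- t) (evolve s (spinor_fourier u)) a; rewrite opprK evolveD in e.
by rewrite (addrC s (- t)); exact: esym e.
Qed.

End SpinorPropagator.

Section SpinorEnergy.
Context {R : realType}.
Local Notation plane := (@plane R).
Local Notation spinor := (@spinor R).
Implicit Types (u v a : plane -> spinor) (w : plane -> R) (k : 'I_2).

Definition senergy u : \bar R := (\sum_k energy (comp u k))%E.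

(** Bounded, so that multiplication by it preserves L^2, and 1-Lipschitz for every [n], so that the
    commutator bound survives the limit. *)
Definition lam_cut (n : nat) (xi : plane) : R := Num.min (lam xi) n%:R.

Lemma lam_cut_ge0 n xi : 0 <= lam_cut n xi.
Proof. by rewrite le_min lam_ge0 ler0n. Qed.

Lemma lam_cut_bound n xi : `|lam_cut n xi| <= n%:R.
Proof. by rewrite (ger0_norm (lam_cut_ge0 n xi)) ge_min lexx orbT. Qed.

Lemma measurable_lam_cut n : measurable_fun setT (lam_cut n).
Proof. by apply: measurable_minr; [exact: measurable_lam|exact: measurable_cst]. Qed.

Lemma lam_cut_lipschitz n (x y : plane) : `|lam_cut n x - lam_cut n y| <= 1 * norm1 (psub x y).
Proof.
rewrite mul1r; apply: le_trans (lam_lipschitz x y); rewrite /lam_cut.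
move: (lam x) (lam y) => a c; rewrite /Num.min.
case: ltP => h1; case: ltP => h2; rewrite ler_norml; apply/andP; split;
  have := ler_norm (a - c); have := ler_norm (c - a); rewrite -normrN opprB; lra.
Qed.

Lemma sip_wmul_same w c u : measurable_fun setT w -> (forall xi, 0 <= w xi) ->
  (forall xi, `|w xi| <= c) -> SL2 u ->
  ((complex.Re (sip (wmul w u) u))%:E =
   \sum_k \int[mu2]_xi (w xi * normc (comp u k xi) ^+ 2)%:E)%E.
Proof.
move=> mw w0 wc Lu; have Lw := SL2_wmul mw wc Lu.
rewrite (sipE Lw Lu) (raddf_sum (@complex.Re R : {additive _ -> _})) -sumEFin.
apply: eq_bigr => k _.
have ci := cintegrable_ip (Lw k) (Lu k).
have e xi : comp (wmul w u) k xi * (comp u k xi)^* = (w xi * normc (comp u k xi) ^+ 2)%:C.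
  by rewrite /comp /wmul mxE -mulrA mulc_conj -rmorphM.
rewrite /ip /cint /= /Rintegral fineK; last first.
  by have := integrable_fin_num measurableT (cintegrable_Re ci); apply.
by apply: eq_integral => xi _; rewrite e.
Qed.

Lemma cvg_lam_cut (xi : plane) : lam_cut n xi @[n --> \oo] --> lam xi.
Proof.
have h : \forall n \near \oo, lam xi <= n%:R by exact: nbhs_infty_ger.
by apply: cvg_near_cst; apply: filterS h => n hn; rewrite /lam_cut; apply/min_idPl.
Qed.

(** Fatou's lemma as [n] tends to infinity. *)
Lemma senergy_le_cut u (c : R) : SL2 u ->
  (forall n, complex.Re (sip (wmul (lam_cut n) u) u) <= c) -> (senergy u <= c%:E)%E.
Proof.
move=> Lu hc; pose h_ n xi := lam_cut n xi * (\sum_k normc (comp u k xi) ^+ 2).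
pose h xi := lam xi * (\sum_k normc (comp u k xi) ^+ 2).
have ms : measurable_fun setT (fun xi => \sum_k normc (comp u k xi) ^+ 2).
  apply: measurable_sum => k; have /measurable_EFinP := measurable_sqnormc (Lu k).1; exact.
have s0 xi : 0 <= \sum_k normc (comp u k xi) ^+ 2 by apply: sumr_ge0 => k _; exact: sqr_ge0.
have sE (w : plane -> R) : measurable_fun setT w -> (forall xi, 0 <= w xi) ->
   (\int[mu2]_xi (w xi * (\sum_k normc (comp u k xi) ^+ 2))%:E =
    \sum_k \int[mu2]_xi (w xi * normc (comp u k xi) ^+ 2)%:E)%E.
  move=> mw w0.
  have mk k : measurable_fun setT (fun xi => (w xi * normc (comp u k xi) ^+ 2)%:E).
    apply/measurable_EFinP; apply: (measurable_funM mw).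
    by have /measurable_EFinP := measurable_sqnormc (Lu k).1.
  have k0 k xi : (setT xi -> 0 <= (w xi * normc (comp u k xi) ^+ 2)%:E)%E.
    by move=> _; rewrite lee_fin; apply: mulr_ge0 => //; exact: sqr_ge0.
  rewrite -(ge0_integral_sum mu2 measurableT mk k0).
  by apply: eq_integral => xi _; rewrite sumEFin mulr_sumr.
rewrite /senergy /energy -(sE _ (@measurable_lam R) (@lam_ge0 R)).
apply: (@fatou_le _ _ _ mu2 h_ h).
- by move=> n; apply: measurable_funM ms; exact: measurable_lam_cut.
- by move=> n xi; apply: mulr_ge0 => //; exact: lam_cut_ge0.
- by apply: aeW => xi; apply: cvgMr_tmp; exact: cvg_lam_cut.
- by apply: measurable_funM ms; exact: measurable_lam.
- by move=> xi; apply: mulr_ge0 => //; exact: lam_ge0.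
- apply: nearW => n; rewrite (sE _ (measurable_lam_cut n) (lam_cut_ge0 n)).
  rewrite -(sip_wmul_same (measurable_lam_cut n) (lam_cut_ge0 n) (lam_cut_bound n) Lu).
  by rewrite lee_fin.
Qed.

Lemma sip_cut_le u n : SL2 u ->
  ((complex.Re (sip (wmul (lam_cut n) u) u))%:E <= senergy u)%E.
Proof.
move=> Lu; rewrite (sip_wmul_same (measurable_lam_cut n) (lam_cut_ge0 n) (lam_cut_bound n) Lu).
apply: lee_sum => k _; apply: (ge0_le_integral _ measurableT) => [x _||| x _].
- by rewrite lee_fin; apply: mulr_ge0; [exact: lam_cut_ge0|exact: sqr_ge0].
- apply/measurable_EFinP; apply: (measurable_funM (measurable_lam_cut n)).
  by have /measurable_EFinP := measurable_sqnormc (Lu k).1.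
- apply/measurable_EFinP; apply: (measurable_funM (@measurable_lam R)).
  by have /measurable_EFinP := measurable_sqnormc (Lu k).1.
- by rewrite lee_fin; apply: ler_wpM2r; [exact: sqr_ge0|rewrite ge_min lexx].
Qed.

End SpinorEnergy.

(** * Integration in time *)

Section TimeIntegration.
Context {R : realType}.
Local Notation leb := (@lebesgue_measure R).
Local Notation plane := (@plane R).
Local Notation spinor := (@spinor R).
Implicit Types (q r : R -> R) (e : R -> \bar R).

Lemma Rintegral_le_ereal (D : set (measurableTypeR R)) r e : measurable D ->
  leb.-integrable D (EFin \o r) -> measurable_fun D e -> (forall x, D x -> (0 <= e x)%E) ->
  (forall x, D x -> ((r x)%:E <= e x)%E) ->
  ((\int[leb]_(x in D) r x)%R%:E <= \int[leb]_(x in D) e x)%E.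
Proof.
move=> mD ri me e0 re.
have I0 : (0 <= \int[leb]_(x in D) e x)%E by exact: integral_ge0.
have [oo|fin] := eqVneq (\int[leb]_(x in D) e x)%E +oo%E; first by rewrite oo leey.
have ei : leb.-integrable D e.
  apply/integrableP; split => //.
  have -> : (\int[leb]_(x in D) `|e x| = \int[leb]_(x in D) e x)%E.
    by apply: eq_integral => x /set_mem Dx; rewrite gee0_abs// e0.
  by rewrite ltey.
rewrite /Rintegral fineK; last by exact: integrable_fin_num.
by apply: le_integral => // x /set_mem Dx; exact: re.
Qed.

(* [I] is the integral over [0, t] of [q]; the approximants are integrable but
   nothing is required of [q] itself. *)
Definition time_primitive (t : R) q (I : R) : Prop := exists (r : nat -> R -> R) (e : nat -> R -> \bar R),
  [/\ forall n, leb.-integrable `[0, t] (EFin \o r n),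
      forall n, measurable_fun (`[0, t] : set (measurableTypeR R)) (e n),
      forall n tau, 0 <= tau <= t -> (`|q tau - r n tau|%:E <= e n tau)%E,
      forall eps : R, 0 < eps -> \forall n \near \oo, (\int[leb]_(tau in `[0%R, t]) e n tau <= eps%:E)%E &
      (\int[leb]_(tau in `[0%R, t]) r n tau)%R @[n --> \oo] --> I].

Lemma time_primitive0 q I : time_primitive 0 q I -> I = 0.
Proof.
move=> [r [e [_ _ _ _ rI]]]; apply: (cvg_unique (@Rhausdorff R) rI).
have -> : (fun n => \int[leb]_(tau in `[0%R, 0]) r n tau)%R = fun=> 0.
  by apply/funext => n; rewrite set_itv1 Rintegral_set1.
exact: cvg_cst.
Qed.

(** The two primitives come with unrelated approximants. On [[0, s]] both are close to [q], so their
    integrals almost cancel; on []s, t]] the approximant of the longer primitive is at most [c] plus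
    its error. *)
Lemma time_primitive_incr_le s t q Is It c : 0 <= s -> s <= t ->
  time_primitive s q Is -> time_primitive t q It ->
  (forall tau, s <= tau <= t -> q tau <= c) -> It - Is <= c * (t - s).
Proof.
move=> s0 st [rs [es [rsi mes rse es0 rsI]]] [rt [et [rti met rte et0 rtI]]] qc.
have st0 : 0 <= t := le_trans s0 st.
pose D := `[0, s]%classic : set (measurableTypeR R).
pose E := `[0, t]%classic : set (measurableTypeR R).
pose D' := `]s, t]%classic : set (measurableTypeR R).
have mD : measurable D by exact: measurable_itv.
have mE : measurable E by exact: measurable_itv.
have mD' : measurable D' by exact: measurable_itv.
have DE : D `<=` E.
  by move=> x; rewrite /D /E /= !in_itv/= => /andP[-> /le_trans]; exact.
have D'E : D' `<=` E.
  move=> x; rewrite /D' /E /= !in_itv/= => /andP[sx ->]; rewrite andbT.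
  exact: ltW (le_lt_trans s0 sx).
have et_ge0 n x : E x -> (0 <= et n x)%E.
  rewrite /E /= in_itv/= => h; apply: le_trans (rte n x h).
  by rewrite lee_fin.
have es_ge0 n x : D x -> (0 <= es n x)%E.
  rewrite /D /= in_itv/= => h; apply: le_trans (rse n x h).
  by rewrite lee_fin.
have rtD n : leb.-integrable D (EFin \o rt n) := integrableS mE mD DE (rti n).
have rtD' n : leb.-integrable D' (EFin \o rt n) := integrableS mE mD' D'E (rti n).
have split_t n : (\int[leb]_(x in E) rt n x = \int[leb]_(x in D) rt n x + \int[leb]_(x in D') rt n x)%R.
  have := @Rintegral_itvB R (rt n) (BLeft 0) (BRight t) s (rti n).
  rewrite !bnd_simp => /(_ s0 st) h; rewrite -[RHS]addrC; apply/eqP; rewrite -subr_eq; exact/eqP.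
have lD' : leb D' = (t - s)%:E.
  rewrite /D' lebesgue_measure_itv/= lte_fin -EFinB; case: ltP => //= ts.
  by congr EFin; apply/eqP; rewrite eq_sym subr_eq0 eq_le ts st.
(* Two errors arise on [[0, s]] and one on []s, t]]. *)
have key (eps : R) : 0 < eps -> It - Is <= c * (t - s) + 3 * eps.
  move=> eps0.
  have cv : ((\int[leb]_(x in E) rt n x)%R - (\int[leb]_(x in D) rs n x)%R)
      @[n --> \oo] --> It - Is by exact: cvgB.
  apply: (cvgr_to_le cv).
  apply: filterS2 (et0 _ eps0) (es0 _ eps0) => n hE hD.
  have meD : measurable_fun D (et n) := measurable_funS mE DE (met n).
  have meD' : measurable_fun D' (et n) := measurable_funS mE D'E (met n).
  have h1 : (\int[leb]_(x in D) rt n x - \int[leb]_(x in D) rs n x)%R <= 2 * eps.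
    rewrite -RintegralB// -lee_fin.
    apply: (@le_trans _ _ (\int[leb]_(x in D) (et n x + es n x))%E).
      apply: Rintegral_le_ereal => //.
      - by have := integrableB mD (rtD n) (rsi n); apply: eq_integrable.
      - exact: emeasurable_funD.
      - by move=> x Dx; apply: adde_ge0; [exact: et_ge0 (DE _ Dx)|exact: es_ge0].
      - move=> x Dx; have := rse n x; have := rte n x.
        have := DE _ Dx; move: (Dx); rewrite /D /E /= !in_itv /= => d1 d2 => /(_ d2) a1 /(_ d1) a2.
        apply: le_trans (leeD a1 a2); rewrite -EFinD lee_fin.
        have := ler_norm (q x - rs n x); have := ler_norm (rt n x - q x); rewrite distrC; lra.
    rewrite ge0_integralD//; [|by move=> x /DE; exact: et_ge0|exact: es_ge0].
    have -> : 2 * eps = eps + eps by ring.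
    rewrite EFinD; apply: leeD => //; apply: le_trans hE.
    by apply: ge0_subset_integral => //; exact: et_ge0.
  have ci : leb.-integrable D' (EFin \o cst c).
    apply/integrableP; split; first by apply/measurable_EFinP; exact: measurable_cst.
    rewrite (_ : (fun x => _) = cst `|c|%:E); last by apply/funext => x.
    have e := integral_cst leb mD' `|c|%:E.
    have e' : (`|c|%:E * leb D')%E = (`|c| * (t - s))%:E by rewrite lD'.
    by rewrite (etrans e e') ltry.
  have h2 : (\int[leb]_(x in D') rt n x)%R <= c * (t - s) + eps.
    rewrite -lerBlDl.
    have -> : c * (t - s) = (\int[leb]_(x in D') cst c x)%R.
      have e := Rintegral_cst leb mD' c.
      have e' : c * fine (leb D') = c * (t - s) by rewrite lD'.
      exact: esym (etrans e e').
    rewrite -RintegralB// -lee_fin.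
    apply: (@le_trans _ _ (\int[leb]_(x in D') et n x)%E).
      apply: Rintegral_le_ereal => //.
      - by have := integrableB mD' (rtD' n) ci; apply: eq_integrable.
      - by move=> x /D'E; exact: et_ge0.
      - move=> x Dx; have := rte n x; have := D'E _ Dx; have := qc x.
        move: Dx; rewrite /D' /E /= !in_itv/= => /andP[/ltW sx xt].
        rewrite sx xt /= => /(_ isT) qx ex /(_ ex); apply: le_trans; rewrite lee_fin.
        by have := ler_norm (rt n x - q x); rewrite distrC; lra.
    by apply: le_trans hE; apply: ge0_subset_integral => //; exact: et_ge0.
  have := split_t n; rewrite /E /D => ->; move: h1 h2; rewrite /D /D'; lra.
apply: le_epsilon_nrm => eps eps0.
have e3 : 0 < eps / 3 by rewrite divr_gt0.
by have := key _ e3; rewrite mulrCA mulfV ?mulr1// pnatr_eq0.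
Qed.

End TimeIntegration.

Section BochnerPairing.
Context {R : realType}.
Local Notation leb := (@lebesgue_measure R).
Local Notation plane := (@plane R).
Local Notation spinor := (@spinor R).
Implicit Types (u v a : plane -> spinor) (s : @step R) (t : R).

(** Includes the factor [i] in front of Duhamel's integral; taking the real part keeps the
    functional linear over the reals, which is all that step functions require. *)
Definition ipair u a : R := complex.Re ('i * sip u a).

Lemma ipair_le u a : SL2 u -> SL2 a -> `|ipair u a| <= snrm u * snrm a.
Proof.
move=> Lu La; apply: le_trans (normc_sip_le Lu La).
apply: le_trans (ler_Re_normc _) _; rewrite normcM.
by rewrite /= expr0n expr1n add0r sqrtr1 mul1r.
Qed.

Lemma ipairB u v a : SL2 u -> SL2 v -> SL2 a ->
  ipair (fun x => u x - v x) a = ipair u a - ipair v a.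
Proof. by move=> Lu Lv La; rewrite /ipair sipBl// mulrBr ReD ReN. Qed.

Lemma ipair_real_comb (c : R) u v a : SL2 u -> SL2 v -> SL2 a ->
  ipair (fun x => c%:C *: u x + v x) a = c * ipair u a + ipair v a.
Proof.
move=> Lu Lv La; rewrite /ipair sipDl//; last exact: SL2Zl.
rewrite sipZl// mulrDr ReD; congr (_ + _).
by rewrite mulrCA ReM Re_realC Im_realC mul0r subr0.
Qed.

Lemma SL2_step_fun s tau : is_step s -> SL2 (step_fun s tau).
Proof.
rewrite /step_fun; elim: s => [|p s IH] hs.
  by under [X in SL2 X]eq_fun do rewrite big_nil; exact: SL2_0.
under [X in SL2 X]eq_fun do rewrite big_cons.
apply: SL2D.
  by apply: SL2Zl; apply/spinor_in_L2P; have [] := hs p (mem_head _ _).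
by apply: IH => q qs; apply: hs; rewrite inE qs orbT.
Qed.

Lemma SL2_step_integral t s : is_step s -> SL2 (step_integral t s).
Proof.
rewrite /step_integral; elim: s => [|p s IH] hs.
  by under [X in SL2 X]eq_fun do rewrite big_nil; exact: SL2_0.
under [X in SL2 X]eq_fun do rewrite big_cons.
apply: SL2D.
  by apply: SL2Zl; apply/spinor_in_L2P; have [] := hs p (mem_head _ _).
by apply: IH => q qs; apply: hs; rewrite inE qs orbT.
Qed.

Lemma step_pairing t s a : 0 <= t -> is_step s -> SL2 a ->
  leb.-integrable `[0, t] (EFin \o (fun tau => ipair (step_fun s tau) a)) /\
  (\int[leb]_(tau in `[0%R, t]) ipair (step_fun s tau) a)%R = ipair (step_integral t s) a.
Proof.
move=> t0 + La; have mD : measurable (`[0, t]%classic : set (measurableTypeR R)).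
  exact: measurable_itv.
have i0 : ipair (fun=> 0) a = 0.
  have /eqP := ipair_le (@SL2_0 R) La; rewrite /ipair.
  have -> : sip (fun=> 0) a = 0.
    rewrite /sip -[RHS](cint0 (@mu2 R)); apply: eq_cint => x.
    by rewrite spinor_dotE big1// => k _; rewrite mxE mul0r.
  by rewrite mulr0.
elim: s => [|p s IH] hs.
  have -> : (fun tau => ipair (step_fun [::] tau) a) = fun=> 0.
    apply/funext => tau; rewrite -[RHS]i0; congr (ipair _ a).
    by apply/funext => x; rewrite /step_fun big_nil.
  split; first exact: integrable0.
  rewrite Rintegral_cst// mul0r -[LHS]i0; congr (ipair _ a).
  by apply/funext => x; rewrite /step_integral big_nil.
have hs' : is_step s by move=> q qs; apply: hs; rewrite inE qs orbT.
have [mA Lp] := hs p (mem_head _ _); move/spinor_in_L2P : Lp => Lp.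
have [ri rI] := IH hs'.
have E tau : ipair (step_fun (p :: s) tau) a =
    \1_(p.1) tau * ipair p.2 a + ipair (step_fun s tau) a.
  rewrite -(ipair_real_comb _ Lp (SL2_step_fun tau hs') La); congr (ipair _ a).
  by apply/funext => x; rewrite /step_fun big_cons.
have -> : (fun tau => ipair (step_fun (p :: s) tau) a) =
    (fun tau => \1_(p.1) tau * ipair p.2 a + ipair (step_fun s tau) a).
  by apply/funext => tau; rewrite E.
have lA : (leb (p.1 `&` `[0%R, t]) < +oo)%E.
  apply: (@le_lt_trans _ _ (leb `[0%R, t]%classic)).
    by apply: le_measure; rewrite ?inE; [exact: measurableI|exact: mD|exact: subIsetr].
  by rewrite lebesgue_measure_itv/=; case: ifP => _; rewrite ?ltry// -EFinB ltry.
have i1 : leb.-integrable `[0, t] (EFin \o (\1_(p.1) : R -> R)).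
  apply/integrableP; split.
    by apply/measurable_EFinP; apply: measurable_funTS; exact: measurable_indic.
  rewrite (_ : (\int[leb]_(x in _) _)%E = leb (p.1 `&` `[0%R, t]))//.
  rewrite -(integral_indic leb mD mA); apply: eq_integral => x _.
  by rewrite gee0_abs// lee_fin.
have i2 : leb.-integrable `[0, t] (EFin \o (fun tau => \1_(p.1) tau * ipair p.2 a)).
  have := integrableZr mD (ipair p.2 a) i1; apply: eq_integrable => //.
split.
  by have := integrableD mD i2 ri; apply: eq_integrable.
rewrite RintegralD// rI RintegralZr//.
rewrite -[RHS](_ : fine (leb (p.1 `&` `[0%R, t])) * ipair p.2 a + ipair (step_integral t s) a = _).
  congr (_ * _ + _); rewrite /Rintegral; congr fine.
  exact: (integral_indic leb mD mA).
rewrite -(ipair_real_comb _ Lp (SL2_step_integral t hs') La); congr (ipair _ a).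
by apply/funext => x; rewrite /step_integral big_cons.
Qed.

(** A bounded functional commutes with the Bochner integral: the step functions paired with [a] are
    the approximants, and pairing multiplies the errors by at most [snrm a]. *)
Lemma bochner_time_primitive t F v a : 0 <= t -> is_bochner_integral t F v -> SL2 a ->
  time_primitive t (fun tau => ipair (F tau) a) (ipair v a).
Proof.
move=> t0 [LF [Lv [s [hs me err0 sI]]]] La; move/spinor_in_L2P : Lv => Lv.
have LF' tau : 0 <= tau <= t -> SL2 (F tau) by move=> h; apply/spinor_in_L2P; exact: LF.
pose err n tau := spinor_norm2 (fun x => F tau x - step_fun (s n) tau x).
have a0 := snrm_ge0 a.
have mD : measurable (`[0, t]%classic : set (measurableTypeR R)) by exact: measurable_itv.
have err_ge0 n tau : (0 <= err n tau)%E by rewrite /err spinor_norm2E poweR_ge0.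
exists (fun n tau => ipair (step_fun (s n) tau) a), (fun n tau => (snrm a)%:E * err n tau)%E.
split.
- by move=> n; have [] := step_pairing t0 (hs n) La.
- by move=> n; apply: measurable_funeM; exact: me.
- move=> n tau ht; have L1 := LF' _ ht; have L2 := SL2_step_fun tau (hs n).
  rewrite -(ipairB L1 L2 La) /err (spinor_norm2_snrm (SL2B L1 L2)) -EFinM lee_fin mulrC.
  by apply: ipair_le => //; exact: SL2B.
(* The added 1 keeps the divisor positive when [a] vanishes. *)
- move=> eps eps0; have a1 : 0 < snrm a + 1 by exact: ltr_wpDl.
  have de : 0 < eps / (snrm a + 1) by rewrite divr_gt0.
  have := err0 => /fine_cvgP[fin /cvgrPdist_lt/(_ _ de) h].
  apply: filterS2 fin h => n fn hn.
  rewrite (ge0_integralZl_EFin leb mD (fun x _ => err_ge0 n x) (me n) a0).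
  have i0 : (0 <= \int[leb]_(x in `[0%R, t]) err n x)%E by apply: integral_ge0 => x _; exact: err_ge0.
  rewrite -(fineK fn) -EFinM lee_fin.
  have f0 : 0 <= fine (\int[leb]_(x in `[0%R, t]) err n x)%E by exact: fine_ge0.
  move: hn; rewrite /= sub0r normrN (ger0_norm f0) ltr_pdivlMr// => hn.
  apply: le_trans (ltW hn); rewrite mulrC; apply: ler_wpM2l => //; lra.
- under eq_fun do rewrite (step_pairing t0 (hs _) La).2.
  have Ls n := SL2_step_integral t (hs n).
  have h : snrm (fun x => step_integral t (s n) x - v x) @[n --> \oo] --> 0.
    have := sI; under eq_fun do rewrite (spinor_norm2_snrm (SL2B (Ls _) Lv)).
    by move/fine_cvgP => -[].
  apply/cvgrPdist_le => eps eps0; have a1 : 0 < snrm a + 1 by exact: ltr_wpDl.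
  have de : 0 < eps / (snrm a + 1) by rewrite divr_gt0.
  move/cvgrPdist_lt : h => /(_ _ de); apply: filterS => n.
  rewrite sub0r normrN (ger0_norm (snrm_ge0 _)) ltr_pdivlMr// => hn.
  rewrite distrC -(ipairB (Ls n) Lv La); apply: le_trans (ipair_le (SL2B (Ls n) Lv) La) _.
  apply: le_trans (ltW hn); apply: ler_wpM2l; [exact: snrm_ge0|lra].
Qed.

End BochnerPairing.

(** * The H^(1/2) norm and the Hartree term of a spinor field *)

Section SobolevHartree.
Context {R : realType}.
Local Notation plane := (@plane R).
Local Notation spinor := (@spinor R).
Implicit Types (u v : plane -> spinor) (w : plane -> R) (k : 'I_2).

(** The weight of [sobolev_norm] at [s = 1/2], with the exponent in the form which that definition
    produces; its square is [lam]. *)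
Definition lift_half u : plane -> spinor := fun xi => ((1 + dot xi xi) `^ (2^-1 / 2))%:C *: u xi.

Lemma comp_lift_half u k xi :
  comp (lift_half u) k xi = ((1 + dot xi xi) `^ (2^-1 / 2))%:C * comp u k xi.
Proof. by rewrite /comp mxE. Qed.

Lemma dot1_gt0 (xi : plane) : 0 < 1 + dot xi xi.
Proof. by rewrite ltr_pwDl// dot_ge0. Qed.

Lemma sqr_lift_half (xi : plane) : ((1 + dot xi xi) `^ (2^-1 / 2)) ^+ 2 = lam xi.
Proof.
have d0 := dot1_gt0 xi.
rewrite -powR_mulrn ?powR_ge0// -powRrM (_ : 2^-1 / 2 * 2%:R = 2^-1 :> R); last by field.
by rewrite powR12_sqrt// ltW.
Qed.

Lemma cmeas_lift_half u k : cmeas (comp u k) -> cmeas (comp (lift_half u) k).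
Proof.
move=> mu; rewrite (funext (comp_lift_half u k)).
apply: cmeasM mu; apply: cmeas_real; apply: (measurableT_comp (measurable_powR _)).
by apply: measurable_funD; [exact: measurable_cst|exact: measurable_sqdot].
Qed.

Lemma nsq_lift_half u k : nsq mu2 (comp (lift_half u) k) = energy (comp u k).
Proof.
apply: eq_integral => xi _; congr EFin; rewrite comp_lift_half normcM normc_real.
by rewrite (ger0_norm (powR_ge0 _ _)) exprMn sqr_lift_half.
Qed.

Lemma senergy_lift_half u : SL2 (lift_half u) -> senergy u = (snrm (lift_half u) ^+ 2)%:E.
Proof.
move=> LX; rewrite snrm_sq -sumEFin; apply: eq_bigr => k _.
by rewrite (nrm_sq (LX k)) nsq_lift_half.
Qed.

Lemma in_sobolev_SL2 u : in_sobolev 2^-1 u ->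
  [/\ SL2 u, SL2 (lift_half (spinor_fourier u)) &
      sobolev_norm 2^-1 u = (snrm (lift_half (spinor_fourier u)))%:E].
Proof.
move=> [/spinor_in_L2P Lu sob]; have LF := SL2_fourier Lu.
have LX : SL2 (lift_half (spinor_fourier u)).
  apply: spinor_norm2_ltyP; last exact: sob.
  by move=> k; apply: cmeas_lift_half; have [] := LF k.
by split => //; rewrite -(spinor_norm2_snrm LX).
Qed.

Lemma snrm_le_lift_half u : SL2 u -> SL2 (lift_half u) -> snrm u <= snrm (lift_half u).
Proof.
move=> Lu LX; rewrite -(ler_sqrE (snrm_ge0 _) (snrm_ge0 _)) !snrm_sq.
apply: ler_sum => k _; rewrite (ler_sqrE (nrm_ge0 _ _) (nrm_ge0 _ _)).
rewrite -[leRHS]mul1r; apply: (nrm_le_mul (Lu k) (LX k) ler01) => xi.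
rewrite mul1r comp_lift_half normcM normc_real (ger0_norm (powR_ge0 _ _)) ler_peMl//.
by rewrite -[leLHS](powRr0 (1 + dot xi xi)) ler_powR// ?lerDl ?dot_ge0// divr_ge0.
Qed.

(** Transforms are chosen representatives, so they respect differences only almost everywhere; the
    norms agree nonetheless. *)
Lemma sobolev_norm_dist u v : in_sobolev 2^-1 u -> in_sobolev 2^-1 v ->
  sobolev_norm 2^-1 (fun x => u x - v x) =
  (snrm (fun xi => lift_half (spinor_fourier u) xi - lift_half (spinor_fourier v) xi))%:E.
Proof.
move=> /in_sobolev_SL2[Lu LXu _] /in_sobolev_SL2[Lv LXv _].
have LB := SL2B LXu LXv; have Luv := SL2B Lu Lv.
rewrite -(spinor_norm2_snrm LB) /sobolev_norm.
apply: (etrans (spinor_norm2E _)); apply: (etrans _ (esym (spinor_norm2E _))).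
congr (_ `^ _)%E.
have LF := SL2_fourier Luv.
have mX k : cmeas (comp (lift_half (spinor_fourier (fun x => u x - v x))) k).
  by apply: cmeas_lift_half; have [] := LF k.
rewrite -[X in (\int[_]_(x in _) X x)%E]/(fun xi => (spinor_norm (lift_half (spinor_fourier (fun x => u x - v x)) xi) ^+ 2)%:E).
rewrite (integral_spinor_norm mX) (integral_spinor_norm (fun k => (LB k).1)).
apply: eq_bigr => k _; apply: (ae_eq_nsq (mX k) (LB k).1).
apply: filterS (fourierB (Lu k) (Lv k)) => xi e.
apply: (etrans (comp_lift_half _ k xi)).
have -> : comp (spinor_fourier (fun x => u x - v x)) k xi = fourier (comp u k) xi - fourier (comp v k) xi.
  by rewrite -e comp_fourier compB.
rewrite mulrBr -!comp_fourier; apply: (etrans _ (esym (congr1 (fun f => f xi) (compB _ _ k)))).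
exact: esym (congr2 (fun a b => a - b) (comp_lift_half _ k xi) (comp_lift_half _ k xi)).
Qed.

Lemma density_comp u : (fun y => (spinor_norm (u y) ^+ 2)%:C) = density (comp u).
Proof. by apply/funext => y; rewrite spinor_normE. Qed.

(** [gamma0] is diagonal with entries 1 and -1, so both components are multiplied by the same
    potential up to sign. *)
Lemma comp_hartree b u k : exists2 c : R, `|c| = 1 &
  comp (hartree b u) k = fun x => c%:C * (resolvent b (density (comp u)) x * comp u k x).
Proof.
have h (x : plane) : comp (hartree b u) k x =
    resolvent b (density (comp u)) x * (gamma0 *m u x) k 0.
  by rewrite /comp /hartree mxE density_comp.
have g (x : plane) : (gamma0 *m u x) k 0 = (if k == 0 then 1 else -1 : R)%:C * comp u k x.
  rewrite mxE sum_ord2 !mx22E /=; case: k h => [[|[|//]] hk] _ /=; rewrite ?mul0r ?add0r ?addr0.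
    by congr (_ * u x _ _); exact: val_inj.
  by rewrite rmorphN; congr (_ * u x _ _); exact: val_inj.
exists (if k == 0 then 1 else -1); first by case: ifP; rewrite ?normrN normr1.
by apply/funext => x; rewrite h g mulrCA.
Qed.

Lemma fine_add (x y : \bar R) (E : R) : (0 <= x)%E -> (0 <= y)%E -> (x + y = E%:E)%E ->
  E = fine x + fine y.
Proof. by case: x => [x||] //; case: y => [y||] //= _ _ []. Qed.

(** Each component contributes, up to the sign from [gamma0], the imaginary part of its own pairing,
    and the energies of the components add up to [E]. *)
Lemma hartree_bounds b u (E : R) : 0 < b -> SL2 u -> senergy (spinor_fourier u) = E%:E ->
  [/\ SL2 (hartree b u), snrm (hartree b u) <= hartreeC b * E * snrm u &
   forall w c l, measurable_fun setT w -> (forall x, `|w x| <= c) -> 0 <= l ->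
     (forall x y, `|w x - w y| <= l * norm1 (psub x y)) ->
     ipair (spinor_fourier (hartree b u)) (wmul w (spinor_fourier u)) <=
       hartreeC b * l * snrm u ^+ 2 * E].
Proof.
move=> b0 Lu EE.
have EE' : (\sum_k energy (fourier (comp u k)) = E%:E)%E.
  by rewrite -EE; apply: eq_bigr => k _; rewrite comp_fourier.
have H := hartree_component b0 Lu EE'.
have E0 : 0 <= E by rewrite -lee_fin -EE; apply: sume_ge0 => k _; exact: energy_ge0.
have cE0 : 0 <= hartreeC b * E by apply: mulr_ge0 => //; exact: hartreeC_ge0.
pose V := resolvent b (density (comp u)).
have LV k : L2 mu2 (fun x => V x * comp u k x) by have [] := H k.
have LN : SL2 (hartree b u).
  by move=> k; have [c _ ->] := comp_hartree b u k; exact: L2Zl.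
split => //.
  rewrite -(ler_sqrE (snrm_ge0 _) (mulr_ge0 cE0 (snrm_ge0 _))).
  have -> : (hartreeC b * E * snrm u) ^+ 2 = (hartreeC b * E) ^+ 2 * snrm u ^+ 2 by ring.
  rewrite !snrm_sq mulr_sumr; apply: ler_sum => k _.
  have -> : (hartreeC b * E) ^+ 2 * nrm mu2 (comp u k) ^+ 2 =
    (hartreeC b * E * nrm mu2 (comp u k)) ^+ 2 by ring.
  rewrite (ler_sqrE (nrm_ge0 _ _) (mulr_ge0 cE0 (nrm_ge0 _ _))).
  have [c c1 ->] := comp_hartree b u k; rewrite (nrmZ c%:C (LV k)) normc_real c1 mul1r.
  by have [] := H k.
move=> w c l mw wc l0 wl; have LF := SL2_fourier Lu.
have Lw := SL2_wmul mw wc LF.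
rewrite /ipair (sipE (SL2_fourier LN) Lw).
have bound k : `|complex.Re ('i * ip mu2 (comp (spinor_fourier (hartree b u)) k)
    (comp (wmul w (spinor_fourier u)) k))| <=
    hartreeC b * l * snrm u ^+ 2 * fine (energy (fourier (comp u k))).
  have Lwk : L2 mu2 (fun xi => (w xi)%:C * fourier (comp u k) xi).
    exact: L2_real_mul mw wc (L2_fourier (Lu k)).
  have hk : (`|complex.Im (ip mu2 (fun x => V x * comp u k x)
      (inv_fourier (fun xi => (w xi)%:C * fourier (comp u k) xi)))|%:E <=
      (hartreeC b * l * snrm u ^+ 2)%:E * energy (fourier (comp u k)))%E.
    have [_ _ /(_ w c l mw wc l0 wl)] := H k.
    by rewrite (fourier_adjoint (LV k) Lwk) -snrm_sq.
  have -> : comp (wmul w (spinor_fourier u)) k = fun xi => (w xi)%:C * fourier (comp u k) xi.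
    by apply/funext => xi; rewrite /comp /wmul !mxE.
  rewrite comp_fourier; have [d d1 dE] := comp_hartree b u k.
  have LNk : L2 mu2 (comp (hartree b u) k) := LN k.
  have -> : ip mu2 (fourier (comp (hartree b u) k)) (fun xi => (w xi)%:C * fourier (comp u k) xi) =
      d%:C * ip mu2 (fun x => V x * comp u k x) (inv_fourier (fun xi => (w xi)%:C * fourier (comp u k) xi)).
    by rewrite (fourier_adjoint LNk Lwk) dE (ipZl d%:C (LV k) (L2_inv_fourier Lwk)).
  move: hk; move: (ip _ _ _) => z.
  have fin : energy (fourier (comp u k)) \is a fin_num.
    rewrite ge0_fin_numE ?energy_ge0//; apply: (@le_lt_trans _ _ E%:E); last by rewrite ltry.
    rewrite -EE' (bigD1 k)//= leeDl// sume_ge0// => j _; exact: energy_ge0.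
  rewrite -[in X in X -> _](fineK fin) -EFinM lee_fin.
  suff -> : `|complex.Re ('i * (d%:C * z))| = `|complex.Im z| by [].
  rewrite !(ReM, ImM) /=.
  rewrite (_ : _ - _ = - d * complex.Im z); first by rewrite normrM normrN d1 mul1r.
  by ring.
rewrite mulr_sumr sum_ord2 ReD.
have hE : E = fine (energy (fourier (comp u 0))) + fine (energy (fourier (comp u 1))).
  apply: (fine_add (energy_ge0 _) (energy_ge0 _)).
  by rewrite -EE' sum_ord2.
have := bound 0; have := bound 1.
move/(le_trans (ler_norm _)) => h1 /(le_trans (ler_norm _)) h0.
by rewrite hE [leRHS]mulrDr; exact: lerD h0 h1.
Qed.

End SobolevHartree.

(** * Growth of the energy *)

Section Subdivision.
Context {R : realType}.

(* Subdividing [s, t] into n equal parts replaces the quadratic error by k (t - s)^2 / n. *)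
Lemma increment_subdivision (f : R -> R) (s t q k : R) : s <= t -> 0 <= k ->
  (forall x y, s <= x -> x <= y -> y <= t -> f y - f x <= (q + k * (y - x)) * (y - x)) ->
  f t - f s <= q * (t - s).
Proof.
move=> st k0 h.
have key n : f t - f s <= q * (t - s) + k * (t - s) ^+ 2 / n.+1%:R.
  have n0 : 0 < n.+1%:R :> R by rewrite ltr0n.
  pose d := (t - s) / n.+1%:R.
  have d0 : 0 <= d by rewrite divr_ge0 ?subr_ge0// ltW.
  have dn : n.+1%:R * d = t - s by rewrite mulrC divfK// gt_eqF.
  have ind i : (i <= n.+1)%N -> f (s + i%:R * d) - f s <= i%:R * ((q + k * d) * d).
    elim: i => [|i IH] hi; first by rewrite !mul0r addr0 subrr.
    have IHi := IH (ltnW hi).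
    have hd : i.+1%:R * d <= t - s by rewrite -dn ler_wpM2r// ler_nat.
    have i0 : 0 <= i%:R * d by rewrite mulr_ge0.
    have e : i.+1%:R * d = i%:R * d + d by rewrite -natr1 mulrDl mul1r.
    have := h (s + i%:R * d) (s + i.+1%:R * d).
    rewrite e in hd *; rewrite (_ : s + (i%:R * d + d) - (s + i%:R * d) = d); last by ring.
    have -> : i.+1%:R * ((q + k * d) * d) = i%:R * ((q + k * d) * d) + (q + k * d) * d.
      by rewrite -natr1 mulrDl mul1r.
    move=> hi'.
    have := hi' ltac:(lra) ltac:(lra) ltac:(lra); lra.
  have := ind n.+1 (leqnn _); rewrite dn (_ : s + (t - s) = t); last by ring.
  rewrite (_ : n.+1%:R * ((q + k * d) * d) = q * (t - s) + k * (t - s) ^+ 2 / n.+1%:R)//.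
  by rewrite /d; field; rewrite gt_eqF.
apply: le_epsilon_nrm => eps eps0.
have c0 : 0 <= k * (t - s) ^+ 2 by rewrite mulr_ge0// sqr_ge0.
have := key (Num.truncn (k * (t - s) ^+ 2 / eps)).
set n := Num.truncn _; move=> hn; apply: le_trans hn _; rewrite lerD2l.
have n0 : 0 < n.+1%:R :> R by rewrite ltr0n.
rewrite ler_pdivrMr// [leRHS]mulrC -ler_pdivrMr//; apply: ltW; exact: truncnS_gt.
Qed.

End Subdivision.

(** * The solution with the free flow undone *)

Section Evolution.
Context {R : realType}.
Local Notation plane := (@plane R).
Local Notation spinor := (@spinor R).
Variables (m b : R) (psi0 : plane -> spinor) (psi : R -> plane -> spinor).
Hypotheses (m0 : 0 < m) (b0 : 0 < b) (sob0 : in_sobolev 2^-1 psi0).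
Hypotheses (cpsi : continuous_sobolev 2^-1 psi) (sol : duhamel_solution m b psi0 psi).
Implicit Types (t s tau : R) (a : plane -> spinor) (w : plane -> R).

Definition psih t : plane -> spinor := spinor_fourier (psi t).
Definition Nh t : plane -> spinor := spinor_fourier (hartree b (psi t)).
(** The interaction picture: the transform of [exp(i t D) psi(t)], which only the Hartree term sets
    in motion. *)
Definition interaction t : plane -> spinor := evolve m (- t) (psih t).
Definition halfnorm t : R := snrm (lift_half (psih t)).
Definition wmass w t : R := complex.Re (sip (wmul w (psih t)) (psih t)).

Lemma psi_SL2 t : 0 <= t -> [/\ SL2 (psi t), SL2 (psih t), SL2 (lift_half (psih t)) &
  senergy (psih t) = (halfnorm t ^+ 2)%:E].
Proof.
move=> t0; have [Lp LX _] := in_sobolev_SL2 (cpsi.1 t t0).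
by split => //; [exact: SL2_fourier|exact: senergy_lift_half].
Qed.

Lemma SL2_interaction t : 0 <= t -> SL2 (interaction t).
Proof. by move=> t0; have [_ Lp _ _] := psi_SL2 t0; exact: (SL2_evolve m0). Qed.

Lemma SL2_hartree t : 0 <= t -> SL2 (hartree b (psi t)).
Proof.
by move=> t0; have [Lp _ _ E] := psi_SL2 t0; have [] := hartree_bounds b0 Lp E.
Qed.

Lemma SL2_Nh t : 0 <= t -> SL2 (Nh t).
Proof. by move=> t0; apply: SL2_fourier; exact: SL2_hartree. Qed.

Lemma time_primitive_ext t q q' I : (forall tau, 0 <= tau <= t -> q tau = q' tau) ->
  time_primitive t q I -> time_primitive t q' I.
Proof.
move=> qq [r [e [h1 h2 h3 h4 h5]]]; exists r, e; split => // n tau ht.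
by rewrite -qq//; exact: h3.
Qed.

(** The integral equation is tested against the free evolution of a fixed [a], so that the time
    integrand does not depend on [t]. *)
Lemma interaction_pairing t a : 0 <= t -> SL2 a ->
  exists I, time_primitive t (fun tau => ipair (evolve m (- tau) (Nh tau)) a) I /\
    complex.Re (sip (interaction t) a) = complex.Re (sip (spinor_fourier psi0) a) + I.
Proof.
move=> t0 La; have [v hv ae] := sol t0.
have [Lp Lh _ _] := psi_SL2 t0; have [L0 _ _] := in_sobolev_SL2 sob0.
have LA := SL2_inv_fourier (SL2_evolve m0 t La).
have Lv : SL2 v by have [_ [/spinor_in_L2P]] := hv.
exists (ipair v (spinor_inv_fourier (evolve m t a))); split.
  apply: time_primitive_ext (bochner_time_primitive t0 hv LA) => tau /andP[tau0 _].
  rewrite /ipair (dirac_group_pairing m0 (t - tau) t (SL2_hartree tau0) La).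
  by rewrite (_ : t - tau - t = - tau)//; ring.
have L1 := SL2_dirac_group m0 t L0.
have e1 : sip (interaction t) a = sip (psi t) (spinor_inv_fourier (evolve m t a)).
  by rewrite /interaction sip_evolve opprK; exact: sip_fourier_adjoint Lp (SL2_evolve m0 t La).
have e2 : sip (psi t) (spinor_inv_fourier (evolve m t a)) =
    sip (fun x => dirac_group m t psi0 x + 'i *: v x) (spinor_inv_fourier (evolve m t a)).
  by apply: (ae_eq_sip Lp (SL2D L1 (SL2Zl 'i Lv)) LA); exact: ae.
rewrite e1 e2 (sipDl L1 (SL2Zl 'i Lv) LA) ReD (dirac_group_pairing m0 t t L0 La) subrr evolve0.
by rewrite (sipZl 'i Lv LA).
Qed.

Lemma interaction_increment s t a c : 0 <= s -> s <= t -> SL2 a ->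
  (forall tau, s <= tau <= t -> ipair (evolve m (- tau) (Nh tau)) a <= c) ->
  complex.Re (sip (interaction t) a) - complex.Re (sip (interaction s) a) <= c * (t - s).
Proof.
move=> s0 st La h; have t0 := le_trans s0 st.
have [Is [hs es]] := interaction_pairing s0 La; have [It [ht et]] := interaction_pairing t0 La.
have dE (p q r x y : R) : p = r + x -> q = r + y -> p - q = x - y by move=> -> ->; ring.
by rewrite (dE _ _ _ _ _ et es); exact: time_primitive_incr_le s0 st hs ht h.
Qed.

Lemma ipair_evolve_le tau a L : 0 <= tau -> SL2 a -> snrm (hartree b (psi tau)) <= L ->
  `|ipair (evolve m (- tau) (Nh tau)) a| <= L * snrm a.
Proof.
move=> tau0 La hL; have LN := SL2_Nh tau0.
apply: le_trans (ipair_le (SL2_evolve m0 (- tau) LN) La) _.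
rewrite (snrm_evolve m0 _ LN) /Nh (snrm_fourier (SL2_hartree tau0)).
by apply: ler_wpM2r; [exact: snrm_ge0|].
Qed.

(** The increment [D] serves as its own test vector: [|D|^2 <= L |D| (t - s)]. *)
Lemma interaction_lipschitz s t L : 0 <= s -> s <= t ->
  (forall tau, s <= tau <= t -> snrm (hartree b (psi tau)) <= L) ->
  snrm (fun x => interaction t x - interaction s x) <= L * (t - s).
Proof.
move=> s0 st hL; have t0 := le_trans s0 st.
have Lt := SL2_interaction t0; have Ls := SL2_interaction s0; have LB := SL2B Lt Ls.
set D := fun x => _; set N := snrm D.
have N0 : 0 <= N := snrm_ge0 _.
have h : N ^+ 2 <= L * N * (t - s).
  have -> : N ^+ 2 = complex.Re (sip (interaction t) D) - complex.Re (sip (interaction s) D).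
    by rewrite -ReN -ReD -(sipBl Lt Ls LB) (sip_same LB) Re_realC.
  apply: interaction_increment => // tau /andP[stau taut].
  apply: le_trans (ler_norm _) _; apply: ipair_evolve_le => //; first exact: le_trans stau.
  by apply: hL; rewrite stau taut.
have [->|Nn] := eqVneq N 0.
  apply: mulr_ge0; last by rewrite subr_ge0.
  by apply: le_trans (hL s _); [exact: snrm_ge0|rewrite lexx st].
have Np : 0 < N by rewrite lt_def Nn.
by rewrite -(ler_pM2l Np) -expr2 (le_trans h)// mulrCA mulrA.
Qed.

Lemma wmass_increment s t w W L Q : 0 <= s -> s <= t ->
  measurable_fun setT w -> (forall x, `|w x| <= W) ->
  (forall tau, s <= tau <= t -> snrm (hartree b (psi tau)) <= L) ->
  (forall tau, s <= tau <= t -> ipair (Nh tau) (wmul w (psih tau)) <= Q) ->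
  wmass w t - wmass w s <= 2 * Q * (t - s).
Proof.
move=> s0 st mw wW hL hQ.
have W0 : 0 <= W by exact: le_trans (normr_ge0 _) (wW (0, 0)).
have wE r : wmass w r = complex.Re (sip (interaction r) (wmul w (interaction r))).
  by rewrite /wmass /interaction -evolve_wmul (sip_evolve2 m0) sip_wmul.
apply: (@increment_subdivision _ _ _ _ _ (2 * (W * L ^+ 2))) => // [|x y sx xy yt].
  by rewrite mulr_ge0// mulr_ge0// sqr_ge0.
have x0 := le_trans s0 sx; have y0 := le_trans x0 xy.
have Lx := SL2_interaction x0; have Ly := SL2_interaction y0.
have Lwx := SL2_wmul mw wW Lx; have Lwy := SL2_wmul mw wW Ly.
have hL' tau : x <= tau <= y -> snrm (hartree b (psi tau)) <= L.
  by move=> /andP[h1 h2]; apply: hL; rewrite (le_trans sx h1) (le_trans h2 yt).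
have L0 : 0 <= L by apply: le_trans (hL' x _); [exact: snrm_ge0|rewrite lexx xy].
(* The error is [L] for the Hartree term times [W L (y - x)] for the motion of [interaction] between
   [r] and [tau]. *)
have bound r : x <= r <= y -> forall tau, x <= tau <= y ->
    ipair (evolve m (- tau) (Nh tau)) (wmul w (interaction r)) <= Q + W * L ^+ 2 * (y - x).
  move=> /andP[xr ry] tau /andP[xtau tauy].
  have tau0 := le_trans x0 xtau; have r0 := le_trans x0 xr.
  have Lr := SL2_interaction r0; have Lt := SL2_interaction tau0.
  have LD := SL2B Lr Lt.
  have LN := SL2_evolve m0 (- tau) (SL2_Nh tau0).
  have e : ipair (evolve m (- tau) (Nh tau)) (wmul w (interaction r)) =
      ipair (Nh tau) (wmul w (psih tau)) +
      ipair (evolve m (- tau) (Nh tau)) (wmul w (fun x => interaction r x - interaction tau x)).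
    rewrite -(_ : ipair (evolve m (- tau) (Nh tau)) (wmul w (interaction tau)) =
        ipair (Nh tau) (wmul w (psih tau))); last first.
      by rewrite /ipair /interaction -evolve_wmul (sip_evolve2 m0).
    have -> : wmul w (fun x => interaction r x - interaction tau x) =
        fun x => wmul w (interaction r) x - wmul w (interaction tau) x.
      by apply/funext => z; rewrite /wmul scalerBr.
    rewrite /ipair (sipBr (SL2_wmul mw wW Lr) (SL2_wmul mw wW Lt) LN) mulrBr ReD ReN.
    by rewrite addrC subrK.
  rewrite e; apply: lerD.
    by apply: hQ; rewrite (le_trans sx xtau) (le_trans tauy yt).
  apply: le_trans (ler_norm _) _.
  apply: le_trans (ipair_evolve_le tau0 (SL2_wmul mw wW LD) (hL' tau _)) _.
    by rewrite xtau tauy.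
  rewrite (_ : W * L ^+ 2 * (y - x) = L * (W * (L * (y - x)))); last by ring.
  apply: ler_wpM2l => //; apply: le_trans (snrm_wmul_le mw wW LD) _; apply: ler_wpM2l => //.
  have mono (p : R) : p <= y - x -> L * p <= L * (y - x) by move=> h; exact: ler_wpM2l.
  case: (leP tau r) => [tr|/ltW rt].
    apply: le_trans (interaction_lipschitz tau0 tr _) _ => [z /andP[z1 z2]|].
      by apply: hL'; rewrite (le_trans xtau z1) (le_trans z2 ry).
    by apply: mono; exact: lerB ry xtau.
  rewrite snrm_distC; apply: le_trans (interaction_lipschitz r0 rt _) _ => [z /andP[z1 z2]|].
    by apply: hL'; rewrite (le_trans xr z1) (le_trans z2 tauy).
  by apply: mono; exact: lerB tauy xr.
have h1 := interaction_increment x0 xy Lwx (bound x _); rewrite lexx xy in h1.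
have h2 := interaction_increment x0 xy Lwy (bound y _); rewrite xy lexx in h2.
(* The mixed terms of the two increments cancel. *)
have sym : complex.Re (sip (interaction y) (wmul w (interaction x))) =
    complex.Re (sip (interaction x) (wmul w (interaction y))).
  have e := etrans (sip_conj Ly Lwx) (sip_wmul w (interaction x) (interaction y)).
  have ReC (z z' : R[i]) : z^* = z' -> complex.Re z = complex.Re z' by move=> <-; rewrite Re_conj.
  exact: ReC e.
have {}h1 := h1 isT; have {}h2 := h2 isT.
have fin (A A' C D e : R) : A = A' -> A - C <= e -> D - A' <= e -> D - C <= e + e.
  by move=> <- u1 u2; have := lerD u2 u1; rewrite addrA subrK.
rewrite (wE y) (wE x); apply: le_trans (fin _ _ _ _ _ sym h1 h2) _.
by rewrite le_eqVlt; apply/orP; left; apply/eqP; ring.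
Qed.

End Evolution.

(** Since [x <= 1/4], the last hypothesis becomes [S <= q + S / 2]. *)
Lemma half_absorb {R : realType} (x p q S : R) : 0 <= S -> x <= 4^-1 -> p <= S ->
  S <= q + 2 * S * x -> p <= 2 * q.
Proof.
move=> S0 hx pS Sq; have : S * x <= S * 4^-1 by exact: ler_wpM2l.
by move: Sq; rewrite -mulrA; lra.
Qed.

Section Growth.
Context {R : realType}.
Local Notation plane := (@plane R).
Local Notation spinor := (@spinor R).
Variables (m b : R) (psi0 : plane -> spinor) (psi : R -> plane -> spinor).
Hypotheses (m0 : 0 < m) (b0 : 0 < b) (sob0 : in_sobolev 2^-1 psi0).
Hypotheses (cpsi : continuous_sobolev 2^-1 psi) (sol : duhamel_solution m b psi0 psi).
Implicit Types (t s tau : R) (w : plane -> R).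

Local Notation halfnorm := (halfnorm psi).
Local Notation psih := (psih psi).
Local Notation r0 := (fine (sobolev_norm 2^-1 psi0)).

Lemma halfnorm_dist s t : 0 <= s -> 0 <= t ->
  (`|halfnorm s - halfnorm t|%:E <= sobolev_norm 2^-1 (fun x => (psi s x - psi t x)%R))%E.
Proof.
move=> s0 t0; rewrite (sobolev_norm_dist (cpsi.1 s s0) (cpsi.1 t t0)) lee_fin.
have [_ _ Ls _] := psi_SL2 cpsi s0; have [_ _ Lt _] := psi_SL2 cpsi t0.
have fin (x y N : R) : x <= y + N -> y <= x + N -> `|x - y| <= N.
  by move=> h1 h2; rewrite ler_norml; apply/andP; split; lra.
have h1 := snrm_le_dist Ls Lt; have h2 := snrm_le_dist Lt Ls.
by apply: fin h1 _; rewrite snrm_distC.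
Qed.

Lemma halfnorm_continuous s t : 0 <= s -> {within `[s, t], continuous halfnorm}.
Proof.
move=> s0; apply/subspace_continuousP => x; rewrite /= in_itv/= => /andP[sx xt].
have x0 := le_trans s0 sx.
apply/cvgrPdist_lt => e e0.
have /fine_cvgP[fin /cvgrPdist_lt/(_ e e0) h] := cpsi.2 x x0.
move: fin h; rewrite !near_withinE => fin h.
apply: filterS2 fin h => y fy hy; rewrite /= in_itv/= => /andP[sy _].
have y0 := le_trans s0 sy.
move: (hy y0) (fy y0); rewrite /= sub0r normrN => hy' fy'.
rewrite distrC -lte_fin; apply: le_lt_trans (halfnorm_dist y0 x0) _.
rewrite -(fineK fy') lte_fin; exact: le_lt_trans (ler_norm _) hy'.
Qed.

(** The maximum is attained and hence finite, so that it can be absorbed in [halfnorm_doubling]. *)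
Lemma halfnorm_max s t : 0 <= s -> s <= t -> exists2 c, s <= c <= t &
  forall tau, s <= tau <= t -> halfnorm tau <= halfnorm c.
Proof.
move=> s0 st; have [c hc h] := EVT_max st (halfnorm_continuous (t := t) s0).
exists c; first by move: hc; rewrite in_itv.
by move=> tau htau; apply: h; rewrite in_itv.
Qed.

Lemma halfnorm_ge0 t : 0 <= halfnorm t. Proof. exact: snrm_ge0. Qed.

Lemma snrm_psi_le t : 0 <= t -> snrm (psi t) <= halfnorm t.
Proof.
move=> t0; have [Lp Lh LX _] := psi_SL2 cpsi t0.
by rewrite -(snrm_fourier Lp); exact: snrm_le_lift_half.
Qed.

(** A qualitative bound: [L] enters only the quadratic error of [wmass_increment] and leaves no
    trace in the growth rate. *)
Lemma hartree_snrm_bound s t : 0 <= s -> s <= t ->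
  exists L, forall tau, s <= tau <= t -> snrm (hartree b (psi tau)) <= L.
Proof.
move=> s0 st; have [c _ hc] := halfnorm_max s0 st.
exists (hartreeC b * halfnorm c ^+ 2 * halfnorm c) => tau ht.
have tau0 : 0 <= tau by move: ht => /andP[/(le_trans s0)].
have [Lp _ _ E] := psi_SL2 cpsi tau0; have [_ h _] := hartree_bounds b0 Lp E.
have H := hc _ ht; have g0 := halfnorm_ge0 tau; have hC := hartreeC_ge0 b0.
apply: le_trans h _; apply: ler_pM.
- by apply: (mulr_ge0 hC); exact: sqr_ge0.
- exact: snrm_ge0.
- apply: (ler_wpM2l hC); rewrite (ler_sqrE g0 (halfnorm_ge0 c)); exact: H.
- exact: le_trans (snrm_psi_le tau0) H.
Qed.

Lemma wmass_le_wmass s t w W l S : 0 <= s -> s <= t ->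
  measurable_fun setT w -> (forall x, `|w x| <= W) -> 0 <= l ->
  (forall x y, `|w x - w y| <= l * norm1 (psub x y)) ->
  (forall tau, s <= tau <= t -> hartreeC b * l * snrm (psi tau) ^+ 2 * halfnorm tau ^+ 2 <= S) ->
  wmass psi w t <= wmass psi w s + 2 * S * (t - s).
Proof.
move=> s0 st mw wW l0 wl hS; have [L hL] := hartree_snrm_bound s0 st.
rewrite -lerBlDl; apply: (wmass_increment m0 b0 sob0 cpsi sol s0 st mw wW hL) => tau ht.
have tau0 : 0 <= tau by move: ht => /andP[/(le_trans s0)].
have [Lp _ _ E] := psi_SL2 cpsi tau0; have [_ _ h] := hartree_bounds b0 Lp E.
exact: le_trans (h w W l mw wW l0 wl) (hS _ ht).
Qed.

Lemma wmass1 t : 0 <= t -> wmass psi (fun=> 1) t = snrm (psi t) ^+ 2.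
Proof.
move=> t0; have [Lp Lh _ _] := psi_SL2 cpsi t0.
rewrite /wmass -(snrm_fourier Lp) (_ : wmul (fun=> 1) (psih t) = psih t).
  by rewrite (sip_same Lh) Re_realC.
by apply/funext => xi; rewrite /wmul scale1r.
Qed.

(** The constant weight has Lipschitz constant 0, so its commutator bound vanishes. *)
Lemma mass_conserved t : 0 <= t -> snrm (psi t) <= snrm (psi 0).
Proof.
move=> t0; rewrite -(ler_sqrE (snrm_ge0 _) (snrm_ge0 _)) -(wmass1 t0) -(wmass1 (lexx 0)).
have -> : wmass psi (fun=> 1) 0 = wmass psi (fun=> 1) 0 + 2 * 0 * (t - 0).
  by rewrite mulr0 mul0r addr0.
apply: (@wmass_le_wmass 0 t (fun=> 1) 1 0 0 (lexx 0) t0).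
- exact: measurable_cst.
- by move=> x; rewrite normr1.
- exact: lexx.
- by move=> x y; rewrite subrr normr0 mul0r.
- by move=> tau _; rewrite mulr0 !mul0r.
Qed.

(** At time 0 the integral term vanishes; testing with [psi 0] itself gives
    [|psi 0|^2 <= |psi0| |psi 0|]. Through this bound the rate depends on the datum only by its
    H^(1/2) norm. *)
Lemma initial_mass : snrm (psi 0) <= r0.
Proof.
have [Lp Lh _ _] := psi_SL2 cpsi (lexx 0).
have [L0 LX E] := in_sobolev_SL2 sob0; rewrite E /=.
have LF := SL2_fourier L0.
apply: le_trans (snrm_le_lift_half LF LX).
have [I [hI0 hI]] := interaction_pairing m0 b0 sob0 cpsi sol (lexx 0) Lh.
have e : interaction m psi 0 = psih 0 by rewrite /interaction oppr0; exact: evolve0.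
have e1 : complex.Re (sip (interaction m psi 0) (psih 0)) = snrm (psih 0) ^+ 2.
  by rewrite e (sip_same Lh).
have hb := le_trans (le_trans (ler_norm _) (ler_Re_normc _)) (normc_sip_le LF Lh).
have q : snrm (psih 0) ^+ 2 <= snrm (spinor_fourier psi0) * snrm (psih 0).
  apply: le_trans hb; rewrite le_eqVlt; apply/orP; left; apply/eqP.
  by apply: (etrans (esym e1)); apply: (etrans hI); rewrite (time_primitive0 hI0) addr0.
have e3 : snrm (psih 0) = snrm (psi 0) := snrm_fourier Lp.
have fin (x y : R) : 0 <= x -> 0 <= y -> x ^+ 2 <= y * x -> x <= y.
  rewrite expr2 => x0 y0; have [->//|n0] := eqVneq x 0.
  by rewrite ler_pM2r// lt_def n0 x0.
by rewrite -e3; exact: fin (snrm_ge0 _) (snrm_ge0 _) q.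
Qed.

(** The bound for the weights [lam_cut n] is uniform in [n]. The cut-off is removed by Fatou's lemma
    at time [t] and by monotonicity at time [s]. *)
Lemma halfnorm_increment s t S : 0 <= s -> s <= t ->
  (forall tau, s <= tau <= t -> halfnorm tau ^+ 2 <= S) ->
  halfnorm t ^+ 2 <= halfnorm s ^+ 2 + 2 * (hartreeC b * r0 ^+ 2 * S) * (t - s).
Proof.
move=> s0 st hS; have t0 := le_trans s0 st.
have [_ Lt _ Et] := psi_SL2 cpsi t0; have [_ Ls _ Es] := psi_SL2 cpsi s0.
rewrite -lee_fin -Et; apply: senergy_le_cut => // n.
have := @wmass_le_wmass s t (lam_cut n) n%:R 1 (hartreeC b * r0 ^+ 2 * S) s0 st
  (measurable_lam_cut n) (lam_cut_bound n) ler01 (lam_cut_lipschitz n).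
rewrite /wmass => h; apply: le_trans (h _) _ => [tau ht|].
  have tau0 : 0 <= tau by move: ht => /andP[/(le_trans s0)].
  have M := le_trans (mass_conserved tau0) initial_mass.
  rewrite mulr1; apply: ler_pM (hS _ ht); [|exact: sqr_ge0|].
    by apply: mulr_ge0; [exact: hartreeC_ge0|exact: sqr_ge0].
  apply: ler_wpM2l; first exact: hartreeC_ge0.
  by rewrite (ler_sqrE (snrm_ge0 _) (le_trans (snrm_ge0 _) M)).
by rewrite lerD2r -lee_fin -Es; exact: sip_cut_le.
Qed.

(* On a step of this length the increment is at most half of the maximum. *)
Definition rate (b r : R) : R := 4 * (hartreeC b + 1) * (r ^+ 2 + 1).

Lemma rate_gt0 r : 0 < rate b r.
Proof.
have hC := hartreeC_ge0 b0; have r2 := sqr_ge0 r.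
by rewrite /rate mulr_gt0 ?mulr_gt0//; lra.
Qed.

(** The increment is taken up to the time [c] of the maximum instead of [t]; this gives an
    inequality in the maximum [S] alone, [S <= halfnorm s ^+ 2 + S / 2]. *)
Lemma halfnorm_doubling s t : 0 <= s -> s <= t -> t - s <= (rate b r0)^-1 ->
  halfnorm t ^+ 2 <= 2 * halfnorm s ^+ 2.
Proof.
move=> s0 st ts; have [c /andP[sc ct] hc] := halfnorm_max s0 st.
pose S := halfnorm c ^+ 2.
have hS tau : s <= tau <= t -> halfnorm tau ^+ 2 <= S.
  by move=> /hc; rewrite -(ler_sqrE (halfnorm_ge0 _) (halfnorm_ge0 _)).
have hS' tau : s <= tau <= c -> halfnorm tau ^+ 2 <= S.
  by move=> /andP[h1 h2]; apply: hS; rewrite h1 (le_trans h2 ct).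
have inc := halfnorm_increment s0 sc hS'.
have small : hartreeC b * r0 ^+ 2 * (c - s) <= 4^-1.
  have hC := hartreeC_ge0 b0; have r2 := sqr_ge0 r0; have rg := rate_gt0 r0.
  have cs : c - s <= (rate b r0)^-1 by apply: le_trans ts; rewrite lerD2r.
  have cs0 : 0 <= c - s by rewrite subr_ge0.
  have h0 : 0 <= hartreeC b * r0 ^+ 2 by exact: mulr_ge0.
  apply: le_trans (ler_wpM2l h0 cs) _; rewrite (ler_pdivrMr _ _ rg) /rate.
  have fin (C q : R) : 0 <= C -> 0 <= q -> C * q <= 4^-1 * (4 * (C + 1) * (q + 1)).
    move=> C0 q0; have -> : 4^-1 * (4 * (C + 1) * (q + 1)) = (C + 1) * (q + 1) by field.
    by apply: ler_pM; rewrite ?lerDl.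
  exact: fin hC r2.
have S0 : 0 <= S by exact: sqr_ge0.
apply: (half_absorb S0 small); first by apply: hS; rewrite st lexx.
have <- : 2 * (hartreeC b * r0 ^+ 2 * S) * (c - s) = 2 * S * (hartreeC b * r0 ^+ 2 * (c - s)) by ring.
exact: inc.
Qed.

(** Each step of length [1 / rate] costs a factor 2, which is at most [expR 1]. At most
    [rate * t + 1] steps are taken, and the additional one accounts for the prefactor [expR 1]. *)
Lemma halfnorm_growth t : 0 <= t ->
  halfnorm t ^+ 2 <= expR 1 * halfnorm 0 ^+ 2 * expR (rate b r0 * t).
Proof.
move=> t0; have rg := rate_gt0 r0; set h := (rate b r0)^-1.
have h0 : 0 < h by rewrite invr_gt0.
have e2 : 2 <= expR 1 :> R by apply: le_trans (expR_ge1Dx 1); lra.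
have ind n : forall s, 0 <= s -> s <= n%:R * h -> halfnorm s ^+ 2 <= expR n%:R * halfnorm 0 ^+ 2.
  elim: n => [|n IH] s s0 sn.
    have -> : s = 0 by apply/eqP; rewrite eq_le s0 andbT (le_trans sn)// mul0r.
    by rewrite expR0 mul1r.
  have e1 : 1 <= expR 1 :> R by apply: le_trans e2; rewrite ler1n.
  have eS : expR n.+1%:R = expR 1 * expR n%:R :> R by rewrite -expRD -natr1 addrC.
  have B0 : 0 <= expR n%:R * halfnorm 0 ^+ 2 by apply: mulr_ge0; [exact: expR_ge0|exact: sqr_ge0].
  case: (leP s (n%:R * h)) => [sn'|/ltW ns].
    apply: le_trans (IH s s0 sn') _; rewrite eS -mulrA ler_peMl//.
  have nh0 : 0 <= n%:R * h by rewrite mulr_ge0// ltW.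
  have sh : s - n%:R * h <= h by rewrite lerBlDl; move: sn; rewrite -natr1 mulrDl mul1r.
  apply: le_trans (halfnorm_doubling nh0 ns sh) _.
  have IHn := IH _ nh0 (lexx _).
  by rewrite eS -mulrA; apply: ler_pM => //; exact: sqr_ge0.
pose n := (Num.truncn (rate b r0 * t)).+1.
have rt0 : 0 <= rate b r0 * t by rewrite mulr_ge0// ltW.
have tn : t <= n%:R * h.
  by rewrite /h ler_pdivlMr// mulrC; apply: ltW; exact: truncnS_gt.
apply: le_trans (ind n t t0 tn) _.
rewrite mulrAC -expRD; apply: ler_wpM2r; first exact: sqr_ge0.
rewrite ler_expR /n -natr1 addrC lerD2l.
by have /andP[] := truncn_itv rt0.
Qed.

End Growth.

(** * The quadratic form is controlled by the energy *)

Section DiracForm.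
Context {R : realType}.
Local Notation plane := (@plane R).
Local Notation spinor := (@spinor R).

(** The diagonal entries have modulus [m], the others modulus [|xi|]. *)
Lemma normc_dirac_symbol_le (m : R) (xi : plane) i j : 0 < m ->
  normc (dirac_symbol m xi i j) <= (1 + m) * lam xi.
Proof.
move=> m0; have l1 := lam_ge1 xi; have l0 := lam_ge0 xi.
have c0 : 0 <= (1 + m) * lam xi by apply: mulr_ge0 => //; lra.
have hm : m <= (1 + m) * lam xi.
  by apply: (@le_trans _ _ (m * lam xi)); [rewrite ler_peMr// ltW|apply: ler_wpM2r => //; lra].
have hl : lam xi <= (1 + m) * lam xi by rewrite ler_peMl//; lra.
have hx (z : R[i]) : normc z ^+ 2 = dot xi xi -> normc z <= (1 + m) * lam xi.
  move=> zE; apply: le_trans hl; rewrite -(ler_sqrE (normc_ge0 z) l0) zE lam_sq; lra.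
rewrite dirac_symbolE mx22E; case: ifP => _; case: ifP => _.
- by rewrite normc_real gtr0_norm.
- by apply: hx; rewrite sqr_normcE /= /dot; ring.
- by apply: hx; rewrite sqr_normcE /= /dot; ring.
- by rewrite normcN normc_real gtr0_norm.
Qed.

(** With [a], [c] the moduli of the components, the four entries add up to a multiple of
    [(a + c)^2 <= 2 (a^2 + c^2)]. *)
Lemma normc_dirac_dot_le (m : R) (xi : plane) (v : spinor) : 0 < m ->
  normc (spinor_dot (dirac_symbol m xi *m v) v) <=
  2 * (1 + m) * (lam xi * \sum_k normc (v k 0) ^+ 2).
Proof.
move=> m0; have h i j := normc_dirac_symbol_le xi i j m0.
move: (dirac_symbol m xi) h => A h; have l0 := lam_ge0 xi.
have c0 : 0 <= (1 + m) * lam xi by apply: mulr_ge0 => //; lra.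
have t i j : normc (A i j * v j 0 * (v i 0)^*) <= (1 + m) * lam xi * (normc (v j 0) * normc (v i 0)).
  rewrite !normcM normc_conj -mulrA; apply: ler_wpM2r; last exact: h.
  by apply: mulr_ge0; exact: normc_ge0.
have -> : spinor_dot (A *m v) v = A 0 0 * v 0 0 * (v 0 0)^* + A 0 1 * v 1 0 * (v 0 0)^* +
    (A 1 0 * v 0 0 * (v 1 0)^* + A 1 1 * v 1 0 * (v 1 0)^*).
  by rewrite spinor_dotE sum_ord2 !mxE !sum_ord2 !mulrDl.
rewrite sum_ord2.
apply: le_trans (le_normcD _ _) _.
apply: le_trans (lerD (le_normcD _ _) (le_normcD _ _)) _.
apply: le_trans (lerD (lerD (t 0 0) (t 0 1)) (lerD (t 1 0) (t 1 1))) _.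
move: (normc (v 0 0)) (normc (v 1 0)) => a c.
have -> : (1 + m) * lam xi * (a * a) + (1 + m) * lam xi * (c * a) +
    ((1 + m) * lam xi * (a * c) + (1 + m) * lam xi * (c * c)) = (1 + m) * lam xi * (a + c) ^+ 2 by ring.
have -> : 2 * (1 + m) * (lam xi * (a ^+ 2 + c ^+ 2)) = (1 + m) * lam xi * (2 * (a ^+ 2 + c ^+ 2)) by ring.
by apply: ler_wpM2l => //; have := sqr_ge0 (a - c); nra.
Qed.

Lemma dirac_form_le (m : R) (u : plane -> spinor) : 0 < m -> in_sobolev 2^-1 u ->
  normc (dirac_form m u) <= 2 * (1 + m) * snrm (lift_half (spinor_fourier u)) ^+ 2.
Proof.
move=> m0 /in_sobolev_SL2[Lu LX _]; have Lh := SL2_fourier Lu.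
pose v := spinor_fourier u; pose h xi := lam xi * \sum_k normc (v xi k 0) ^+ 2.
have mk k : measurable_fun setT (fun xi => normc (v xi k 0) ^+ 2).
  by have /measurable_EFinP := measurable_sqnormc (Lh k).1.
have h0 xi : (0 <= (h xi)%:E)%E.
  rewrite lee_fin; apply: mulr_ge0; first exact: lam_ge0.
  by apply: sumr_ge0 => k _; exact: sqr_ge0.
have mh : measurable_fun setT h.
  by apply: (measurable_funM (@measurable_lam R)); apply: measurable_sum => k; exact: mk.
have ih : (\int[mu2]_xi (h xi)%:E = (snrm (lift_half v) ^+ 2)%:E)%E.
  rewrite -(senergy_lift_half LX).
  have ml k : measurable_fun setT (fun xi => (lam xi * normc (comp v k xi) ^+ 2)%:E).
    by apply/measurable_EFinP; exact: (measurable_funM (@measurable_lam R) (mk k)).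
  have l0 k xi : (setT xi -> 0 <= (lam xi * normc (comp v k xi) ^+ 2)%:E)%E.
    by move=> _; rewrite lee_fin; apply: mulr_ge0; [exact: lam_ge0|exact: sqr_ge0].
  apply: (etrans _ (ge0_integral_sum mu2 measurableT ml l0 _)).
  by apply: eq_integral => xi _; rewrite /h mulr_sumr sumEFin.
have c0 : 0 <= 2 * (1 + m) by lra.
have mg : measurable_fun setT (fun xi => 2 * (1 + m) * h xi).
  by apply: measurable_funM mh; exact: measurable_cst.
have ig : (\int[mu2]_xi (2 * (1 + m) * h xi)%:E = (2 * (1 + m) * snrm (lift_half v) ^+ 2)%:E)%E.
  rewrite EFinM -ih -(ge0_integralZl_EFin mu2 measurableT (fun x _ => h0 x) _ c0) //.
  by apply/measurable_EFinP.
have md : cmeas (fun xi => spinor_dot (dirac_symbol m xi *m v xi) (v xi)).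
  rewrite (_ : (fun xi => _) = fun xi => \sum_k (\sum_j dirac_symbol m xi k j * comp v j xi) * (comp v k xi)^*); last first.
    by apply/funext => xi; rewrite spinor_dotE; apply: eq_bigr => k _; rewrite mxE.
  apply: cmeas_sum => k; apply: cmeasM; last by apply: cmeas_conj; have [] := Lh k.
  apply: cmeas_sum => j; apply: cmeasM; first exact: cmeas_dirac_symbol.
  by have [] := Lh j.
have le xi := normc_dirac_dot_le xi (v xi) m0.
have ci : cintegrable mu2 (fun xi => spinor_dot (dirac_symbol m xi *m v xi) (v xi)).
  by apply: (le_cintegrable md mg le); rewrite ig ltry.
rewrite /dirac_form cintegralE -lee_fin -ig.
apply: le_trans (normc_cint_le ci) _.
apply: (ge0_le_integral _ measurableT) => [x _||| x _].
- by rewrite lee_fin; exact: normc_ge0.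
- exact: measurable_normcE.
- by apply/measurable_EFinP.
- by rewrite lee_fin; exact: le.
Qed.

End DiracForm.

Theorem theorem4 (R : realType) (m b : R) (hm : 0 < m) (hb : 0 < b) :
  exists C : R -> R, (forall r, 0 < C r) /\
    forall psi0 : @plane R -> @spinor R, in_sobolev 2^-1 psi0 ->
    forall psi : R -> @plane R -> @spinor R,
      continuous_sobolev 2^-1 psi -> duhamel_solution m b psi0 psi ->
    exists K : R, 0 < K /\
      forall t : R, 0 <= t ->
        ComplexField.Normc.normc (dirac_form m (psi t))
          <= K * expR (C (fine (sobolev_norm 2^-1 psi0)) * t).
Proof.
exists (rate b); split; first by move=> r; exact: rate_gt0.
move=> psi0 sob0 psi cpsi sol.
have c0 : 0 <= 2 * (1 + m) by rewrite mulr_ge0// addr_ge0// ltW.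
pose K := 2 * (1 + m) * (expR 1 * halfnorm psi 0 ^+ 2).
have K0 : 0 <= K.
  by apply: mulr_ge0 c0 _; apply: mulr_ge0; [exact: expR_ge0|exact: sqr_ge0].
(* [K] vanishes together with [psi 0], so 1 is added for positivity. *)
exists (K + 1); split; first exact: ltr_wpDl.
move=> t t0; apply: le_trans (dirac_form_le hm (cpsi.1 t t0)) _.
apply: le_trans (ler_wpM2l c0 (halfnorm_growth hm hb sob0 cpsi sol t0)) _.
rewrite mulrA -/K; apply: ler_wpM2r; first exact: expR_ge0.
by rewrite lerDl.
Qed.
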